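(* Let $G$ be a non-elementary subgroup of $\mbox{Möb}(\mathbb{S})$. If $fGf^{-1}\subset\mbox{Möb}(\mathbb{S})$ for some $f\in\mathrm{QS}_{\sharp}^X$ with a finite subset $X\subset\mathbb{S}$, then $f\in\mbox{Möb}(\mathbb{S})$.
   Context: $\mathbb{S}$ is the unit circle and $\mathbb{D}$ the unit disk. $\mbox{Möb}(\mathbb{S})$ is the group of (sense-preserving) Möbius transformations of $\mathbb{S}$, identified with the group $\mbox{Möb}(\mathbb{D})$ of Möbius transformations of $\mathbb{D}$ onto itself, and so acting on $\overline{\mathbb{D}}$. A subgroup $G$ is non-elementary if there is no nonempty finite subset $F\subset\overline{\mathbb{D}}$ with $g(F)=F$ for every $g\in G$. For $X\subset\mathbb{S}$, $M_{\sharp}^{X}(\mathbb{D})$ is the set of all $\mu\in L^\infty(\mathbb{D})$ with $\Vert\mu\Vert_\infty<1$ such that for every $\varepsilon>0$ there exists a compact subset $K$ of $\mathbb{D}\cup X$ with $\Vert\mu|_{\mathbb{D}\setminus K}\Vert_\infty<\varepsilon$. $\mathrm{QS}_{\sharp}^{X}$ is the set of all (quasisymmetric, sense-preserving) self-homeomorphisms of $\mathbb{S}$ obtained as the boundary extension of some quasiconformal homeomorphism of $\mathbb{D}$ onto itself whose complex dilatation belongs to $M_{\sharp}^{X}(\mathbb{D})$. *)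

(* Defs.v *)
From HB Require Import structures.
From mathcomp Require Import all_boot all_order all_algebra.
From mathcomp Require Import complex.
From mathcomp Require Import all_classical all_reals all_analysis.

Set Implicit Arguments.
Unset Strict Implicit.
Unset Printing Implicit Defensive.

Import Order.TTheory GRing.Theory Num.Theory.
Import numFieldNormedType.Exports.

Local Open Scope classical_set_scope.
Local Open Scope ring_scope.
Local Open Scope complex_scope.

(* The complex plane is R * R, which carries the topology, the differential
   structure and the Lebesgue measure; R[i] is used for complex arithmetic. *)
Definition toC (R : realType) (p : R * R) : R[i] := p.1 +i* p.2.

Definition ofC (R : realType) (z : R[i]) : R * R := (complex.Re z, complex.Im z).

(* The library norm `|p| on R * R is the max norm, not the modulus. *)
Definition cmod (R : realType) (p : R * R) : R :=
  Num.sqrt (p.1 ^+ 2 + p.2 ^+ 2).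

Definition unit_disk (R : realType) : set (R * R) := [set p | cmod p < 1].

Definition closed_unit_disk (R : realType) : set (R * R) :=
  [set p | cmod p <= 1].

Definition unit_circle (R : realType) : set (R * R) := [set p | cmod p = 1].

Arguments unit_disk R : clear implicits.
Arguments closed_unit_disk R : clear implicits.
Arguments unit_circle R : clear implicits.

(* With |b| < |a|, these are exactly the Moebius transformations that map the
   unit disk onto itself; the denominator has no zero in the closed disk. *)
Definition disk_mobius (R : realType) (a b : R[i]) (p : R * R) : R * R :=
  ofC ((a * toC p + b) / (b^*%C * toC p + a^*%C)).

Definition is_mobius_of (R : realType) (a b : R[i])
    (g : unit_circle R -> unit_circle R) : Prop :=
  `|b| < `|a| /\ forall z, \val (g z) = disk_mobius a b (\val z).

Definition Mob_circle (R : realType) : set (unit_circle R -> unit_circle R) :=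
  [set g | exists a b : R[i], is_mobius_of a b g].

Arguments Mob_circle R : clear implicits.

Definition Mob_subgroup (R : realType)
    (G : set (unit_circle R -> unit_circle R)) : Prop :=
  [/\ G `<=` Mob_circle R,
      G id,
      (forall g h, G g -> G h -> G (g \o h)) &
      (forall g, G g -> exists h, [/\ G h, cancel g h & cancel h g])].

(* g acts on the closed disk through its coefficients a, b; they are unique up
   to a common real factor, so that this action does not depend on them. *)
Definition non_elementary (R : realType)
    (G : set (unit_circle R -> unit_circle R)) : Prop :=
  ~ exists F : set (R * R),
    [/\ finite_set F, F !=set0, F `<=` closed_unit_disk R &
        forall g (a b : R[i]), G g -> is_mobius_of a b g ->
          disk_mobius a b @` F = F].

(* This is f G f^-1 when f is bijective. *)
Definition conj_set (T : Type) (f : T -> T) (G : set (T -> T)) : set (T -> T) :=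
  [set h : T -> T | exists2 g : T -> T, G g & h \o f = f \o g].

Definition circle_homeo (R : realType) (f : unit_circle R -> unit_circle R) :
    Prop :=
  exists f' : unit_circle R -> unit_circle R,
    [/\ cancel f f', cancel f' f, continuous f & continuous f'].

(* phi is a lift of f to the universal cover of the circle. *)
Definition sense_preserving_lift (R : realType)
    (f : unit_circle R -> unit_circle R) (phi : R -> R) : Prop :=
  [/\ continuous phi,
      {homo phi : s t / s < t},
      (forall t, phi (t + 2 * pi) = phi t + 2 * pi) &
      (forall (t : R) (z : unit_circle R), \val z = (cos t, sin t) ->
         \val (f z) = (cos (phi t), sin (phi t)))].

(* Beurling-Ahlfors M-condition on the lift. *)
Definition quasisymmetric (R : realType)
    (f : unit_circle R -> unit_circle R) : Prop :=
  exists phi : R -> R, sense_preserving_lift f phi /\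
    exists2 M : R, 1 <= M & forall t h : R, 0 < h ->
      M^-1 <= (phi (t + h) - phi t) / (phi t - phi (t - h)) <= M.

Definition area (R : realType) :
    set (measurableTypeR R * measurableTypeR R) -> \bar R :=
  (@lebesgue_measure R \x @lebesgue_measure R)%E.

Arguments area R : clear implicits.

Definition abs_continuous (R : realType) (g : R -> R * R) (a b : R) : Prop :=
  forall e : R, 0 < e -> exists2 d : R, 0 < d &
    forall (n : nat) (s t : 'I_n -> R),
      (forall i, a <= s i /\ s i <= t i /\ t i <= b) ->
      trivIset [set: 'I_n] (fun i => `]s i, t i[%classic) ->
      \sum_(i < n) (t i - s i) < d ->
      \sum_(i < n) cmod (g (t i) - g (s i)) < e.

(* Absolute continuity on lines. *)
Definition ACL_disk (R : realType) (F : R * R -> R * R) : Prop :=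
  forall a b c d : R, a < b -> c < d ->
    `[a, b]%classic `*` `[c, d]%classic `<=` unit_disk R ->
    (\forall y \ae @lebesgue_measure R, y \in `[c, d] ->
       abs_continuous (fun x => F (x, y)) a b) /\
    (\forall x \ae @lebesgue_measure R, x \in `[a, b] ->
       abs_continuous (fun y => F (x, y)) c d).

(* Wirtinger derivatives. *)
Definition d_z (R : realType) (F : R * R -> R * R) (p : R * R) : R[i] :=
  (toC ('D_(1, 0) F p) - 'i * toC ('D_(0, 1) F p)) / 2.

Definition d_zbar (R : realType) (F : R * R -> R * R) (p : R * R) : R[i] :=
  (toC ('D_(1, 0) F p) + 'i * toC ('D_(0, 1) F p)) / 2.

Definition disk_homeo (R : realType) (F : R * R -> R * R) : Prop :=
  exists F' : R * R -> R * R,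
    [/\ {within unit_disk R, continuous F} /\
        {within unit_disk R, continuous F'},
        (forall p, unit_disk R p -> unit_disk R (F p)),
        (forall p, unit_disk R p -> unit_disk R (F' p)),
        (forall p, unit_disk R p -> F' (F p) = p) &
        (forall p, unit_disk R p -> F (F' p) = p)].

(* Analytic definition (Ahlfors) of a sense-preserving quasiconformal
   homeomorphism of the unit disk onto itself; F is irrelevant off the disk.
   The inequality |F_zbar| <= k |F_z| makes the Jacobian nonnegative almost
   everywhere, which is what excludes sense-reversing maps. *)
Definition quasiconformal (R : realType) (F : R * R -> R * R) : Prop :=
  [/\ disk_homeo F,
      ACL_disk F &
      exists2 k : R, 0 <= k < 1 &
        \forall p \ae area R, unit_disk R p ->
          [/\ derivable F p (1, 0), derivable F p (0, 1) &
              `|d_zbar F p| <= k%:C * `|d_z F p|]].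

Definition complex_dilatation (R : realType) (F mu : R * R -> R * R) : Prop :=
  \forall p \ae area R, unit_disk R p -> d_zbar F p = toC (mu p) * d_z F p.

(* L^oo norm of the restriction of mu to A. *)
Definition Linf_on (R : realType) (A : set (R * R)) (mu : R * R -> R * R) :
    \bar R :=
  'N[area R]_+oo[(fun p => (cmod (mu p))%:E) \_ A]%E.

Definition M_sharp (R : realType) (X : set (R * R)) : set (R * R -> R * R) :=
  [set mu | [/\
    measurable_fun (unit_disk R : set (measurableTypeR R * measurableTypeR R))
      (mu : measurableTypeR R * measurableTypeR R ->
            measurableTypeR R * measurableTypeR R),
    (Linf_on (unit_disk R) mu < 1)%E &
    forall e : R, 0 < e -> exists K : set (R * R),
      [/\ compact K, K `<=` (unit_disk R `|` X) &
          (Linf_on (unit_disk R `\` K) mu < e%:E)%E]]].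

Definition boundary_extension (R : realType) (F : R * R -> R * R)
    (f : unit_circle R -> unit_circle R) : Prop :=
  forall z : unit_circle R,
    F p @[p --> within (unit_disk R) (nbhs (\val z))] --> \val (f z).

Definition QS_sharp (R : realType) (X : set (R * R)) :
    set (unit_circle R -> unit_circle R) :=
  [set f | [/\ circle_homeo f, quasisymmetric f &
    exists F mu : R * R -> R * R,
      [/\ quasiconformal F, complex_dilatation F mu, M_sharp X mu &
          boundary_extension F f]]].

(* Main.v *)
(* Proof idea.  A non-elementary group contains a hyperbolic element g with a
   fixed point a outside X: the fixed points of the hyperbolic elements form an
   invariant set, which cannot be a subset of X, and a group without hyperbolic
   elements has a common fixed point in the closed disk.  The logarithmic
   coordinate w = x + i y that sends a and the other fixed point of g to the
   ends of the strip 0 < y < pi turns g into a translation by some l; the same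
   coordinate for the images of the two points turns f g f^-1 into a translation
   by some l'.  So the boundary values of the quasiconformal extension F are
   functions u0, u1 with u_j (x + l) = u_j x + l'.  The dilatation of F tends to
   0 at a, hence far out in the strip exp (i s W) is almost holomorphic, where W
   is the image coordinate.  It is paired with exp (i (t w + th)) over a window of
   length L that is moved towards a by iterating g.  The area inequality for F
   controls the error, and the equivariance of u0, u1 moves the window back.  For
   all real s, t, th this bounds, independently of L, the integral of
     bump (x / L) (sin (s u0 + t x + th) - exp (-(s + t) pi) sin (s u1 + t x + th)).
   With s = 2 pi / l' and t = 2 pi n / l it follows that all Fourier coefficients
   of exp (2 pi i u_j / l') but one vanish, so that u0 = u1 = x + C, which says
   that f is a Moebius transformation. *)
Require Import Defs.
From HB Require Import structures.
From mathcomp Require Import all_boot all_order all_algebra.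
From mathcomp Require Import complex ring lra.
From mathcomp Require Import all_classical all_reals all_analysis.
From mathcomp Require Import measurable_realfun lebesgue_measure.

Set Implicit Arguments.
Unset Strict Implicit.
Unset Printing Implicit Defensive.

Import Order.TTheory GRing.Theory Num.Theory.
Import numFieldNormedType.Exports.

Local Open Scope classical_set_scope.
Local Open Scope ring_scope.

(** * Absolute continuity *)

(** The shape of the proof comes from how little is known of F: it is absolutely continuous on
    lines, its partial derivatives exist almost everywhere without any integrability, and u0, u1 are
    merely continuous. Differentiability almost everywhere is therefore obtained by the
    Gehring-Lehto argument, and a one-sided area inequality takes the place of the change of
    variables; it already gives the weighted energy bound for F. The pairing is done weakly, against
    fields with compact support in the open disk, and u0, u1 enter only as limits of cutoffs. The
    bound does not depend on L because three scales are balanced: a source window of half-width L,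
    an image cutoff of half-width M >= L, and a dilatation of at most 1/M on the window. The energy
    is of order M, the mass of the window of order L, and the squared defect of order 1/M^2, so that
    what remains is L/M. Then M tends to infinity. A periodic function whose integrals against bump
    (x / L) stay bounded has mean 0; this turns the bound into vanishing Fourier coefficients. The
    terms with u0 and u1 can be separated only if s + t is nonzero, whence the one exceptional
    coefficient. *)

Section almost_everywhere_connectives.
Context d (T : measurableType d) (R : realType) (m : {measure set T -> \bar R}).
Implicit Types P Q S : T -> Prop.

Lemma ae_imply P Q : (forall x, P x -> Q x) ->
  {ae m, forall x, P x} -> {ae m, forall x, Q x}.
Proof. move=> PQ; apply: filterS; exact: PQ. Qed.

Lemma ae_imply2 P Q S : (forall x, P x -> Q x -> S x) ->
  {ae m, forall x, P x} -> {ae m, forall x, Q x} -> {ae m, forall x, S x}.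
Proof. move=> PQ; apply: filterS2; exact: PQ. Qed.

End almost_everywhere_connectives.

Section scalar_absolute_continuity.
Context {R : realType}.
Local Notation mu := (@lebesgue_measure R).
Implicit Types (g f : R -> R) (a b : R).

Lemma is_derive1_eps (g : R -> R) (x d : R) : is_derive x 1 g d <->
  forall e : R, 0 < e -> exists2 r : R, 0 < r & forall y, `|y - x| < r ->
    `|g y - g x - d * (y - x)| <= e * `|y - x|.
Proof.
have E h : h != 0 -> `|d - h^-1 *: (g (h *: 1 + x) - g x)| =
    `|g (x + h) - g x - d * h| / `|h|.
  move=> h0; rewrite [h *: 1]mulr1 -normfV -normrM -normrN; congr `|_|.
  by rewrite opprB (mulrBl (h^-1)) mulfK// (addrC h x) [_ *: _]mulrC.
split=> [[dg Dg] e e0|H].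
  have : (h^-1 *: (g (h *: 1 + x) - g x) @[h --> 0^']) --> d by rewrite -Dg.
  move=> /cvgrPdist_le /(_ e e0).
  rewrite /prop_near1 /dnbhs /within /= => /nbhs_ballP[r /= r0 hr].
  exists r => // y yx; have [->|yneq] := eqVneq y x.
    by rewrite !subrr mulr0 subrr normr0 mulr0.
  have := hr (y - x); rewrite /ball/= !sub0r !normrN yx => /(_ erefl).
  rewrite subr_eq0 => /(_ yneq); rewrite E ?subr_eq0//.
  by rewrite ler_pdivrMr ?normr_gt0 ?subr_eq0// [x + _]addrC subrK.
suff : (h^-1 *: (g (h *: 1 + x) - g x) @[h --> 0^']) --> d.
  by move=> h; split; [apply/cvg_ex; exists d|apply/cvg_lim].
apply/cvgrPdist_le => e e0; have [r r0 hr] := H e e0.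
rewrite /prop_near1 /dnbhs /within /=; apply/nbhs_ballP; exists r => //= h.
rewrite /ball/= sub0r normrN => hr' h0; rewrite E// ler_pdivrMr ?normr_gt0//.
by have := hr (x + h); rewrite addrC addKr; apply.
Qed.

(** The intervals are listed from right to left: the head lies below [b] and the tail ends before
    the head begins. Real induction moving to the right then extends a chain by a cons. *)
Fixpoint interval_chain (a b : R) (l : seq (R * R)) : Prop :=
  if l is p :: l' then
    [/\ p.1 <= p.2, p.2 <= b & interval_chain a p.1 l'] else a <= b.

Definition chain_var g (l : seq (R * R)) : R :=
  \sum_(p <- l) `|g p.2 - g p.1|.

Definition chain_len (l : seq (R * R)) : R := \sum_(p <- l) (p.2 - p.1).

(** Half-open intervals keep adjacent members of a chain disjoint, so that the measure of the set is
    exactly the length of the chain. *)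
Definition chain_set (l : seq (R * R)) : set R :=
  foldr (fun p A => `]p.1, p.2]%classic `|` A) set0 l.

Definition abs_continuousR g a b := forall e : R, 0 < e ->
  exists2 d : R, 0 < d & forall l, interval_chain a b l ->
    chain_len l < d -> chain_var g l < e.

Lemma interval_chain_le a b l : interval_chain a b l -> a <= b.
Proof.
elim: l b => [//|p l IH] b /= [p12 pb /IH ap].
exact: le_trans (le_trans ap p12) pb.
Qed.

Lemma interval_chainW a b c l : b <= c ->
  interval_chain a b l -> interval_chain a c l.
Proof.
case: l => [|p l] /= bc; first by move=> /le_trans; apply.
by move=> [? pb ?]; split=> //; exact: le_trans bc.
Qed.

Lemma interval_chain_nth a b l i j : interval_chain a b l ->
  (i < j < size l)%N ->
  (nth (0, 0) l j).2 <= (nth (0, 0) l i).1.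
Proof.
elim: l b i j => [|p l IH] b i j /=; first by rewrite andbF.
move=> [p12 pb lp].
case: i => [|i]; case: j => [|j] //=; last by rewrite ltnS; exact: IH lp.
rewrite ltnS => jl.
have := lp; move: jl; clear.
elim: l p j => [//|q l IH] p [|j] /=; first by move=> _ [].
rewrite ltnS => jl [q12 q2p H].
exact: le_trans (IH _ _ jl H) (le_trans q12 q2p).
Qed.

Lemma interval_chain_bnd a b l i : interval_chain a b l -> (i < size l)%N ->
  [/\ a <= (nth (0, 0) l i).1, (nth (0, 0) l i).1 <= (nth (0, 0) l i).2 &
      (nth (0, 0) l i).2 <= b].
Proof.
elim: l b i => [//|p l IH] b [|i] /= [p12 pb lp] il.
  by split=> //; exact: interval_chain_le lp.
have [? ? ?] := IH _ i lp il; split=> //.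
exact: le_trans (le_trans _ p12) pb.
Qed.

(** Passes from a planar curve [h] and families indexed by ['I_n] to a scalar function and lists. It
    is used for [g = Psi \o h] with [Psi] Lipschitz on a disc that contains the curve. *)
Lemma abs_continuous_chain (h : R -> R * R) g a b :
  (forall s t, a <= s -> t <= b -> s <= t ->
     exists2 C, 0 < C & forall s' t', s <= s' -> s' <= t' -> t' <= t ->
      `|g t' - g s'| <= C * cmod (h t' - h s')) ->
  abs_continuous h a b -> abs_continuousR g a b.
Proof.
move=> hg hac e e0.
have [ab|ba] := leP a b; last first.
  exists 1 => // l /interval_chain_le ab; exfalso.
  by move: ba; rewrite ltNge ab.
have [C C0 hC] := hg a b (lexx _) (lexx _) ab.
have [d d0 hd] := hac (e / C) (divr_gt0 e0 C0).
exists d => // l chl lend.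
have := hd (size l) (fun i => (nth (0, 0) l i).1) (fun i => (nth (0, 0) l i).2).
have -> : \sum_(i < size l) ((nth (0, 0) l i).2 - (nth (0, 0) l i).1) =
    chain_len l.
  by rewrite /chain_len (big_nth (0, 0)) big_mkord.
move=> /(_ _ _ lend) hs.
have {hs} : \sum_(i < size l) cmod (h (nth (0, 0) l i).2 -
    h (nth (0, 0) l i).1) < e / C.
  apply: hs => [i|]; first by have [] := interval_chain_bnd chl (ltn_ord i).
  apply/trivIsetP => /= i j _ _ ij; apply/seteqP; split => // x [] /=.
  rewrite !in_itv /= => /andP[ix xi] /andP[jx xj].
  case: (ltngtP i j) ij => [ij _|ji _|/val_inj -> /eqP//].
    have := interval_chain_nth chl (_ : (i < j < size l)%N).
    by rewrite ij ltn_ord => /(_ isT) /le_lt_trans/(_ ix)/(lt_trans xj); rewrite ltxx.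
  have := interval_chain_nth chl (_ : (j < i < size l)%N).
  by rewrite ji ltn_ord => /(_ isT) /le_lt_trans/(_ jx)/(lt_trans xi); rewrite ltxx.
rewrite ltr_pdivlMr// => /(le_lt_trans _); apply.
rewrite mulrC mulr_sumr /chain_var (big_nth (0, 0)) big_mkord.
apply: ler_sum => i _.
by have [] := interval_chain_bnd chl (ltn_ord i); exact: hC.
Qed.

Lemma chain_set_sub a b l : interval_chain a b l ->
  chain_set l `<=` `]a, b]%classic.
Proof.
elim: l b => [|p l IH] b /=; first by move=> _ x.
move=> [p12 pb lp] x [|].
  rewrite /= !in_itv/= => /andP[px xp]; rewrite (le_trans xp pb) andbT.
  exact: le_lt_trans (interval_chain_le lp) px.
move=> /(IH _ lp); rewrite /= !in_itv/= => /andP[-> xp] /=.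
exact: le_trans xp (le_trans p12 pb).
Qed.

Lemma measurable_chain_set l : measurable (chain_set l).
Proof. by elim: l => [|p l IH] /=; [exact: measurable0|exact: measurableU]. Qed.

Lemma measure_chain_set a b l : interval_chain a b l ->
  mu (chain_set l) = (chain_len l)%:E.
Proof.
elim: l b => [|p l IH] b /=; first by rewrite measure0 /chain_len big_nil.
move=> [p12 pb lp]; rewrite measureU//=; last 2 first.
  exact: measurable_chain_set.
  apply/seteqP; split => // x [] /=; rewrite in_itv/= => /andP[px _].
  move=> /(chain_set_sub lp) /=; rewrite in_itv/= => /andP[_].
  by rewrite leNgt px.
rewrite (IH _ lp) lebesgue_measure_itv/= /chain_len big_cons EFinD.
congr (_ + _)%E; case: ltP => //; rewrite lee_fin => ?.
by have -> : p.2 = p.1 by [apply/eqP; rewrite eq_le; apply/andP]; rewrite subrr.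
Qed.

Lemma abs_continuousRB g f a b : abs_continuousR g a b ->
  abs_continuousR f a b -> abs_continuousR (fun x => g x - f x) a b.
Proof.
move=> hg hf e e0; have e20 : 0 < e / 2 by rewrite divr_gt0.
have [d d0 hd] := hg _ e20; have [d' d'0 hd'] := hf _ e20.
exists (Num.min d d'); first by rewrite lt_min d0.
move=> l cl; rewrite lt_min => /andP[/(hd _ cl) lg /(hd' _ cl) lf].
rewrite [ltRHS]splitr; apply: le_lt_trans (ltrD lg lf).
rewrite /chain_var -big_split /=; apply: ler_sum => p _.
have -> : g p.2 - f p.2 - (g p.1 - f p.1) = (g p.2 - g p.1) - (f p.2 - f p.1).
  by ring.
exact: ler_normB.
Qed.

(* The exceptional null set is absorbed by intervals inside an open set of small
   measure, on which absolute continuity applies; elsewhere the derivative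
   controls the increment. The two are combined by real induction. *)
Lemma abs_continuous_derive0 g a b : a <= b -> abs_continuousR g a b ->
  {ae mu, forall x, a < x < b -> is_derive x 1 g 0} -> g a = g b.
Proof.
move=> ab gac gd.
have {gd} [N [mN N0 hN]] : exists N, [/\ measurable N, mu N = 0 &
    forall x, a <= x <= b -> ~ N x -> is_derive x 1 g 0].
  have [N' [mN' N'0 hN']] := gd.
  exists (N' `|` [set a; b]); split.
  - by apply: measurableU => //; exact: measurableU.
  - apply/eqP; rewrite eq_le measure_ge0 andbT.
    apply: (le_trans (measureU2 _ _ _)) => //; first exact: measurableU.
    rewrite [X in (X + _)%E](N'0 : mu N' = 0%E) add0e.
    apply: (le_trans (measureU2 _ _ _)) => //.
    by rewrite [X in (X + _)%E]lebesgue_measure_set1 [X in (_ + X)%E]lebesgue_measure_set1 adde0.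
  - move=> x axb /not_orP[xN' /not_orP[/eqP xa /eqP xb]].
    apply: contrapT => nd; apply: xN'; apply: hN' => /= h; apply: nd; apply: h.
    by rewrite !lt_neqAle eq_sym xa xb.
suff H : forall e, 0 < e -> `|g b - g a| <= e * (b - a) + e.
  apply/eqP; rewrite eq_sym -subr_eq0 -normr_le0.
  apply/ler_addgt0Pl => e e0; rewrite addr0.
  have k0 : 0 < b - a + 1 by lra.
  have := H (e / (b - a + 1)) (divr_gt0 e0 k0); move=> /le_trans; apply.
  rewrite -[X in _ + X]mulr1 -mulrDr divfK ?lt0r_neq0//.
move=> e e0.
have [d d0 hd] := gac e e0.
have [Om [oO NO muO]] : exists Om, [/\ open Om, N `<=` Om & (mu Om < d%:E)%E].
  have := @lebesgue_regularity_outer R N d mN.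
  have Noo : (mu N < +oo)%E by rewrite N0 ltry.
  move=> /(_ Noo d0)[Om [oO NO h]]; exists Om; split => //.
  rewrite (_ : Om = N `|` (Om `\` N)); last by rewrite setDUK.
  apply: le_lt_trans (measureU2 _ _ _) _ => //.
    by apply: measurableD => //; exact: open_measurable.
  by rewrite [X in (X + _)%E](N0 : mu N = 0%E) add0e.
have mO : measurable Om by exact: open_measurable.
(* [P t] says that the increment over [[a, t]] is paid for by slope [e] and by the variation over a
   chain inside [Om]. Such a chain is shorter than [d], so at [t = b] its variation is below [e]. *)
pose P t := exists l, [/\ interval_chain a t l,
  chain_set l `<=` Om & `|g t - g a| <= e * (t - a) + chain_var g l].
have Pstep s t : s <= t -> P s ->
    (`|g t - g s| <= e * (t - s) \/ `]s, t]%classic `<=` Om) -> P t.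
  move=> st [l [cl lO hl]].
  have tri : `|g t - g a| <= `|g t - g s| + `|g s - g a|.
    by rewrite (le_trans _ (ler_normD _ _))// addrA subrK.
  case=> [h|h]; [exists l|exists ((s, t) :: l)]; split => //.
  - exact: interval_chainW cl.
  - lra.
  - by move=> x [/h//|/lO].
  - rewrite /chain_var big_cons /= -/(chain_var g l).
    by have := ler_wpM2l (ltW e0) st; lra.
have local x : a <= x <= b -> exists2 r, 0 < r & forall s t, x - r < s ->
    s <= x -> x <= t -> t < x + r -> P s -> P t.
  move=> axb; have [Nx|Nx] := pselect (N x).
    have /nbhs_ballP[r /= r0 hr] : nbhs x Om by apply: open_nbhs_nbhs; split=> //; exact: NO.
    exists r => // s t xs sx xt tx Ps; apply: (Pstep s t) => //.
      exact: le_trans xt.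
    right=> y /=; rewrite in_itv/= => /andP[sy yt]; apply: hr.
    by rewrite /ball/= ltr_distlC; lra.
  have [r r0 Hy] := (is_derive1_eps _ _ _).1 (hN _ axb Nx) e e0.
  exists r => // s t xs sx xt tx Ps; apply: (Pstep s t) => //.
    exact: le_trans xt.
  left; have := Hy s; have := Hy t; rewrite !mul0r !subr0.
  rewrite ltr_norml (ger0_norm (_ : 0 <= t - x)) ?subr_ge0//.
  rewrite ltr_norml (ler0_norm (_ : s - x <= 0)) ?subr_le0//.
  move=> /(_ ltac:(lra)) h1 /(_ ltac:(lra)) h2.
  have -> : g t - g s = (g t - g x) - (g s - g x) by ring.
  by apply: (le_trans (ler_normB _ _)); lra.
have Pa : P a.
  by exists [::]; split => //=; rewrite /chain_var big_nil !subrr normr0 mulr0 addr0.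
pose S := [set t | a <= t <= b /\ P t].
have Sa : S a by split=> //; rewrite lexx.
have Sub : ubound S b by move=> t [/andP[]].
have hS : has_sup S by split; [exists a|exists b].
pose c := sup S.
have ac : a <= c by apply: ub_le_sup => //; exists b.
have cb : c <= b by apply: ge_sup => //; exists a.
have acb : a <= c <= b by rewrite ac.
have [r r0 hr] := local c acb.
have [s [/andP[as_ sb] Ps] cs] := sup_adherent r0 hS.
have sc : s <= c by apply: ub_le_sup; [exists b|split=> //; rewrite as_].
have [cb'|bc] := ltP (c + r / 2) b.
  have : S (c + r / 2).
    split; first by apply/andP; split; lra.
    by apply: (hr s) => //; lra.
  by move=> /(ub_le_sup (ex_intro _ b Sub)); rewrite -/c; lra.
have [l [cl lO hl]] : P b by apply: (hr s) => //; lra.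
apply: (le_trans hl); rewrite lerD2l ltW//; apply: (hd _ cl).
rewrite -lte_fin -(measure_chain_set cl); apply: le_lt_trans muO.
by apply: le_measure => //; rewrite inE//; exact: measurable_chain_set.
Qed.

Lemma abs_continuousR_integral f a b : mu.-integrable setT (EFin \o f) ->
  abs_continuousR (fun x => \int[mu]_(t in `[a, x]) f t) a b.
Proof.
move=> fi e e0; have [d [d0 hd]] := integral_normr_continuous fi e0.
exists d => // l cl ld.
have iS (A : set R) : measurable A -> mu.-integrable A (EFin \o f).
  by move=> mA; exact: integrableS fi.
apply: (@le_lt_trans _ _ (\int[mu]_(x in chain_set l) `|f x|)); last first.
  apply: hd; first exact: measurable_chain_set.
  have h : (mu (chain_set l) < d%:E)%E by rewrite (measure_chain_set cl) lte_fin.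
  exact: h.
elim: l b cl {ld} => [|p l IH] b /=; first by rewrite /chain_var big_nil Rintegral_set0.
move=> [p12 pb lp]; rewrite /chain_var big_cons Rintegral_setU//=; first last.
- apply/disj_setPS => x [] /=; rewrite in_itv/= => /andP[px _].
  by move=> /(chain_set_sub lp) /=; rewrite in_itv/= => /andP[_]; rewrite leNgt px.
- have mA : measurable (`]p.1, p.2]%classic `|` chain_set l).
    by apply: measurableU => //; exact: measurable_chain_set.
  exact: (integrable_abse (iS _ mA)).
- exact: measurable_chain_set.
apply: lerD; last exact: IH lp.
have ap := interval_chain_le lp.
rewrite (@Rintegral_itvB _ f (BLeft a) (BRight p.2) p.1) ?bnd_simp//; last exact: iS.
by apply: le_normr_Rintegral => //; exact: iS.
Qed.

(** By Lebesgue differentiation [g] minus the indefinite integral of [f] has derivative 0 almost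
    everywhere; being absolutely continuous, it is constant. *)
Lemma abs_continuous_FTC g f a b : a <= b -> abs_continuousR g a b ->
  mu.-integrable `[a, b] (EFin \o f) ->
  {ae mu, forall x, a < x < b -> is_derive x 1 g (f x)} ->
  \int[mu]_(t in `[a, b]) f t = g b - g a.
Proof.
move=> ab gac fi gd.
pose fr := f \_ `[a, b]%classic.
have fri : mu.-integrable setT (EFin \o fr).
  rewrite /fr (_ : EFin \o _ = (EFin \o f) \_ `[a, b]%classic).
    exact/(integrable_mkcond _ _).1.
  by apply/funext => x; rewrite /= !patchE; case: ifP.
pose F x := \int[mu]_(t in `[a, x]) fr t.
have Fac := @abs_continuousR_integral fr a b fri.
have Fd : {ae mu, forall x, (BLeft a < BRight x)%E -> derivable F x 1 /\ derive1 F x = fr x}.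
  apply: FTC1 => [y|]; first exact: integrableS fri.
  exact: integrable_locally fi.
have := abs_continuous_derive0 ab (abs_continuousRB gac Fac).
have -> : \int[mu]_(t in `[a, a]) fr t = 0 by rewrite set_itv1 Rintegral_set1.
have -> : \int[mu]_(t in `[a, b]) fr t = \int[mu]_(t in `[a, b]) f t.
  by apply: eq_Rintegral => x xab; rewrite /fr patchE xab.
rewrite subr0 => h; rewrite h; first by rewrite opprB addrC subrK.
apply: ae_imply2 Fd gd => x Fx gx axb; have /andP[ax xb] := axb.
have axE : (BLeft a < BRight x)%E by [].
have [dF DF] := Fx axE; rewrite derive1E in DF.
have fx : fr x = f x by rewrite /fr patchE mem_set//= in_itv/= !ltW.
have := gx axb => gx'.
have Fx' : is_derive x 1 F (f x) by split=> //; rewrite DF.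
by have := is_deriveB gx' Fx'; rewrite subrr.
Qed.

End scalar_absolute_continuity.

(** * Plane topology and area *)

Section plane.
Context {R : realType}.
Local Notation mu := (@lebesgue_measure R).
Local Notation pt := (R * R)%type.
Implicit Types (p q z w : pt) (A : set pt).

Lemma toC_norm p : `|toC p| = (cmod p)%:C%C.
Proof. by rewrite normc_def. Qed.

Lemma toCD p q : toC (p + q) = toC p + toC q.
Proof. by apply/eqP; rewrite eq_complex /= !eqxx. Qed.

Lemma cmod_ge0 p : 0 <= cmod p. Proof. exact: sqrtr_ge0. Qed.

Lemma cmodD p q : cmod (p + q) <= cmod p + cmod q.
Proof. by rewrite -lecR rmorphD /= -!toC_norm toCD ler_normD. Qed.

Lemma cmodN p : cmod (- p) = cmod p.
Proof. by rewrite /cmod /= !sqrrN. Qed.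

Lemma cmodC p q : cmod (p - q) = cmod (q - p).
Proof. by rewrite -cmodN opprB. Qed.

Lemma cmodBD z p q : cmod (p - q) <= cmod (p - z) + cmod (z - q).
Proof. by rewrite (le_trans _ (cmodD _ _))// addrA subrK. Qed.

Lemma cmod0 : cmod (0 : pt) = 0.
Proof. by rewrite /cmod /= expr0n /= addr0 sqrtr0. Qed.

Lemma cmodBB p q : cmod p - cmod q <= cmod (p - q).
Proof. by rewrite lerBlDr (le_trans _ (cmodD _ _))// subrK. Qed.

Lemma cmod_sqr p : cmod p ^+ 2 = p.1 ^+ 2 + p.2 ^+ 2.
Proof. by rewrite sqr_sqrtr// addr_ge0// sqr_ge0. Qed.

Lemma cmodZ (r : R) p : cmod (r *: p) = `|r| * cmod p.
Proof.
by rewrite /cmod /= !exprMn -mulrDr sqrtrM ?sqr_ge0// sqrtr_sqr.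
Qed.

Lemma fst_le_cmod p : `|p.1| <= cmod p.
Proof. by rewrite -sqrtr_sqr ler_wsqrtr// lerDl sqr_ge0. Qed.

Lemma snd_le_cmod p : `|p.2| <= cmod p.
Proof. by rewrite -sqrtr_sqr ler_wsqrtr// lerDr sqr_ge0. Qed.

Lemma cmod_le_norm1 p : cmod p <= `|p.1| + `|p.2|.
Proof.
rewrite -(ger0_norm (addr_ge0 (normr_ge0 p.1) (normr_ge0 p.2))) -sqrtr_sqr.
apply: ler_wsqrtr; rewrite sqrrD !real_normK ?num_real//.
by rewrite addrAC lerDl mulrn_wge0// mulr_ge0.
Qed.

Lemma cmod_eq0 p : (cmod p == 0) = (p == 0).
Proof.
apply/eqP/eqP => [h|->]; last exact: cmod0.
apply/eqP; rewrite -pair_eqE /pair_eq /= -!normr_le0 -h.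
by rewrite fst_le_cmod snd_le_cmod.
Qed.

Definition disc z (r : R) : set pt := [set w | cmod (w - z) < r].

(** The bridge between the product topology, given by the max norm, and Euclidean discs. *)
Lemma nbhs_disc z A : nbhs z A <-> exists2 r : R, 0 < r & disc z r `<=` A.
Proof.
split=> [/nbhs_ballP[r /= r0 rA]|[r r0 rA]].
  exists r => // w zw; apply: rA; split; rewrite /ball/= distrC.
    exact: le_lt_trans (fst_le_cmod (w - z)) zw.
  exact: le_lt_trans (snd_le_cmod (w - z)) zw.
apply/nbhs_ballP; exists (r / 2); rewrite /= ?divr_gt0// => w [/=].
rewrite /ball/= => h1 h2; apply: rA; rewrite /disc/= cmodC.
by rewrite (le_lt_trans (cmod_le_norm1 _))// [ltRHS]splitr ltrD.
Qed.

Lemma disc_center z r : 0 < r -> disc z r z.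
Proof. by rewrite /disc /= subrr cmod0. Qed.

Lemma open_disc z r : open (disc z r).
Proof.
rewrite openE => w zw; apply/nbhs_disc; exists (r - cmod (w - z)).
  by rewrite subr_gt0.
move=> v; rewrite /disc/= => vw; rewrite (le_lt_trans (cmodBD w _ _))//.
by rewrite -ltrBrDr.
Qed.

Lemma open_discP A : open A <-> forall z, A z -> exists2 r : R, 0 < r & disc z r `<=` A.
Proof.
rewrite openE; split=> h z /h; first by move=> /nbhs_disc.
by move=> ?; apply/nbhs_disc.
Qed.

Lemma cts_cmodP (f : pt -> pt) z : {for z, continuous f} <->
  forall e : R, 0 < e -> exists2 d : R, 0 < d & forall w, cmod (w - z) < d ->
    cmod (f w - f z) < e.
Proof.
split=> [h e e0|h].
  have /h /nbhs_disc [d d0 dh] : nbhs (f z) (disc (f z) e).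
    by apply/nbhs_disc; exists e.
  by exists d.
move=> A /nbhs_disc[r r0 rA]; have [d d0 dh] := h r r0.
by apply/nbhs_disc; exists d => // w /dh /rA.
Qed.

Lemma cts_normP (f : pt -> R) z : {for z, continuous f} <->
  forall e : R, 0 < e -> exists2 d : R, 0 < d & forall w, cmod (w - z) < d ->
    `|f w - f z| < e.
Proof.
split=> [h e e0|h].
  have /h /nbhs_disc [d d0 dh] : nbhs (f z) (ball (f z) e) by exact: nbhsx_ballx.
  by exists d => // w /dh; rewrite /= /ball/= distrC.
move=> A /nbhs_ballP[r /= r0 rA]; have [d d0 dh] := h r r0.
by apply/nbhs_disc; exists d => // w /dh wh; apply: rA; rewrite /ball/= distrC.
Qed.

(** Measurability in the plane refers to the product sigma-algebra, so an open set is written as the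
    countable union of the rational boxes that it contains. *)
Lemma open_measurable_plane A : open A -> measurable A.
Proof.
move=> oA; pose box (r : (rat * rat) * (rat * rat)) : set pt :=
  (`]ratr r.1.1, ratr r.1.2[%classic `*` `]ratr r.2.1, ratr r.2.2[%classic).
suff -> : A = \bigcup_(r in [set: (rat * rat) * (rat * rat)])
    (if `[< box r `<=` A >] then box r else set0).
  apply: countable_bigcupT_measurable => // r.
  by case: ifPn => _; [exact: measurableX|exact: measurable0].
apply/seteqP; split => [z Az|z [r _]]; last by case: ifPn => // /asboolP; apply.
have [e e0 eA] := (open_discP _).1 oA z Az.
have e2 : 0 < e / 2 by rewrite divr_gt0.
have rl x : exists q : rat, x - e / 2 < ratr q < x.
  have [q] := @rat_in_itvoo R (x - e / 2) x ltac:(lra).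
  by rewrite in_itv/= => ?; exists q.
have rr x : exists q : rat, x < ratr q < x + e / 2.
  have [q] := @rat_in_itvoo R x (x + e / 2) ltac:(lra).
  by rewrite in_itv/= => ?; exists q.
have [[q1 /andP[q11 q12]] [q2 /andP[q21 q22]]] := (rl z.1, rr z.1).
have [[q3 /andP[q31 q32]] [q4 /andP[q41 q42]]] := (rl z.2, rr z.2).
have bA : box ((q1, q2), (q3, q4)) `<=` A.
  move=> w [/=]; rewrite !in_itv/= => /andP[w1 w2] /andP[w3 w4].
  apply: eA; rewrite /disc/= (le_lt_trans (cmod_le_norm1 _))// [ltRHS]splitr.
  by rewrite ltrD//= ltr_distlC; apply/andP; split; lra.
exists ((q1, q2), (q3, q4)) => //; rewrite asboolT//.
by split; rewrite /= in_itv/= ?q12 ?q32.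
Qed.

Lemma closed_measurable_plane A : closed A -> measurable A.
Proof. by move/closed_openC/open_measurable_plane/measurableC; rewrite setCK. Qed.

Lemma continuous_measurable_plane A (f : pt -> R) : open A ->
  (forall z, A z -> {for z, continuous f}) -> measurable_fun A f.
Proof.
move=> oA cf; apply: (measurability _ (RGenOpens.measurableE R)).
move=> _ [_ [a [b ->] <-]]; apply: open_measurable_plane.
rewrite openE => z [Az faz]; apply: filterI.
  by move: oA; rewrite openE; apply.
by apply: (cf z Az); apply: open_nbhs_nbhs; split=> //; exact: interval_open.
Qed.

Lemma continuous_measurable_map A (f : pt -> pt) : open A ->
  (forall z, A z -> {for z, continuous f}) -> measurable_fun A f.
Proof.
move=> oA cf; have mA := open_measurable_plane oA.
apply/(measurable_restrictT _ mA).
rewrite (_ : f \_ A = fun z => (((fst \o f) \_ A) z, ((snd \o f) \_ A) z)); last first.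
  by apply/funext => z; rewrite !patchE; case: ifP => //= _; case: (f z).
have cts (g : pt -> R) : (forall v, `|g v| <= cmod v) -> (forall u v, g (u - v) = g u - g v) ->
    measurable_fun setT ((g \o f) \_ A).
  move=> g1 gB; apply: (measurable_restrictT (g \o f) mA).1.
  apply: continuous_measurable_plane => // z /cf /cts_cmodP h; apply/cts_normP => e /h[d d0 hd].
  by exists d => // w /hd; apply: le_lt_trans; rewrite /= -gB.
by apply: measurable_fun_pair; apply: cts => // v; [exact: fst_le_cmod|exact: snd_le_cmod].
Qed.

Lemma connected_convex A :
  (forall p q (t : R), A p -> A q -> 0 <= t <= 1 -> A (p + t *: (q - p))) ->
  connected A.
Proof.
move=> h; have [->|/set0P[p Ap]] := eqVneq A set0; first exact: connected0.
have -> : A = \bigcup_(q in A) ((fun t : R => p + t *: (q - p)) @` `[0, 1]%classic).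
  apply/seteqP; split => [q Aq|w [q Aq [t]]] /=.
    exists q => //; exists 1; rewrite /= ?in_itv/= ?ler01 ?lexx//.
    by rewrite scale1r addrC subrK.
  by rewrite in_itv/= => t01 <-; exact: h.
apply: bigcup_connected.
  exists p => q _ /=; exists 0; rewrite /= ?in_itv/= ?ler01 ?lexx//.
  by rewrite scale0r addr0.
move=> q _; apply: connected_continuous_connected; first exact: segment_connected.
apply: continuous_subspaceT => t; apply: cvgD; first exact: cvg_cst.
by apply: cvgZr_tmp; exact: cvg_id.
Qed.

Lemma connected_disc z r : connected (disc z r).
Proof.
apply: connected_convex => p q t; rewrite /disc/= => pz qz /andP[t0 t1].
have -> : p + t *: (q - p) - z = (1 - t) *: (p - z) + t *: (q - z).
  by rewrite scalerBl scale1r !scalerBr; apply/eqP; rewrite -pair_eqE /pair_eq/=;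
    apply/andP; split; apply/eqP; ring.
apply: (le_lt_trans (cmodD _ _)); rewrite !cmodZ (ger0_norm t0) ger0_norm ?subr_ge0//.
have [<-|tn] := eqVneq 0 t; first by rewrite subr0 mul1r mul0r addr0.
have tp : 0 < t by rewrite lt_neqAle tn.
have := ler_wpM2l (_ : 0 <= 1 - t) (ltW pz); rewrite subr_ge0 => /(_ t1).
have : t * cmod (q - z) < t * r by rewrite ltr_pM2l.
lra.
Qed.

Lemma compact_closed_disc z r : compact [set w | cmod (w - z) <= r].
Proof.
apply: (@subclosed_compact _ _ (`[z.1 - r, z.1 + r]%classic `*` `[z.2 - r, z.2 + r]%classic)).
- rewrite -[X in closed X]setCK; apply: open_closedC; apply/open_discP => w /= /negP.
  rewrite -ltNge => rw; exists (cmod (w - z) - r); first by rewrite subr_gt0.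
  move=> v; rewrite /disc/= => vw; apply/negP; rewrite -ltNge.
  by have := cmodBD v w z; rewrite (cmodC w v); lra.
- by apply: compact_setX; exact: segment_compact.
- move=> w /= wz; split; rewrite /= in_itv/= -ler_distlC distrC.
    exact: le_trans (fst_le_cmod (w - z)) wz.
  exact: le_trans (snd_le_cmod (w - z)) wz.
Qed.

End plane.

HB.instance Definition _ (R : realType) := Measure.on (area R).

(** * Area of discs and images of discs *)

Section disc_area.
Context {R : realType}.
Local Notation mu := (@lebesgue_measure R).
Local Notation lam := (area R).
Local Notation pt := (R * R)%type.
Implicit Types (p q z w : pt) (A : set pt).

Lemma area_disc_section z (h : R) : 0 <= h ->
  lam (disc z h) = (\int[mu]_x (2 * Num.sqrt (h ^+ 2 - (x - z.1) ^+ 2))%:E)%E.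
Proof.
move=> h0; rewrite /area /= /product_measure1; apply: eq_integral => x _ /=.
rewrite (_ : xsection (disc z h) x = ball z.2 (Num.sqrt (h ^+ 2 - (x - z.1) ^+ 2))).
  by rewrite lebesgue_measure_ball ?sqrtr_ge0// mulr_natl.
apply/seteqP; split => y; rewrite /xsection /disc /ball /= inE /= distrC.
- move=> yh; rewrite -sqrtr_sqr ltr_sqrt ?subr_gt0; last first.
    by rewrite -ltr_sqrt ?exprn_gt0 ?(le_lt_trans (cmod_ge0 _) yh)//;
      rewrite [ltRHS]sqrtr_sqr (ger0_norm h0) sqrtr_sqr;
      exact: le_lt_trans (fst_le_cmod ((x, y) - z)) yh.
  have := cmod_sqr ((x, y) - z); rewrite /= ltrBrDl => <-.
  by rewrite ltr_pXn2r ?nnegrE ?cmod_ge0.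
- move=> yh; rewrite -(ltr_pXn2r (_ : 0 < 2)%N) ?nnegrE ?cmod_ge0// cmod_sqr/=.
  rewrite -ltrBrDl -ltr_sqrt ?sqrtr_sqr//.
  by rewrite -sqrtr_gt0 (le_lt_trans _ yh).
Qed.

(** Only the scaling law matters: of the area of the unit disc it is enough to know that it is
    positive and finite. *)
Lemma area_disc z (h : R) : 0 < h -> lam (disc z h) = ((h ^+ 2)%:E * lam (disc 0%R 1%R))%E.
Proof.
move=> h0; rewrite !area_disc_section ?ler01 ?ltW//.
pose G (x : R) := 2 * Num.sqrt (h ^+ 2 - (x - z.1) ^+ 2).
pose F (t : R) := h * t + z.1.
have cG (c a : R) : continuous (fun x : R => 2 * Num.sqrt (c ^+ 2 - (x - a) ^+ 2)).
  move=> x; apply: cvgM; first exact: cvg_cst.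
  apply: (@continuous_comp _ _ _ (fun x : R => c ^+ 2 - (x - a) ^+ 2)); last exact: sqrt_continuous.
  apply: cvgB; first exact: cvg_cst.
  apply: (@continuous_comp _ _ _ (fun x : R => x - a) (fun y : R => y ^+ 2) x); last exact: exprn_continuous.
  by apply: cvgB; [exact: cvg_id|exact: cvg_cst].
have dF (t : R) : is_derive t (1 : R) F h.
  by apply: is_derive_eq; rewrite [_ *: _]mulr1 addr0.
have F' : derive1 F = cst h.
  by apply/funext => t; rewrite derive1E; have [_ ->] := dF t.
rewrite (@increasing_ge0_integration_by_substitutionT _ F G).
- rewrite -ge0_integralZl//=; last 2 first.
  + by apply/measurable_EFinP; apply: continuous_measurable_fun; exact: (cG 1 0).
  + by rewrite lee_fin sqr_ge0.
  apply: eq_integral => x _; rewrite -EFinM F' /= /G /F /=; congr (_%:E).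
  change (2 * Num.sqrt (h ^+ 2 - (h * x + z.1 - z.1) ^+ 2) * h =
    h ^+ 2 * (2 * Num.sqrt (1 ^+ 2 - (x - 0) ^+ 2))).
  rewrite addrK exprMn -{1}[h ^+ 2]mulr1 -mulrBr subr0 expr1n sqrtrM ?sqr_ge0//.
  by rewrite sqrtr_sqr gtr0_norm//; ring.
- by move=> x y xy; rewrite /F ltrD2r ltr_pM2l.
- by rewrite F' => x; exact: cvg_cst.
- by rewrite F'; exact: is_cvg_cst.
- by rewrite F'; exact: is_cvg_cst.
- by move=> x; have [] := dF x.
- apply/cvgrNyPle => M; exists ((M - z.1) / h); split; first exact: num_real.
  by move=> x; rewrite ltr_pdivlMr// /F; lra.
- apply/cvgryPge => M; exists ((M - z.1) / h); split; first exact: num_real.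
  by move=> x; rewrite ltr_pdivrMr// /F; lra.
- exact: cG.
- by move=> x; rewrite mulr_ge0// sqrtr_ge0.
Qed.

Lemma area_disc1_gt0 : (0 < lam (disc (0%R : pt) 1%R))%E.
Proof.
apply: (@lt_le_trans _ _ (lam (`](0 : R), 1/2[%classic `*` `](0 : R), 1/2[%classic))).
  rewrite /area product_measure1E//= lebesgue_measure_itv/= lte_fin ifT; last by lra.
  by rewrite -EFinB -EFinM lte_fin; lra.
apply: le_measure; rewrite ?inE//=; first exact: measurableX.
- by apply: open_measurable_plane; exact: open_disc.
- move=> w [/=]; rewrite !in_itv/= => /andP[a1 a2] /andP[b1 b2].
  rewrite /disc/= subr0 (le_lt_trans (cmod_le_norm1 _))// !gtr0_norm//; lra.
Qed.

Lemma area_disc1_lty : (lam (disc (0%R : pt) 1%R) < +oo)%E.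
Proof.
apply: (@le_lt_trans _ _ (lam (`](-1 : R), 1[%classic `*` `](-1 : R), 1[%classic))); last first.
  rewrite /area product_measure1E//= lebesgue_measure_itv/= lte_fin ifT; last by lra.
  by rewrite -EFinB -EFinM ltry.
apply: le_measure; rewrite ?inE//=; last 2 first.
- exact: measurableX.
- move=> w; rewrite /disc/= subr0 => w1; split => /=; rewrite in_itv/= -ltr_norml.
    exact: le_lt_trans (fst_le_cmod w) w1.
  exact: le_lt_trans (snd_le_cmod w) w1.
- by apply: open_measurable_plane; exact: open_disc.
Qed.

(* A homeomorphism that expands distances by [r / h] on the boundary of a disc
   maps the disc onto a set containing the concentric image disc: the latter is
   connected and misses the image of the boundary circle. *)
Lemma disc_in_image (Om W : set pt) (P Q : pt -> pt) z (h r : R) :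
  open W -> 0 < h -> 0 < r ->
  (forall w, Om w -> {for w, continuous P}) ->
  (forall w, W w -> {for w, continuous Q}) ->
  (forall w, Om w -> W (P w) /\ Q (P w) = w) ->
  (forall w, W w -> Om (Q w) /\ P (Q w) = w) ->
  [set w | cmod (w - z) <= h] `<=` Om ->
  (forall w, cmod (w - z) = h -> r <= cmod (P w - P z)) ->
  disc (P z) r `<=` W `&` [set w | disc z h (Q w)].
Proof.
move=> oW h0 r0 cP cQ PW QW zOm Pr.
have Oz : Om z by apply: zOm; rewrite /= subrr cmod0 ltW.
pose C := W `&` [set w | disc z h (Q w)].
have oC : open C.
  rewrite openE => w [Ww Qw]; apply: filterI; first by move: oW; rewrite openE; apply.
  by apply: (cQ w Ww); apply: open_nbhs_nbhs; split=> //; exact: open_disc.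
pose K := P @` [set w | cmod (w - z) <= h].
have cK : closed K.
  apply: compact_closed; first exact: norm_hausdorff.
  apply: continuous_compact; last exact: compact_closed_disc.
  by apply: continuous_in_subspaceT => w /set_mem /zOm /cP.
(* Inside the image disc the open set [C] and the closed set [K] agree, because images of boundary
   points of the disc stay at distance at least [r] from [P z]. So the intersection is open, closed
   and nonempty in a connected set. *)
have CK : disc (P z) r `&` C = disc (P z) r `&` K.
  apply/seteqP; split => v [vr vC]; split=> //.
    have [Wv Qv] := vC; exists (Q v); first exact: ltW.
    by have [_] := QW _ Wv.
  move: vC => [w /= wh wv]; have Ow := zOm w wh.
  have [Wv Qv] := PW w Ow; rewrite -wv; split=> //=; rewrite Qv /disc/=.
  rewrite lt_neqAle wh andbT; apply/eqP => /Pr; rewrite leNgt => /negP; apply.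
  by rewrite wv.
have := @connected_disc R (P z) r.
rewrite -/(connected _) => /(_ (disc (P z) r `&` C)) E v vr.
suff e : disc (P z) r `&` C = disc (P z) r by move: vr; rewrite -e => -[].
apply: E.
- exists (P z); split; first exact: disc_center.
  by have [Wz Qz] := PW z Oz; split=> //=; rewrite Qz; exact: disc_center.
- by exists C.
- by exists K.
Qed.

Lemma area_sigma_finite : sigma_finite setT lam.
Proof.
exists (fun n => disc (0 : pt) n.+1%:R).
  apply/seteqP; split => // w _; exists (Num.truncn (cmod w)) => //.
  by rewrite /disc /= subr0 -truncn_le_nat.
move=> n; split; first by apply: open_measurable_plane; exact: open_disc.
by rewrite area_disc// lte_mul_pinfty// ?lee_fin ?sqr_ge0//; exact: area_disc1_lty.
Qed.

End disc_area.

HB.instance Definition _ (R : realType) :=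
  Measure_isSigmaFinite.Build _ _ _ (area R) (@area_sigma_finite R).

(** * The area inequality *)

Section limn_einf_bounds.
Context {R : realType}.
Implicit Types (u : (\bar R)^nat) (a : \bar R).

Lemma limn_einfE u : limn_einf u = ereal_sup (range (einfs u)).
Proof. by rewrite limn_einf_lim; apply/cvg_lim => //; exact: cvg_einfs_sup. Qed.

Lemma limn_einf_ge u a N : (forall n, (N <= n)%N -> (a <= u n)%E) ->
  (a <= limn_einf u)%E.
Proof.
move=> h; rewrite limn_einfE; apply: (@le_trans _ _ (einfs u N)); last first.
  by apply: ereal_sup_ubound; exists N.
by apply: le_ereal_inf_tmp => _ [n /= Nn <-]; exact: h.
Qed.

Lemma limn_einf_le u a : (forall n, (u n <= a)%E) -> (limn_einf u <= a)%E.
Proof.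
move=> h; rewrite limn_einfE; apply: ge_ereal_sup => _ [n _ <-].
by apply: le_trans (h n); apply: ereal_inf_lbound; exists n => /=.
Qed.

End limn_einf_bounds.

Section area_inequality.
Context {R : realType}.
Local Notation lam := (area R).
Local Notation pt := (R * R)%type.
Variables (Om W : set pt) (P Q : pt -> pt) (l rho : pt -> R).
Hypotheses (oOm : open Om) (oW : open W).
Hypotheses (cP : forall w, Om w -> {for w, continuous P})
  (cQ : forall w, W w -> {for w, continuous Q}).
Hypotheses (PW : forall w, Om w -> W (P w) /\ Q (P w) = w)
  (QW : forall w, W w -> Om (Q w) /\ P (Q w) = w).
Hypotheses (l0 : forall z, 0 <= l z) (rho0 : forall w, 0 <= rho w)
  (ml : measurable_fun Om l).
Hypothesis crho : forall w, W w -> {for w, continuous rho}.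

Let c : R := fine (lam (disc (0%R : pt) 1)).

Let cE : lam (disc (0%R : pt) 1) = c%:E.
Proof.
by rewrite /c fineK// ge0_fin_numE//; exact: area_disc1_lty.
Qed.

Let c0 : 0 < c.
Proof. by rewrite -lte_fin -cE; exact: area_disc1_gt0. Qed.

Let areaE z h : 0 < h -> lam (disc z h) = (h ^+ 2 * c)%:E.
Proof. by move=> h0; rewrite EFinM -cE; exact: area_disc. Qed.

Let mW : measurable W := open_measurable_plane oW.
Let mOm : measurable Om := open_measurable_plane oOm.

(** Read as a function of [w] it is [rho] restricted to the image of the disc of radius [h] about
    [z]; read as a function of [z] it is a constant on a disc of radius [h]. Tonelli's theorem
    exchanges the two readings. *)
Let f (h : R) (zw : pt * pt) : \bar R :=
  if cmod ((Q \_ W) zw.2 - zw.1) < h then ((rho \_ W) zw.2)%:E else 0%E.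

Let f0 h zw : (0 <= f h zw)%E.
Proof.
rewrite /f; case: ifP => // _; rewrite lee_fin patchE.
by case: ifP.
Qed.

Lemma measurable_cmod : measurable_fun setT (@cmod R).
Proof.
apply: continuous_measurable_plane; first exact: openT.
move=> z _; apply/cts_normP => e e0; exists e => // w wz.
rewrite (le_lt_trans _ wz)// ler_norml cmodBB andbT lerNl opprB cmodC.
exact: cmodBB.
Qed.

Let mf h : measurable_fun setT (f h).
Proof.
have mQ : measurable_fun setT (Q \_ W).
  by apply: (measurable_restrictT Q mW).1; exact: continuous_measurable_map.
have mQ2 : measurable_fun setT (fun zw : pt * pt => (Q \_ W) zw.2).
  exact: (measurableT_comp mQ measurable_snd).
have m1 : measurable_fun setT (fun zw : pt * pt => (Q \_ W) zw.2 - zw.1).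
  rewrite (_ : (fun zw => _) = fun zw : pt * pt =>
     (((Q \_ W) zw.2).1 - zw.1.1, ((Q \_ W) zw.2).2 - zw.1.2))//.
  apply: measurable_fun_pair; apply: measurable_funB.
  - exact: (measurableT_comp measurable_fst mQ2).
  - exact: (measurableT_comp measurable_fst measurable_fst).
  - exact: (measurableT_comp measurable_snd mQ2).
  - exact: (measurableT_comp measurable_snd measurable_fst).
apply: measurable_fun_ifT.
- apply: measurable_fun_ltr; last exact: measurable_cst.
  exact: (measurableT_comp measurable_cmod m1).
- apply/measurable_EFinP.
  apply: (measurableT_comp _ measurable_snd).
  by apply: (measurable_restrictT rho mW).1; exact: continuous_measurable_plane.
- exact: measurable_cst.
Qed.

(** The [rho]-mass of the image of the disc of radius [h] about [z], divided by the area of that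
    disc: a difference quotient for the measure pulled back by [P]. *)
Let D (h : R) z : \bar R := ((h ^+ 2 * c)^-1%:E * \int[lam]_w f h (z, w))%E.

Let mD h : measurable_fun Om (D h).
Proof.
apply: (@measurable_funS _ _ _ _ setT) => //.
apply: measurable_funeM.
exact: (@measurable_fun_fubini_tonelli_F _ _ _ _ R lam _ (@mf h) (@f0 h)).
Qed.

Let D0 h z : (0 <= D h z)%E.
Proof.
apply: mule_ge0; first by rewrite lee_fin invr_ge0 mulr_ge0 ?sqr_ge0// ltW.
by apply: integral_ge0 => w _; exact: f0.
Qed.

(** Integrating over [z] first produces for every [w] the area of a disc about [Q w], which cancels
    the normalisation of [D]. *)
Let intD h : 0 < h -> (\int[lam]_(z in Om) D h z <= \int[lam]_(w in W) (rho w)%:E)%E.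
Proof.
move=> h0.
apply: (@le_trans _ _ (\int[lam]_z D h z)%E).
  apply: ge0_subset_integral => //.
  apply: measurable_funeM.
  exact: (@measurable_fun_fubini_tonelli_F _ _ _ _ R lam _ (@mf h) (@f0 h)).
rewrite ge0_integralZl//; first last.
- by rewrite lee_fin invr_ge0 mulr_ge0 ?sqr_ge0// ltW.
- by move=> z _; apply: integral_ge0 => w _; exact: f0.
- exact: (@measurable_fun_fubini_tonelli_F _ _ _ _ R lam _ (@mf h) (@f0 h)).
rewrite (@fubini_tonelli _ _ _ _ R lam lam (f h) (@mf h) (@f0 h)).
have k0 : h ^+ 2 * c != 0 by rewrite mulf_neq0 ?expf_neq0 ?gt_eqF.
have E w : (\int[lam]_z f h (z, w) = (h ^+ 2 * c)%:E * ((rho \_ W) w)%:E)%E.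
  rewrite -(areaE ((Q \_ W) w) h0) muleC -integral_cst//; last first.
    by apply: open_measurable_plane; exact: open_disc.
  rewrite [RHS]integral_mkcond; apply: eq_integral => z _.
  rewrite /f /= [RHS]patchE cmodC.
  have -> : (z \in disc ((Q \_ W) w) h) = (cmod (z - (Q \_ W) w) < h).
    by apply/idP/idP; rewrite inE.
  by case: ifP.
under eq_integral do rewrite E.
rewrite ge0_integralZl//; first last.
- by rewrite lee_fin mulr_ge0 ?sqr_ge0// ltW.
- by move=> w _; rewrite lee_fin patchE; case: ifP.
- apply/measurable_EFinP; apply: (measurable_restrictT rho mW).1.
  exact: continuous_measurable_plane.
rewrite muleA -EFinM mulVf// mul1e [leRHS]integral_mkcond.
rewrite le_eqVlt; apply/orP; left; apply/eqP; apply: eq_integral => w _.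
by rewrite !patchE; case: ifP.
Qed.

Hypothesis expand : {ae lam, forall z, Om z -> forall e : R, 0 < e ->
  exists2 d : R, 0 < d & forall w, cmod (w - z) < d ->
    (l z - e) * cmod (w - z) <= cmod (P w - P z)}.

(** The image of the disc of radius [h] contains the disc of radius [(l z - e) * h] about [P z], by
    [disc_in_image], and there [rho] exceeds [rho (P z) - e]. *)
Let Dlow z e d : Om z -> 0 < e -> e < l z -> e < rho (P z) -> 0 < d ->
  (forall w, cmod (w - z) < d -> (l z - e) * cmod (w - z) <= cmod (P w - P z)) ->
  exists2 d' : R, 0 < d' & forall h, 0 < h -> h < d' ->
    (((rho (P z) - e) * (l z - e) ^+ 2)%:E <= D h z)%E.
Proof.
move=> Oz e0 el er d0 hd.
have [d1 d10 hd1] := (open_discP _).1 oOm z Oz.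
have [Wz _] := PW Oz.
have [d2 d20 hd2] := (cts_normP _ _).1 (crho Wz) e e0.
have le0 : 0 < l z - e by rewrite subr_gt0.
exists (Num.min d (Num.min d1 (d2 / (l z - e)))).
  by rewrite !lt_min d0 d10 divr_gt0.
move=> h h0; rewrite !lt_min => /andP[hd' /andP[hd1' hd2']].
have r0 : 0 < (l z - e) * h by rewrite mulr_gt0.
have sub := disc_in_image oW h0 r0 cP cQ PW QW.
have {}sub : disc (P z) ((l z - e) * h) `<=` W `&` [set w | disc z h (Q w)].
  apply: sub => [w /= wh|w wh]; first by apply: hd1; exact: le_lt_trans hd1'.
  by rewrite -wh; apply: hd; rewrite wh.
have k0 : 0 < h ^+ 2 * c by rewrite mulr_gt0// exprn_gt0.
rewrite /D -lee_pdivrMl ?invr_gt0// invrK -EFinM.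
apply: (@le_trans _ _ (\int[lam]_(w in disc (P z) ((l z - e) * h)) f h (z, w))%E); last first.
  apply: ge0_subset_integral => //; first by apply: open_measurable_plane; exact: open_disc.
  exact: (measurableT_comp (@mf h) (pair1_measurable z)).
apply: (@le_trans _ _ (\int[lam]_(w in disc (P z) ((l z - e) * h)) (rho (P z) - e)%:E)%E).
  rewrite integral_cst; last by apply: open_measurable_plane; exact: open_disc.
  rewrite [X in (_ <= _ * X)%E](areaE (P z) r0) -EFinM lee_fin exprMn.
  by rewrite le_eqVlt; apply/orP; left; apply/eqP; ring.
apply: ge0_le_integral => //.
- by apply: open_measurable_plane; exact: open_disc.
- by move=> w _; rewrite lee_fin subr_ge0 ltW.
- apply: (@measurable_funS _ _ _ _ setT) => //.
  exact: (measurableT_comp (@mf h) (pair1_measurable z)).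
- move=> w wd; have [Ww Qw] := sub _ wd.
  rewrite /f /= !patchE mem_set// Qw lee_fin.
  have wd2 : cmod (w - P z) < d2.
    by rewrite (lt_trans wd)// mulrC -ltr_pdivlMr.
  have := hd2 w wd2; rewrite distrC ltr_distlC => /andP[+ _].
  by move=> /ltW; rewrite lerBlDr -lerBlDl => h1; lra.
Qed.

(** One half of the change of variables, for a homeomorphism of which only the infinitesimal stretch
    is known from below. The quotients [D] have integral at most that of [rho], their lower limit
    dominates [rho (P z) * l z ^+ 2] almost everywhere, and Fatou's lemma combines the two. *)
Lemma area_inequality :
  (\int[lam]_(z in Om) (rho (P z) * l z ^+ 2)%:E <= \int[lam]_(w in W) (rho w)%:E)%E.
Proof.
pose hn n : R := n.+1%:R^-1.
apply: (@le_trans _ _ (\int[lam]_(z in Om) limn_einf (fun n => D (hn n) z))%E); last first.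
  apply: (le_trans (fatou lam mOm (fun n => @mD (hn n)) _)) => //.
  by apply: limn_einf_le => n; apply: intD; rewrite invr_gt0.
apply: ae_ge0_le_integral => //.
- by move=> z _; rewrite lee_fin mulr_ge0// sqr_ge0.
- apply/measurable_EFinP; apply: measurable_funM; last exact: measurable_funX.
  apply: continuous_measurable_plane => // z Oz.
  by apply: continuous_comp; [exact: cP|apply: crho; have [] := PW Oz].
- by move=> z _; apply: (@limn_einf_ge _ _ _ 0).
- apply: (@emeasurable_fun_cvg _ _ _ _ (fun n z => einfs (fun m => D (hn m) z) n)).
    by move=> n; apply: measurable_fun_einfs => m; exact: mD.
  by move=> z _; rewrite limn_einfE; exact: cvg_einfs_sup.
apply: ae_imply expand => z hz Oz; have {}hz := hz Oz.
have L0 : (0 <= limn_einf (fun n => D (hn n) z))%E by apply: (@limn_einf_ge _ _ _ 0).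
have [rz|] := leP (rho (P z)) 0.
  by rewrite (_ : rho _ = 0) ?mul0r//; apply/eqP; rewrite eq_le rz rho0.
move=> rz; have [lz|lz] := leP (l z) 0.
  by rewrite (_ : l z = 0) ?expr0n ?mulr0//; apply/eqP; rewrite eq_le lz l0.
apply/lee_addgt0Pr => e e0; rewrite -leeBlDr// -EFinB.
(* Since [(rho - t) (l - t)^2 = rho l^2 - t k + t^2 (rho + 2 l - t)], it is enough that
   [t k <= e]. *)
pose k := l z ^+ 2 + 2 * rho (P z) * l z.
have k0 : 0 < k by rewrite addr_gt0 ?exprn_gt0// !mulr_gt0.
pose t := Num.min (l z / 2) (Num.min (rho (P z) / 2) (e / k)).
have t0 : 0 < t by rewrite !lt_min !divr_gt0.
have tl : t <= l z / 2 by rewrite ge_min lexx.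
have tr : t <= rho (P z) / 2 by rewrite !ge_min lexx orbT.
have te : t * k <= e by rewrite -ler_pdivlMr// !ge_min lexx !orbT.
have [d d0 hd] := hz t t0.
have tl' : t < l z by lra.
have tr' : t < rho (P z) by lra.
have [d' d'0 hd'] := Dlow Oz t0 tl' tr' d0 hd.
apply: (@limn_einf_ge _ _ _ (Num.truncn d'^-1)) => n nd.
apply: (@le_trans _ _ ((rho (P z) - t) * (l z - t) ^+ 2)%:E).
  rewrite lee_fin; apply: (@le_trans _ _ (rho (P z) * l z ^+ 2 - t * k)); first by lra.
  rewrite -subr_ge0 (_ : _ - _ = t ^+ 2 * (rho (P z) + 2 * l z - t)); last by rewrite /k; ring.
  by rewrite mulr_ge0 ?sqr_ge0//; lra.
apply: hd'; first by rewrite invr_gt0.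
rewrite invf_plt ?posrE// (lt_le_trans (truncnS_gt _))//.
by rewrite ler_nat ltnS.
Qed.

End area_inequality.

(** * Differentiability almost everywhere *)

Lemma ae_forall_countable d (T : measurableType d) (R : realType)
    (m : {measure set T -> \bar R}) (I : countType) (P : I -> T -> Prop) :
  (forall i, {ae m, forall x, P i x}) -> {ae m, forall x, forall i, P i x}.
Proof.
move=> h; have : {ae m, forall x, forall n, if unpickle n is Some i then P i x else True}.
  apply: ae_foralln => n; case: (unpickle n) => [i|]; first exact: h.
  by apply: (@filterE _ (almost_everywhere m)) => x.
apply: ae_imply => x hx i; by have := hx (pickle i); rewrite pickleK.
Qed.

Section linear_density.
Context {R : realType}.
Local Notation mu := (@lebesgue_measure R).
Local Notation pt := (R * R)%type.

(** A one-sided density condition at 0 that quantifies over the countably many scales [q ^+ k] only,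
    so that the sets defined with it are measurable. *)
Definition meets_scales (q : R) (B : set R) :=
  exists k0 : nat, forall k, (k0 <= k)%N ->
    exists2 t : R, q ^+ k.+1 <= t <= q ^+ k & B t.

Lemma expr_lt_exists (q e : R) : 0 < q < 1 -> 0 < e -> exists k0 : nat, forall k,
  (k0 <= k)%N -> q ^+ k < e.
Proof.
move=> /andP[q0 q1] e0.
have : q ^+ n @[n --> \oo] --> (0 : R) by apply: cvg_expr; rewrite ger0_norm// ltW.
move=> /cvgrPdist_lt /(_ e e0)[k0 _ hk]; exists k0 => k kk.
by have := hk k kk; rewrite sub0r normrN ger0_norm// exprn_ge0// ltW.
Qed.

(** At a density point a gap between the distances [q ^+ k.+1] and [q ^+ k] on one side would remove
    a fixed fraction of the interval of radius [q ^+ k], which is impossible for large [k]. The sign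
    [v] selects the side. *)
Lemma density_meets_scales (q : R) (B : set R) (v : R) : 0 < q < 1 ->
  measurable B -> v = 1 \/ v = -1 ->
  {ae mu, forall x, B x -> meets_scales q [set t | B (x + t * v)]}.
Proof.
move=> q01 mB v1; have /andP[q0 q1] := q01.
apply: ae_imply (lebesgue_density mB) => x + Bx.
rewrite indicE mem_set// => /fine_cvgP[fin].
(* The gap has length [(1 - q) r] in an interval of length [2 r]. *)
have e0 : 0 < (1 - q) / 2 by lra.
move=> /cvgrPdist_lt /(_ _ e0); rewrite near_withinE => /nbhs_ballP[d /= d0 hd].
have [k0 hk0] := expr_lt_exists q01 d0.
exists k0 => k /hk0; set r := q ^+ k => rd.
have r0 : 0 < r by rewrite exprn_gt0.
apply: contrapT => /forall2NP miss.
have := hd r; rewrite /ball/= sub0r normrN gtr0_norm// => /(_ rd r0).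
apply/negP; rewrite -leNgt.
have le1 : (mu (B `&` ball x r) <= ((1 + q) * r)%:E)%E.
  have far y : B y -> ball x r y -> (y - x) * v < q * r.
    move=> By; rewrite /ball/= ltr_distlC => /andP[y1 y2].
    rewrite ltNge; apply/negP => yq.
    have [ntq|/= nB] := miss ((y - x) * v); last first.
      apply: nB; rewrite -mulrA (_ : v * v = 1) ?mulr1 1?addrC ?subrK//.
      by case: v1 => ->; ring.
    apply: ntq; rewrite exprSr -/r mulrC yq /=.
    by case: v1 => ->; lra.
  have mBb : measurable (B `&` ball x r).
    by apply: measurableI => //; exact: measurable_ball.
  case: v1 => vE; rewrite {}vE in far.
    apply: (@le_trans _ _ (mu `]x - r, x + q * r]%classic)); last first.
      rewrite lebesgue_measure_itv/= lte_fin ifT; last by nra.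
      by rewrite -EFinB lee_fin; lra.
    apply: le_measure; rewrite ?inE//.
    move=> y [By xy]; have := far y By xy; move: xy.
    rewrite /ball/= ltr_distlC in_itv/= => /andP[-> _] /=; lra.
  apply: (@le_trans _ _ (mu `[x - q * r, x + r[%classic)); last first.
    rewrite lebesgue_measure_itv/= lte_fin ifT; last by nra.
    by rewrite -EFinB lee_fin; lra.
  apply: le_measure; rewrite ?inE//.
  move=> y [By xy]; have := far y By xy; move: xy.
  rewrite /ball/= ltr_distlC in_itv/= => /andP[_ ->] /=; lra.
have mub : mu (ball x r) = (2 * r)%:E by rewrite lebesgue_measure_ball ?ltW// mulr_natl.
rewrite mub /= inver mulf_eq0 gt_eqF// gt_eqF//=.
have fin1 : mu (B `&` ball x r) \is a fin_num.
  by rewrite ge0_fin_numE//; apply: le_lt_trans le1 _; rewrite ltry.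
rewrite -(fineK fin1) -EFinM /=.
have le2 : fine (mu (B `&` ball x r)) <= (1 + q) * r by rewrite -lee_fin fineK.
rewrite ler_normr; apply/orP; left.
rewrite lerBrDr -lerBrDl ler_pdivrMr ?mulr_gt0//.
by apply: (le_trans le2); rewrite le_eqVlt; apply/orP; left; apply/eqP; field.
Qed.

Lemma pair_addZ1 (x y t e : R) : (x, y) + t *: ((e, 0) : pt) = (x + t * e, y).
Proof. by congr pair; rewrite /= [_ *: _]mulr0 addr0. Qed.

Lemma pair_addZ2 (x y t e : R) : (x, y) + t *: ((0, e) : pt) = (x, y + t * e).
Proof. by congr pair; rewrite /= [_ *: _]mulr0 addr0. Qed.

Lemma null_ysection (N : set pt) : measurable N ->
  (forall y, mu [set x | N (x, y)] = 0%E) -> area R N = 0%E.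
Proof.
move=> mN h; rewrite -(setIT N) -(@integral_indic _ _ _ (area R) setT)//.
rewrite /area fubini_tonelli2; last 2 first.
- by apply/measurable_EFinP; exact: measurable_indic.
- by move=> z; rewrite lee_fin.
apply: integral0_eq => y _; rewrite /fubini_G.
have mNy : measurable [set x | N (x, y)].
  have := measurable_ysection y mN; rewrite /ysection.
  by congr measurable; apply/seteqP; split => x /=; rewrite inE.
rewrite (_ : (fun x => _) = (fun x => (\1_[set x | N (x, y)] x)%:E)); last first.
  by apply/funext => x; rewrite !indicE; congr (_%:R%:E); apply/idP/idP; rewrite !inE.
by rewrite integral_indic// setIT; exact: h.
Qed.

Lemma null_xsection (N : set pt) : measurable N ->
  (forall x, mu [set y | N (x, y)] = 0%E) -> area R N = 0%E.
Proof.
move=> mN h; rewrite /area /product_measure1; apply: integral0_eq => x _ /=.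
rewrite -(h x); congr (mu _).
by apply/seteqP; split => y /=; rewrite /xsection /= inE.
Qed.

(* The points [z] of the compact set [A] for which [z + t v] meets [A] at all
   small geometric scales; [v] will be a unit coordinate vector or its opposite. *)
Definition meets_along (q : R) (A : set pt) (v z : pt) :=
  meets_scales q [set t | A (z + t *: v)].

(** For each [k] the points from which [A] is met at scale [k] form the image of a compact set under
    a continuous map, hence a closed set. This is why the sets [A] are kept compact. *)
Lemma measurable_meets_along (q : R) (A : set pt) (v : pt) : compact A ->
  measurable [set z | meets_along q A v z].
Proof.
move=> cA; pose C k := (fun zt : pt * R => zt.1 - zt.2 *: v) @` (A `*` `[q ^+ k.+1, q ^+ k]%classic).
have mC k : measurable (C k).
  apply: closed_measurable_plane; apply: compact_closed; first exact: norm_hausdorff.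
  apply: continuous_compact; last by apply: compact_setX => //; exact: segment_compact.
  apply: continuous_subspaceT => zt; apply: cvgB; first exact: cvg_fst.
  by apply: cvgZr_tmp; exact: cvg_snd.
have -> : [set z | meets_along q A v z] = \bigcup_k0 \bigcap_(k in [set k | (k0 <= k)%N]) C k.
  apply/seteqP; split => z /= [k0].
    move=> hk; exists k0 => // k /hk[t tq /= Az].
    by exists (z + t *: v, t); rewrite /= ?addrK// in_itv/=.
  move=> _ hk; exists k0 => k /hk[[w t] /= [Aw]]; rewrite in_itv/= => tq <-.
  by exists t => //=; rewrite subrK.
apply: bigcup_measurable => k0 _; apply: bigcap_measurableType => k _; exact: mC.
Qed.

(** The density theorem on every line parallel to [v] makes the exceptional set null on each such
    line; Tonelli's theorem makes it null in the plane. *)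
Lemma ae_meets_along (q : R) (A : set pt) (v : pt) : 0 < q < 1 -> compact A ->
  v \in [:: (1, 0); (-1, 0); (0, 1); (0, -1)] ->
  {ae area R, forall z, A z -> meets_along q A v z}.
Proof.
move=> q01 cA vE; pose N := A `\` [set z | meets_along q A v z].
have clA : closed A by apply: compact_closed => //; exact: norm_hausdorff.
have mA : measurable A by exact: closed_measurable_plane.
have mN : measurable N by apply: measurableD => //; exact: measurable_meets_along.
have mxs x : measurable [set y | A (x, y)].
  have := measurable_xsection x mA; congr measurable.
  by apply/seteqP; split => y; rewrite /xsection /= inE.
have mys y : measurable [set x | A (x, y)].
  have := measurable_ysection y mA; congr measurable.
  by apply/seteqP; split => x; rewrite /ysection /= inE.
have mNx x : measurable [set y | N (x, y)].
  have := measurable_xsection x mN; congr measurable.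
  by apply/seteqP; split => y; rewrite /xsection /= inE.
have mNy y : measurable [set x | N (x, y)].
  have := measurable_ysection y mN; congr measurable.
  by apply/seteqP; split => x; rewrite /ysection /= inE.
suff N0 : area R N = 0%E.
  exists N; split => // z /= /not_implyP[Az nz]; by split.
have null (B S : set R) : {ae mu, forall x, B x -> S x} -> measurable (B `\` S) ->
    mu (B `\` S) = 0%E.
  move=> h mBS; apply: measure_negligible => //.
  by apply: negligibleS h => x /= [Bx Sx] /(_ Bx).
have hor (e : R) : e = 1 \/ e = -1 -> v = (e, 0) -> area R N = 0%E.
  move=> e1 ve; apply: null_ysection => // y.
  have E : [set x | N (x, y)] = [set x | A (x, y)] `\`
      [set x | meets_scales q [set t | A (x + t * e, y)]].
    rewrite /N /meets_along ve; apply/seteqP; split => x [Ax nx]; split => // -[k0 hk];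
      apply: nx; exists k0 => k /hk[t tq At]; exists t => //; move: At => /=;
      by rewrite pair_addZ1.
  by rewrite E; apply: null; [exact: (density_meets_scales q01 (mys y) e1)|rewrite -E].
have ver (e : R) : e = 1 \/ e = -1 -> v = (0, e) -> area R N = 0%E.
  move=> e1 ve; apply: null_xsection => // x.
  have E : [set y | N (x, y)] = [set y | A (x, y)] `\`
      [set y | meets_scales q [set t | A (x, y + t * e)]].
    rewrite /N /meets_along ve; apply/seteqP; split => y [Ax nx]; split => // -[k0 hk];
      apply: nx; exists k0 => k /hk[t tq At]; exists t => //; move: At => /=;
      by rewrite pair_addZ2.
  by rewrite E; apply: null; [exact: (density_meets_scales q01 (mxs x) e1)|rewrite -E].
move: vE; rewrite !inE => /or4P[] /eqP vE.
- by apply: (hor 1) => //; left.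
- by apply: (hor (-1)) => //; right.
- by apply: (ver 1) => //; left.
- by apply: (ver (-1)) => //; right.
Qed.

(** Replaces the discrete scales by a continuous one at the price of a factor [q ^- 2]: if [n] is
    least with [q ^+ n < s], then scale [n - 2] provides a point between [q ^+ n.-1 >= s] and
    [q ^+ (n - 2) < s / q ^+ 2]. *)
Lemma meets_scales_select (q : R) (B : set R) : 0 < q < 1 -> meets_scales q B ->
  exists2 r : R, 0 < r & forall s, 0 < s < r ->
    exists2 t, B t & s <= t <= s / q ^+ 2.
Proof.
move=> q01 [k0 hk]; have /andP[q0 q1] := q01.
(* With [s] below this bound, [n] exceeds [k0.+1], so that scale [n - 2] is still one where [B] is
   met. *)
exists (q ^+ k0.+1); first by rewrite exprn_gt0.
move=> s /andP[s0 sq].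
have ex : exists n, q ^+ n < s by have [n hn] := expr_lt_exists q01 s0; exists n; exact: hn.
case: (ex_minnP ex) => n ns nmin.
have kn : (k0.+1 < n)%N.
  rewrite ltnNge; apply/negP => nk; have := lt_trans ns sq.
  by rewrite ltNge ler_wiXn2l// ltW.
case: n ns nmin kn => [//|[//|n]] ns nmin; rewrite !ltnS => kn.
have [t /andP[t1 t2] Bt] := hk n kn; exists t => //; apply/andP; split.
  apply: le_trans t1; rewrite leNgt; apply/negP => /nmin; by rewrite ltnn.
apply: (le_trans t2); rewrite ler_pdivlMr ?exprn_gt0// -exprD addn2.
exact: ltW.
Qed.

(** The error is measured against [s], not against [d]. When [d] is small compared with [s] no scale
    below [d] is consulted: the point 0 of [B] serves from below. *)
Lemma meets_scales_between_pos (q : R) (B : set R) : 0 < q < 1 -> B 0 ->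
  q ^- 2 - 1 <= 1 -> meets_scales q B ->
  exists2 r : R, 0 < r & forall d s, 0 < s < r -> 0 <= d <= s ->
    exists t1 t2, [/\ B t1, B t2, d - 2 * (q ^- 2 - 1) * s <= t1 <= d &
      d <= t2 <= d + 2 * (q ^- 2 - 1) * s].
Proof.
move=> q01 B0 de1 mB; have /andP[q0 q1] := q01.
have [r r0 hr] := meets_scales_select q01 mB.
pose de := q ^- 2 - 1.
have qq : 0 < q ^+ 2 < 1 by rewrite exprn_gt0//= exprn_ilt1 ?ltW.
have /andP[q20 q21] := qq.
have qV : q ^- 2 * q ^+ 2 = 1 by rewrite mulVf// gt_eqF.
have de0 : 0 < de by rewrite subr_gt0 invf_gt1.
exists r => // d s /andP[s0 sr] /andP[d0 ds].
(* The maximum keeps the scale positive when [d = 0], while the loss stays of size [de * s]. *)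
pose t := Num.max d (de * s).
have t0 : 0 < t by rewrite lt_max mulr_gt0// orbT.
have ts : t <= s by rewrite ge_max ds ler_piMl// ltW.
have [t2 Bt2 /andP[t21 t22]] := hr t ltac:(by rewrite t0 (le_lt_trans ts)).
have dt : d <= t by rewrite le_max lexx.
have h2 : t / q ^+ 2 <= d + 2 * de * s.
  have -> : t / q ^+ 2 = t + de * t by rewrite /de mulrBl mul1r addrC subrK mulrC.
  have [E|E] : t = d \/ t = de * s by rewrite /t; case: leP; auto.
    by rewrite E; have := ler_wpM2l (ltW de0) ds; have := mulr_ge0 (ltW de0) (ltW s0); lra.
  rewrite E; have : de * (de * s) <= 1 * (de * s) by rewrite ler_wpM2r// mulr_ge0// ltW.
  lra.
have [dle|dlt] := leP (de * s) d.
  have d0' : 0 < d by rewrite (lt_le_trans _ dle)// mulr_gt0.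
  have [|t1 Bt1 /andP[t11 t12]] := hr (q ^+ 2 * d).
    rewrite mulr_gt0//= (le_lt_trans _ sr)// (le_trans _ ds)// ler_piMl// ltW//.
  exists t1, t2; split=> //; last by rewrite (le_trans dt)//= (le_trans t22).
  rewrite mulrAC mulfV ?gt_eqF// mul1r in t12; rewrite t12 andbT (le_trans _ t11)//.
  have h : (1 - q ^+ 2) * d <= de * d.
    apply: ler_wpM2r => //; rewrite -/de.
    have -> : de = (1 - q ^+ 2) * q ^- 2 by rewrite mulrBl mul1r [q ^+ 2 * _]mulrC qV.
    by rewrite ler_peMr ?subr_ge0 ?ltW// invf_gt1.
  by rewrite -/de; have := ler_wpM2l (ltW de0) ds; have := mulr_ge0 (ltW de0) (ltW s0); lra.
exists 0, t2; split=> //; last by rewrite (le_trans dt)//= (le_trans t22).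
by rewrite d0 andbT -/de; have := mulr_ge0 (ltW de0) (ltW s0); lra.
Qed.

Lemma meets_scales_between (q : R) (B : set R) : 0 < q < 1 -> B 0 ->
  q ^- 2 - 1 <= 1 -> meets_scales q B -> meets_scales q [set t | B (- t)] ->
  exists2 r : R, 0 < r & forall d s, 0 < s < r -> `|d| <= s ->
    exists t1 t2, [/\ B t1, B t2, d - 2 * (q ^- 2 - 1) * s <= t1 <= d &
      d <= t2 <= d + 2 * (q ^- 2 - 1) * s].
Proof.
move=> q01 B0 de1 mB mB'.
have [r r0 hr] := meets_scales_between_pos q01 B0 de1 mB.
have [|r' r'0 hr'] := meets_scales_between_pos q01 _ de1 mB'.
  by rewrite /= oppr0.
exists (Num.min r r'); first by rewrite lt_min r0.
move=> d s; rewrite lt_min => /and3P[s0 sr sr']; rewrite ler_norml => /andP[d1 d2].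
have [d0|d0] := leP 0 d; first by apply: hr; rewrite ?s0 ?d0.
have [||t1 [t2 [/= B1 B2 /andP[h1 h2] /andP[h3 h4]]]] := hr' (- d) s; rewrite ?s0//; first lra.
by exists (- t2), (- t1); split=> //; apply/andP; split; lra.
Qed.

Definition rect_boundary (x1 x2 y1 y2 : R) (w : pt) :=
  [/\ x1 <= w.1 <= x2, y1 <= w.2 <= y2 &
     [\/ w.1 = x1, w.1 = x2, w.2 = y1 | w.2 = y2]].

(** Stated for closed rectangles, whose sides can be placed on lines through points of a set that is
    dense along the axes. The coordinates of a homeomorphism satisfy it because such a map is
    open. *)
Definition max_principle (Om : set pt) (u : pt -> R) :=
  forall x1 x2 y1 y2 z, (forall w : pt, x1 <= w.1 <= x2 -> y1 <= w.2 <= y2 -> Om w) ->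
    x1 <= z.1 <= x2 -> y1 <= z.2 <= y2 ->
    exists2 w, rect_boundary x1 x2 y1 y2 w & u z <= u w.

Definition linear_on_axes (u : pt -> R) (al be e r : R) (z : pt) :=
  forall h, `|h| <= r ->
    `|u (z + h *: (1, 0)) - u z - al * h| <= e * `|h| /\
    `|u (z + h *: (0, 1)) - u z - be * h| <= e * `|h|.

(* Gehring-Lehto: near a point of linear density of [A] every point is enclosed
   by a nearly tight rectangle whose sides lie on lines through [A], along which
   the increment of [u] is known; the maximum principle does the rest. *)
Lemma linear_upper_bound (Om : set pt) (u : pt -> R) (al be e r q : R) (A : set pt) (z0 : pt) :
  0 < e -> 0 < r -> 0 < q < 1 -> q ^- 2 - 1 <= 1 / 8 ->
  (`|al| + `|be|) * (4 * (q ^- 2 - 1)) <= e ->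
  disc z0 r `<=` Om -> max_principle Om u ->
  (forall z, A z -> linear_on_axes u al be e r z) -> A z0 ->
  (forall v, v \in [:: (1, 0); (-1, 0); (0, 1); (0, -1)] -> meets_along q A v z0) ->
  exists2 d : R, 0 < d & forall z, cmod (z - z0) < d ->
    u z - u z0 - al * (z.1 - z0.1) - be * (z.2 - z0.2) <= 4 * e * cmod (z - z0).
Proof.
move=> e0 r0 q01 q8 qe zOm MP hA A0 mA.
have q1 : q ^- 2 - 1 <= 1 by lra.
have de0 : 0 < q ^- 2 - 1.
  by have /andP[? ?] := q01; rewrite subr_gt0 invf_gt1 ?exprn_gt0// exprn_ilt1 ?ltW.
set de := q ^- 2 - 1 in q8 qe q1 de0.
have [rx rx0 hx] : exists2 r' : R, 0 < r' & forall d s, 0 < s < r' -> `|d| <= s ->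
    exists t1 t2, [/\ A (z0 + t1 *: (1, 0)), A (z0 + t2 *: (1, 0)), d - 2 * de * s <= t1 <= d &
      d <= t2 <= d + 2 * de * s].
  apply: (@meets_scales_between q [set t | A (z0 + t *: (1, 0))]) => //=.
  - by rewrite scale0r addr0.
  - by apply: mA; rewrite !inE eqxx.
  - have /mA : ((-1, 0) : pt) \in [:: (1, 0); (-1, 0); (0, 1); (0, -1)] by rewrite !inE eqxx orbT.
    move=> [k0 hk]; exists k0 => k /hk[t tq At]; exists t => //=.
    by move: At; rewrite /= (surjective_pairing z0) !pair_addZ1 mulrN mulNr.
have [ry ry0 hy] : exists2 r' : R, 0 < r' & forall d s, 0 < s < r' -> `|d| <= s ->
    exists t1 t2, [/\ A (z0 + t1 *: (0, 1)), A (z0 + t2 *: (0, 1)), d - 2 * de * s <= t1 <= d &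
      d <= t2 <= d + 2 * de * s].
  apply: (@meets_scales_between q [set t | A (z0 + t *: (0, 1))]) => //=.
  - by rewrite scale0r addr0.
  - by apply: mA; rewrite !inE eqxx !orbT.
  - have /mA : ((0, -1) : pt) \in [:: (1, 0); (-1, 0); (0, 1); (0, -1)] by rewrite !inE eqxx !orbT.
    move=> [k0 hk]; exists k0 => k /hk[t tq At]; exists t => //=.
    by move: At; rewrite /= (surjective_pairing z0) !pair_addZ2 mulrN mulNr.
exists (Num.min (r / 4) (Num.min rx ry)); first by rewrite !lt_min divr_gt0 ?rx0.
move=> z; set s := cmod (z - z0); rewrite !lt_min => /and3P[sr sx sy].
have [z0E|zn] := eqVneq z z0.
  by rewrite /s z0E !subrr !mulr0 !subr0 cmod0 mulr0.
have s0 : 0 < s by rewrite lt_neqAle cmod_ge0 andbT eq_sym cmod_eq0 subr_eq0.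
have [||x1 [x2 [Ax1 Ax2 /andP[x1a x1b] /andP[x2a x2b]]]] := hx (z - z0).1 s.
- by rewrite s0.
- exact: fst_le_cmod.
have [||y1 [y2 [Ay1 Ay2 /andP[y1a y1b] /andP[y2a y2b]]]] := hy (z - z0).2 s.
- by rewrite s0.
- exact: snd_le_cmod.
rewrite /= in x1a x1b x2a x2b y1a y1b y2a y2b.
have des : 2 * de * s <= s / 4 by have := ler_wpM2r (ltW s0) q8; clear; lra.
have := fst_le_cmod (z - z0); rewrite /= -/s ler_norml => /andP[dx1 dx2].
have := snd_le_cmod (z - z0); rewrite /= -/s ler_norml => /andP[dy1 dy2].
have box (w : pt) : z0.1 + x1 <= w.1 <= z0.1 + x2 -> z0.2 + y1 <= w.2 <= z0.2 + y2 ->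
    `|w.1 - z0.1| <= 5 / 4 * s /\ `|w.2 - z0.2| <= 5 / 4 * s.
  by move: x1a x2b y1a y2b des dx1 dx2 dy1 dy2; clear; rewrite !ler_norml; lra.
have [||| w [wx wy wb] uw] := MP (z0.1 + x1) (z0.1 + x2) (z0.2 + y1) (z0.2 + y2) z.
- move=> w wx wy; have [bx by_] := box w wx wy; apply: zOm.
  by rewrite /disc/= (le_lt_trans (cmod_le_norm1 _))//=; move: bx by_ sr s0; clear; lra.
- by move: x1b x2a; clear; lra.
- by move: y1b y2a; clear; lra.
have [bx by_] := box w wx wy.
have sr4 : 5 / 4 * s <= r by move: sr s0 r0; clear; lra.
(* A side of the rectangle lies on a line through a point of [A] on an axis through [z0]. So the
   increment from [z0] to [w] is known in two steps, first along the axis from [z0] to that point,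
   then along the side. *)
have key : `|u w - u z0 - al * (w.1 - z0.1) - be * (w.2 - z0.2)| <=
    e * (`|w.1 - z0.1| + `|w.2 - z0.2|).
  have vert t : A (z0 + t *: (1, 0)) -> w.1 = z0.1 + t ->
      `|u w - u z0 - al * (w.1 - z0.1) - be * (w.2 - z0.2)| <=
      e * (`|w.1 - z0.1| + `|w.2 - z0.2|).
    move=> At wt; have tE : w.1 - z0.1 = t by rewrite wt addrC addKr.
    have [|h1 _] := hA _ A0 t; first by rewrite -tE (le_trans bx).
    have [|_ h2] := hA _ At (w.2 - z0.2); first exact: le_trans by_ sr4.
    have wE : z0 + t *: (1, 0) + (w.2 - z0.2) *: (0, 1) = w.
      rewrite (surjective_pairing z0) pair_addZ1 pair_addZ2 /= !mulr1 -wt.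
      by rewrite [z0.2 + _]addrC subrK -surjective_pairing.
    rewrite wE in h2; rewrite tE.
    apply: (@le_trans _ _ (`|u (z0 + t *: (1, 0)) - u z0 - al * t| +
       `|u w - u (z0 + t *: (1, 0)) - be * (w.2 - z0.2)|)); last by rewrite (mulrDr e); exact: lerD.
    by rewrite (le_trans _ (ler_normD _ _))// le_eqVlt; apply/orP; left; apply/eqP; congr `|_|; ring.
  have hori t : A (z0 + t *: (0, 1)) -> w.2 = z0.2 + t ->
      `|u w - u z0 - al * (w.1 - z0.1) - be * (w.2 - z0.2)| <=
      e * (`|w.1 - z0.1| + `|w.2 - z0.2|).
    move=> At wt; have tE : w.2 - z0.2 = t by rewrite wt addrC addKr.
    have [|_ h1] := hA _ A0 t; first by rewrite -tE (le_trans by_).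
    have [|h2 _] := hA _ At (w.1 - z0.1); first exact: le_trans bx sr4.
    have wE : z0 + t *: (0, 1) + (w.1 - z0.1) *: (1, 0) = w.
      rewrite (surjective_pairing z0) pair_addZ2 pair_addZ1 /= !mulr1 -wt.
      by rewrite [z0.1 + _]addrC subrK -surjective_pairing.
    rewrite wE in h2; rewrite tE.
    apply: (@le_trans _ _ (`|u (z0 + t *: (0, 1)) - u z0 - be * t| +
       `|u w - u (z0 + t *: (0, 1)) - al * (w.1 - z0.1)|)); last by rewrite (mulrDr e) [leRHS]addrC; exact: lerD.
    by rewrite (le_trans _ (ler_normD _ _))// le_eqVlt; apply/orP; left; apply/eqP; congr `|_|; ring.
  by case: wb => wE; [exact: vert Ax1 wE|exact: vert Ax2 wE|exact: hori Ay1 wE|exact: hori Ay2 wE].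
have {}key : u w - u z0 - al * (w.1 - z0.1) - be * (w.2 - z0.2) <= e * (5 / 2 * s).
  by apply: (le_trans (ler_norm _)); apply: (le_trans key); rewrite ler_pM2l//; move: bx by_; clear; lra.
have ax : al * (w.1 - z.1) <= `|al| * (4 * de * s).
  apply: (le_trans (ler_norm _)); rewrite normrM ler_wpM2l// ler_norml.
  by move: wx x1a x1b x2a x2b; clear; lra.
have ay : be * (w.2 - z.2) <= `|be| * (4 * de * s).
  apply: (le_trans (ler_norm _)); rewrite normrM ler_wpM2l// ler_norml.
  by move: wy y1a y1b y2a y2b; clear; lra.
have es := mulr_ge0 (ltW e0) (ltW s0).
by have := ler_wpM2r (ltW s0) qe; move: uw key ax ay es; clear; lra.
Qed.

Definition has_differential (u : pt -> R) (p q : R) (z : pt) :=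
  forall e, 0 < e -> exists2 d, 0 < d & forall w, cmod (w - z) < d ->
    `|u w - u z - p * (w.1 - z.1) - q * (w.2 - z.2)| <= e * cmod (w - z).

Lemma linear_upper_boundN (u : pt -> R) (al be e r : R) z :
  linear_on_axes u al be e r z -> linear_on_axes (fun w => - u w) (- al) (- be) e r z.
Proof.
move=> h t /h[h1 h2].
have E x y c : `|- x - - y - (- c) * t| = `|x - y - c * t|.
  by rewrite -normrN; congr `|_|; ring.
by rewrite !E.
Qed.

Lemma directional_eps (u : pt -> R) z v : derivable u z v ->
  forall e, 0 < e -> exists2 d : R, 0 < d & forall h, `|h| <= d ->
    `|u (z + h *: v) - u z - 'D_v u z * h| <= e * `|h|.
Proof.
move=> du e e0.
have : (h^-1 *: (u (h *: v + z) - u z) @[h --> 0^']) --> 'D_v u z by [].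
move=> /cvgrPdist_le /(_ e e0).
rewrite /prop_near1 /dnbhs /within /= => /nbhs_ballP[r /= r0 hr].
exists (r / 2); first by rewrite divr_gt0.
move=> h hd; have [->|h0] := eqVneq h 0.
  by rewrite scale0r addr0 subrr mulr0 subrr normr0 mulr0.
have := hr h; rewrite /ball/= sub0r normrN => /(_ _ h0).
rewrite [h *: v + z]addrC distrC => H.
have {}H := H ltac:(lra).
have hn : 0 < `|h| by rewrite normr_gt0.
rewrite -ler_pdivrMr// -normfV -normrM mulrBl mulfK//.
by move: H; rewrite [_ *: _]mulrC.
Qed.

(** Ratios of the form [1 - 1 / (j + 2)] come as close to 1 as desired, and there are only countably
    many, so that one null set serves all of them. *)
Lemma scale_ratio (a : R) (n : nat) : 0 < a -> exists j : nat,
  let q := 1 - j.+2%:R^-1 in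
  [/\ 0 < q < 1, q ^- 2 - 1 <= 1 / 8 & q ^- 2 - 1 <= a].
Proof.
move=> a0; pose b := Num.min (1 / 8) a.
have b0 : 0 < b by rewrite lt_min a0 divr_gt0.
exists (Num.truncn (4 / b)) => q.
set N := (Num.truncn (4 / b)).+2%:R in q *.
have Nb : 4 / b < N.
  by rewrite (lt_trans (truncnS_gt _))// ltr_nat.
have N0 : 0 < N by rewrite ltr0n.
have NV : N^-1 * 4 <= b.
  by rewrite mulrC ler_pdivrMr// -ler_pdivrMl// mulrC ltW.
have b8 : b <= 1 / 8 by rewrite ge_min lexx.
have ba : b <= a by rewrite ge_min lexx orbT.
have NV0 : 0 < N^-1 by rewrite invr_gt0.
set M := N^-1 in q NV NV0 *.
have M8 : M * 4 <= 1 / 8 by exact: le_trans b8.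
have q0 : 0 < q by rewrite /q; move: M8; clearbody M; clear; lra.
have qb : q ^- 2 - 1 <= b.
  rewrite lerBlDr -div1r ler_pdivrMr ?exprn_gt0// /q.
  have b1 : b <= 1 by move: b8; clear; lra.
  have : M * b <= M by rewrite ler_piMr// ltW.
  have : 0 <= M ^+ 2 * (b + 1) by rewrite mulr_ge0 ?sqr_ge0// addr_ge0 ?ltW.
  by rewrite !expr2; move: NV NV0 b0; clearbody M; clear; lra.
split; [|exact: le_trans b8|exact: le_trans ba].
by rewrite q0 /q ltrBlDr ltrDl.
Qed.

(** The Gehring-Lehto theorem. Points with partial derivatives are distributed over countably many
    compact sets on which the partial difference quotients are uniformly close to rational slopes.
    Almost every point of each set is a point of linear density for it, and the upper bounds for [u]
    and for [- u] together give the differential. *)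
Lemma ae_differentiable (Om : set pt) (u : pt -> R) : open Om ->
  (forall z, Om z -> {for z, continuous u}) ->
  max_principle Om u -> max_principle Om (fun z => - u z) ->
  {ae area R, forall z, Om z -> derivable u z (1, 0) /\ derivable u z (0, 1)} ->
  {ae area R, forall z, Om z -> has_differential u ('D_(1, 0) u z) ('D_(0, 1) u z) z}.
Proof.
move=> oOm cu MP MPn du.
(* The radius is twice the range [1 / (m + 1)] of the difference quotients, so that the test points
   [z + h v] remain inside [Om]. *)
pose K (m : nat) : set pt := [set z | cmod z <= m%:R /\ disc z (2 / m.+1%:R) `<=` Om].
pose A (i m : nat) (al be : rat) : set pt :=
  [set z | K m z /\ linear_on_axes u (ratr al) (ratr be) i.+1%:R^-1 m.+1%:R^-1 z].
have m0 (m : nat) : 0 < m.+1%:R^-1 :> R by rewrite invr_gt0.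
have KOm m z h v : K m z -> `|h| <= m.+1%:R^-1 -> cmod v = 1 -> Om (z + h *: v).
  move=> [_ kz] hm v1; apply: kz; rewrite /disc/= [z + _]addrC addrK cmodZ v1 mulr1.
  by rewrite mulr_natl mulr2n (le_lt_trans hm)// ltrDl.
(* Both conditions are closed: a strict failure of a difference quotient persists nearby, by
   continuity of [u] at the two points involved. *)
have cA i m al be : compact (A i m al be).
  apply: (@subclosed_compact _ _ [set w | cmod (w - 0) <= m%:R]); last 2 first.
  - exact: compact_closed_disc.
  - by move=> z [[]]; rewrite /= subr0.
  rewrite -[X in closed X]setCK; apply: open_closedC; apply/open_discP => z nz.
  have [Kz|nKz] := pselect (K m z); last first.
    suff [d d0 hd] : exists2 d : R, 0 < d & disc z d `<=` ~` K m.
      by exists d => // w /hd nK [].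
    have [cz|cz] := leP (cmod z) m%:R; last first.
      exists (cmod z - m%:R); first by rewrite subr_gt0.
      move=> w; rewrite /disc/= cmodC => wz [cw _].
      by have := cmodBB z w; move: wz cw; clear; lra.
    have /existsNP[w /not_implyP[zw nw]] : ~ (disc z (2 / m.+1%:R) `<=` Om).
      by move=> h; apply: nKz.
    exists (2 / m.+1%:R - cmod (w - z)); first by rewrite subr_gt0.
    move=> v; rewrite /disc/= => vz [_ /(_ w)]; rewrite /disc/= => h; apply: nw; apply: h.
    by apply: le_lt_trans (cmodBD z _ _) _; rewrite (cmodC z v) addrC -ltrBrDr.
  have uc (al' : R) (v : pt) : cmod v = 1 ->
      ~ (forall h, `|h| <= m.+1%:R^-1 -> `|u (z + h *: v) - u z - al' * h| <= i.+1%:R^-1 * `|h|) ->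
      exists2 d : R, 0 < d & forall w, disc z d w ->
      ~ (forall h, `|h| <= m.+1%:R^-1 -> `|u (w + h *: v) - u w - al' * h| <= i.+1%:R^-1 * `|h|).
    move=> v1 /existsNP[h /not_implyP[hm /negP]]; rewrite -ltNge => hh.
    have g0 : 0 < (`|u (z + h *: v) - u z - al' * h| - i.+1%:R^-1 * `|h|) / 2.
      by rewrite divr_gt0// subr_gt0.
    have Oz : Om z by have := KOm m z 0 v Kz; rewrite normr0 scale0r addr0; apply => //; exact: ltW.
    have Ozh := KOm m z h v Kz hm v1.
    have [d d0 hd] := (cts_normP _ _).1 (cu z Oz) _ g0.
    have [d' d'0 hd'] := (cts_normP _ _).1 (cu _ Ozh) _ g0.
    exists (Num.min d d'); first by rewrite lt_min d0.
    move=> w; rewrite /disc/= lt_min => /andP[wd wd'] /(_ h hm).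
    have {}wd := hd w wd; have {}wd' : `|u (w + h *: v) - u (z + h *: v)| <
        (`|u (z + h *: v) - u z - al' * h| - i.+1%:R^-1 * `|h|) / 2.
      by apply: hd'; rewrite opprD addrACA subrr addr0.
    have : `|u (z + h *: v) - u z - al' * h| <= `|u (w + h *: v) - u w - al' * h| +
        `|u (w + h *: v) - u (z + h *: v)| + `|u w - u z|.
      have -> : u (z + h *: v) - u z - al' * h = (u (w + h *: v) - u w - al' * h) -
        (u (w + h *: v) - u (z + h *: v)) + (u w - u z) by ring.
      by apply: (le_trans (ler_normD _ _)); rewrite lerD2r ler_normB.
    by move: wd wd'; move: (i.+1%:R^-1 * `|h|) => c; clear; lra.
  have c10 : cmod ((1, 0) : pt) = 1 by rewrite /cmod /= expr1n expr0n addr0 sqrtr1.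
  have c01 : cmod ((0, 1) : pt) = 1 by rewrite /cmod /= expr1n expr0n add0r sqrtr1.
  have [h1|h1] := pselect (forall h, `|h| <= m.+1%:R^-1 ->
     `|u (z + h *: (1, 0)) - u z - ratr al * h| <= i.+1%:R^-1 * `|h|).
    have [h2|h2] := pselect (forall h, `|h| <= m.+1%:R^-1 ->
       `|u (z + h *: (0, 1)) - u z - ratr be * h| <= i.+1%:R^-1 * `|h|).
      by exfalso; apply: nz; split=> // h hh; split; [exact: h1|exact: h2].
    have [d d0 hd] := uc _ _ c01 h2; exists d => // w /hd nw [_ lw].
    by apply: nw => h /lw[].
  have [d d0 hd] := uc _ _ c10 h1; exists d => // w /hd nw [_ lw].
  by apply: nw => h /lw[].
pose V : seq pt := [:: (1, 0); (-1, 0); (0, 1); (0, -1)].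
have good i m al be j v : v \in V -> {ae area R, forall z, A i m al be z ->
    meets_along (1 - j.+2%:R^-1) (A i m al be) v z}.
  move=> vV; apply: ae_meets_along => //.
  have : 0 < j.+2%:R^-1 :> R by rewrite invr_gt0.
  have : j.+2%:R^-1 < 1 :> R by rewrite invf_lt1// ltr1n.
  by move=> jl jg; rewrite subr_gt0 jl ltrBlDr ltrDl jg.
have {}good : {ae area R, forall z, forall k : nat * nat * rat * rat * nat * 'I_4,
    let: (i, m, al, be, j, v) := k in A i m al be z ->
    meets_along (1 - j.+2%:R^-1) (A i m al be) (nth (0, 0) V v) z}.
  apply: ae_forall_countable => -[[[[[i m] al] be] j] v] /=; apply: good.
  exact: mem_nth.
apply: ae_imply2 good du => z gz dz Oz e e0; have {dz} [dz1 dz2] := dz Oz.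
set p := 'D_(1, 0) u z; set q := 'D_(0, 1) u z.
(* Four units come from [linear_upper_bound], and one from the rational approximations of the two
   partial derivatives, half a unit each. *)
have [i ie] : exists i : nat, 5 * i.+1%:R^-1 <= e.
  exists (Num.truncn (5 / e)); rewrite -ler_pdivlMl// -[leRHS]invrK lef_pV2 ?posrE ?invr_gt0 ?mulr_gt0 ?invr_gt0//.
  by rewrite invfM invrK (le_trans _ (ltW (truncnS_gt _)))// mulrC.
set e1 := i.+1%:R^-1 in ie.
have e10 : 0 < e1 by rewrite invr_gt0.
have e120 : 0 < e1 / 2 by rewrite divr_gt0.
have approx (x : R) : exists r : rat, `|x - ratr r| <= e1 / 2.
  have [r] := @rat_in_itvoo R (x - e1 / 2) (x + e1 / 2) ltac:(lra).
  rewrite in_itv/= => /andP[r1 r2]; exists r; rewrite ler_norml; apply/andP; split; lra.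
have [[al hal] [be hbe]] := (approx p, approx q).
have [d1 d10 hd1] := directional_eps dz1 e120.
have [d2 d20 hd2] := directional_eps dz2 e120.
have [d3 d30 hd3] := (open_discP _).1 oOm z Oz.
pose M := Num.max (cmod z) (Num.max d1^-1 (Num.max d2^-1 (2 / d3))).
pose m := (Num.truncn M).+1.
have Mm : M < m%:R by rewrite truncnS_gt.
have Mm1 : M < m.+1%:R by rewrite (lt_trans Mm)// ltr_nat.
have Vlt (d : R) : 0 < d -> d^-1 <= M -> m.+1%:R^-1 <= d.
  move=> d0 dM; rewrite invf_ple ?posrE//; exact: le_trans dM (ltW Mm1).
have Az : A i m al be z.
  split; first split.
  - by rewrite (le_trans _ (ltW Mm))// le_max lexx.
  - move=> w; rewrite /disc/= => wz; apply: hd3; rewrite /disc/= (lt_le_trans wz)//.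
    rewrite ler_pdivrMr// mulrC -ler_pdivrMr// (le_trans _ (ltW Mm1))//.
    by rewrite !le_max lexx !orbT.
  - move=> h hm; split.
      have hd : `|h| <= d1 by rewrite (le_trans hm)// Vlt// !le_max lexx !orbT.
      have := hd1 h hd; rewrite -/p => h1.
      have -> : u (z + h *: (1, 0)) - u z - ratr al * h =
        (u (z + h *: (1, 0)) - u z - p * h) + (p - ratr al) * h by ring.
      apply: (le_trans (ler_normD _ _)); rewrite normrM.
      have := ler_wpM2r (normr_ge0 h) hal; move: h1; rewrite -/e1; clear; lra.
    have hd : `|h| <= d2 by rewrite (le_trans hm)// Vlt// !le_max lexx !orbT.
    have := hd2 h hd; rewrite -/q => h1.
    have -> : u (z + h *: (0, 1)) - u z - ratr be * h =
      (u (z + h *: (0, 1)) - u z - q * h) + (q - ratr be) * h by ring.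
    apply: (le_trans (ler_normD _ _)); rewrite normrM.
    have := ler_wpM2r (normr_ge0 h) hbe; move: h1; rewrite -/e1; clear; lra.
pose S := `|ratr al| + `|ratr be| + 1 : R.
have S0 : 0 < S by rewrite ltr_wpDl// addr_ge0.
have [j [j1 j2 j3]] := @scale_ratio (e1 / (4 * S)) 0 ltac:(by rewrite divr_gt0// mulr_gt0).
set qj := 1 - j.+2%:R^-1 in j1 j2 j3.
have mz v : v \in V -> meets_along qj (A i m al be) v z.
  move=> /(nthP (0, 0))[k kV <-].
  exact: (gz (i, m, al, be, j, Ordinal kV)).
have zOm : disc z m.+1%:R^-1 `<=` Om.
  move=> w; rewrite /disc/= => wz; have [[_ kz] _] := Az; apply: kz.
  by rewrite /disc/= (lt_le_trans wz)// mulr_natl mulr2n lerDl ltW.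
have qS : (`|ratr al| + `|ratr be|) * (4 * (qj ^- 2 - 1)) <= e1.
  move: j3; rewrite ler_pdivlMr ?mulr_gt0// => j3.
  have : 0 <= qj ^- 2 - 1.
    by have /andP[? ?] := j1; rewrite subr_ge0 invf_ge1 ?exprn_gt0// exprn_ile1 ?ltW.
  move: j3; rewrite /S; clear; lra.
have hA w : A i m al be w -> linear_on_axes u (ratr al) (ratr be) e1 m.+1%:R^-1 w by move=> [].
have hAn w : A i m al be w -> linear_on_axes (fun w => - u w) (- ratr al) (- ratr be) e1 m.+1%:R^-1 w.
  by move=> /hA; exact: linear_upper_boundN.
have [r r0 hr] := linear_upper_bound e10 (m0 m) j1 j2 qS zOm MP hA Az mz.
have qSn : (`|- ratr al| + `|- ratr be|) * (4 * (qj ^- 2 - 1)) <= e1 by rewrite !normrN.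
have [r' r'0 hr'] := linear_upper_bound e10 (m0 m) j1 j2 qSn zOm MPn hAn Az mz.
exists (Num.min r r'); first by rewrite lt_min r0.
move=> w; rewrite lt_min => /andP[/hr wr /hr' wr'].
have ax : `|(p - ratr al) * (w.1 - z.1)| <= e1 / 2 * cmod (w - z).
  by rewrite normrM ler_pM//; exact: (fst_le_cmod (w - z)).
have ay : `|(q - ratr be) * (w.2 - z.2)| <= e1 / 2 * cmod (w - z).
  by rewrite normrM ler_pM//; exact: (snd_le_cmod (w - z)).
have := ler_wpM2r (cmod_ge0 (w - z)) ie.
move: ax ay wr wr'; rewrite !ler_norml; clear; lra.
Qed.

End linear_density.

(** * Differential calculus of real functions on the plane *)

Section plane_calculus.
Context {R : realType}.
Local Notation pt := (R * R)%type.
Implicit Types (u v : pt -> R) (z w : pt).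

Lemma continuous_fst z : {for z, continuous (@fst R R)}.
Proof. exact: cvg_fst. Qed.

Lemma continuous_snd z : {for z, continuous (@snd R R)}.
Proof. exact: cvg_snd. Qed.

(* Caratheodory's form of differentiability, which makes the product and chain
   rules immediate. *)
Lemma has_differentialP u (p q : R) z : has_differential u p q z <->
  exists P Q, [/\ {for z, continuous P}, {for z, continuous Q}, P z = p, Q z = q &
    forall w, u w - u z = P w * (w.1 - z.1) + Q w * (w.2 - z.2)].
Proof.
split=> [h|[P [Q [cP cQ <- <- E]]] e e0]; last first.
  have e20 : 0 < e / 2 by rewrite divr_gt0.
  have [d d0 hd] := (cts_normP _ _).1 cP _ e20.
  have [d' d'0 hd'] := (cts_normP _ _).1 cQ _ e20.
  exists (Num.min d d'); first by rewrite lt_min d0.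
  move=> w; rewrite lt_min => /andP[/hd /ltW wd /hd' /ltW wd']; rewrite E.
  have -> : P w * (w.1 - z.1) + Q w * (w.2 - z.2) - P z * (w.1 - z.1) - Q z * (w.2 - z.2) =
    (P w - P z) * (w.1 - z.1) + (Q w - Q z) * (w.2 - z.2) by ring.
  apply: (le_trans (ler_normD _ _)); rewrite [in leRHS](splitr e) [leRHS]mulrDl !normrM.
  by apply: lerD; apply: ler_pM => //; [exact: (fst_le_cmod (w - z))|exact: (snd_le_cmod (w - z))].
(* The remainder is split between the coordinates as [r = r (x^2 + y^2) / |w - z|^2]. At [w = z] the
   correction terms are 0, so [P] and [Q] take the values [p] and [q]. *)
pose r w := u w - u z - p * (w.1 - z.1) - q * (w.2 - z.2).
pose P w := p + r w * (w.1 - z.1) / cmod (w - z) ^+ 2.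
pose Q w := q + r w * (w.2 - z.2) / cmod (w - z) ^+ 2.
have bnd c w e : 0 < e -> `|c| <= cmod (w - z) -> `|r w| <= e * cmod (w - z) ->
    `|r w * c / cmod (w - z) ^+ 2| <= e.
  move=> e0 h1 h2; have [->|wz] := eqVneq (cmod (w - z)) 0.
    by rewrite expr0n invr0 mulr0 normr0 ltW.
  rewrite normrM normfV ler_pdivrMr ?normr_gt0 ?expf_neq0// normrX.
  rewrite (ger0_norm (cmod_ge0 _)) expr2 mulrA normrM.
  by apply: ler_pM.
exists P, Q; split.
- apply/cts_normP => e e0; have e20 : 0 < e / 2 by rewrite divr_gt0.
  have [d d0 hd] := h _ e20; exists d => // w /hd hw.
  rewrite /P subrr mulr0 mul0r addr0 addrC addKr.
  rewrite (@le_lt_trans _ _ (e / 2))//; last by rewrite ltr_pdivrMr// ltr_pMr// ltr1n.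
  by apply: bnd => //; exact: (fst_le_cmod (w - z)).
- apply/cts_normP => e e0; have e20 : 0 < e / 2 by rewrite divr_gt0.
  have [d d0 hd] := h _ e20; exists d => // w /hd hw.
  rewrite /Q subrr mulr0 mul0r addr0 addrC addKr.
  rewrite (@le_lt_trans _ _ (e / 2))//; last by rewrite ltr_pdivrMr// ltr_pMr// ltr1n.
  by apply: bnd => //; exact: (snd_le_cmod (w - z)).
- by rewrite /P subrr mulr0 mul0r addr0.
- by rewrite /Q subrr mulr0 mul0r addr0.
- move=> w; rewrite /P /Q; have [wz|wz] := eqVneq (cmod (w - z)) 0.
    have /eqP := wz; rewrite cmod_eq0 subr_eq0 => /eqP ->.
    by rewrite !subrr !mulr0 addr0.
  have := cmod_sqr (w - z); rewrite /= => nE.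
  have n0 : (w.1 - z.1) ^+ 2 + (w.2 - z.2) ^+ 2 != 0 by rewrite -nE expf_neq0.
  rewrite nE.
  have -> : (p + r w * (w.1 - z.1) / ((w.1 - z.1) ^+ 2 + (w.2 - z.2) ^+ 2)) * (w.1 - z.1) +
    (q + r w * (w.2 - z.2) / ((w.1 - z.1) ^+ 2 + (w.2 - z.2) ^+ 2)) * (w.2 - z.2) =
    p * (w.1 - z.1) + q * (w.2 - z.2) + r w * (((w.1 - z.1) ^+ 2 + (w.2 - z.2) ^+ 2) /
     ((w.1 - z.1) ^+ 2 + (w.2 - z.2) ^+ 2)) by ring.
  by rewrite divff// /r; ring.
Qed.

Lemma has_differential_continuous u p q z : has_differential u p q z ->
  {for z, continuous u}.
Proof.
move=> /has_differentialP[P [Q [cP cQ _ _ E]]].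
have -> : u = fun w => u z + (P w * (w.1 - z.1) + Q w * (w.2 - z.2)).
  by apply/funext => w; rewrite -E addrC subrK.
apply: cvgD; first exact: cvg_cst.
by apply: cvgD; apply: cvgM => //; apply: cvgB; [exact: cvg_fst|exact: cvg_cst|exact: cvg_snd|exact: cvg_cst].
Qed.

Lemma has_differential_cst (c : R) z : has_differential (fun=> c) 0 0 z.
Proof.
move=> e e0; exists 1 => // w _; rewrite subrr !mul0r !subr0 normr0.
by rewrite mulr_ge0 ?cmod_ge0// ltW.
Qed.

Lemma has_differential_fst z : has_differential fst 1 0 z.
Proof.
move=> e e0; exists 1 => // w _; rewrite mul1r mul0r subr0 subrr normr0.
by rewrite mulr_ge0 ?cmod_ge0// ltW.
Qed.

Lemma has_differential_snd z : has_differential snd 0 1 z.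
Proof.
move=> e e0; exists 1 => // w _; rewrite mul1r mul0r subr0 subrr normr0.
by rewrite mulr_ge0 ?cmod_ge0// ltW.
Qed.

Lemma has_differentialD u v p q p' q' z : has_differential u p q z ->
  has_differential v p' q' z -> has_differential (fun w => u w + v w) (p + p') (q + q') z.
Proof.
move=> /has_differentialP[P [Q [cP cQ <- <- E]]] /has_differentialP[P' [Q' [cP' cQ' <- <- E']]].
apply/has_differentialP; exists (fun w => P w + P' w), (fun w => Q w + Q' w); split=> //.
- exact: cvgD.
- exact: cvgD.
- by move=> w; rewrite opprD addrACA E E'; ring.
Qed.

Lemma has_differentialM u v p q p' q' z : has_differential u p q z ->
  has_differential v p' q' z -> has_differential (fun w => u w * v w)
    (p * v z + u z * p') (q * v z + u z * q') z.
Proof.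
move=> hu hv; have cv := has_differential_continuous hv.
move: hu hv => /has_differentialP[P [Q [cP cQ <- <- E]]] /has_differentialP[P' [Q' [cP' cQ' <- <- E']]].
apply/has_differentialP; exists (fun w => P w * v w + u z * P' w), (fun w => Q w * v w + u z * Q' w).
have cc (f : pt -> R) : {for z, continuous f} -> {for z, continuous (fun w => u z * f w)}.
  by move=> cf; apply: cvgM => //; exact: cvg_cst.
split=> //.
- by apply: cvgD; [exact: cvgM|exact: cc].
- by apply: cvgD; [exact: cvgM|exact: cc].
- move=> w; have -> : u w * v w - u z * v z = (u w - u z) * v w + u z * (v w - v z) by ring.
  by rewrite E E'; ring.
Qed.

Lemma is_derive1P (f : R -> R) (x d : R) : is_derive x (1 : R) f d <->
  exists g, [/\ {for x, continuous g}, g x = d & forall y, f y - f x = g y * (y - x)].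
Proof.
split=> [df|[g [cg <- E]]].
  pose g y := if y == x then d else (f y - f x) / (y - x).
  exists g; split; last 1 first.
  - move=> y; rewrite /g; case: eqVneq => [->|n]; first by rewrite !subrr mulr0.
    by rewrite divfK// subr_eq0.
  - apply/cvgrPdist_le => e e0; have [r r0 hr] := (is_derive1_eps _ _ _).1 df _ e0.
    apply/nbhs_ballP; exists r => // y; rewrite /ball/= distrC => yx.
    rewrite distrC /g eqxx; case: eqVneq => [_|n]; first by rewrite subrr normr0 ltW.
    have n0 : 0 < `|y - x| by rewrite normr_gt0 subr_eq0.
    by rewrite -(ler_pM2r n0) -normrM mulrBl divfK ?subr_eq0//; exact: hr.
  - by rewrite /g eqxx.
apply/is_derive1_eps => e e0.
move/cvgrPdist_le : cg => /(_ e e0) /nbhs_ballP[r /= r0 hr]; exists r => // y yx.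
rewrite E -mulrBl normrM ler_wpM2r// distrC; apply: hr.
by rewrite /ball/= distrC.
Qed.

Lemma has_differential_comp (f : R -> R) (d : R) u p q z :
  is_derive (u z) (1 : R) f d -> has_differential u p q z ->
  has_differential (fun w => f (u w)) (d * p) (d * q) z.
Proof.
move=> df hu; have cu := has_differential_continuous hu.
move: hu => /has_differentialP[P [Q [cP cQ <- <- E]]].
have [g [cg <- gE]] := (is_derive1P _ _ _).1 df.
have {}cg : {for z, continuous (g \o u)} by exact: continuous_comp.
apply/has_differentialP; exists (fun w => g (u w) * P w), (fun w => g (u w) * Q w); split.
- exact: cvgM.
- exact: cvgM.
- by [].
- by [].
- by move=> w; rewrite gE E; ring.
Qed.

Lemma has_differentialN u p q z : has_differential u p q z ->
  has_differential (fun w => - u w) (- p) (- q) z.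
Proof.
move=> h; have := has_differentialM (has_differential_cst (-1) z) h.
by rewrite !mul0r !add0r !mulN1r; congr has_differential; apply/funext => w; rewrite mulN1r.
Qed.

Lemma has_differentialB u v p q p' q' z : has_differential u p q z ->
  has_differential v p' q' z -> has_differential (fun w => u w - v w) (p - p') (q - q') z.
Proof. by move=> hu /has_differentialN; exact: has_differentialD. Qed.

Lemma is_derive_comp2 u p q (f g : R -> R) (x df dg : R) :
  has_differential u p q (f x, g x) ->
  is_derive x (1 : R) f df -> is_derive x (1 : R) g dg ->
  is_derive x (1 : R) (fun t => u (f t, g t)) (p * df + q * dg).
Proof.
move=> /has_differentialP[P [Q [cP cQ <- <- E]]] hf hg.
have cf : {for x, continuous f} by apply: differentiable_continuous; apply/derivable1_diffP; case: hf.
have cg : {for x, continuous g} by apply: differentiable_continuous; apply/derivable1_diffP; case: hg.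
have cc (W : pt -> R) : {for (f x, g x), continuous W} -> {for x, continuous (fun t => W (f t, g t))}.
  move=> cW; apply: (@continuous_comp _ _ _ (fun t => (f t, g t)) W) => //.
  exact: (cvg_pair cf cg).
move: hf hg => /is_derive1P[F [cF <- EF]] /is_derive1P[G [cG <- EG]].
apply/is_derive1P; exists (fun t => P (f t, g t) * F t + Q (f t, g t) * G t); split=> //.
- by apply: cvgD; apply: cvgM => //; exact: cc.
- by move=> t; rewrite E /= EF EG; ring.
Qed.

Lemma has_differential_partial1 u p q z : has_differential u p q z ->
  is_derive z.1 (1 : R) (fun t => u (t, z.2)) p.
Proof.
move=> h; apply/is_derive1_eps => e /h[d d0 hd]; exists d => // y yx.
have cE : cmod ((y, z.2) - z) = `|y - z.1|.
  by rewrite /cmod /= subrr expr0n addr0 sqrtr_sqr.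
have := hd (y, z.2); rewrite cE /= subrr mulr0 subr0 => /(_ yx).
by rewrite -surjective_pairing.
Qed.

Lemma has_differential_partial2 u p q z : has_differential u p q z ->
  is_derive z.2 (1 : R) (fun t => u (z.1, t)) q.
Proof.
move=> h; apply/is_derive1_eps => e /h[d d0 hd]; exists d => // y yx.
have cE : cmod ((z.1, y) - z) = `|y - z.2|.
  by rewrite /cmod /= subrr expr0n add0r sqrtr_sqr.
have := hd (z.1, y); rewrite cE /= subrr mulr0 subr0 => /(_ yx).
by rewrite -surjective_pairing.
Qed.

End plane_calculus.

(** * Unit complex numbers, angles and polar form *)

Section unit_complex.
Context {R : realType}.
Local Notation pt := (R * R)%type.
Local Open Scope complex_scope.
Implicit Types (s t : R).

Definition cis t : R[i] := cos t +i* sin t.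

Definition circle_pt t : pt := (cos t, sin t).

Lemma toC_circle_pt t : toC (circle_pt t) = cis t. Proof. by []. Qed.

Lemma cisD s t : cis (s + t) = cis s * cis t.
Proof. by apply/eqP; rewrite eq_complex /= cosD sinD addrC eqxx [X in _ == X]addrC [cos s * _]mulrC eqxx. Qed.

Lemma cis0 : cis 0 = 1.
Proof. by rewrite /cis cos0 sin0. Qed.

Lemma cisNK t : cis (- t) * cis t = 1.
Proof. by rewrite -cisD addNr cis0. Qed.

Lemma cisKN t : cis t * cis (- t) = 1.
Proof. by rewrite mulrC cisNK. Qed.

Lemma conj_cis t : (cis t)^* = cis (- t).
Proof. by rewrite /cis cosN sinN. Qed.

Lemma norm_cis t : `|cis t| = 1.
Proof. by rewrite normc_def /= cos2Dsin2 sqrtr1. Qed.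

Lemma cis_neq0 t : cis t != 0.
Proof. by rewrite -normr_eq0 norm_cis oner_neq0. Qed.

Lemma cispi : cis pi = -1.
Proof. by apply/eqP; rewrite eq_complex /= cospi sinpi oppr0 !eqxx. Qed.

Lemma cmod_circle_pt t : cmod (circle_pt t) = 1.
Proof. by rewrite /cmod /= cos2Dsin2 sqrtr1. Qed.

Lemma sin_nonneg_range (y : R) : - pi < y < 2 * pi -> 0 <= sin y -> 0 <= y <= pi.
Proof.
move=> /andP[y1 y2] sy; apply/andP; split; rewrite leNgt; apply/negP => h.
  have : 0 < sin (- y) by apply: sin_gt0_pi; apply/andP; split; lra.
  by rewrite sinN; lra.
have : 0 < sin (y - pi) by apply: sin_gt0_pi; apply/andP; split; lra.
by rewrite sinB sinpi cospi; lra.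
Qed.

Lemma sin_pos_range (y : R) : - pi < y < 2 * pi -> 0 < sin y -> 0 < y < pi.
Proof.
move=> yr sy; have /andP[y0 y1] := sin_nonneg_range yr (ltW sy).
rewrite !lt_neqAle y0 y1 !andbT; apply/andP; split; apply/eqP => yE.
  by move: sy; rewrite -yE sin0 ltxx.
by move: sy; rewrite yE sinpi ltxx.
Qed.

Lemma circle_angle (p : pt) : cmod p = 1 -> exists t, p = circle_pt t.
Proof.
move=> p1; have E := cmod_sqr p; rewrite p1 expr1n in E.
have x1 : -1 <= p.1 <= 1 by rewrite -ler_norml -p1 fst_le_cmod.
have [/andP[t0 tpi] ct] := acos_def x1.
have st : 0 <= sin (acos p.1) by rewrite sin_ge0_pi// t0.
have s2 : sin (acos p.1) ^+ 2 = p.2 ^+ 2.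
  by have := cos2Dsin2 (acos p.1); rewrite ct; lra.
have [p2|p2] := leP 0 p.2.
  exists (acos p.1); rewrite /circle_pt ct (surjective_pairing p) /=; congr pair.
  by apply/eqP; rewrite -(eqrXn2 (_ : 0 < 2)%N p2 st)// s2.
exists (- acos p.1); rewrite /circle_pt cosN sinN ct (surjective_pairing p) /=; congr pair.
have p2' : 0 <= - p.2 by lra.
apply/eqP; rewrite -eqr_oppLR; apply/eqP/esym; apply/eqP.
by rewrite -(eqrXn2 (_ : 0 < 2)%N st p2')// s2 sqrrN.
Qed.

Lemma expR_cis_log s t : 0 < s ->
  (expR (ln (s ^+ 2 + t ^+ 2) / 2))%:C * cis (atan (t / s)) = s +i* t.
Proof.
move=> s0; set n := s ^+ 2 + t ^+ 2.
have n0 : 0 < n by rewrite ltr_pwDl ?exprn_gt0// sqr_ge0.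
have eE : expR (ln n / 2) = Num.sqrt n.
  apply/eqP; rewrite -(eqrXn2 (_ : 0 < 2)%N (expR_ge0 _) (sqrtr_ge0 _))//.
  by rewrite expr2 -expRD -splitr lnK ?posrE// sqr_sqrtr// ltW.
have cE : cos (atan (t / s)) = s / Num.sqrt n.
  rewrite cos_atan; have -> : 1 + (t / s) ^+ 2 = n / s ^+ 2.
    by rewrite /n; field; rewrite gt_eqF.
  by rewrite sqrtrM ?ltW// sqrtrV ?exprn_ge0 ?ltW// sqrtr_sqr gtr0_norm// invfM invrK mulrC.
have sE : sin (atan (t / s)) = t / Num.sqrt n.
  have c0 : cos (atan (t / s)) != 0 by rewrite cE mulf_neq0 ?invr_eq0 ?gt_eqF// sqrtr_gt0.
  have := atanK (t / s); rewrite /tan => /(canRL (divfK c0)) ->; rewrite cE.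
  by field; rewrite !gt_eqF// sqrtr_gt0.
have sq0 : Num.sqrt n != 0 by rewrite gt_eqF// sqrtr_gt0.
by apply/eqP; rewrite eq_complex /= eE cE sE !mul0r subr0 addr0 !(mulrC (Num.sqrt n)) !divfK// !eqxx.
Qed.

End unit_complex.

(** * Strip coordinates *)

Section strip_coordinates.
Context {R : realType}.
Local Notation pt := (R * R)%type.
Local Open Scope complex_scope.
Variables (ta D : R).
Hypothesis D0 : 0 < D < 2 * pi.
Implicit Types (z w : pt).

Let a : pt := circle_pt ta.
Let b : pt := circle_pt (ta + D).

(* [1 - c^* z], whose real part is positive on the closed disk minus [c] *)
Definition polar_re (c z : pt) : R := 1 - (c.1 * z.1 + c.2 * z.2).
Definition polar_im (c z : pt) : R := c.2 * z.1 - c.1 * z.2.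
Definition log_mod (c z : pt) : R := ln (polar_re c z ^+ 2 + polar_im c z ^+ 2) / 2.
Definition log_arg (c z : pt) : R := atan (polar_im c z / polar_re c z).

(* Real and imaginary parts of log ((1 - a^* z) / (1 - b^* z)) + i (pi - D / 2):
   conformal coordinates of the disk onto the strip 0 < y < pi, sending [a] to
   -oo and [b] to +oo. *)
Definition strip_x z : R := log_mod a z - log_mod b z.
Definition strip_y z : R := log_arg a z - log_arg b z + (pi - D / 2).
Definition strip_map z : pt := (strip_x z, strip_y z).

Definition strip_dom z := [/\ cmod z <= 1, z <> a & z <> b].

(** The solution [z] of [W = K (1 - a^* z) / (1 - b^* z)], with [K = cis (pi - D / 2)] and
    [W = exp (w.1 + i w.2)]. *)
Definition strip_inv (w : pt) : pt :=
  let W := (expR w.1)%:C * cis w.2 in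
  ofC ((W - cis (pi - D / 2)) / (W * cis (- (ta + D)) - cis (pi - D / 2) * cis (- ta))).

Lemma polarE t z : polar_re (circle_pt t) z +i* polar_im (circle_pt t) z = 1 - cis (- t) * toC z.
Proof.
apply/eqP; rewrite eq_complex /= /polar_re /polar_im /= cosN sinN.
by apply/andP; split; apply/eqP; ring.
Qed.

(** Follows from [2 polar_re c z = |z - c|^2 + 1 - |z|^2], where [c = circle_pt t]. *)
Lemma polar_re_gt0 t z : cmod z <= 1 -> z <> circle_pt t -> 0 < polar_re (circle_pt t) z.
Proof.
move=> z1 zt; have : 0 < cmod (z - circle_pt t) ^+ 2.
  by rewrite exprn_gt0// lt_neqAle cmod_ge0 andbT eq_sym cmod_eq0 subr_eq0; apply/eqP.
rewrite cmod_sqr /= /polar_re /=.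
have : cmod z ^+ 2 <= 1 by rewrite expr_le1// cmod_ge0.
rewrite cmod_sqr; have := cos2Dsin2 t; nra.
Qed.

Lemma polar_sqr t z : polar_re (circle_pt t) z ^+ 2 + polar_im (circle_pt t) z ^+ 2 =
  cmod (z - circle_pt t) ^+ 2.
Proof.
rewrite cmod_sqr /polar_re /polar_im /=; have := cos2Dsin2 t => h.
transitivity (1 - 2 * (cos t * z.1 + sin t * z.2) +
  (cos t ^+ 2 + sin t ^+ 2) * (z.1 ^+ 2 + z.2 ^+ 2)); first by ring.
rewrite h; transitivity ((cos t ^+ 2 + sin t ^+ 2) - 2 * (cos t * z.1 + sin t * z.2) +
   (z.1 ^+ 2 + z.2 ^+ 2)); last by ring.
by rewrite h; ring.
Qed.

Lemma strip_exp z : strip_dom z -> (expR (strip_x z))%:C * cis (strip_y z) =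
  cis (pi - D / 2) * ((1 - cis (- ta) * toC z) / (1 - cis (- (ta + D)) * toC z)).
Proof.
move=> [z1 za zb]; rewrite -!polarE -!expR_cis_log; [|exact: polar_re_gt0..].
rewrite /strip_x /strip_y expRD cisD cisD -/(log_mod a z) -/(log_mod b z).
rewrite -/(log_arg a z) -/(log_arg b z) rmorphM/= expRN fmorphV/=.
have e0 : (expR (log_mod b z))%:C != 0.
  by rewrite -(rmorph0 (@real_complex R)) (inj_eq (@complexI _)) gt_eqF// expR_gt0.
have cN : cis (- log_arg b z) = (cis (log_arg b z))^-1.
  by apply: (mulfI (cis_neq0 (log_arg b z))); rewrite cisKN divff// cis_neq0.
rewrite cN; field; rewrite cis_neq0 //=.
Qed.

(** A zero would give [W = cis (pi + D / 2)], which lies in the lower half-plane, whereas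
    [0 <= w.2 <= pi] puts [W] in the closed upper one. *)
Lemma strip_den_neq0 (w : pt) : 0 <= w.2 <= pi ->
  (expR w.1)%:C * cis w.2 * cis (- (ta + D)) - cis (pi - D / 2) * cis (- ta) != 0.
Proof.
move=> w2; apply/negP => /eqP h.
have E : (expR w.1)%:C * cis w.2 = cis (pi + D / 2).
  have -> : pi + D / 2 = (pi - D / 2) + (- ta) + (ta + D) by lra.
  rewrite cisD cisD.
  by move/eqP: h; rewrite subr_eq0 => /eqP <-; rewrite -mulrA cisNK mulr1.
have : expR w.1 * sin w.2 = sin (pi + D / 2).
  by have /(congr1 (@complex.Im R)) := E; rewrite /= mul0r addr0.
have s1 : 0 <= expR w.1 * sin w.2 by rewrite mulr_ge0 ?expR_ge0// sin_ge0_pi.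
have /andP[D1 D2] := D0.
have s2 : 0 < sin (D / 2) by apply: sin_gt0_pi; apply/andP; split; lra.
by rewrite sinD sinpi cospi mul0r add0r mulN1r; lra.
Qed.

Let ofCK (c : R[i]) : toC (ofC c) = c. Proof. by case: c. Qed.

Let toCI (p q : pt) : toC p = toC q -> p = q.
Proof. by case: p q => [? ?] [? ?] [-> ->]. Qed.

Lemma strip_invK z : strip_dom z -> strip_inv (strip_map z) = z.
Proof.
move=> dz; have E := strip_exp dz; have [z1 za zb] := dz.
apply: toCI; rewrite /strip_inv ofCK /= E.
have nb : 1 - cis (- (ta + D)) * toC z != 0.
  rewrite -polarE eq_complex /= negb_and; apply/orP; left.
  by rewrite gt_eqF// polar_re_gt0.
set A := cis (- ta); set B := cis (- (ta + D)); set K := cis (pi - D / 2).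
have BA : B - A != 0.
  apply/negP => /eqP h; have : cis D = 1.
    have -> : D = (ta + D) + (- ta) by lra.
    rewrite cisD -/A; have <- : B = A by apply/eqP; rewrite -subr_eq0 h.
    by rewrite cisKN.
  move=> /(congr1 (@complex.Re R)) /=; have /andP[D1 D2] := D0.
  have s2 : 0 < sin (D / 2) by apply: sin_gt0_pi; apply/andP; split; lra.
  by rewrite {1}(splitr D) cosD; have := cos2Dsin2 (D / 2); nra.
have K0 : K != 0 by exact: cis_neq0.
have -> : K * ((1 - A * toC z) / (1 - B * toC z)) - K = K * (B - A) * toC z / (1 - B * toC z).
  by field.
have -> : K * ((1 - A * toC z) / (1 - B * toC z)) * B - K * A = K * (B - A) / (1 - B * toC z).
  by field.
by field; rewrite nb K0 BA.
Qed.

Lemma cisD_neq1 : cis D != 1.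
Proof.
apply/negP => /eqP /(congr1 (@complex.Re R)) /=; have /andP[D1 D2] := D0.
have s2 : 0 < sin (D / 2) by apply: sin_gt0_pi; apply/andP; split; lra.
by rewrite {1}(splitr D) cosD; have := cos2Dsin2 (D / 2); nra.
Qed.

Lemma sin_half_gt0 : 0 < sin (D / 2).
Proof. by have /andP[D1 D2] := D0; apply: sin_gt0_pi; apply/andP; split; lra. Qed.

Lemma mul_conj_cmod (c : R[i]) : c * c^* = (cmod (ofC c) ^+ 2)%:C.
Proof.
rewrite cmod_sqr; case: c => x y; apply/eqP; rewrite eq_complex /=.
by apply/andP; split; apply/eqP; ring.
Qed.

Lemma cmod_cis_sub (E s t : R) : cmod (ofC (E%:C * cis s - cis t)) ^+ 2 =
  E ^+ 2 + 1 - 2 * E * cos (s - t).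
Proof.
rewrite cmod_sqr /= !mul0r subr0 addr0 cosB.
transitivity (E ^+ 2 * (cos s ^+ 2 + sin s ^+ 2) + (cos t ^+ 2 + sin t ^+ 2) -
  2 * E * (cos s * cos t + sin s * sin t)); first by ring.
by rewrite !cos2Dsin2 mulr1.
Qed.

(** For the fraction [N / Dn] that defines [strip_inv], [|Dn|^2 - |N|^2 = 4 exp (w.1) sin (D / 2)
    sin (w.2)]. So the sign of [sin w.2] separates disk and circle: the open strip goes into the
    disk, the lines [y = 0] and [y = pi] into the circle. *)
Lemma strip_inv_mod (w : pt) : 0 <= w.2 <= pi ->
  exists2 c, 0 < c & 1 - cmod (strip_inv w) ^+ 2 = c * sin w.2.
Proof.
move=> w2; have den0 := strip_den_neq0 w2.
set Dn := (X in X != 0) in den0; set E := expR w.1.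
pose N := E%:C * cis w.2 - cis (pi - D / 2).
have DnE : Dn = E%:C * cis (w.2 - (ta + D)) - cis (pi - D / 2 - ta).
  by rewrite /Dn !cisD mulrA.
have n0 : 0 < cmod (ofC Dn) ^+ 2.
  rewrite exprn_gt0// lt_neqAle cmod_ge0 andbT eq_sym cmod_eq0; apply: contra den0.
  by case: (Dn) => x y /eqP[-> ->].
have key : cmod (ofC Dn) ^+ 2 - cmod (ofC N) ^+ 2 = 4 * E * sin (D / 2) * sin w.2.
  rewrite DnE /N !cmod_cis_sub.
  have -> : w.2 - (ta + D) - (pi - D / 2 - ta) = (w.2 - D / 2) - pi by lra.
  have -> : w.2 - (pi - D / 2) = (w.2 + D / 2) - pi by lra.
  by rewrite !(cosB _ pi) !cospi !sinpi cosB cosD; ring.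
have frac : cmod (strip_inv w) ^+ 2 * cmod (ofC Dn) ^+ 2 = cmod (ofC N) ^+ 2.
  apply: (@complexI R); rewrite rmorphM/=.
  have -> : (cmod (strip_inv w) ^+ 2)%:C = (N / Dn) * (N / Dn)^*.
    by rewrite mul_conj_cmod.
  rewrite -(mul_conj_cmod N) -(mul_conj_cmod Dn) rmorphM fmorphV.
  by field; rewrite den0 fmorph_eq0 den0.
exists (4 * E * sin (D / 2) / cmod (ofC Dn) ^+ 2).
  by rewrite divr_gt0// !mulr_gt0// ?expR_gt0// sin_half_gt0.
rewrite mulrAC -key mulrBl divff ?gt_eqF//; congr (_ - _).
by rewrite -frac mulfK// gt_eqF.
Qed.

Lemma strip_inv_dom (w : pt) : 0 <= w.2 <= pi -> strip_dom (strip_inv w).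
Proof.
move=> w2; have den0 := strip_den_neq0 w2.
have [c c0 cE] := strip_inv_mod w2.
have E0 : (expR w.1)%:C != 0 :> R[i].
  by rewrite -(rmorph0 (@real_complex R)) (inj_eq (@complexI _)) gt_eqF// expR_gt0.
have sE : toC (strip_inv w) * ((expR w.1)%:C * cis w.2 * cis (- (ta + D)) - cis (pi - D / 2) * cis (- ta))
    = (expR w.1)%:C * cis w.2 - cis (pi - D / 2) by rewrite /strip_inv ofCK divfK.
have Dn : cis (- D) != 1.
  by apply/negP => /eqP h; have := cisNK D; rewrite h mul1r => h'; move: cisD_neq1; rewrite h' eqxx.
split.
- by rewrite -(@expr_le1 _ 2)// ?cmod_ge0// -subr_ge0 cE; apply: mulr_ge0; [exact: ltW|exact: sin_ge0_pi].
- move=> h; move: sE; rewrite h toC_circle_pt => sE; move: Dn.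
  have -> : cis (- D) = cis ta * cis (- (ta + D)) by rewrite -cisD opprD addNKr.
  have /eqP : (expR w.1)%:C * cis w.2 * (cis ta * cis (- (ta + D)) - 1) = 0.
    set W := _ * cis w.2 in sE *; set K := cis (pi - _) in sE *.
    transitivity (cis ta * (W * cis (- (ta + D)) - K * cis (- ta)) - (W - K) + K * (cis ta * cis (- ta) - 1)).
      by ring.
    by rewrite sE cisKN !subrr mulr0 addr0.
  by rewrite !mulf_eq0 (negbTE E0) (negbTE (cis_neq0 _)) /= subr_eq0 => ->.
- move=> h; move: sE; rewrite h toC_circle_pt => sE; move: cisD_neq1.
  have -> : cis D = cis (ta + D) * cis (- ta) by rewrite -cisD addrAC subrr add0r.
  have /eqP : cis (pi - D / 2) * (1 - cis (ta + D) * cis (- ta)) = 0.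
    set W := _ * cis w.2 in sE *; set K := cis (pi - _) in sE *.
    transitivity (cis (ta + D) * (W * cis (- (ta + D)) - K * cis (- ta)) - (W - K) -
      W * (cis (ta + D) * cis (- (ta + D)) - 1)); first by ring.
    by rewrite sE cisKN !subrr mulr0 subr0.
  by rewrite mulf_eq0 (negbTE (cis_neq0 _)) /= subr_eq0 eq_sym => ->.
Qed.

(** A crude bound from the range of [atan], but on this interval a nonnegative sine already confines
    [strip_y z] to [[0, pi]]. *)
Lemma strip_y_bound z : - pi < strip_y z < 2 * pi.
Proof.
have := atan_ltpi2 (polar_im a z / polar_re a z); have := atan_gtNpi2 (polar_im a z / polar_re a z).
have := atan_ltpi2 (polar_im b z / polar_re b z); have := atan_gtNpi2 (polar_im b z / polar_re b z).
have /andP[D1 D2] := D0.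
rewrite /strip_y /log_arg => h1 h2 h3 h4; apply/andP; split; lra.
Qed.

(** The counterpart of [strip_inv_mod]. With [P = 1 - a^* z] and [Q = 1 - b^* z], the imaginary part
    of [K P Q^*] is [sin (D / 2) (1 - |z|^2)]. *)
Lemma sin_strip_y z : strip_dom z -> exists2 c, 0 < c & sin (strip_y z) = c * (1 - cmod z ^+ 2).
Proof.
move=> dz; have [z1 za zb] := dz; have E := strip_exp dz.
set Z := toC z in E; set P := 1 - cis (- ta) * Z in E; set Q := 1 - cis (- (ta + D)) * Z in E.
have Q0 : Q != 0.
  rewrite /Q -polarE eq_complex /= negb_and; apply/orP; left.
  by rewrite gt_eqF// polar_re_gt0.
have n0 : 0 < cmod (ofC Q) ^+ 2.
  rewrite exprn_gt0// lt_neqAle cmod_ge0 andbT eq_sym cmod_eq0; apply: contra Q0.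
  by case: (Q) => x y /eqP[-> ->].
have KPQ : cis (pi - D / 2) * P * Q^* = cis (pi - D / 2) + cis (pi + D / 2) * (cmod z ^+ 2)%:C
    - cis (pi - (D / 2 + ta)) * Z - cis (pi + (D / 2 + ta)) * Z^*.
  have -> : (cmod z ^+ 2)%:C = Z * Z^* by rewrite mul_conj_cmod /Z; case: (z).
  have -> : pi + D / 2 = (pi - D / 2) + (- ta) + (ta + D) by lra.
  have -> : pi - (D / 2 + ta) = (pi - D / 2) + (- ta) by lra.
  have -> : pi + (D / 2 + ta) = (pi - D / 2) + (ta + D) by lra.
  rewrite !(cisD (pi - D / 2)) !(cisD (pi - D / 2 - ta)) (cisD (pi - D / 2)).
  have -> : (Q^*)%R = 1 - cis (ta + D) * Z^*.
    rewrite /Q; case: (Z) => x y; apply/eqP; rewrite eq_complex /= cosN sinN.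
    by apply/andP; split; apply/eqP; ring.
  have AA : cis (- ta) * cis ta = 1 by exact: cisNK.
  by rewrite /P; ring.
have im : complex.Im (cis (pi - D / 2) * P * Q^*) = sin (D / 2) * (1 - cmod z ^+ 2).
  rewrite KPQ /Z; case: (z) => x y /=.
  by rewrite !(sinD pi) !(cosD pi) !sinpi !cospi !cosN !sinN !(sinD (D / 2)) !(cosD (D / 2)); ring.
have E2 : (expR (strip_x z))%:C * cis (strip_y z) * (cmod (ofC Q) ^+ 2)%:C =
    cis (pi - D / 2) * P * Q^*.
  by rewrite E -mul_conj_cmod; field.
have : expR (strip_x z) * sin (strip_y z) * cmod (ofC Q) ^+ 2 = sin (D / 2) * (1 - cmod z ^+ 2).
  by rewrite -im -E2 /= !mul0r !mulr0 !addr0 add0r.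
move=> h; exists (sin (D / 2) / (expR (strip_x z) * cmod (ofC Q) ^+ 2)).
  by rewrite divr_gt0 ?sin_half_gt0// mulr_gt0// expR_gt0.
have e0 : expR (strip_x z) != 0 by rewrite gt_eqF// expR_gt0.
rewrite mulrAC -h; field.
rewrite e0 andbT; apply: contraTneq n0 => ->; by rewrite expr0n ltxx.
Qed.

Lemma strip_y_range z : strip_dom z -> 0 <= strip_y z <= pi.
Proof.
move=> dz; have [c c0 cE] := sin_strip_y dz; have [z1 _ _] := dz.
apply: sin_nonneg_range; first exact: strip_y_bound.
by rewrite cE; apply: mulr_ge0; [exact: ltW|rewrite subr_ge0 expr_le1// cmod_ge0].
Qed.

Lemma disk_strip_dom z : cmod z < 1 -> strip_dom z.
Proof.
by move=> z1; split; [exact: ltW|move=> zE; move: z1; rewrite zE cmod_circle_pt ltxx..].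
Qed.

Lemma strip_y_interior z : cmod z < 1 -> 0 < strip_y z < pi.
Proof.
move=> z1; have [c c0 cE] := sin_strip_y (disk_strip_dom z1).
apply: sin_pos_range; first exact: strip_y_bound.
by rewrite cE mulr_gt0// subr_gt0 expr_lt1// cmod_ge0.
Qed.

Lemma polar_inj (x x' y y' : R) : 0 <= y <= pi -> 0 <= y' <= pi ->
  (expR x)%:C * cis y = (expR x')%:C * cis y' -> (x, y) = (x', y').
Proof.
move=> yr yr' h; have nx (t s : R) : `|(expR t)%:C * cis s| = (expR t)%:C.
  by rewrite normrM norm_cis mulr1 ger0_norm// lecR expR_ge0.
have xx : x = x'.
  by apply: expR_inj; apply: (@complexI R); rewrite -(nx x y) -(nx x' y') h.
rewrite -xx in h *; congr pair; apply: cos_inj; rewrite ?in_itv//.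
have /(congr1 (@complex.Re R)) := h; rewrite /= !mul0r !subr0.
by apply: mulfI; rewrite gt_eqF// expR_gt0.
Qed.

Lemma strip_mapK (w : pt) : 0 <= w.2 <= pi -> strip_map (strip_inv w) = w.
Proof.
move=> w2; have dz := strip_inv_dom w2; rewrite (surjective_pairing w).
apply: polar_inj => //; first by rewrite -surjective_pairing; exact: strip_y_range.
rewrite -surjective_pairing strip_exp//.
have den0 := strip_den_neq0 w2; have [z1 za zb] := dz.
have nb : 1 - cis (- (ta + D)) * toC (strip_inv w) != 0.
  rewrite -polarE eq_complex /= negb_and; apply/orP; left.
  by rewrite gt_eqF// polar_re_gt0.
have sE : toC (strip_inv w) * ((expR w.1)%:C * cis w.2 * cis (- (ta + D)) - cis (pi - D / 2) * cis (- ta))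
    = (expR w.1)%:C * cis w.2 - cis (pi - D / 2) by rewrite /strip_inv ofCK divfK.
apply: (mulIf nb); rewrite mulrA divfK//.
apply/eqP; rewrite -subr_eq0; apply/eqP.
transitivity ((cis (pi - D / 2) - (expR w.1)%:C * cis w.2) + toC (strip_inv w) *
  ((expR w.1)%:C * cis w.2 * cis (- (ta + D)) - cis (pi - D / 2) * cis (- ta))); first by ring.
by rewrite sE; ring.
Qed.

Lemma one_sub_cis (x : R) : 1 - cis x = (- (2 * sin (x / 2)))%:C * 'i * cis (x / 2).
Proof.
rewrite {1}(splitr x) cisD; have h := cos2Dsin2 (x / 2); apply/eqP; rewrite eq_complex /=.
apply/andP; split; apply/eqP; last by ring.
by rewrite -{1}h; ring.
Qed.

Lemma circle_strip_dom t : ta < t < ta + 2 * pi -> t != ta + D -> strip_dom (circle_pt t).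
Proof.
move=> /andP[t1 t2] tD; have /andP[D1 D2] := D0.
have s1 : sin ((t - ta) / 2) != 0.
  by rewrite gt_eqF//; apply: sin_gt0_pi; apply/andP; split; lra.
have s2 : sin ((t - (ta + D)) / 2) != 0.
  have [td|td] := ltP t (ta + D).
    rewrite -oppr_eq0 -sinN gt_eqF//; apply: sin_gt0_pi; apply/andP; split; lra.
  have {}td : ta + D < t by rewrite lt_neqAle td eq_sym tD.
  by rewrite gt_eqF//; apply: sin_gt0_pi; apply/andP; split; lra.
have ca (s : R) : sin ((t - s) / 2) != 0 -> circle_pt t <> circle_pt s.
  move=> sn E; have : 1 - cis (t - s) = 0.
    by rewrite cisD -!toC_circle_pt E toC_circle_pt cisKN subrr.
  rewrite one_sub_cis => /eqP; rewrite !mulf_eq0 (negbTE (cis_neq0 _)) orbF.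
  rewrite (negbTE (_ : 'i != 0)) ?orbF; last by rewrite eq_complex /= oner_eq0 andbF.
  by rewrite eq_complex /= eqxx andbT oppr_eq0 mulf_eq0 pnatr_eq0 (negbTE sn).
by split; [rewrite cmod_circle_pt|exact: ca|exact: ca].
Qed.

(** On the circle [1 - cis x] is [sin (x / 2)] times a factor of known argument, and the constant
    [pi - D / 2] in [strip_y] is chosen to cancel these arguments. The exponential is real, positive
    on the arc from [a] to [b] and negative on the other one, which decides between the lines
    [y = 0] and [y = pi]. *)
Lemma strip_boundary_exp t : ta < t < ta + 2 * pi -> t != ta + D ->
  (expR (strip_x (circle_pt t)))%:C * cis (strip_y (circle_pt t)) =
  (sin ((t - ta) / 2) / sin ((ta + D - t) / 2))%:C.
Proof.
move=> /andP[t1 t2] tD; have /andP[D1 D2] := D0.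
have s1 : sin ((t - ta) / 2) != 0.
  by rewrite gt_eqF//; apply: sin_gt0_pi; apply/andP; split; lra.
have s2 : sin ((t - (ta + D)) / 2) != 0.
  have [td|td] := ltP t (ta + D).
    rewrite -oppr_eq0 -sinN gt_eqF//; apply: sin_gt0_pi; apply/andP; split; lra.
  have {}td : ta + D < t by rewrite lt_neqAle td eq_sym tD.
  by rewrite gt_eqF//; apply: sin_gt0_pi; apply/andP; split; lra.
rewrite strip_exp; last by apply: circle_strip_dom; rewrite ?t1.
rewrite toC_circle_pt -!cisD ![- _ + t]addrC !one_sub_cis.
have cE : cis ((t - ta) / 2) = cis (- (pi - D / 2)) * - cis ((t - (ta + D)) / 2).
  rewrite -[- cis _]mulN1r -[-1]cispi -!cisD; congr cis; lra.
have sE : sin ((ta + D - t) / 2) = - sin ((t - (ta + D)) / 2) by rewrite -sinN; congr sin; lra.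
have mC (x : R) : (- (2 * x))%:C = - (2 * x%:C).
  by apply/eqP; rewrite eq_complex /=; apply/andP; split; apply/eqP; ring.
have dC (x y : R) : (x / - y)%:C = - (x%:C / y%:C) by rewrite invrN mulrN rmorphN rmorphM/= fmorphV.
rewrite sE dC cE !mC.
have k1 := cisKN (pi - D / 2).
have S2 : (sin ((t - (ta + D)) / 2))%:C != 0 :> R[i] by rewrite eq_complex /= eqxx andbT.
have i0 : 'i != 0 :> R[i] by rewrite eq_complex /= oner_eq0 andbF.
rewrite -[RHS]mul1r -k1; field.
by rewrite S2 i0 !cis_neq0.
Qed.

Lemma strip_y_boundary t : ta < t < ta + 2 * pi -> t != ta + D ->
  strip_y (circle_pt t) = if t < ta + D then 0 else pi.
Proof.
move=> tr tD; have E := strip_boundary_exp tr tD; have /andP[t1 t2] := tr.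
have /andP[D1 D2] := D0; have pi0 := pi_gt0 R.
have s1 : 0 < sin ((t - ta) / 2) by apply: sin_gt0_pi; apply/andP; split; lra.
have dz : strip_dom (circle_pt t) by exact: circle_strip_dom.
have yr := strip_y_range dz.
case: ifPn => td.
  have s2 : 0 < sin ((ta + D - t) / 2) by apply: sin_gt0_pi; apply/andP; split; lra.
  have q0 : 0 < sin ((t - ta) / 2) / sin ((ta + D - t) / 2) by rewrite divr_gt0.
  have E' : (expR (strip_x (circle_pt t)))%:C * cis (strip_y (circle_pt t)) =
    (expR (ln (sin ((t - ta) / 2) / sin ((ta + D - t) / 2))))%:C * cis 0.
    by rewrite E cis0 mulr1 lnK.
  have z0 : (0 : R) <= (0 : R) <= pi by rewrite lexx ltW.
  by case: (polar_inj yr z0 E').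
have {}td : ta + D < t by rewrite lt_neqAle leNgt td andbT eq_sym tD.
have s2 : 0 < - sin ((ta + D - t) / 2).
  by rewrite -sinN; apply: sin_gt0_pi; apply/andP; split; lra.
have q0 : 0 < sin ((t - ta) / 2) / - sin ((ta + D - t) / 2) by rewrite divr_gt0.
have E' : (expR (strip_x (circle_pt t)))%:C * cis (strip_y (circle_pt t)) =
    (expR (ln (sin ((t - ta) / 2) / - sin ((ta + D - t) / 2))))%:C * cis pi.
  by rewrite E cispi lnK// mulrN1 -rmorphN -mulrN -invrN opprK.
have z0 : (0 : R) <= (pi : R) <= pi by rewrite lexx ltW.
by case: (polar_inj yr z0 E').
Qed.

End strip_coordinates.

Section differential_expansion.
Context {R : realType}.
Local Notation pt := (R * R)%type.
Implicit Types (z w : pt).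

(** Turns a lower bound for the linear map given by the differential into the infinitesimal
    expansion that [area_inequality] asks for. *)
Lemma differential_expand (u v : pt -> R) (p q p' q' l : R) z :
  has_differential u p q z -> has_differential v p' q' z -> 0 <= l ->
  (forall x y : R, l ^+ 2 * (x ^+ 2 + y ^+ 2) <=
     (p * x + q * y) ^+ 2 + (p' * x + q' * y) ^+ 2) ->
  forall e : R, 0 < e -> exists2 d : R, 0 < d & forall w, cmod (w - z) < d ->
    (l - e) * cmod (w - z) <= cmod ((u w, v w) - (u z, v z)).
Proof.
move=> hu hv l0 hl e e0; have e20 : 0 < e / 2 by rewrite divr_gt0.
have [d1 d10 h1] := hu _ e20; have [d2 d20 h2] := hv _ e20.
exists (Num.min d1 d2); first by rewrite lt_min d10.
move=> w; rewrite lt_min => /andP[/h1 {}h1 /h2 {}h2].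
set x := w.1 - z.1 in h1 h2; set y := w.2 - z.2 in h1 h2.
pose Dv : pt := (p * x + q * y, p' * x + q' * y).
have lD : l * cmod (w - z) <= cmod Dv.
  rewrite -(@ler_pXn2r _ 2)// ?nnegrE ?cmod_ge0 ?mulr_ge0 ?cmod_ge0//.
  by rewrite exprMn !cmod_sqr; exact: hl.
have := cmodBB Dv (Dv - ((u w, v w) - (u z, v z))); rewrite subKr.
have := cmod_le_norm1 (Dv - ((u w, v w) - (u z, v z))).
rewrite /Dv /=; rewrite -[`|_ - (u w - u z)|]normrN -[`|_ - (v w - v z)|]normrN.
rewrite !opprB !opprD !addrA in h1 h2 *.
lra.
Qed.

Lemma differential_bound (u v : pt -> R) (p q p' q' l : R) z :
  has_differential u p q z -> has_differential v p' q' z -> 0 <= l ->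
  (forall x y : R, (p * x + q * y) ^+ 2 + (p' * x + q' * y) ^+ 2 <=
     l ^+ 2 * (x ^+ 2 + y ^+ 2)) ->
  forall e : R, 0 < e -> exists2 d : R, 0 < d & forall w, cmod (w - z) < d ->
    cmod ((u w, v w) - (u z, v z)) <= (l + e) * cmod (w - z).
Proof.
move=> hu hv l0 hl e e0; have e20 : 0 < e / 2 by rewrite divr_gt0.
have [d1 d10 h1] := hu _ e20; have [d2 d20 h2] := hv _ e20.
exists (Num.min d1 d2); first by rewrite lt_min d10.
move=> w; rewrite lt_min => /andP[/h1 {}h1 /h2 {}h2].
set x := w.1 - z.1 in h1 h2; set y := w.2 - z.2 in h1 h2.
pose Dv : pt := (p * x + q * y, p' * x + q' * y).
have lD : cmod Dv <= l * cmod (w - z).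
  rewrite -(@ler_pXn2r _ 2)// ?nnegrE ?cmod_ge0 ?mulr_ge0 ?cmod_ge0//.
  by rewrite exprMn !cmod_sqr; exact: hl.
have := cmodD Dv (((u w, v w) - (u z, v z)) - Dv); rewrite addrC subrK.
have := cmod_le_norm1 (((u w, v w) - (u z, v z)) - Dv).
rewrite /Dv /=.
rewrite !opprD !addrA in h1 h2 *.
lra.
Qed.

End differential_expansion.

(** * Derivatives of the strip coordinates *)

Section log_gradient.
Context {R : realType}.
Local Notation pt := (R * R)%type.
Implicit Types (z w c : pt).

(** [grad_log1 c z - i grad_log2 c z] is [1 / (z - c)], the derivative of a branch of the logarithm
    of [z - c]. *)
Definition grad_log1 c z : R := (z.1 - c.1) / ((z.1 - c.1) ^+ 2 + (z.2 - c.2) ^+ 2).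
Definition grad_log2 c z : R := (z.2 - c.2) / ((z.1 - c.1) ^+ 2 + (z.2 - c.2) ^+ 2).

Let affine (al be ga : R) z : has_differential (fun w => al * w.1 + be * w.2 + ga) al be z.
Proof.
by move=> e e0; exists 1 => // w _; rewrite (_ : _ - _ - _ - _ = 0) ?normr0 ?mulr_ge0 ?cmod_ge0 ?ltW//; ring.
Qed.

Lemma has_differential_ext (u v : pt -> R) (p q p' q' : R) z : u = v -> p = p' -> q = q' ->
  has_differential u p q z -> has_differential v p' q' z.
Proof. by move=> -> -> ->. Qed.

Lemma has_differentialV (u : pt -> R) (p q : R) z : u z != 0 -> has_differential u p q z ->
  has_differential (fun w => (u w)^-1) (- p / u z ^+ 2) (- q / u z ^+ 2) z.
Proof.
move=> u0 hu; have hd : is_derive (u z) (1 : R) (fun x => x^-1) (- (u z) ^- 2).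
  have := @is_deriveV R id (u z) 1 (1 : R) u0 (is_derive_id _ _).
  by rewrite /GRing.scale /= mulr1.
by apply: has_differential_ext (has_differential_comp hd hu) => //; rewrite !mulNr mulrC.
Qed.

Lemma has_differential_polar_re c z : has_differential (polar_re c) (- c.1) (- c.2) z.
Proof.
apply: has_differential_ext (affine (- c.1) (- c.2) 1 z) => //.
by apply/funext => w; rewrite /polar_re; ring.
Qed.

Lemma has_differential_polar_im c z : has_differential (polar_im c) c.2 (- c.1) z.
Proof.
apply: has_differential_ext (affine c.2 (- c.1) 0 z) => //.
by apply/funext => w; rewrite /polar_im; ring.
Qed.

Lemma polar_im_mul t z : let c := circle_pt t in
  (polar_re c z * c.2 + polar_im c z * c.1 = c.2 - z.2) *
  (polar_re c z * c.1 - polar_im c z * c.2 = c.1 - z.1).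
Proof.
rewrite /= /polar_re /polar_im /=; have := cos2Dsin2 t.
move=> h; split.
  by transitivity (sin t - (cos t ^+ 2 + sin t ^+ 2) * z.2); [ring|rewrite h mul1r].
by transitivity (cos t - (cos t ^+ 2 + sin t ^+ 2) * z.1); [ring|rewrite h mul1r].
Qed.

Lemma has_differential_log_mod t z : let c := circle_pt t in 0 < polar_re c z ->
  has_differential (log_mod c) (grad_log1 c z) (grad_log2 c z) z.
Proof.
move=> c r0; have [c2 c1] := polar_im_mul t z.
set n := polar_re c z ^+ 2 + polar_im c z ^+ 2.
have n0 : 0 < n by rewrite ltr_pwDl ?exprn_gt0 ?sqr_ge0.
have nE : (z.1 - c.1) ^+ 2 + (z.2 - c.2) ^+ 2 = n by rewrite /n polar_sqr cmod_sqr.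
have hn := has_differentialD (has_differentialM (has_differential_polar_re c z) (has_differential_polar_re c z))
  (has_differentialM (has_differential_polar_im c z) (has_differential_polar_im c z)).
have hl : is_derive (polar_re c z * polar_re c z + polar_im c z * polar_im c z) (1 : R) (@ln R) n^-1.
  by rewrite -!expr2; exact: is_derive1_ln.
have := has_differentialM (has_differential_comp hl hn) (has_differential_cst (2^-1) z).
apply: has_differential_ext.
- by [].
- rewrite /grad_log1 nE mulr0 addr0 -/c in c1 *; rewrite -opprB -c1; field; rewrite gt_eqF//.
- rewrite /grad_log2 nE mulr0 addr0 -/c in c2 *; rewrite -opprB -c2; field; rewrite gt_eqF//.
Qed.

Lemma has_differential_log_arg t z : let c := circle_pt t in 0 < polar_re c z ->
  has_differential (log_arg c) (- grad_log2 c z) (grad_log1 c z) z.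
Proof.
move=> c r0; have [c2 c1] := polar_im_mul t z.
set n := polar_re c z ^+ 2 + polar_im c z ^+ 2.
have n0 : 0 < n by rewrite ltr_pwDl ?exprn_gt0 ?sqr_ge0.
have nE : (z.1 - c.1) ^+ 2 + (z.2 - c.2) ^+ 2 = n by rewrite /n polar_sqr cmod_sqr.
have r1 : polar_re c z != 0 by rewrite gt_eqF.
have hq := has_differentialM (has_differential_polar_im c z)
  (has_differentialV r1 (has_differential_polar_re c z)).
have := has_differential_comp (is_derive1_atan (polar_im c z / polar_re c z)) hq.
have E : 1 + (polar_im c z / polar_re c z) ^+ 2 = n / polar_re c z ^+ 2.
  by rewrite /n; field.
apply: has_differential_ext.
- by [].
- rewrite /grad_log2 nE E -mulNr opprB -c2; field; rewrite ?r1 ?gt_eqF//.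
- rewrite /grad_log1 nE E -opprB -c1; field; rewrite ?r1 ?gt_eqF//.
Qed.

(** The real form of the fact that [1 / (z - c)] has derivative [- 1 / (z - c)^2]. *)
Lemma has_differential_grad_log c z : z <> c ->
  let A := grad_log1 c z in let B := grad_log2 c z in
  has_differential (grad_log1 c) (B ^+ 2 - A ^+ 2) (- (2 * A * B)) z /\
  has_differential (grad_log2 c) (- (2 * A * B)) (A ^+ 2 - B ^+ 2) z.
Proof.
move=> zc A B; set n := (z.1 - c.1) ^+ 2 + (z.2 - c.2) ^+ 2.
have n0 : n != 0.
  have -> : n = cmod (z - c) ^+ 2 by rewrite cmod_sqr.
  rewrite expf_neq0// cmod_eq0 subr_eq0.
  exact/eqP.
have h1 : has_differential (fun w : pt => w.1 - c.1) 1 0 z.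
  by apply: has_differential_ext (affine 1 0 (- c.1) z) => //; apply/funext => w; ring.
have h2 : has_differential (fun w : pt => w.2 - c.2) 0 1 z.
  by apply: has_differential_ext (affine 0 1 (- c.2) z) => //; apply/funext => w; ring.
have hn := has_differentialD (has_differentialM h1 h1) (has_differentialM h2 h2).
have n0' : (z.1 - c.1) * (z.1 - c.1) + (z.2 - c.2) * (z.2 - c.2) != 0 by rewrite -!expr2.
have hV := has_differentialV n0' hn.
rewrite /A /B /grad_log1 /grad_log2; split.
- apply: has_differential_ext (has_differentialM h1 hV).
  + by apply/funext => w; rewrite !expr2.
  + by rewrite -!expr2 -/n; move: n0; rewrite /n => n0; field.
  + by rewrite -!expr2 -/n; move: n0; rewrite /n => n0; field.
- apply: has_differential_ext (has_differentialM h2 hV).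
  + by apply/funext => w; rewrite !expr2.
  + by rewrite -!expr2 -/n; move: n0; rewrite /n => n0; field.
  + by rewrite -!expr2 -/n; move: n0; rewrite /n => n0; field.
Qed.

End log_gradient.
Section strip_gradient.
Context {R : realType}.
Local Notation pt := (R * R)%type.
Local Open Scope complex_scope.
Variables (ta D : R).
Hypothesis D0 : 0 < D < 2 * pi.
Implicit Types (z w : pt).

Let a : pt := circle_pt ta.
Let b : pt := circle_pt (ta + D).

(** [strip_A - i strip_B] is the complex derivative of the conformal map [strip_map]; its squared
    modulus [strip_om] is the Jacobian. *)
Definition strip_A z : R := grad_log1 a z - grad_log1 b z.
Definition strip_B z : R := grad_log2 a z - grad_log2 b z.
Definition strip_om z : R := strip_A z ^+ 2 + strip_B z ^+ 2.

Lemma cts_pair (f g : pt -> R) z : {for z, continuous f} -> {for z, continuous g} ->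
  {for z, continuous (fun w => (f w, g w))}.
Proof. by move=> cf cg; exact: (cvg_pair cf cg). Qed.

Lemma has_differential_strip_x z : strip_dom ta D z ->
  has_differential (strip_x ta D) (strip_A z) (strip_B z) z.
Proof.
move=> [z1 za zb]; apply: has_differentialB; apply: has_differential_log_mod.
  exact: polar_re_gt0.
exact: polar_re_gt0.
Qed.

Lemma has_differential_strip_y z : strip_dom ta D z ->
  has_differential (strip_y ta D) (- strip_B z) (strip_A z) z.
Proof.
move=> [z1 za zb].
have h := has_differentialB (has_differential_log_arg (polar_re_gt0 z1 za))
  (has_differential_log_arg (polar_re_gt0 z1 zb)).
have := has_differentialD h (has_differential_cst (pi - D / 2) z).
by apply: has_differential_ext; rewrite /strip_A /strip_B ?addr0// opprB opprK addrC.
Qed.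

Lemma continuous_strip_map z : strip_dom ta D z -> {for z, continuous (strip_map ta D)}.
Proof.
move=> dz; apply: cts_pair.
  exact: has_differential_continuous (has_differential_strip_x dz).
exact: has_differential_continuous (has_differential_strip_y dz).
Qed.

Lemma strip_poles_neq : a <> b.
Proof.
move=> ab; move: (cisD_neq1 D0); rewrite -subr_eq0 => /negP; apply.
rewrite -(mulKf (cis_neq0 ta) (cis D - 1)) mulrBr mulr1 -cisD -!toC_circle_pt.
by rewrite -/a -/b ab subrr mulr0.
Qed.

Lemma grad_log_sqr (c z : pt) : z <> c ->
  grad_log1 c z ^+ 2 + grad_log2 c z ^+ 2 = ((z.1 - c.1) ^+ 2 + (z.2 - c.2) ^+ 2)^-1.
Proof.
move=> zc; set n := (z.1 - c.1) ^+ 2 + (z.2 - c.2) ^+ 2.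
have n0 : n != 0.
  have -> : n = cmod (z - c) ^+ 2 by rewrite cmod_sqr.
  by rewrite expf_neq0// cmod_eq0 subr_eq0; exact/eqP.
by rewrite /grad_log1 /grad_log2 -/n !exprMn -mulrDl -/n; field.
Qed.

(** The derivative is [1 / (z - a) - 1 / (z - b)], and it could vanish only if the two poles
    coincided. *)
Lemma strip_om_gt0 z : z <> a -> z <> b -> 0 < strip_om z.
Proof.
move=> za zb; rewrite lt_neqAle addr_ge0 ?sqr_ge0// andbT eq_sym.
apply/negP; rewrite paddr_eq0 ?sqr_ge0// !sqrf_eq0 !subr_eq0 => /andP[/eqP e1 /eqP e2].
have := grad_log_sqr za; rewrite e1 e2 (grad_log_sqr zb) => /invr_inj nE.
have := grad_log_sqr za; have := grad_log_sqr zb; move: e1 e2.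
rewrite /grad_log1 /grad_log2 nE; set n := (X in _ = X) in nE *.
have n0 : n != 0.
  have -> : n = cmod (z - a) ^+ 2 by rewrite cmod_sqr.
  by rewrite expf_neq0// cmod_eq0 subr_eq0; exact/eqP.
have ni : n^-1 != 0 by rewrite invr_eq0.
move=> /(mulIf ni) e1 /(mulIf ni) e2 _ _; apply: strip_poles_neq.
rewrite (surjective_pairing a) (surjective_pairing b); congr pair; lra.
Qed.

Lemma has_differential_strip_AB z : z <> a -> z <> b -> exists P Q : R,
  has_differential strip_A P Q z /\ has_differential strip_B Q (- P) z.
Proof.
move=> za zb; have [a1 a2] := has_differential_grad_log za.
have [b1 b2] := has_differential_grad_log zb.
eexists; eexists; split; first exact: has_differentialB a1 b1.
by apply: has_differential_ext (has_differentialB a2 b2) => //; ring.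
Qed.

Lemma ofC_div (c d : R[i]) : ofC (c / d) =
  ((complex.Re c * complex.Re d + complex.Im c * complex.Im d) / (complex.Re d ^+ 2 + complex.Im d ^+ 2),
   (complex.Im c * complex.Re d - complex.Re c * complex.Im d) / (complex.Re d ^+ 2 + complex.Im d ^+ 2)).
Proof. by case: c d => [x y] [x' y']; rewrite /ofC /=; congr pair; ring. Qed.

Lemma continuous_strip_inv w : 0 <= w.2 <= pi -> {for w, continuous (strip_inv ta D)}.
Proof.
move=> w2; have := @strip_den_neq0 _ ta _ D0 w w2.
pose k : R := pi - D / 2.
pose n1 (w : pt) := expR w.1 * cos w.2 - cos k.
pose n2 (w : pt) := expR w.1 * sin w.2 - sin k.
pose d1 (w : pt) := expR w.1 * cos (w.2 - (ta + D)) - cos (k - ta).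
pose d2 (w : pt) := expR w.1 * sin (w.2 - (ta + D)) - sin (k - ta).
have nE w' : (expR w'.1)%:C * cis w'.2 - cis (pi - D / 2) = n1 w' +i* n2 w'.
  by apply/eqP; rewrite eq_complex /= /n1 /n2; apply/andP; split; apply/eqP; ring.
have dE w' : (expR w'.1)%:C * cis w'.2 * cis (- (ta + D)) - cis (pi - D / 2) * cis (- ta)
    = d1 w' +i* d2 w'.
  rewrite -mulrA -!cisD.
  by apply/eqP; rewrite eq_complex /= /d1 /d2 /k; apply/andP; split; apply/eqP; ring.
rewrite dE => dn0.
have d0 : d1 w ^+ 2 + d2 w ^+ 2 != 0.
  apply: contra dn0; rewrite paddr_eq0 ?sqr_ge0// !sqrf_eq0 => /andP[/eqP -> /eqP ->].
  by rewrite eq_complex /= !eqxx.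
have -> : strip_inv ta D = fun w => ((n1 w * d1 w + n2 w * d2 w) / (d1 w ^+ 2 + d2 w ^+ 2),
   (n2 w * d1 w - n1 w * d2 w) / (d1 w ^+ 2 + d2 w ^+ 2)).
  by apply/funext => w'; rewrite /strip_inv nE dE ofC_div.
have cE : {for w, continuous (fun w : pt => expR w.1)}.
  by apply: continuous_comp; [exact: continuous_fst|exact: continuous_expR].
have cS (r : R) : {for w, continuous (fun w : pt => w.2 - r)}.
  by apply: cvgB; [exact: continuous_snd|exact: cvg_cst].
have cc (r s : R) : {for w, continuous (fun w : pt => expR w.1 * cos (w.2 - r) - cos s)}.
  apply: cvgB; last exact: cvg_cst.
  apply: cvgM; first exact: cE.
  by apply: (@continuous_comp _ _ _ (fun w : pt => w.2 - r)); [exact: cS|exact: continuous_cos].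
have cs (r s : R) : {for w, continuous (fun w : pt => expR w.1 * sin (w.2 - r) - sin s)}.
  apply: cvgB; last exact: cvg_cst.
  apply: cvgM; first exact: cE.
  by apply: (@continuous_comp _ _ _ (fun w : pt => w.2 - r)); [exact: cS|exact: continuous_sin].
have cn1 : {for w, continuous n1}.
  by rewrite (_ : n1 = fun w => expR w.1 * cos (w.2 - 0) - cos k)//; apply/funext => w'; rewrite subr0.
have cn2 : {for w, continuous n2}.
  by rewrite (_ : n2 = fun w => expR w.1 * sin (w.2 - 0) - sin k)//; apply/funext => w'; rewrite subr0.
have cd1 : {for w, continuous d1} by exact: cc.
have cd2 : {for w, continuous d2} by exact: cs.
have cden : {for w, continuous (fun w => (d1 w ^+ 2 + d2 w ^+ 2)^-1)}.
  by apply: cvgV => //; apply: cvgD; apply: cvgM.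
apply: cts_pair; apply: cvgM => //; first by apply: cvgD; apply: cvgM.
by apply: cvgB; apply: cvgM.
Qed.

(** Here [strip_x] is [ln (|z - a| / |z - b|)] and [|z - b| <= 2] on the closed disk. This makes the
    left end of the strip a neighbourhood of [a], where the dilatation is small. *)
Lemma strip_x_left (z : R * R) (e : R) : 0 < e -> strip_dom ta D z ->
  strip_x ta D z <= ln (e / 2) -> cmod (z - a) <= e.
Proof.
move=> e0 [z1 za zb].
have lm t : z <> circle_pt t -> log_mod (circle_pt t) z = ln (cmod (z - circle_pt t)).
  move=> zt; have c0 : 0 < cmod (z - circle_pt t).
    by rewrite lt_neqAle cmod_ge0 andbT eq_sym cmod_eq0 subr_eq0; exact/eqP.
  by rewrite /log_mod polar_sqr lnXn// -[_ *+ 2]mulr_natl mulrAC divff ?mul1r// pnatr_eq0.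
have ca : 0 < cmod (z - a).
  by rewrite lt_neqAle cmod_ge0 andbT eq_sym cmod_eq0 subr_eq0; exact/eqP.
have cb : 0 < cmod (z - b).
  by rewrite lt_neqAle cmod_ge0 andbT eq_sym cmod_eq0 subr_eq0; exact/eqP.
have cb2 : cmod (z - b) <= 2.
  by have := cmodD z (- b); rewrite cmodN cmod_circle_pt; lra.
rewrite /strip_x !lm// lerBlDr => h.
rewrite -ler_ln ?posrE// (le_trans h)//.
rewrite -lnM ?posrE ?divr_gt0// ler_ln ?posrE ?mulr_gt0 ?divr_gt0//.
by rewrite mulrAC ler_pdivrMr// ler_pM2l.
Qed.

End strip_gradient.

(** * Change of variables between the disk and the strip *)

Section strip_change_of_variables.
Context {R : realType}.
Local Notation lam := (area R).
Local Notation pt := (R * R)%type.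
Variables (ta D : R).
Hypothesis D0 : 0 < D < 2 * pi.
Implicit Types (z w : pt).

Definition open_strip : set pt := [set w | 0 < w.2 < pi].

Lemma open_open_strip : open open_strip.
Proof.
apply/open_discP => w /andP[w0 wpi]; exists (Num.min w.2 (pi - w.2)).
  by rewrite lt_min w0 subr_gt0.
move=> w'; rewrite /disc /= lt_min => /andP[h1 h2]; rewrite /open_strip /=.
have := snd_le_cmod (w' - w); rewrite ler_norml => /andP[/= h3 h4].
by apply/andP; split; lra.
Qed.

Lemma open_unit_disk : open (unit_disk R).
Proof.
have -> : unit_disk R = disc 0 1 by apply/seteqP; split => z; rewrite /disc /unit_disk /= subr0.
exact: open_disc.
Qed.

Lemma strip_map_disk z : unit_disk R z ->
  open_strip (strip_map ta D z) /\ strip_inv ta D (strip_map ta D z) = z.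
Proof.
move=> z1; split; first exact: strip_y_interior.
by apply: strip_invK => //; exact: disk_strip_dom.
Qed.

Lemma strip_inv_strip w : open_strip w ->
  unit_disk R (strip_inv ta D w) /\ strip_map ta D (strip_inv ta D w) = w.
Proof.
move=> /andP[w0 wpi]; have wr : 0 <= w.2 <= pi by rewrite !ltW.
split; last exact: strip_mapK.
have [c c0 cE] := strip_inv_mod ta D0 wr.
rewrite /unit_disk /= -(@expr_lt1 _ 2)// ?cmod_ge0// -subr_gt0 cE mulr_gt0//.
by apply: sin_gt0_pi; rewrite w0.
Qed.

Lemma disk_neq_pole t z : unit_disk R z -> z <> circle_pt t.
Proof. by move=> + zE; rewrite zE /unit_disk /= cmod_circle_pt ltxx. Qed.

Lemma continuous_strip_AB z : unit_disk R z ->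
  {for z, continuous (strip_A ta D)} /\ {for z, continuous (strip_B ta D)}.
Proof.
move=> z1; have [P [Q [hA hB]]] := has_differential_strip_AB (@disk_neq_pole ta z z1)
  (@disk_neq_pole (ta + D) z z1).
by split; [exact: has_differential_continuous hA|exact: has_differential_continuous hB].
Qed.

Lemma continuous_strip_om z : unit_disk R z -> {for z, continuous (strip_om ta D)}.
Proof.
move=> /continuous_strip_AB[cA cB]; apply: cvgD; rewrite /GRing.exp /=; exact: cvgM.
Qed.

Lemma strip_om_disk_gt0 z : unit_disk R z -> 0 < strip_om ta D z.
Proof. by move=> z1; apply: strip_om_gt0 => //; exact: disk_neq_pole. Qed.

(** The one-sided area inequality, applied to [strip_map] and to its inverse, gives the two
    inequalities. *)
Lemma strip_change_ge0 (h : pt -> R) : (forall w, 0 <= h w) ->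
  (forall w, open_strip w -> {for w, continuous h}) ->
  (\int[lam]_(z in unit_disk R) (h (strip_map ta D z) * strip_om ta D z)%:E =
   \int[lam]_(w in open_strip) (h w)%:E)%E.
Proof.
move=> h0 ch; apply/eqP; rewrite eq_le; apply/andP; split.
  have -> : (fun z => (h (strip_map ta D z) * strip_om ta D z)%:E) =
      (fun z => (h (strip_map ta D z) * Num.sqrt (strip_om ta D z) ^+ 2)%:E).
    by apply/funext => z; rewrite sqr_sqrtr// addr_ge0// sqr_ge0.
  apply: (@area_inequality R _ _ _ (strip_inv ta D) (fun z => Num.sqrt (strip_om ta D z)) h open_unit_disk open_open_strip) => //.
  - by move=> z z1; apply: continuous_strip_map; exact: disk_strip_dom.
  - by move=> w /andP[w0 w1]; apply: continuous_strip_inv => //; rewrite !ltW.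
  - exact: strip_map_disk.
  - exact: strip_inv_strip.
  - apply: continuous_measurable_plane; first exact: open_unit_disk.
    move=> z z1; apply: (@continuous_comp _ _ _ (strip_om ta D)); first exact: continuous_strip_om.
    exact: sqrt_continuous.
  - apply: (@filterE _ (almost_everywhere lam)) => z z1.
    have dz := @disk_strip_dom _ ta D z z1.
    apply: (differential_expand (has_differential_strip_x dz) (has_differential_strip_y dz)) => // x y.
    by rewrite sqr_sqrtr ?addr_ge0 ?sqr_ge0// /strip_om le_eqVlt; apply/orP; left; apply/eqP; ring.
have E : (\int[lam]_(w in open_strip) (h w)%:E = \int[lam]_(w in open_strip)
   ((fun z => h (strip_map ta D z) * strip_om ta D z) (strip_inv ta D w) *
     (Num.sqrt (strip_om ta D (strip_inv ta D w)))^-1 ^+ 2)%:E)%E.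
  apply: eq_integral => w; rewrite inE => sw; have [z1 zE] := strip_inv_strip sw.
  rewrite zE exprVn sqr_sqrtr ?addr_ge0 ?sqr_ge0// -mulrA divff ?mulr1//.
  by rewrite gt_eqF// strip_om_disk_gt0.
rewrite E.
apply: (@area_inequality R _ _ (strip_inv ta D) (strip_map ta D)
   (fun w => (Num.sqrt (strip_om ta D (strip_inv ta D w)))^-1) _ open_open_strip open_unit_disk) => //.
- by move=> w /andP[w0 w1]; apply: continuous_strip_inv => //; rewrite !ltW.
- by move=> z z1; apply: continuous_strip_map; exact: disk_strip_dom.
- exact: strip_inv_strip.
- exact: strip_map_disk.
- by move=> z; rewrite mulr_ge0// addr_ge0// sqr_ge0.
- apply: continuous_measurable_plane; first exact: open_open_strip.
  move=> w sw; have [z1 _] := strip_inv_strip sw.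
  apply: cvgV; first by rewrite gt_eqF// sqrtr_gt0 strip_om_disk_gt0.
  apply: (@continuous_comp _ _ _ (fun w => strip_om ta D (strip_inv ta D w))); last exact: sqrt_continuous.
  apply: continuous_comp; last exact: continuous_strip_om.
  by move: sw => /andP[w0 w1]; apply: continuous_strip_inv => //; rewrite !ltW.
- move=> z z1; apply: cvgM; last exact: continuous_strip_om.
  apply: continuous_comp; first by apply: continuous_strip_map; exact: disk_strip_dom.
  by apply: ch; have [] := strip_map_disk z1.
- apply: (@filterE _ (almost_everywhere lam)) => w sw e e0.
  have [z1 TG] := strip_inv_strip sw; set z := strip_inv ta D w in z1 TG *.
  set L := Num.sqrt (strip_om ta D z).
  have L0 : 0 < L by rewrite sqrtr_gt0 strip_om_disk_gt0.
  have dz := @disk_strip_dom _ ta D z z1.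
  (* The inverse expands distances by at least [1 / (L + e L^2)], and this tolerance makes that at
     least [1 / L - e]. *)
  have e10 : 0 < e * L ^+ 2 by rewrite mulr_gt0// exprn_gt0.
  have hb (x y : R) : (strip_A ta D z * x + strip_B ta D z * y) ^+ 2 +
     (- strip_B ta D z * x + strip_A ta D z * y) ^+ 2 <= L ^+ 2 * (x ^+ 2 + y ^+ 2).
    by rewrite sqr_sqrtr ?addr_ge0 ?sqr_ge0// /strip_om le_eqVlt; apply/orP; left; apply/eqP; ring.
  have [d d0 hd] := differential_bound (has_differential_strip_x dz)
     (has_differential_strip_y dz) (ltW L0) hb e10.
  have cG : {for w, continuous (strip_inv ta D)}.
    by move: sw => /andP[w0 w1]; apply: continuous_strip_inv => //; rewrite !ltW.
  have [d1 d10 hd1] := (cts_cmodP _ _).1 cG d d0.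
  have [d2 d20 hd2] := (open_discP _).1 open_open_strip w sw.
  exists (Num.min d1 d2); first by rewrite lt_min d10.
  move=> w'; rewrite lt_min => /andP[/hd1 wd1 /hd2 sw'].
  have [z1' TG'] := strip_inv_strip sw'.
  have := hd _ wd1; rewrite -/(strip_map ta D (strip_inv ta D w')) -/(strip_map ta D z) TG' TG.
  set c1 := cmod (w' - w); set c2 := cmod _ => hc.
  have c10 : 0 <= c1 by exact: cmod_ge0.
  apply: (@le_trans _ _ ((L + e * L ^+ 2)^-1 * c1)); last by rewrite ler_pdivrMl ?addr_gt0.
  apply: ler_wpM2r => //.
  have k0 : 0 < 1 + e * L by rewrite addr_gt0// mulr_gt0.
  have -> : L + e * L ^+ 2 = L * (1 + e * L) by ring.
  rewrite invfM ler_pdivlMr// mulrBl mulrDr mulr1 mulrDr.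
  have -> : L^-1 * (e * L) = e by field; rewrite gt_eqF.
  rewrite mulr1 opprD addrA addrK.
  by rewrite gerBl mulr_ge0 ?ltW// mulr_gt0.
Qed.

Lemma strip_change (h : pt -> R) : (forall w, open_strip w -> {for w, continuous h}) ->
  (\int[lam]_(z in unit_disk R) (h (strip_map ta D z) * strip_om ta D z)%:E =
   \int[lam]_(w in open_strip) (h w)%:E)%E.
Proof.
move=> ch; rewrite integralE [RHS]integralE; congr (_ - _)%E.
- transitivity (\int[lam]_(z in unit_disk R) (Num.max (h (strip_map ta D z)) 0 * strip_om ta D z)%:E)%E.
    apply: eq_integral => z; rewrite inE => z1; rewrite funeposE -EFin_max; congr (_%:E).
    by rewrite maxr_pMl ?mul0r// ltW// strip_om_disk_gt0.
  rewrite (@strip_change_ge0 (fun w => Num.max (h w) 0)).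
  + by apply: eq_integral => w _; rewrite funeposE -EFin_max.
  + by move=> w; rewrite le_max lexx orbT.
  + by move=> w sw; apply: continuous_max; [exact: ch|exact: cvg_cst].
- transitivity (\int[lam]_(z in unit_disk R) (Num.max (- h (strip_map ta D z)) 0 * strip_om ta D z)%:E)%E.
    apply: eq_integral => z; rewrite inE => z1; rewrite funenegE -EFinN -EFin_max; congr (_%:E).
    by rewrite maxr_pMl ?mul0r ?mulNr// ltW// strip_om_disk_gt0.
  rewrite (@strip_change_ge0 (fun w => Num.max (- h w) 0)).
  + by apply: eq_integral => w _; rewrite funenegE -EFinN -EFin_max.
  + by move=> w; rewrite le_max lexx orbT.
  + by move=> w sw; apply: continuous_max; [apply: cvgN; exact: ch|exact: cvg_cst].
Qed.

End strip_change_of_variables.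

(** * Integration by parts *)

Section parts_on_a_segment.
Context {R : realType}.
Local Notation mu := (@lebesgue_measure R).

Lemma abs_continuousRM (g f : R -> R) a b (M : R) : 0 <= M ->
  (forall x, a <= x <= b -> `|g x| <= M) -> (forall x, a <= x <= b -> `|f x| <= M) ->
  abs_continuousR g a b -> abs_continuousR f a b -> abs_continuousR (fun x => g x * f x) a b.
Proof.
move=> M0 gM fM hg hf e e0; have M1 : 0 < M + 1 by lra.
have e20 : 0 < e / (2 * (M + 1)) by rewrite divr_gt0// mulr_gt0.
have [d d0 hd] := hg _ e20; have [d' d'0 hd'] := hf _ e20.
exists (Num.min d d'); first by rewrite lt_min d0.
move=> l cl; rewrite lt_min => /andP[/(hd _ cl) lg /(hd' _ cl) lf].
have bnd : chain_var (fun x => g x * f x) l <= (M + 1) * (chain_var g l + chain_var f l).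
  rewrite /chain_var -big_split /= big_distrr /= big_seq [leRHS]big_seq.
  apply: ler_sum => p /(nthP (0, 0))[i il pE].
  have [h1 h2 h3] := interval_chain_bnd cl il; rewrite pE in h1 h2 h3.
  have p1 : a <= p.1 <= b by rewrite h1 (le_trans h2).
  have p2 : a <= p.2 <= b by rewrite h3 (le_trans h1).
  have -> : g p.2 * f p.2 - g p.1 * f p.1 = (g p.2 - g p.1) * f p.2 + g p.1 * (f p.2 - f p.1) by ring.
  apply: (le_trans (ler_normD _ _)); rewrite !normrM mulrDr.
  apply: lerD; first by rewrite mulrC ler_wpM2r// (le_trans (fM _ p2))// lerDl.
  by rewrite ler_wpM2r// (le_trans (gM _ p1))// lerDl.
apply: (le_lt_trans bnd); rewrite -ltr_pdivlMl//.
apply: (lt_le_trans (ltrD lg lf)).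
by rewrite le_eqVlt; apply/orP; left; apply/eqP; field; rewrite gt_eqF.
Qed.

Lemma abs_continuousR_lipschitz (f : R -> R) a b (L : R) : 0 <= L ->
  (forall x y, a <= x -> x <= y -> y <= b -> `|f y - f x| <= L * (y - x)) ->
  abs_continuousR f a b.
Proof.
move=> L0 hf e e0; have L1 : 0 < L + 1 by lra.
exists (e / (L + 1)); first by rewrite divr_gt0.
move=> l cl; rewrite ltr_pdivlMr// => le; apply: le_lt_trans le.
rewrite /chain_var /chain_len big_distrl /= big_seq [leRHS]big_seq.
apply: ler_sum => p /(nthP (0, 0))[i il pE].
have [h1 h2 h3] := interval_chain_bnd cl il; rewrite pE in h1 h2 h3.
rewrite (le_trans (hf _ _ h1 h2 h3))// mulrC ler_wpM2l ?subr_ge0// lerDl.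
exact: ler01.
Qed.

Lemma lipschitz_derive (f f' : R -> R) a b (L : R) :
  (forall x : R, a <= x <= b -> is_derive x (1 : R) f (f' x)) ->
  (forall x : R, a <= x <= b -> `|f' x| <= L) ->
  forall x y : R, a <= x -> x <= y -> y <= b -> `|f y - f x| <= L * (y - x).
Proof.
move=> df bf x y ax xy yb.
have [c /[!in_itv]/= /andP[xc cy] ->] : exists2 c, c \in `[x, y] & f y - f x = f' c * (y - x).
  apply: MVT_segment => // [z /[!in_itv]/= /andP[xz zy]|].
    by apply: df; apply/andP; split; lra.
  apply: derivable_within_continuous => z /[!in_itv]/= /andP[xz zy].
  by have [] : is_derive z (1 : R) f (f' z) by apply: df; apply/andP; split; lra.
rewrite normrM [`|y - x|]ger0_norm ?subr_ge0// ler_wpM2r ?subr_ge0//.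
by apply: bf; apply/andP; split; lra.
Qed.

Lemma segment_parts (u g Z Z1 : R -> R) (s M : R) : 0 <= s -> 0 <= M ->
  abs_continuousR u (- s) s ->
  (forall x : R, - s <= x <= s -> [/\ `|u x| <= M, `|Z x| <= M, `|Z1 x| <= M & is_derive x (1 : R) Z (Z1 x)]) ->
  mu.-integrable `[- s, s] (EFin \o (fun x => g x * Z x + u x * Z1 x)) ->
  {ae mu, forall x : R, - s < x < s -> is_derive x (1 : R) u (g x)} ->
  Z s = 0 -> Z (- s) = 0 ->
  (\int[mu]_(x in `[(- s)%R, s%R]) (g x * Z x + u x * Z1 x)%:E = 0)%E.
Proof.
move=> s0 M0 uac hM fi du Zs ZNs.
have Ns : - s <= s by lra.
have Zac : abs_continuousR Z (- s) s.
  apply: (abs_continuousR_lipschitz M0); apply: (lipschitz_derive (f' := Z1)) => x /hM[] //.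
have ac := abs_continuousRM M0 (fun x hx => let: And4 h _ _ _ := hM x hx in h)
  (fun x hx => let: And4 _ h _ _ := hM x hx in h) uac Zac.
have := abs_continuous_FTC Ns ac fi.
rewrite /Rintegral Zs ZNs !mulr0 subr0 => h.
rewrite -[LHS]fineK ?h//; last exact: (integrable_fin_num _ fi).
apply: ae_imply du => x dx xs.
have [_ _ _ dZ] : [/\ `|u x| <= M, `|Z x| <= M, `|Z1 x| <= M & is_derive x (1 : R) Z (Z1 x)].
  by apply: hM; move/andP: xs => [? ?]; rewrite !ltW.
have := is_deriveM (dx xs) dZ.
by rewrite /GRing.scale /= addrC [Z x * _]mulrC.
Qed.

End parts_on_a_segment.

Section null_sections.
Context {R : realType}.
Local Notation mu := (@lebesgue_measure R).
Local Notation lam := (area R).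
Local Notation pt := (R * R)%type.

Lemma ae_ysection (P : pt -> Prop) : {ae lam, forall z, P z} ->
  {ae mu, forall y, {ae mu, forall x, P (x, y)}}.
Proof.
move=> [N [mN N0 PN]].
have mf : measurable_fun setT (fun z : pt => (\1_N z)%:E : \bar R).
  by apply/measurable_EFinP; exact: measurable_indic.
have f0 (z : pt) : (0 <= (\1_N z)%:E :> \bar R)%E by rewrite lee_fin.
have mG := @measurable_fun_fubini_tonelli_G _ _ _ _ R mu _ mf f0.
have G0 : (\int[mu]_y `|fubini_G mu (fun z : pt => (\1_N z)%:E : \bar R) y| = 0)%E.
  under eq_integral do rewrite gee0_abs ?integral_ge0//.
  have I0 : (\int[lam]_z (\1_N z)%:E = 0)%E.
    by rewrite (@integral_indic _ _ _ lam setT measurableT _ mN) setIT.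
  exact: (etrans (esym (@fubini_tonelli2 _ _ _ _ R mu mu _ mf f0)) I0).
have /(ae_eq_integral_abs mu measurableT mG).1 := G0.
apply: ae_imply => y /(_ I) /=; rewrite /fubini_G => Gy.
have mNy : measurable [set x | N (x, y)].
  have := measurable_ysection y mN; rewrite (_ : ysection N y = [set x | N (x, y)])//.
  by apply/seteqP; split => x /=; rewrite /ysection /= inE.
exists [set x | N (x, y)]; split => //; last by move=> x /= nP; apply: PN.
rewrite -[LHS](_ : (\int[mu]_x (\1_N (x, y))%:E = _)%E) //.
rewrite (_ : (fun x => (\1_N (x, y))%:E) = (fun x => (\1_[set x | N (x, y)] x)%:E)).
  by rewrite integral_indic// setIT.
by apply/funext => x; rewrite !indicE.
Qed.

Lemma ae_xsection (P : pt -> Prop) : {ae lam, forall z, P z} ->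
  {ae mu, forall x, {ae mu, forall y, P (x, y)}}.
Proof.
move=> [N [mN N0 PN]].
have mf : measurable_fun setT (fun z : pt => (\1_N z)%:E : \bar R).
  by apply/measurable_EFinP; exact: measurable_indic.
have f0 (z : pt) : (0 <= (\1_N z)%:E :> \bar R)%E by rewrite lee_fin.
have mG := @measurable_fun_fubini_tonelli_F _ _ _ _ R mu _ mf f0.
have G0 : (\int[mu]_y `|fubini_F mu (fun z : pt => (\1_N z)%:E : \bar R) y| = 0)%E.
  under eq_integral do rewrite gee0_abs ?integral_ge0//.
  have I0 : (\int[lam]_z (\1_N z)%:E = 0)%E.
    by rewrite (@integral_indic _ _ _ lam setT measurableT _ mN) setIT.
  exact: (etrans (esym (@fubini_tonelli1 _ _ _ _ R mu mu _ mf f0)) I0).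
have /(ae_eq_integral_abs mu measurableT mG).1 := G0.
apply: ae_imply => y /(_ I) /=; rewrite /fubini_F => Gy.
have mNy : measurable [set x | N (y, x)].
  have := measurable_xsection y mN; rewrite (_ : xsection N y = [set x | N (y, x)])//.
  by apply/seteqP; split => x /=; rewrite /xsection /= inE.
exists [set x | N (y, x)]; split => //; last by move=> x /= nP; apply: PN.
rewrite -[LHS](_ : (\int[mu]_x (\1_N (y, x))%:E = _)%E) //.
rewrite (_ : (fun x => (\1_N (y, x))%:E) = (fun x => (\1_[set x | N (y, x)] x)%:E)).
  by rewrite integral_indic// setIT.
by apply/funext => x; rewrite !indicE.
Qed.

End null_sections.

Section parts_on_the_disk.
Context {R : realType}.
Local Notation mu := (@lebesgue_measure R).
Local Notation lam := (area R).
Local Notation pt := (R * R)%type.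
Implicit Types (z w : pt).

Lemma bounded_closed_disc (f : pt -> R) (r : R) : r < 1 ->
  (forall z, unit_disk R z -> {for z, continuous f}) ->
  exists2 M : R, 0 <= M & forall z, cmod z <= r -> `|f z| <= M.
Proof.
move=> r1 cf; set K := [set z : pt | cmod (z - 0) <= r].
have cK : compact (f @` K).
  apply: continuous_compact; last exact: compact_closed_disc.
  apply: continuous_in_subspaceT => z; rewrite inE /K /= subr0 => zr; apply: cf.
  exact: le_lt_trans r1.
have [M [_ hM]] := compact_bounded cK.
exists (`|M| + 1) => [|z zr]; first by rewrite addr_ge0.
apply: hM; first by rewrite (le_lt_trans (ler_norm M))// ltrDl.
by exists z => //; rewrite /K /= subr0.
Qed.

Variables (u g Z Z1 : pt -> R) (r : R).
Hypotheses (r0 : 0 < r) (r1 : r < 1).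
Hypothesis cu : forall z, unit_disk R z -> {for z, continuous u}.
Hypotheses (mg : measurable_fun (unit_disk R) g)
  (ig : lam.-integrable (unit_disk R) (EFin \o g)).
Hypothesis Z0 : forall z, unit_disk R z -> r <= cmod z -> Z z = 0 /\ Z1 z = 0.
Hypotheses (cZ : forall z, unit_disk R z -> {for z, continuous Z})
  (cZ1 : forall z, unit_disk R z -> {for z, continuous Z1}).

Let h z := g z * Z z + u z * Z1 z.

Let mD : measurable (unit_disk R : set (measurableTypeR R * measurableTypeR R)). Proof. exact: open_measurable_plane open_unit_disk. Qed.

Let lamD : (lam (unit_disk R) < +oo)%E.
Proof.
have -> : unit_disk R = disc 0 1 by apply/seteqP; split => z; rewrite /disc /unit_disk /= subr0.
exact: area_disc1_lty.
Qed.

Let bounded_disk (f : pt -> R) : (forall z, unit_disk R z -> {for z, continuous f}) ->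
  (forall z, unit_disk R z -> r <= cmod z -> f z = 0) ->
  exists2 M : R, 0 <= M & forall z, unit_disk R z -> `|f z| <= M.
Proof.
move=> cf f0; have [M M0 hM] := bounded_closed_disc r1 cf; exists M => // z z1.
by have [/(f0 _ z1) ->|/ltW/hM] := leP r (cmod z); rewrite ?normr0.
Qed.

Lemma integrable_parts : lam.-integrable (unit_disk R) (EFin \o (fun z => g z * Z z)) /\
  lam.-integrable (unit_disk R) (EFin \o (fun z => u z * Z1 z)).
Proof.
have [M M0 hM] := bounded_disk cZ (fun z dz zr => (Z0 dz zr).1).
have cuZ z : unit_disk R z -> {for z, continuous (fun z => u z * Z1 z)}.
  by move=> z1; apply: cvgM; [exact: cu|exact: cZ1].
have [M' M'0 hM'] : exists2 M : R, 0 <= M & forall z, unit_disk R z -> `|u z * Z1 z| <= M.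
  by apply: bounded_disk => // z z1 /(Z0 z1)[_ ->]; rewrite mulr0.
have mZ : measurable_fun (unit_disk R) Z.
  by apply: continuous_measurable_plane => //; exact: open_unit_disk.
have muZ : measurable_fun (unit_disk R) (fun z => u z * Z1 z).
  by apply: continuous_measurable_plane => //; exact: open_unit_disk.
split.
  have i2 := @integrableZl _ _ _ lam _ mD M _ ig.
  apply: (@le_integrable _ _ _ lam _ mD _ _ _ _ i2).
    by apply/measurable_EFinP; exact: measurable_funM.
  by move=> z z1 /=; rewrite lee_fin !normrM mulrC ler_wpM2r// [leRHS]ger0_norm// hM.
apply: (@le_integrable _ _ _ lam _ mD _ (EFin \o cst M')).
- by apply/measurable_EFinP.
- by move=> z z1 /=; rewrite lee_fin [leRHS]ger0_norm// hM'.
- apply/integrableP; split; first by apply/measurable_EFinP; exact: measurable_cst.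
  rewrite (_ : (fun x => _) = cst `|M'|%:E)//.
  by rewrite (@integral_cst _ _ _ lam _ mD) lte_mul_pinfty// lee_fin.
Qed.

Let ih : lam.-integrable setT (EFin \o (h \_ (unit_disk R))).
Proof.
have [i1 i2] := integrable_parts.
have := @integrableD _ _ _ lam _ mD _ _ i1 i2.
move=> /(@integrable_mkcond _ _ _ lam _ _ mD).1.
by apply: eq_integrable => // z _; rewrite /h /= !patchE; case: ifP.
Qed.

Let intE : (\int[lam]_(z in unit_disk R) (g z * Z z + u z * Z1 z)%:E =
  \int[lam]_z (EFin \o (h \_ (unit_disk R))) z)%E.
Proof.
rewrite integral_mkcond; apply: eq_integral => z _.
by rewrite /h /= !patchE; case: ifP.
Qed.

Let bounds : exists2 M : R, 0 <= M & forall z, cmod z <= (1 + r) / 2 ->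
  [/\ `|u z| <= M, `|Z z| <= M & `|Z1 z| <= M].
Proof.
have rho1 : (1 + r) / 2 < 1 by have r1' := r1; lra.
have [M1 M10 h1] := bounded_closed_disc rho1 cu.
have [M2 M20 h2] := bounded_closed_disc rho1 cZ.
have [M3 M30 h3] := bounded_closed_disc rho1 cZ1.
exists (M1 + M2 + M3) => [|z zr]; first by rewrite !addr_ge0.
by have := h1 z zr; have := h2 z zr; have := h3 z zr; move=> *; split; lra.
Qed.

(* for a.e. height [y] one rational half-width [s] suits, between the support and the circle *)
Let pick_width (y : R) : `|y| < r -> exists q : rat, let s : R := ratr q in
  [/\ 0 < s, r ^+ 2 <= s ^+ 2 + y ^+ 2 & s ^+ 2 + y ^+ 2 < ((1 + r) / 2) ^+ 2].
Proof.
move=> yr; have y2 : y ^+ 2 < r ^+ 2.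
  by move: yr; rewrite ltr_norml => /andP[? ?]; have r0' := r0; nra.
have rr : r ^+ 2 < ((1 + r) / 2) ^+ 2 by rewrite (@ltr_pXn2r _ 2)// ?nnegrE; have r0' := r0; have r1' := r1; lra.
have : Num.sqrt (r ^+ 2 - y ^+ 2) < Num.sqrt (((1 + r) / 2) ^+ 2 - y ^+ 2).
  by rewrite ltr_sqrt ?subr_gt0 ?(lt_trans y2)// ltrD2r.
move=> /rat_in_itvoo[q]; rewrite in_itv/= => /andP[q1 q2]; exists q; set s : R := ratr q in q1 q2 *.
have s0 : 0 < s by apply: le_lt_trans q1; exact: sqrtr_ge0.
split => //.
  have : Num.sqrt (r ^+ 2 - y ^+ 2) ^+ 2 <= s ^+ 2 by rewrite (@ler_pXn2r _ 2)// ?nnegrE ?sqrtr_ge0// ltW.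
  by rewrite sqr_sqrtr; lra.
have : s ^+ 2 < Num.sqrt (((1 + r) / 2) ^+ 2 - y ^+ 2) ^+ 2 by rewrite (@ltr_pXn2r _ 2)// ?nnegrE ?sqrtr_ge0// ltW.
by rewrite sqr_sqrtr; lra.
Qed.

Let rho0 : 0 < (1 + r) / 2. Proof. by have r0' := r0; lra. Qed.

Let hlarge z : r <= cmod z -> (h \_ (unit_disk R)) z = 0.
Proof.
by move=> zr; rewrite patchE; case: ifP => // /set_mem z1; rewrite /h; have [-> ->] := Z0 z1 zr; rewrite !mulr0 addr0.
Qed.

(** Absolute continuity holds on almost every line of a given rectangle only. With rational
    half-widths countably many rectangles are enough, so on almost every horizontal line some
    segment reaches beyond the support of [Z] inside the disk, and the one-dimensional formula
    applies to it. *)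
Lemma disk_parts1 :
  (forall s t : R, 0 < s -> 0 < t -> s ^+ 2 + t ^+ 2 < 1 ->
     {ae mu, forall y, `|y| <= t -> abs_continuousR (fun x => u (x, y)) (- s) s}) ->
  {ae lam, forall z, unit_disk R z -> is_derive z.1 (1 : R) (fun t => u (t, z.2)) (g z)} ->
  (forall z, unit_disk R z -> is_derive z.1 (1 : R) (fun t => Z (t, z.2)) (Z1 z)) ->
  (\int[lam]_(z in unit_disk R) (g z * Z z + u z * Z1 z)%:E = 0)%E.
Proof.
move=> acu du dZ; rewrite intE -(integral21_prod_meas1 ih).
have mG := measurable_fubini_G ih.
rewrite (@ae_eq_integral _ _ _ mu setT (cst 0%E) _ measurableT mG) ?integral0//.
have acq : {ae mu, forall y, forall q : rat, let s : R := ratr q in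
   0 < s -> s ^+ 2 < ((1 + r) / 2) ^+ 2 -> `|y| <= Num.sqrt (((1 + r) / 2) ^+ 2 - s ^+ 2) ->
   abs_continuousR (fun x => u (x, y)) (- s) s}.
  apply: ae_forall_countable => q; set s : R := ratr q.
  have [s0|s0] := ltP 0 s; last first.
    by apply: (@filterE _ (almost_everywhere mu)) => y /=; rewrite ltNge s0.
  have [s1|s1] := ltP (s ^+ 2) (((1 + r) / 2) ^+ 2); last first.
    by apply: (@filterE _ (almost_everywhere mu)) => y /= _; rewrite ltNge s1.
  have := acu s (Num.sqrt (((1 + r) / 2) ^+ 2 - s ^+ 2)) s0.
  rewrite sqrtr_gt0 subr_gt0 s1 => /(_ isT); rewrite sqr_sqrtr ?subr_ge0 1?ltW//.
  have l1 : ((1 + r) / 2) ^+ 2 < 1 by rewrite expr_lt1//; have r0' := r0; have r1' := r1; lra.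
  rewrite addrC subrK => /(_ l1); apply: ae_imply => y hy s' _ _; exact: hy.
apply: ae_imply2 (ae_imply2 _ acq (ae_ysection du)) (ae_integrable2 ih); last first.
  by move=> y h1 h2; exact: (conj h1 h2).
move=> y [hq dy] iy _; rewrite /fubini_G /=.
have [yr|yr] := leP r `|y|.
  by apply: integral0_eq => x _; rewrite hlarge// (le_trans yr)// (snd_le_cmod (x, y)).
have [q [s0 rs sr]] := pick_width yr; move: (hq q) => /=; set s : R := ratr q in s0 rs sr *.
move=> /(_ s0) hac.
have ac : abs_continuousR (fun x => u (x, y)) (- s) s.
  apply: hac; first by apply: le_lt_trans sr; rewrite lerDl sqr_ge0.
  by rewrite -sqrtr_sqr ler_wsqrtr// lerBrDl ltW.
have [M M0 hM] := bounds.
have inD (x : R) : - s <= x <= s -> cmod (x, y) <= (1 + r) / 2.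
  move=> xs; rewrite -(@ler_pXn2r _ 2)// ?nnegrE ?cmod_ge0//; last exact: ltW.
  rewrite cmod_sqr /= (le_trans _ (ltW sr))// lerD2r -(@real_normK _ x) ?num_real//.
  by rewrite (@ler_pXn2r _ 2)// ?nnegrE ?(ltW s0)// ler_norml.
have D1 (x : R) : cmod (x, y) <= (1 + r) / 2 -> unit_disk R (x, y).
  by move=> h1; rewrite /unit_disk /=; apply: (le_lt_trans h1); have r1' := r1; lra.
have out (x : R) : s <= `|x| -> r <= cmod (x, y).
  move=> xs; rewrite -(@ler_pXn2r _ 2)// ?nnegrE ?cmod_ge0//; last exact: ltW.
  rewrite cmod_sqr /= (le_trans rs)// lerD2r -(@real_normK _ x) ?num_real//.
  by rewrite (@ler_pXn2r _ 2)// ?nnegrE (ltW s0).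
transitivity (\int[mu]_(x in `[(- s)%R, s]) (g (x, y) * Z (x, y) + u (x, y) * Z1 (x, y))%:E)%E.
  rewrite [RHS]integral_mkcond; apply: eq_integral => x _ /=.
  rewrite [RHS]patchE mem_setE in_itv/= -ler_norml; case: ifPn => xs.
    by rewrite patchE mem_set//; apply: D1; apply: inD; rewrite -ler_norml.
  by rewrite hlarge// out// ltW// ltNge.
apply: (segment_parts (M := M)) => //; rewrite ?ltW//.
- move=> x /inD xr; have [? ? ?] := hM _ xr; split => //.
  exact: (dZ (x, y) (D1 _ xr)).
- have : mu.-integrable `[(- s), s] (fun x => (EFin \o (h \_ (unit_disk R))) (x, y)).
    exact: (@integrableS _ _ _ mu setT).
  apply: eq_integrable => // x; rewrite inE /= in_itv/= => xs.
  by rewrite patchE mem_set//; apply: D1; exact: inD.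
- apply: ae_imply dy => x dx /andP[xs1 xs2]; apply: (dx _).
  by apply: D1; apply: inD; rewrite !ltW.
- by apply: (Z0 (D1 _ (inD _ _)) (out _ _)).1; rewrite ?gtr0_norm// lexx andbT; lra.
- by apply: (Z0 (D1 _ (inD _ _)) (out _ _)).1; rewrite ?normrN ?gtr0_norm// lexx; lra.
Qed.

Lemma disk_parts2 :
  (forall s t : R, 0 < s -> 0 < t -> s ^+ 2 + t ^+ 2 < 1 ->
     {ae mu, forall y, `|y| <= t -> abs_continuousR (fun x => u (y, x)) (- s) s}) ->
  {ae lam, forall z, unit_disk R z -> is_derive z.2 (1 : R) (fun t => u (z.1, t)) (g z)} ->
  (forall z, unit_disk R z -> is_derive z.2 (1 : R) (fun t => Z (z.1, t)) (Z1 z)) ->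
  (\int[lam]_(z in unit_disk R) (g z * Z z + u z * Z1 z)%:E = 0)%E.
Proof.
move=> acu du dZ; rewrite intE -(integral12_prod_meas1 ih).
have mG := measurable_fubini_F ih.
rewrite (@ae_eq_integral _ _ _ mu setT (cst 0%E) _ measurableT mG) ?integral0//.
have acq : {ae mu, forall y, forall q : rat, let s : R := ratr q in
   0 < s -> s ^+ 2 < ((1 + r) / 2) ^+ 2 -> `|y| <= Num.sqrt (((1 + r) / 2) ^+ 2 - s ^+ 2) ->
   abs_continuousR (fun x => u (y, x)) (- s) s}.
  apply: ae_forall_countable => q; set s : R := ratr q.
  have [s0|s0] := ltP 0 s; last first.
    by apply: (@filterE _ (almost_everywhere mu)) => y /=; rewrite ltNge s0.
  have [s1|s1] := ltP (s ^+ 2) (((1 + r) / 2) ^+ 2); last first.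
    by apply: (@filterE _ (almost_everywhere mu)) => y /= _; rewrite ltNge s1.
  have := acu s (Num.sqrt (((1 + r) / 2) ^+ 2 - s ^+ 2)) s0.
  rewrite sqrtr_gt0 subr_gt0 s1 => /(_ isT); rewrite sqr_sqrtr ?subr_ge0 1?ltW//.
  have l1 : ((1 + r) / 2) ^+ 2 < 1 by rewrite expr_lt1//; have r0' := r0; have r1' := r1; lra.
  rewrite addrC subrK => /(_ l1); apply: ae_imply => y hy s' _ _; exact: hy.
apply: ae_imply2 (ae_imply2 _ acq (ae_xsection du)) (ae_integrable1 ih); last first.
  by move=> y h1 h2; exact: (conj h1 h2).
move=> y [hq dy] iy _; rewrite /fubini_F /=.
have [yr|yr] := leP r `|y|.
  by apply: integral0_eq => x _; rewrite hlarge// (le_trans yr)// (fst_le_cmod (y, x)).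
have [q [s0 rs sr]] := pick_width yr; move: (hq q) => /=; set s : R := ratr q in s0 rs sr *.
move=> /(_ s0) hac.
have ac : abs_continuousR (fun x => u (y, x)) (- s) s.
  apply: hac; first by apply: le_lt_trans sr; rewrite lerDl sqr_ge0.
  by rewrite -sqrtr_sqr ler_wsqrtr// lerBrDl ltW.
have [M M0 hM] := bounds.
have inD (x : R) : - s <= x <= s -> cmod (y, x) <= (1 + r) / 2.
  move=> xs; rewrite -(@ler_pXn2r _ 2)// ?nnegrE ?cmod_ge0//; last exact: ltW.
  rewrite cmod_sqr /= [leLHS]addrC (le_trans _ (ltW sr))// lerD2r -(@real_normK _ x) ?num_real//.
  by rewrite (@ler_pXn2r _ 2)// ?nnegrE ?(ltW s0)// ler_norml.
have D1 (x : R) : cmod (y, x) <= (1 + r) / 2 -> unit_disk R (y, x).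
  by move=> h1; rewrite /unit_disk /=; apply: (le_lt_trans h1); have r1' := r1; lra.
have out (x : R) : s <= `|x| -> r <= cmod (y, x).
  move=> xs; rewrite -(@ler_pXn2r _ 2)// ?nnegrE ?cmod_ge0//; last exact: ltW.
  rewrite cmod_sqr /= [leRHS]addrC (le_trans rs)// lerD2r -(@real_normK _ x) ?num_real//.
  by rewrite (@ler_pXn2r _ 2)// ?nnegrE (ltW s0).
transitivity (\int[mu]_(x in `[(- s)%R, s]) (g (y, x) * Z (y, x) + u (y, x) * Z1 (y, x))%:E)%E.
  rewrite [RHS]integral_mkcond; apply: eq_integral => x _ /=.
  rewrite [RHS]patchE mem_setE in_itv/= -ler_norml; case: ifPn => xs.
    by rewrite patchE mem_set//; apply: D1; apply: inD; rewrite -ler_norml.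
  by rewrite hlarge// out// ltW// ltNge.
apply: (segment_parts (M := M)) => //; rewrite ?ltW//.
- move=> x /inD xr; have [? ? ?] := hM _ xr; split => //.
  exact: (dZ (y, x) (D1 _ xr)).
- have : mu.-integrable `[(- s), s] (fun x => (EFin \o (h \_ (unit_disk R))) (y, x)).
    exact: (@integrableS _ _ _ mu setT).
  apply: eq_integrable => // x; rewrite inE /= in_itv/= => xs.
  by rewrite patchE mem_set//; apply: D1; exact: inD.
- apply: ae_imply dy => x dx /andP[xs1 xs2]; apply: (dx _).
  by apply: D1; apply: inD; rewrite !ltW.
- by apply: (Z0 (D1 _ (inD _ _)) (out _ _)).1; rewrite ?gtr0_norm// lexx andbT; lra.
- by apply: (Z0 (D1 _ (inD _ _)) (out _ _)).1; rewrite ?normrN ?gtr0_norm// lexx; lra.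
Qed.

End parts_on_the_disk.

Section second_gradient.
Context {R : realType}.
Local Notation pt := (R * R)%type.
Implicit Types (z w : pt).

Lemma has_differential_comp22 (f u v : pt -> R) (p q a b c d : R) z :
  has_differential f p q (u z, v z) -> has_differential u a b z -> has_differential v c d z ->
  has_differential (fun w => f (u w, v w)) (p * a + q * c) (p * b + q * d) z.
Proof.
move=> hf hu hv; have cu := has_differential_continuous hu.
have cv := has_differential_continuous hv.
move: hf hu hv => /has_differentialP[P [Q [cP cQ <- <- E]]].
move=> /has_differentialP[U1 [U2 [cU1 cU2 <- <- EU]]] /has_differentialP[V1 [V2 [cV1 cV2 <- <- EV]]].
have cc (W : pt -> R) : {for (u z, v z), continuous W} -> {for z, continuous (fun w => W (u w, v w))}.
  move=> cW; apply: (@continuous_comp _ _ _ (fun w => (u w, v w)) W) => //.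
  exact: (cvg_pair cu cv).
apply/has_differentialP; exists (fun w => P (u w, v w) * U1 w + Q (u w, v w) * V1 w),
  (fun w => P (u w, v w) * U2 w + Q (u w, v w) * V2 w); split => //.
- by apply: cvgD; apply: cvgM => //; exact: cc.
- by apply: cvgD; apply: cvgM => //; exact: cc.
- by move=> w; rewrite E /= EU EV; ring.
Qed.

Variables (ta D : R).
Let a : pt := circle_pt ta.
Let b : pt := circle_pt (ta + D).

(** [strip_A1 - i strip_A2] is the second complex derivative of [strip_map]. *)
Definition strip_A1 z : R := (grad_log2 a z ^+ 2 - grad_log1 a z ^+ 2) -
  (grad_log2 b z ^+ 2 - grad_log1 b z ^+ 2).
Definition strip_A2 z : R := 2 * grad_log1 b z * grad_log2 b z - 2 * grad_log1 a z * grad_log2 a z.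

Lemma has_differential_strip_AB12 z : unit_disk R z ->
  [/\ has_differential (strip_A ta D) (strip_A1 z) (strip_A2 z) z,
      has_differential (strip_B ta D) (strip_A2 z) (- strip_A1 z) z,
      {for z, continuous strip_A1} & {for z, continuous strip_A2}].
Proof.
move=> z1; have [a1 a2] := has_differential_grad_log (@disk_neq_pole _ ta z z1).
have [b1 b2] := has_differential_grad_log (@disk_neq_pole _ (ta + D) z z1).
have [ca1 ca2] := (has_differential_continuous a1, has_differential_continuous a2).
have [cb1 cb2] := (has_differential_continuous b1, has_differential_continuous b2).
have cX (f : pt -> R) : {for z, continuous f} -> {for z, continuous (fun w => f w ^+ 2)}.
  by move=> cf; rewrite /GRing.exp /=; exact: cvgM.
split.
- by apply: has_differential_ext (has_differentialB a1 b1) => //; rewrite /strip_A2; ring.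
- by apply: has_differential_ext (has_differentialB a2 b2) => //; rewrite ?/strip_A2 ?/strip_A1; ring.
- by apply: cvgB; apply: cvgB; exact: cX.
- by apply: cvgB; apply: cvgM => //; apply: cvgM => //; exact: cvg_cst.
Qed.

End second_gradient.

(** * Integration by parts in strip coordinates *)

Section weak_identity.
Context {R : realType}.
Local Notation mu := (@lebesgue_measure R).
Local Notation lam := (area R).
Local Notation pt := (R * R)%type.
Variables (ta D : R).
Hypothesis D0 : 0 < D < 2 * pi.
Implicit Types (z w : pt).
Local Notation T := (strip_map ta D).
Local Notation G := (strip_inv ta D).

Definition in_box (L d : R) : set pt := [set w | `|w.1| <= L /\ d <= w.2 <= pi - d].

Lemma compact_in_box L d : compact (in_box L d).
Proof.
have -> : in_box L d = `[- L, L]%classic `*` `[d, pi - d]%classic.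
  by apply/seteqP; split => w /=; rewrite /in_box /= !in_itv/= ler_norml.
by apply: compact_setX; exact: segment_compact.
Qed.

(** The inverse image of a compact rectangle of the strip is compact in the open disk, so a field
    supported in the rectangle pulls back to one that vanishes near the circle. *)
Lemma strip_inv_box (L d : R) : 0 < d -> exists r : R, [/\ 0 < r, r < 1 &
  forall z, unit_disk R z -> in_box L d (T z) -> cmod z < r].
Proof.
move=> d0.
have sub w : in_box L d w -> unit_disk R (G w).
  move=> [_ /andP[w1 w2]]; apply: (strip_inv_strip ta D0 _).1.
  by apply/andP; split; lra.
have cK : compact ((@cmod R) @` (G @` in_box L d)).
  apply: continuous_compact; last first.
    apply: continuous_compact; last exact: compact_in_box.
    apply: continuous_in_subspaceT => w; rewrite inE => -[_ /andP[w1 w2]].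
    by apply: continuous_strip_inv => //; apply/andP; split; lra.
  apply: continuous_subspaceT => z; apply/cts_normP => e e0; exists e => // w wz.
  rewrite (le_lt_trans _ wz)// ler_norml cmodBB andbT lerNl opprB cmodC.
  exact: cmodBB.
have [K0|/set0P K0] := eqVneq ((@cmod R) @` (G @` in_box L d)) set0.
  exists (1 / 2); split; [lra|lra|] => z z1 bz.
  suff : (set0 : set R) (cmod z) by [].
  rewrite -K0; exists z => //; exists (T z) => //.
  by have [] := strip_map_disk ta D0 z1.
have cid : {within (@cmod R) @` (G @` in_box L d), continuous (id : R -> R)}.
  by apply: continuous_subspaceT => x; exact: cvg_id.
have [c] := compact_EVT_max K0 cK cid; rewrite inE => -[_ [w bw <-] <-] cmax.
have c1 : cmod (G w) < 1 by exact: sub.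
have c0 := cmod_ge0 (G w).
exists ((1 + cmod (G w)) / 2); split; [lra|lra|] => z z1 bz.
have : cmod z <= cmod (G w).
  apply: cmax; rewrite inE; exists z => //; exists (T z) => //.
  by have [] := strip_map_disk ta D0 z1.
lra.
Qed.

Variables (u g1 g2 : pt -> R).
Hypothesis cu : forall z, unit_disk R z -> {for z, continuous u}.
Hypotheses (mg1 : measurable_fun (unit_disk R) g1) (mg2 : measurable_fun (unit_disk R) g2).
Hypotheses (ig1 : lam.-integrable (unit_disk R) (EFin \o g1))
  (ig2 : lam.-integrable (unit_disk R) (EFin \o g2)).
Hypothesis ac1 : forall s t : R, 0 < s -> 0 < t -> s ^+ 2 + t ^+ 2 < 1 ->
  {ae mu, forall y, `|y| <= t -> abs_continuousR (fun x => u (x, y)) (- s) s}.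
Hypothesis ac2 : forall s t : R, 0 < s -> 0 < t -> s ^+ 2 + t ^+ 2 < 1 ->
  {ae mu, forall x, `|x| <= t -> abs_continuousR (fun y => u (x, y)) (- s) s}.
Hypothesis du1 : {ae lam, forall z, unit_disk R z ->
  is_derive z.1 (1 : R) (fun t => u (t, z.2)) (g1 z)}.
Hypothesis du2 : {ae lam, forall z, unit_disk R z ->
  is_derive z.2 (1 : R) (fun t => u (z.1, t)) (g2 z)}.

Variables (f1 p1 q1 f2 p2 q2 : pt -> R) (L d : R).
Hypothesis d0 : 0 < d.
Hypotheses (df1 : forall w, has_differential f1 (p1 w) (q1 w) w)
  (df2 : forall w, has_differential f2 (p2 w) (q2 w) w).
Hypotheses (cp1 : continuous p1) (cq1 : continuous q1) (cp2 : continuous p2) (cq2 : continuous q2).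
Hypothesis supp : forall w, ~ in_box L d w ->
  [/\ f1 w = 0, p1 w = 0 & q1 w = 0] /\ [/\ f2 w = 0, p2 w = 0 & q2 w = 0].

Let A := strip_A ta D.
Let B := strip_B ta D.
Let Z1 z := f1 (T z) * A z - f2 (T z) * B z.
Let Z2 z := f1 (T z) * B z + f2 (T z) * A z.

(** The field [(f1, f2)] on the strip is pulled back to [(Z1, Z2)] on the disk. As [strip_map] is
    conformal, the terms with its second derivative cancel in the divergence of [(Z1, Z2)], which is
    [strip_om] times [p1 + q2] taken at the image point. That factor is absorbed by the change of
    variables. *)
Lemma weak_identity :
  lam.-integrable (unit_disk R) (EFin \o (fun z => g1 z * Z1 z + g2 z * Z2 z)) /\
  (\int[lam]_(z in unit_disk R) (g1 z * Z1 z + g2 z * Z2 z)%:E =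
   - \int[lam]_(w in open_strip) (u (G w) * (p1 w + q2 w))%:E)%E.
Proof.
have [r [r0 r1 hr]] := strip_inv_box L d0.
have cT z : unit_disk R z -> {for z, continuous T}.
  by move=> z1; apply: continuous_strip_map; exact: disk_strip_dom.
have cfT (f : pt -> R) z : unit_disk R z -> {for T z, continuous f} -> {for z, continuous (fun z => f (T z))}.
  by move=> z1 cf; apply: (@continuous_comp _ _ _ T f) => //; exact: cT.
have cf1 w : {for w, continuous f1} by exact: has_differential_continuous (df1 w).
have cf2 w : {for w, continuous f2} by exact: has_differential_continuous (df2 w).
have dT (f p q : pt -> R) z : (forall w, has_differential f (p w) (q w) w) -> unit_disk R z ->
    has_differential (fun z => f (T z)) (p (T z) * A z - q (T z) * B z) (p (T z) * B z + q (T z) * A z) z.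
  move=> df z1.
  have dz := @disk_strip_dom _ ta D z z1.
  have := has_differential_comp22 (df (T z)) (has_differential_strip_x dz) (has_differential_strip_y dz).
  by apply: has_differential_ext => //; rewrite mulrN.
pose A1 := strip_A1 ta D; pose A2 := strip_A2 ta D.
pose Z11 z := (p1 (T z) * A z - q1 (T z) * B z) * A z + f1 (T z) * A1 z -
  ((p2 (T z) * A z - q2 (T z) * B z) * B z + f2 (T z) * A2 z).
pose Z22 z := (p1 (T z) * B z + q1 (T z) * A z) * B z - f1 (T z) * A1 z +
  ((p2 (T z) * B z + q2 (T z) * A z) * A z + f2 (T z) * A2 z).
have dZ z : unit_disk R z -> exists P Q, has_differential Z1 (Z11 z) Q z /\ has_differential Z2 P (Z22 z) z.
  move=> z1; have [dA dB _ _] := @has_differential_strip_AB12 _ ta D z z1.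
  have d1 := dT f1 p1 q1 z df1 z1; have d2 := dT f2 p2 q2 z df2 z1.
  have h1 := has_differentialB (has_differentialM d1 dA) (has_differentialM d2 dB).
  have h2 := has_differentialD (has_differentialM d1 dB) (has_differentialM d2 dA).
  eexists; eexists; split.
    by apply: has_differential_ext h1 => //.
  by apply: has_differential_ext h2 => //; rewrite /Z22 /A /B /A1 /A2; ring.
have cAll z : unit_disk R z -> [/\ {for z, continuous A}, {for z, continuous B},
    {for z, continuous A1} & {for z, continuous A2}].
  move=> z1; have [dA dB c1 c2] := @has_differential_strip_AB12 _ ta D z z1.
  by split=> //; [exact: has_differential_continuous dA|exact: has_differential_continuous dB].
have cZ z : unit_disk R z -> {for z, continuous Z1} /\ {for z, continuous Z2}.
  move=> /dZ[P [Q [h1 h2]]].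
  by split; [exact: has_differential_continuous h1|exact: has_differential_continuous h2].
have cp (f : pt -> R) z : continuous f -> unit_disk R z -> {for z, continuous (fun z => f (T z))}.
  by move=> cf z1; apply: cfT => //; exact: cf.
have cZ1' z (dz : unit_disk R z) : {for z, continuous Z1} by have [] := cZ z dz.
have cZ2' z (dz : unit_disk R z) : {for z, continuous Z2} by have [] := cZ z dz.
have cZ11 z : unit_disk R z -> {for z, continuous Z11}.
  move=> z1; have [? ? ? ?] := cAll z z1.
  apply: cvgB; apply: cvgD; apply: cvgM => //; try (by apply: cfT);
    (apply: cvgB || idtac); apply: cvgM => //; exact: cp.
have cZ22 z : unit_disk R z -> {for z, continuous Z22}.
  move=> z1; have [? ? ? ?] := cAll z z1.
  apply: cvgD; [apply: cvgB|apply: cvgD]; apply: cvgM => //; try (by apply: cfT);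
    apply: cvgD; apply: cvgM => //; exact: cp.
have Z0 z : unit_disk R z -> r <= cmod z -> [/\ Z1 z = 0, Z11 z = 0, Z2 z = 0 & Z22 z = 0].
  move=> z1 zr; have nb : ~ in_box L d (T z).
    by move=> /(hr _ z1); rewrite ltNge zr.
  have [[E1 E2 E3] [E4 E5 E6]] := supp nb.
  by rewrite /Z1 /Z2 /Z11 /Z22 E1 E2 E3 E4 E5 E6; split; ring.
have Z01 z : unit_disk R z -> r <= cmod z -> Z1 z = 0 /\ Z11 z = 0.
  by move=> z1 zr; have [] := Z0 z z1 zr.
have Z02 z : unit_disk R z -> r <= cmod z -> Z2 z = 0 /\ Z22 z = 0.
  by move=> z1 zr; have [] := Z0 z z1 zr.
have [i1 j1] := integrable_parts r1 cu mg1 ig1 Z01 cZ1' cZ11.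
have [i2 j2] := integrable_parts r1 cu mg2 ig2 Z02 cZ2' cZ22.
have P1 := @disk_parts1 R u g1 Z1 Z11 r r0 r1 cu mg1 ig1 Z01 cZ1' cZ11 ac1 du1.
have P2 := @disk_parts2 R u g2 Z2 Z22 r r0 r1 cu mg2 ig2 Z02 cZ2' cZ22 ac2 du2.
have mD : measurable (unit_disk R : set (measurableTypeR R * measurableTypeR R)).
  exact: open_measurable_plane open_unit_disk.
have {}P1 : (\int[lam]_(z in unit_disk R) (g1 z * Z1 z)%:E +
   \int[lam]_(z in unit_disk R) (u z * Z11 z)%:E = 0)%E.
  rewrite -(@integralD _ _ _ lam _ mD _ _ i1 j1) -[RHS]P1 //.
  move=> z z1; have [P [Q [h _]]] := dZ z z1; exact: has_differential_partial1 h.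
have {}P2 : (\int[lam]_(z in unit_disk R) (g2 z * Z2 z)%:E +
   \int[lam]_(z in unit_disk R) (u z * Z22 z)%:E = 0)%E.
  rewrite -(@integralD _ _ _ lam _ mD _ _ i2 j2) -[RHS]P2 //.
  move=> z z1; have [P [Q [_ h]]] := dZ z z1; exact: has_differential_partial2 h.
split; first exact: (@integrableD _ _ _ lam _ mD _ _ i1 i2).
rewrite (@integralD _ _ _ lam _ mD _ _ i1 i2).
have <- : (\int[lam]_(z in unit_disk R) (u z * Z11 z)%:E +
   \int[lam]_(z in unit_disk R) (u z * Z22 z)%:E = \int[lam]_(w in open_strip) (u (G w) * (p1 w + q2 w))%:E)%E.
  rewrite -(@integralD _ _ _ lam _ mD _ _ j1 j2) -(@strip_change R ta D D0 (fun w => u (G w) * (p1 w + q2 w))).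
    apply: eq_integral => z; rewrite inE => z1 /=.
    have [_ ->] := strip_map_disk ta D0 z1.
    by rewrite -EFinD; congr (_%:E); rewrite /Z11 /Z22 /strip_om -/A -/B; ring.
  move=> w sw; have [Gw _] := strip_inv_strip ta D0 sw.
  apply: cvgM; last by apply: cvgD; [exact: cp1|exact: cq2].
  apply: (@continuous_comp _ _ _ G u); last exact: cu.
  by move: sw => /andP[w1 w2]; apply: continuous_strip_inv => //; rewrite !ltW.
have fin (f : pt -> R) : lam.-integrable (unit_disk R) (EFin \o f) ->
    exists c : R, (\int[lam]_(z in unit_disk R) (f z)%:E = c%:E)%E.
  move=> /(@integrable_fin_num _ _ _ lam _ mD) h.
  by exists (fine (\int[lam]_(z in unit_disk R) (f z)%:E)%E); rewrite fineK.
move: P1 P2; have [I1 ->] := fin _ i1; have [I2 ->] := fin _ i2.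
have [J1 ->] := fin _ j1; have [J2 ->] := fin _ j2.
rewrite -!EFinD => -[P1] [P2]; rewrite -EFinN; congr (_%:E); lra.
Qed.

End weak_identity.

(** * Gradients of quasiconformal maps *)

Section smooth_functions_on_the_disk.
Context {R : realType}.
Local Notation pt := (R * R)%type.
Implicit Types (z w : pt).

Lemma lipschitz_on_disc (Psi P Q : pt -> R) (r : R) : r < 1 ->
  (forall z, unit_disk R z -> has_differential Psi (P z) (Q z) z) ->
  (forall z, unit_disk R z -> {for z, continuous P}) ->
  (forall z, unit_disk R z -> {for z, continuous Q}) ->
  exists2 C : R, 0 < C & forall z w, cmod z <= r -> cmod w <= r ->
    `|Psi z - Psi w| <= C * cmod (z - w).
Proof.
move=> r1 dPsi cP cQ; have [M1 M10 h1] := bounded_closed_disc r1 cP.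
have [M2 M20 h2] := bounded_closed_disc r1 cQ.
exists (M1 + M2 + 1) => [|z w zr wr]; first by rewrite ltr_wpDl// addr_ge0.
pose ga (t : R) : pt := (w.1 + t * (z.1 - w.1), w.2 + t * (z.2 - w.2)).
have gar (t : R) : 0 <= t <= 1 -> cmod (ga t) <= r.
  move=> /andP[t0 t1]; have -> : ga t = (1 - t) *: w + t *: z.
    by rewrite /ga; congr pair; rewrite /= /GRing.scale /=; ring.
  rewrite (le_trans (cmodD _ _))// !cmodZ !ger0_norm ?subr_ge0//.
  have -> : r = (1 - t) * r + t * r by ring.
  by apply: lerD; apply: ler_wpM2l => //; rewrite subr_ge0.
have dl (c e t : R) : is_derive t (1 : R) (fun t => c + t * e) e.
  apply/is_derive1_eps => ep ep0; exists 1 => // y _.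
  have -> : c + y * e - (c + t * e) - e * (y - t) = 0 by ring.
  by rewrite normr0 mulr_ge0// ltW.
have dphi (t : R) : 0 <= t <= 1 -> is_derive t (1 : R) (fun t => Psi (ga t))
    (P (ga t) * (z.1 - w.1) + Q (ga t) * (z.2 - w.2)).
  move=> t01; apply: is_derive_comp2 => //; apply: dPsi.
  exact: le_lt_trans (gar t t01) r1.
have bphi (t : R) : 0 <= t <= 1 -> `|P (ga t) * (z.1 - w.1) + Q (ga t) * (z.2 - w.2)| <=
    (M1 + M2 + 1) * cmod (z - w).
  move=> /gar gt; have p1 := h1 _ gt; have q1 := h2 _ gt.
  have a1 := fst_le_cmod (z - w); have a2 := snd_le_cmod (z - w).
  rewrite (le_trans (ler_normD _ _))// !normrM.
  have := ler_pM (normr_ge0 _) (normr_ge0 _) p1 a1.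
  have := ler_pM (normr_ge0 _) (normr_ge0 _) q1 a2.
  by rewrite /=; have := cmod_ge0 (z - w); nra.
have := @lipschitz_derive _ _ _ 0 1 _ dphi bphi 0 1 (lexx _) ler01 (lexx _).
rewrite subr0 mulr1 /ga !mul1r !mul0r !addr0 ![_ + (_ - _)]addrC !subrK.
by rewrite -!surjective_pairing.
Qed.

End smooth_functions_on_the_disk.

Section measurable_partials.
Context {R : realType}.
Local Notation pt := (R * R)%type.
Implicit Types (z w : pt).

(** The upper limit of the difference quotients with steps [1 / (n + 1)] is measurable everywhere
    and equals the derivative wherever that exists. *)
Lemma measurable_partial (u : pt -> R) (v : pt) (Om : set pt) : open Om ->
  (forall z, Om z -> {for z, continuous u}) ->
  exists2 g : pt -> R, measurable_fun setT g &
    forall z, Om z -> derivable u z v -> g z = 'D_v u z.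
Proof.
move=> oOm cu; pose ub := u \_ Om.
have mub : measurable_fun setT ub.
  apply: (measurable_restrictT u (open_measurable_plane oOm)).1.
  exact: continuous_measurable_plane.
pose q (n : nat) z : R := n.+1%:R * (ub (n.+1%:R^-1 *: v + z) - ub z).
have mq n : measurable_fun setT (q n).
  apply: measurable_funM; first exact: measurable_cst.
  apply: measurable_funB => //.
  apply: (measurableT_comp mub); apply: continuous_measurable_map; first exact: openT.
  by move=> z _; apply: cvgD; [exact: cvg_cst|exact: cvg_id].
exists (fun z => fine (limn_esup (fun n => (q n z)%:E))).
  apply: (measurableT_comp (@fine_measurable R setT measurableT)).
  by apply: measurable_fun_limn_esup => n; apply/measurable_EFinP.
move=> z Oz du; suff : (fun n => (q n z)%:E) @ \oo --> ('D_v u z)%:E.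
  by move=> /cvg_limn_einf_sup[_ ->].
apply: cvg_EFin; first by near=> n.
have h : h^-1 *: (u (h *: v + z) - u z) @[h --> 0^'] --> 'D_v u z by exact: du.
have cn : (n.+1%:R^-1 : R) @[n --> \oo] --> 0^'.
  move=> A; rewrite /dnbhs /within /= => /nbhs_ballP[e /= e0 eA].
  have := @cvg_harmonic R; rewrite /harmonic => /cvgrPdist_lt /(_ e e0)[N _ hN].
  exists N => // n Nn; apply: eA; last by rewrite gt_eqF// invr_gt0.
  by have := hN n Nn; rewrite /ball /=.
have /= h2 := cvg_comp _ _ cn h.
apply: cvg_trans h2; apply: near_eq_cvg.
have [d d0 hd] := (open_discP _).1 oOm z Oz.
have e0 : 0 < d / (cmod v + 1) by rewrite divr_gt0// ltr_wpDl// cmod_ge0.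
near=> n; rewrite /= /q /ub !patchE (mem_set Oz) mem_set.
  by rewrite invrK.
apply: hd; rewrite /disc /= addrK cmodZ ger0_norm ?invr_ge0//.
have : n.+1%:R^-1 < d / (cmod v + 1) by near: n; exact: (near_infty_natSinv_lt (PosNum e0)).
rewrite ltr_pdivlMr ?ltr_wpDl ?cmod_ge0//; apply: le_lt_trans.
by rewrite ler_wpM2l ?invr_ge0// lerDl.
Unshelve. all: by end_near.
Qed.

End measurable_partials.

Section quasiconformal_gradient.
Context {R : realType}.
Local Notation lam := (area R).
Local Notation pt := (R * R)%type.
Implicit Types (z w : pt).
Variables (F F' : pt -> pt).
Hypotheses (cF : forall z, unit_disk R z -> {for z, continuous F})
  (cF' : forall z, unit_disk R z -> {for z, continuous F'})
  (FD : forall z, unit_disk R z -> unit_disk R (F z) /\ F' (F z) = z)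
  (FD' : forall z, unit_disk R z -> unit_disk R (F' z) /\ F (F' z) = z).

(** [F] is open: from the image of an interior maximum one could move a little in the direction [v],
    which increases [la], and still stay inside the image of the rectangle. *)
Lemma max_principle_coordinate (la : pt -> R) (v : pt) :
  (forall z, {for z, continuous la}) -> (forall z t, la (z + t *: v) = la z + t) ->
  max_principle (unit_disk R) (fun z => la (F z)).
Proof.
move=> cla lav x1 x2 y1 y2 z rD zx zy.
pose K : set pt := `[x1, x2]%classic `*` `[y1, y2]%classic.
have Kin w : K w <-> x1 <= w.1 <= x2 /\ y1 <= w.2 <= y2 by rewrite /K /= !in_itv.
have Kz : K z by apply/Kin.
have cK : compact K by apply: compact_setX; exact: segment_compact.
have claF : {within K, continuous (fun z => la (F z))}.
  apply: continuous_in_subspaceT => w; rewrite inE => /Kin[wx wy].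
  by apply: (@continuous_comp _ _ _ F la); [exact/cF/rD|exact: cla].
have [w wK wmax] := compact_EVT_max (ex_intro _ z Kz) cK claF.
have [wx wy] : x1 <= w.1 <= x2 /\ y1 <= w.2 <= y2 by apply/Kin; move: wK; rewrite inE.
exists w; last by apply: wmax; rewrite inE.
split => //; apply: contrapT => nb.
have /andP[w1 w2] := wx; have /andP[w3 w4] := wy.
have {}w1 : x1 < w.1 by rewrite lt_neqAle w1 andbT; apply/eqP => h; apply: nb; constructor 1.
have {}w2 : w.1 < x2 by rewrite lt_neqAle w2 andbT; apply/eqP => h; apply: nb; constructor 2.
have {}w3 : y1 < w.2 by rewrite lt_neqAle w3 andbT; apply/eqP => h; apply: nb; constructor 3.
have {}w4 : w.2 < y2 by rewrite lt_neqAle w4 andbT; apply/eqP => h; apply: nb; constructor 4.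
have Dw : unit_disk R w by exact: rD.
have [DFw FFw] := FD Dw.
pose e := Num.min (Num.min (w.1 - x1) (x2 - w.1)) (Num.min (w.2 - y1) (y2 - w.2)).
have e0 : 0 < e by rewrite !lt_min !subr_gt0 w1 w2 w3 w4.
have [d d0 hd] := (cts_cmodP _ _).1 (cF' DFw) e e0.
have [d' d'0 hd'] := (open_discP _).1 (@open_unit_disk R) _ DFw.
pose t := Num.min d d' / (2 * (cmod v + 1)).
have v1 : 0 < cmod v + 1 by rewrite ltr_wpDl ?cmod_ge0.
have m0 : 0 < Num.min d d' by rewrite lt_min d0.
have t0 : 0 < t by rewrite divr_gt0// mulr_gt0.
have tv : cmod (F w + t *: v - F w) < Num.min d d'.
  rewrite addrAC subrr add0r cmodZ gtr0_norm// /t mulrAC ltr_pdivrMr ?mulr_gt0// ltr_pM2l//.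
  by have := cmod_ge0 v; lra.
move: tv; rewrite lt_min => /andP[/hd ve /hd' Dy].
have [Dy' yE] := FD' Dy.
have : la (F (F' (F w + t *: v))) <= la (F w).
  apply: wmax; rewrite inE; apply/Kin; move: ve; rewrite FFw => ve.
  have := le_lt_trans (fst_le_cmod _) ve; have := le_lt_trans (snd_le_cmod _) ve.
  have e1 : e <= w.1 - x1 by rewrite /e !ge_min lexx.
  have e2 : e <= x2 - w.1 by rewrite /e !ge_min lexx ?orbT.
  have e3 : e <= w.2 - y1 by rewrite /e !ge_min lexx ?orbT.
  have e4 : e <= y2 - w.2 by rewrite /e !ge_min lexx ?orbT.
  rewrite !ltr_norml /= => /andP[a1 a2] /andP[a3 a4].
  move: e1 e2 e3 e4 a1 a2 a3 a4; clear; set p := F' _; move: e (p) => e {}p * /=.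
  by split; apply/andP; split; lra.
by rewrite yE lav gerDl leNgt t0.
Qed.

Lemma derive_coordinates (u : pt -> pt) (v z : pt) : derivable u z v ->
  [/\ derivable (fun w => (u w).1) z v, 'D_v (fun w => (u w).1) z = ('D_v u z).1,
      derivable (fun w => (u w).2) z v & 'D_v (fun w => (u w).2) z = ('D_v u z).2].
Proof.
move=> du; have h : h^-1 *: (u (h *: v + z) - u z) @[h --> 0^'] --> 'D_v u z by exact: du.
have h1 := cvg_comp _ _ h (@continuous_fst R ('D_v u z)).
have h2 := cvg_comp _ _ h (@continuous_snd R ('D_v u z)).
split.
- by apply/cvg_ex; exists ('D_v u z).1; exact: h1.
- exact: (cvg_lim _ h1).
- by apply/cvg_ex; exists ('D_v u z).2; exact: h2.
- exact: (cvg_lim _ h2).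
Qed.

Lemma wirtinger_sqr (p q : pt) : 
  `|(toC p + 'i * toC q) / 2| ^+ 2 = (((p.1 - q.2) ^+ 2 + (p.2 + q.1) ^+ 2) / 4)%:C%C /\
  `|(toC p - 'i * toC q) / 2| ^+ 2 = (((p.1 + q.2) ^+ 2 + (p.2 - q.1) ^+ 2) / 4)%:C%C.
Proof.
have E (x y : R) : `|(x +i* y)%C / 2| ^+ 2 = ((x ^+ 2 + y ^+ 2) / 4)%:C%C.
  have N : `|(x +i* y)%C| = (cmod (x, y))%:C%C := toC_norm (x, y).
  rewrite normrM exprMn normfV normr_nat N -rmorphXn /= cmod_sqr /=.
  by rewrite rmorphM/= fmorphV/= rmorph_nat; congr (_ * _); rewrite exprVn -natrX.
split; rewrite -E; congr (`|_ / _| ^+ 2).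
  by apply/eqP; rewrite eq_complex /=; apply/andP; split; apply/eqP; ring.
by apply/eqP; rewrite eq_complex /=; apply/andP; split; apply/eqP; ring.
Qed.

(** The least stretch is [|F_z| - |F_zbar| >= (1 - k) |F_z|], while the sum of the squares of the
    partial derivatives is [2 (|F_z|^2 + |F_zbar|^2) <= 4 |F_z|^2]. *)
Lemma qc_stretch (a1 b1 a2 b2 k x y : R) : 0 < k < 1 ->
  (a1 - b2) ^+ 2 + (a2 + b1) ^+ 2 <= k ^+ 2 * ((a1 + b2) ^+ 2 + (a2 - b1) ^+ 2) ->
  (1 - k) ^+ 2 / 4 * (a1 ^+ 2 + b1 ^+ 2 + (a2 ^+ 2 + b2 ^+ 2)) * (x ^+ 2 + y ^+ 2) <=
  (a1 * x + b1 * y) ^+ 2 + (a2 * x + b2 * y) ^+ 2.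
Proof.
move=> /andP[k0 k1]; set Q := _ + _ ^+ 2; set P := _ + (a2 - b1) ^+ 2 => QP.
have eE : a1 ^+ 2 + b1 ^+ 2 + (a2 ^+ 2 + b2 ^+ 2) = (P + Q) / 2 by rewrite /P /Q; field.
set n := x ^+ 2 + y ^+ 2; have n0 : 0 <= n by rewrite addr_ge0// sqr_ge0.
have P0 : 0 <= P by rewrite addr_ge0// sqr_ge0.
have Q0 : 0 <= Q by rewrite addr_ge0// sqr_ge0.
set V := _ + (a2 * x + b2 * y) ^+ 2.
(* With [v = x + i y], [p = 2 F_z v] and [q = 2 F_zbar v^*] this is [k |p + q|^2 = k (1 - k) |p|^2 -
   (1 - k) |q|^2 + |k p + q|^2]; the last square is dropped. *)
have VE : 4 * k * V = k * (1 - k) * P * n - (1 - k) * Q * n +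
   ((k * ((a1 + b2) * x - (a2 - b1) * y) + ((a1 - b2) * x + (a2 + b1) * y)) ^+ 2 +
    (k * ((a1 + b2) * y + (a2 - b1) * x) + ((a2 + b1) * x - (a1 - b2) * y)) ^+ 2).
  by rewrite /V /P /Q /n; ring.
have k4 : 0 < 4 * k by rewrite mulr_gt0.
rewrite -(ler_pM2l k4) VE eE.
set S := (X in _ <= _ + X); have S0 : 0 <= S by rewrite addr_ge0// sqr_ge0.
have k10 : 0 < 1 - k by rewrite subr_gt0.
have QP' : Q <= P.
  by rewrite (le_trans QP)// ler_piMl// expr_le1 ?ltW.
have h1 : 0 <= k * (1 - k) ^+ 2 * n * (P - Q) by rewrite !mulr_ge0 ?sqr_ge0 ?subr_ge0// ltW.
have h2 : 0 <= (1 - k) * n * (k ^+ 2 * P - Q) by rewrite !mulr_ge0 ?subr_ge0// ltW.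
rewrite -subr_ge0 (_ : _ - _ = S + (1 - k) * n * (k ^+ 2 * P - Q) + k * (1 - k) ^+ 2 * n * (P - Q) / 2).
  by apply: addr_ge0; [exact: addr_ge0|exact: (divr_ge0 h1)].
by field.
Qed.

Definition grad_sqr (a1 b1 a2 b2 : pt -> R) z : R := a1 z ^+ 2 + b1 z ^+ 2 + (a2 z ^+ 2 + b2 z ^+ 2).

(** Collects what later arguments use of [F]: measurable representatives of the partial derivatives,
    the differential almost everywhere, the transfer of any pointwise bound on the dilatation to
    real form, and the energy bound. The last is the area inequality with [l] the lower stretch of
    [qc_stretch]. *)
Lemma qc_gradient (k : R) : 0 < k < 1 ->
  {ae lam, forall z, unit_disk R z -> [/\ derivable F z (1, 0), derivable F z (0, 1) &
     `|d_zbar F z| <= k%:C%C * `|d_z F z|]} ->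
  exists a1 b1 a2 b2 : pt -> R,
  [/\ [/\ measurable_fun setT a1, measurable_fun setT b1, measurable_fun setT a2 & measurable_fun setT b2],
    {ae lam, forall z, unit_disk R z -> [/\ has_differential (fun w => (F w).1) (a1 z) (b1 z) z,
       has_differential (fun w => (F w).2) (a2 z) (b2 z) z,
       (forall e : R, 0 <= e -> `|d_zbar F z| <= e%:C%C * `|d_z F z| ->
         (a1 z - b2 z) ^+ 2 + (a2 z + b1 z) ^+ 2 <= e ^+ 2 * ((a1 z + b2 z) ^+ 2 + (a2 z - b1 z) ^+ 2)) &
       (a1 z - b2 z) ^+ 2 + (a2 z + b1 z) ^+ 2 <= k ^+ 2 * ((a1 z + b2 z) ^+ 2 + (a2 z - b1 z) ^+ 2)]} &
    forall rho : pt -> R, (forall w, 0 <= rho w) ->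
      (forall w, unit_disk R w -> {for w, continuous rho}) ->
      (\int[lam]_(z in unit_disk R) (rho (F z) * grad_sqr a1 b1 a2 b2 z)%:E <=
       (4 / (1 - k) ^+ 2)%:E * \int[lam]_(z in unit_disk R) (rho z)%:E)%E].
Proof.
move=> /andP[k0 k1] hF.
have oD := @open_unit_disk R.
have cF1 z : unit_disk R z -> {for z, continuous (fun w => (F w).1)}.
  by move=> z1; apply: (@continuous_comp _ _ _ F fst); [exact: cF|exact: continuous_fst].
have cF2 z : unit_disk R z -> {for z, continuous (fun w => (F w).2)}.
  by move=> z1; apply: (@continuous_comp _ _ _ F snd); [exact: cF|exact: continuous_snd].
have [a1 ma1 a1E] := measurable_partial (1, 0) oD cF1.
have [b1 mb1 b1E] := measurable_partial (0, 1) oD cF1.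
have [a2 ma2 a2E] := measurable_partial (1, 0) oD cF2.
have [b2 mb2 b2E] := measurable_partial (0, 1) oD cF2.
exists a1, b1, a2, b2.
have mp1 : max_principle (unit_disk R) (fun z => (F z).1).
  apply: (@max_principle_coordinate fst (1, 0)); first exact: continuous_fst.
  by move=> z t; rewrite /= [t *: _]mulr1.
have mp2 : max_principle (unit_disk R) (fun z => (F z).2).
  apply: (@max_principle_coordinate snd (0, 1)); first exact: continuous_snd.
  by move=> z t; rewrite /= [t *: _]mulr1.
have mp1n : max_principle (unit_disk R) (fun z => - (F z).1).
  apply: (@max_principle_coordinate (fun z => - z.1) (-1, 0)).
    by move=> z; apply: cvgN; exact: continuous_fst.
  by move=> z t; rewrite /= [t *: _]mulrN1 opprD opprK.
have mp2n : max_principle (unit_disk R) (fun z => - (F z).2).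
  apply: (@max_principle_coordinate (fun z => - z.2) (0, -1)).
    by move=> z; apply: cvgN; exact: continuous_snd.
  by move=> z t; rewrite /= [t *: _]mulrN1 opprD opprK.
have d1 : {ae lam, forall z, unit_disk R z -> has_differential (fun w => (F w).1)
    ('D_(1, 0) (fun w => (F w).1) z) ('D_(0, 1) (fun w => (F w).1) z) z}.
  apply: ae_differentiable => //; apply: ae_imply hF => z hz /hz[h1 h2 _].
  by have [? _ _ _] := derive_coordinates h1; have [? _ _ _] := derive_coordinates h2.
have d2 : {ae lam, forall z, unit_disk R z -> has_differential (fun w => (F w).2)
    ('D_(1, 0) (fun w => (F w).2) z) ('D_(0, 1) (fun w => (F w).2) z) z}.
  apply: ae_differentiable => //; apply: ae_imply hF => z hz /hz[h1 h2 _].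
  by have [_ _ ? _] := derive_coordinates h1; have [_ _ ? _] := derive_coordinates h2.
have key : {ae lam, forall z, unit_disk R z -> [/\ has_differential (fun w => (F w).1) (a1 z) (b1 z) z,
       has_differential (fun w => (F w).2) (a2 z) (b2 z) z,
       (forall e : R, 0 <= e -> `|d_zbar F z| <= e%:C%C * `|d_z F z| ->
         (a1 z - b2 z) ^+ 2 + (a2 z + b1 z) ^+ 2 <= e ^+ 2 * ((a1 z + b2 z) ^+ 2 + (a2 z - b1 z) ^+ 2)) &
       (a1 z - b2 z) ^+ 2 + (a2 z + b1 z) ^+ 2 <= k ^+ 2 * ((a1 z + b2 z) ^+ 2 + (a2 z - b1 z) ^+ 2)]}.
  apply: ae_imply2 (ae_imply2 _ d1 d2) hF; last by move=> z h1 h2; exact: (conj h1 h2).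
  move=> z [h1 h2] hz z1; have [dx dy kz] := hz z1.
  have [x1 Dx1 x2 Dx2] := derive_coordinates dx.
  have [y1 Dy1 y2 Dy2] := derive_coordinates dy.
  have E1 := a1E z z1 x1; have E2 := b1E z z1 y1; have E3 := a2E z z1 x2; have E4 := b2E z z1 y2.
  have gen (e : R) : 0 <= e -> `|d_zbar F z| <= e%:C%C * `|d_z F z| ->
         (a1 z - b2 z) ^+ 2 + (a2 z + b1 z) ^+ 2 <= e ^+ 2 * ((a1 z + b2 z) ^+ 2 + (a2 z - b1 z) ^+ 2).
    move=> e0 ez; have [W1 W2] := wirtinger_sqr ('D_(1, 0) F z) ('D_(0, 1) F z).
    rewrite -/(d_zbar F z) in W1; rewrite -/(d_z F z) in W2.
    have : `|d_zbar F z| ^+ 2 <= (e%:C%C * `|d_z F z|) ^+ 2.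
      by rewrite lerXn2r ?nnegrE// mulr_ge0// lecR.
    rewrite exprMn W1 W2 -rmorphXn -rmorphM /= lecR E1 E2 E3 E4 Dx1 Dx2 Dy1 Dy2.
    by rewrite mulrA ler_pM2r.
  by split; rewrite ?E1 ?E2 ?E3 ?E4 -?E1 -?E2 -?E3 -?E4//; [rewrite E1 E2; exact: h1|rewrite E3 E4; exact: h2|apply: gen => //; exact: ltW].
split => // rho rho0 crho.
pose c : R := (1 - k) ^+ 2 / 4.
have c0 : 0 < c by rewrite divr_gt0// exprn_gt0// subr_gt0.
pose e := grad_sqr a1 b1 a2 b2.
have e0 z : 0 <= e z by rewrite !addr_ge0// sqr_ge0.
pose l z := Num.sqrt (c * e z).
have msq (f : pt -> R) : measurable_fun setT f -> measurable_fun setT (fun z => f z ^+ 2).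
  exact: measurable_funX.
have me : measurable_fun setT e.
  by apply: measurable_funD; apply: measurable_funD; exact: msq.
have ml : measurable_fun setT l.
  apply: (@measurableT_comp _ _ _ _ _ _ (@Num.sqrt R)); first exact: (continuous_measurable_fun (@sqrt_continuous R)).
  by apply: measurable_funM => //; exact: measurable_cst.
have -> : (4 / (1 - k) ^+ 2)%:E = c^-1%:E :> \bar R by rewrite /c invf_div.
have := @area_inequality R (unit_disk R) (unit_disk R) F F' l rho oD oD cF cF'.
move=> /(_ FD FD' (fun z => sqrtr_ge0 _) rho0 (measurable_funS measurableT (@subsetT _ _) ml) crho).
have expand : {ae lam, forall z, unit_disk R z -> forall e : R, 0 < e ->
  exists2 d : R, 0 < d & forall w, cmod (w - z) < d ->
    (l z - e) * cmod (w - z) <= cmod (F w - F z)}.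
  apply: ae_imply key => z hz z1; have [h1 h2 _ kk] := hz z1.
  move=> ep ep0.
  have hs x y : l z ^+ 2 * (x ^+ 2 + y ^+ 2) <= (a1 z * x + b1 z * y) ^+ 2 + (a2 z * x + b2 z * y) ^+ 2.
    rewrite /l sqr_sqrtr; last exact: (mulr_ge0 (ltW c0) (e0 z)).
    by apply: (qc_stretch x y _ kk); rewrite k0.
  have [d d0 hd] := differential_expand h1 h2 (sqrtr_ge0 _) hs ep0.
  by exists d => // w /hd; rewrite -!surjective_pairing.
move=> /(_ expand) h.
have -> : (\int[lam]_(z in unit_disk R) (rho (F z) * e z)%:E =
    \int[lam]_(z in unit_disk R) (c^-1%:E * (rho (F z) * l z ^+ 2)%:E))%E.
  apply: eq_integral => z _; rewrite -EFinM; congr (_%:E).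
  have ce0 : 0 <= c * e z := mulr_ge0 (ltW c0) (e0 z).
  by rewrite /l sqr_sqrtr// [RHS]mulrCA mulKf ?gt_eqF.
have mD : measurable (unit_disk R : set (measurableTypeR R * measurableTypeR R)).
  exact: open_measurable_plane oD.
rewrite (@ge0_integralZl _ _ _ lam _ mD).
- by rewrite lee_pmul2l// lte_fin invr_gt0.
- apply/measurable_EFinP; apply: measurable_funM.
    apply: continuous_measurable_plane => // z z1; apply: (@continuous_comp _ _ _ F rho); first exact: cF.
    by apply: crho; have [] := FD z1.
  exact: (measurable_funS measurableT (@subsetT _ _) (msq _ ml)).
- by move=> z _; rewrite lee_fin mulr_ge0// sqr_ge0.
- by rewrite lee_fin invr_ge0 ltW.
Qed.

End quasiconformal_gradient.

(** * Estimates for almost holomorphic waves *)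

Section cutoffs.
Context {R : realType}.
Implicit Types (t : R).

Definition pos_part t : R := Num.max t 0.

Lemma pos_part_ge0 t : 0 <= pos_part t.
Proof. by rewrite /pos_part le_max lexx orbT. Qed.

Lemma pos_part_le0 t : t <= 0 -> pos_part t = 0.
Proof. by move=> t0; rewrite /pos_part max_r. Qed.

Lemma pos_part_id t : 0 <= t -> pos_part t = t.
Proof. by move=> t0; rewrite /pos_part max_l. Qed.

Lemma continuous_pos_part : continuous pos_part.
Proof. by move=> t; apply: continuous_max; [exact: cvg_id|exact: cvg_cst]. Qed.

Lemma is_derive_pos_part_sqr t : is_derive t (1 : R) (fun x => pos_part x ^+ 2) (2 * pos_part t).
Proof.
apply/is_derive1_eps => e e0; exists e => // y yt.
have [y0|y0] := leP y 0; have [t0|t0] := leP t 0.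
- by rewrite !pos_part_le0// !expr0n /= mulr0 mul0r !subr0 normr0 mulr_ge0// ltW.
- rewrite (pos_part_le0 y0) (pos_part_id (ltW t0)) expr0n /= sub0r.
  have ty : t <= `|y - t| by rewrite ler0_norm; lra.
  rewrite (_ : - t ^+ 2 - 2 * t * (y - t) = t * (t - 2 * y)); last by ring.
  rewrite ger0_norm; last by rewrite mulr_ge0//; lra.
  rewrite ler0_norm in yt *; [|lra..].
  by nra.
- rewrite (pos_part_le0 t0) (pos_part_id (ltW y0)) expr0n /= mulr0 mul0r !subr0.
  have ty : y <= `|y - t| by rewrite ger0_norm; lra.
  by rewrite ger0_norm ?sqr_ge0//; nra.
- rewrite (pos_part_id (ltW y0)) (pos_part_id (ltW t0)) (_ : _ - _ - _ = (y - t) ^+ 2); last by ring.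
  by rewrite normrX expr2 ler_wpM2r// ltW.
Qed.

(** A bump of class C^1 for which [bump ^+ 2] and [bump' ^+ 2] are both at most a multiple of the
    continuous weight [pos_part (1 - t ^+ 2)], so that one weight controls function and
    derivative. *)
Definition bump t : R := pos_part (1 - t ^+ 2) ^+ 2.
Definition bump' t : R := - (4 * t * pos_part (1 - t ^+ 2)).

Lemma is_derive_bump t : is_derive t (1 : R) bump (bump' t).
Proof.
have h : is_derive t (1 : R) (fun x : R => 1 - x ^+ 2) (- (2 * t)).
  apply/is_derive1_eps => e e0; exists e => // y yt.
  rewrite (_ : _ - _ - _ = - (y - t) ^+ 2); last by ring.
  by rewrite normrN normrX expr2 ler_wpM2r// ltW.
have := @is_derive1_comp _ (fun x => pos_part x ^+ 2) (fun x : R => 1 - x ^+ 2) t _ _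
  (is_derive_pos_part_sqr (1 - t ^+ 2)) h.
have -> : 2 * pos_part (1 - t ^+ 2) * - (2 * t) = bump' t by rewrite /bump'; ring.
exact.
Qed.

Lemma continuous_bump' : continuous bump'.
Proof.
move=> t; apply: cvgN; apply: cvgM; first by apply: cvgM; [exact: cvg_cst|exact: cvg_id].
apply: (@continuous_comp _ _ _ (fun x : R => 1 - x ^+ 2)); last exact: continuous_pos_part.
by apply: cvgB; [exact: cvg_cst|rewrite /GRing.exp /=; apply: cvgM; exact: cvg_id].
Qed.

Lemma bump_out t : 1 <= `|t| -> bump t = 0 /\ bump' t = 0.
Proof.
move=> t1; have h : 1 - t ^+ 2 <= 0.
  by rewrite subr_le0 -(real_normK (num_real t)) expr_ge1.
by rewrite /bump /bump' pos_part_le0// expr0n mulr0 oppr0.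
Qed.

Lemma pos_part_one_sub_le1 t : pos_part (1 - t ^+ 2) <= 1.
Proof. by rewrite /pos_part ge_max ler01 andbT gerBl sqr_ge0. Qed.

Lemma bump_bounds t : [/\ 0 <= bump t, bump t <= 1 & `|bump' t| <= 4].
Proof.
split; first exact: sqr_ge0.
  by rewrite expr_le1 ?pos_part_ge0 ?pos_part_one_sub_le1.
have [/bump_out[_ ->]|t1] := leP 1 `|t|; first by rewrite normr0.
rewrite normrN !normrM ger0_norm// [`|pos_part _|]ger0_norm ?pos_part_ge0//.
have := pos_part_one_sub_le1 t; have := pos_part_ge0 (1 - t ^+ 2); have := normr_ge0 t.
by nra.
Qed.

Definition smoothstep t : R := 1 - bump (pos_part t).
Definition smoothstep' t : R := 4 * pos_part t * pos_part (1 - pos_part t ^+ 2).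

Lemma is_derive_smoothstep t : is_derive t (1 : R) smoothstep (smoothstep' t).
Proof.
have h : is_derive t (1 : R) (fun x : R => 1 - pos_part x ^+ 2) (0 - 2 * pos_part t).
  exact: (is_deriveB (is_derive_cst _ _ _) (is_derive_pos_part_sqr t)).
have h2 := @is_derive1_comp _ (fun x => pos_part x ^+ 2) (fun x : R => 1 - pos_part x ^+ 2) t _ _
  (is_derive_pos_part_sqr (1 - pos_part t ^+ 2)) h.
have := is_deriveB (is_derive_cst (1 : R) t (1 : R)) h2.
have -> : 0 - 2 * pos_part (1 - pos_part t ^+ 2) * (0 - 2 * pos_part t) = smoothstep' t.
  by rewrite /smoothstep'; ring.
exact.
Qed.

Lemma continuous_smoothstep' : continuous smoothstep'.
Proof.
move=> t; apply: cvgM; first by apply: cvgM; [exact: cvg_cst|exact: continuous_pos_part].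
apply: (@continuous_comp _ _ _ (fun x : R => 1 - pos_part x ^+ 2)); last exact: continuous_pos_part.
by apply: cvgB; [exact: cvg_cst|rewrite /GRing.exp /=; apply: cvgM; exact: continuous_pos_part].
Qed.

Lemma smoothstep_le0 t : t <= 0 -> smoothstep t = 0 /\ smoothstep' t = 0.
Proof.
move=> /pos_part_le0 t0; rewrite /smoothstep /smoothstep' /bump t0 expr0n /= subr0.
by rewrite pos_part_id ?ler01// expr1n subrr mulr0 mul0r.
Qed.

Lemma smoothstep_ge1 t : 1 <= t -> smoothstep t = 1 /\ smoothstep' t = 0.
Proof.
move=> t1; have t0 : 0 <= t by lra.
rewrite /smoothstep /smoothstep' pos_part_id//; have t1' : 1 <= `|t| by rewrite ger0_norm.
have [-> _] := bump_out t1'.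
by rewrite subr0 [pos_part (1 - _)]pos_part_le0 ?mulr0// subr_le0 expr_ge1.
Qed.

Lemma smoothstep_bounds t : [/\ 0 <= smoothstep t, smoothstep t <= 1 & 0 <= smoothstep' t].
Proof.
have [b0 b1 _] := bump_bounds (pos_part t).
split; [by rewrite subr_ge0|by rewrite gerBl|by rewrite !mulr_ge0// pos_part_ge0].
Qed.

End cutoffs.

Section cauchy_riemann_defect.
Context {R : realType}.

(* With [2 v_zbar = N_w F_zbar + N_wbar (F_z)^*] (all halves cleared), the defect of
   [v = N \o F] is bounded by the parallelogram inequality. *)
Lemma defect_bound (a1 b1 a2 b2 A B nx ny mx my : R) :
  let P1 := nx * A - ny * B in let Q1 := nx * B + ny * A in
  let P2 := mx * A - my * B in let Q2 := mx * B + my * A in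
  let g1 := P1 * a1 + Q1 * a2 in let g2 := P1 * b1 + Q1 * b2 in
  let h1 := P2 * a1 + Q2 * a2 in let h2 := P2 * b1 + Q2 * b2 in
  (g1 - h2) ^+ 2 + (g2 + h1) ^+ 2 <= (A ^+ 2 + B ^+ 2) / 2 *
    (((nx + my) ^+ 2 + (mx - ny) ^+ 2) * ((a1 - b2) ^+ 2 + (a2 + b1) ^+ 2) +
     ((nx - my) ^+ 2 + (mx + ny) ^+ 2) * ((a1 + b2) ^+ 2 + (a2 - b1) ^+ 2)).
Proof.
cbv zeta.
pose d1 := nx + my; pose d2 := mx - ny; pose e1 := nx - my; pose e2 := mx + ny.
pose r := a1 - b2; pose s := a2 + b1; pose p := a1 + b2; pose q := a2 - b1.
pose al1 := (d1 * A + d2 * B) * r - (d2 * A - d1 * B) * s.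
pose al2 := (d1 * A + d2 * B) * s + (d2 * A - d1 * B) * r.
pose be1 := (e1 * A - e2 * B) * p + (e2 * A + e1 * B) * q.
pose be2 := - (e1 * A - e2 * B) * q + (e2 * A + e1 * B) * p.
rewrite -subr_ge0.
rewrite (_ : _ - _ = ((al1 - be1) ^+ 2 + (al2 - be2) ^+ 2) / 4).
  by rewrite divr_ge0// addr_ge0// sqr_ge0.
by rewrite /al1 /be1 /al2 /be2 /d1 /d2 /e1 /e2 /r /s /p /q; field.
Qed.

(* the pairing of the two weak identities is [Re (2 v_zbar T' psi)] *)
Lemma pairing_bound (g1 g2 h1 h2 A B f1 f2 t : R) : 0 < t ->
  `|(g1 * (f1 * A + f2 * B) + g2 * (f1 * B - f2 * A)) +
    (h1 * (- f2 * A + f1 * B) + h2 * (- f2 * B - f1 * A))| <=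
  (t * ((g1 - h2) ^+ 2 + (g2 + h1) ^+ 2) + (A ^+ 2 + B ^+ 2) * (f1 ^+ 2 + f2 ^+ 2) / t) / 2.
Proof.
move=> t0; set x := g1 - h2; set y := g2 + h1.
pose u := f1 * A + f2 * B; pose v := f1 * B - f2 * A.
have -> : (g1 * (f1 * A + f2 * B) + g2 * (f1 * B - f2 * A)) +
    (h1 * (- f2 * A + f1 * B) + h2 * (- f2 * B - f1 * A)) = x * u + y * v.
  by rewrite /x /y /u /v; ring.
have -> : (A ^+ 2 + B ^+ 2) * (f1 ^+ 2 + f2 ^+ 2) = u ^+ 2 + v ^+ 2 by rewrite /u /v; ring.
have ti : t * t^-1 = 1 by rewrite divff// gt_eqF.
rewrite ler_norml; apply/andP; split; rewrite -subr_ge0.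
  rewrite (_ : _ - _ = t / 2 * ((x + u / t) ^+ 2 + (y + v / t) ^+ 2)).
    by rewrite mulr_ge0 ?addr_ge0 ?sqr_ge0// divr_ge0// ltW.
  by field; rewrite gt_eqF.
rewrite (_ : _ - _ = t / 2 * ((x - u / t) ^+ 2 + (y - v / t) ^+ 2)).
  by rewrite mulr_ge0 ?addr_ge0 ?sqr_ge0// divr_ge0// ltW.
by field; rewrite gt_eqF.
Qed.

End cauchy_riemann_defect.

Section waves.
Context {R : realType}.
Local Notation pt := (R * R)%type.
Implicit Types (f g : R -> R) (w : pt) (s th : R).

(* real and imaginary parts of [f x * g y * exp (i (s w + th))], [w = x + i y] *)
Definition wave_cos f g s th w : R := f w.1 * g w.2 * (expR (- (s * w.2)) * cos (s * w.1 + th)).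
Definition wave_sin f g s th w : R := f w.1 * g w.2 * (expR (- (s * w.2)) * sin (s * w.1 + th)).

(** The terms with the factor [s] come from the holomorphic exponential and cancel in the
    Cauchy-Riemann combinations; only those with [f'] and [g'] survive there. *)
Lemma has_differential_wave f f' g g' s th w : is_derive w.1 (1 : R) f (f' w.1) ->
  is_derive w.2 (1 : R) g (g' w.2) ->
  has_differential (wave_cos f g s th) (wave_cos f' g s th w - s * wave_sin f g s th w)
    (wave_cos f g' s th w - s * wave_cos f g s th w) w /\
  has_differential (wave_sin f g s th) (wave_sin f' g s th w + s * wave_cos f g s th w)
    (wave_sin f g' s th w - s * wave_sin f g s th w) w.
Proof.
move=> df dg.
have hf := has_differential_comp df (has_differential_fst w).
have hg := has_differential_comp dg (has_differential_snd w).
have hy : has_differential (fun w : pt => - (s * w.2)) 0 (- s) w.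
  have := has_differentialM (has_differential_cst (- s) w) (has_differential_snd w).
  apply: has_differential_ext; last 2 first; [by ring|by ring|].
  by apply/funext => w'; ring.
have hx : has_differential (fun w : pt => s * w.1 + th) s 0 w.
  have := has_differentialD (has_differentialM (has_differential_cst s w) (has_differential_fst w))
    (has_differential_cst th w).
  by apply: has_differential_ext => //; ring.
have he := has_differential_comp (is_derive_expR (- (s * w.2))) hy.
have hc := has_differential_comp (is_derive_cos (s * w.1 + th)) hx.
have hs := has_differential_comp (is_derive_sin (s * w.1 + th)) hx.
have hfg := has_differentialM hf hg.
split.
  apply: has_differential_ext (has_differentialM hfg (has_differentialM he hc)) => //.
    by rewrite /wave_cos /wave_sin; ring.
  by rewrite /wave_cos /wave_sin; ring.
apply: has_differential_ext (has_differentialM hfg (has_differentialM he hs)) => //.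
  by rewrite /wave_cos /wave_sin; ring.
by rewrite /wave_cos /wave_sin; ring.
Qed.

Lemma continuous_wave f g s th : continuous f -> continuous g ->
  continuous (wave_cos f g s th) /\ continuous (wave_sin f g s th).
Proof.
move=> cf cg.
have cfg w : {for w, continuous (fun w : pt => f w.1 * g w.2)}.
  apply: cvgM; first by apply: (@continuous_comp _ _ _ fst f); [exact: continuous_fst|exact: cf].
  by apply: (@continuous_comp _ _ _ snd g); [exact: continuous_snd|exact: cg].
have ce w : {for w, continuous (fun w : pt => expR (- (s * w.2)))}.
  apply: (@continuous_comp _ _ _ (fun w : pt => - (s * w.2)) (@expR R)); last exact: continuous_expR.
  by apply: cvgN; apply: cvgM; [exact: cvg_cst|exact: continuous_snd].
have cl w : {for w, continuous (fun w : pt => s * w.1 + th)}.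
  by apply: cvgD; [apply: cvgM; [exact: cvg_cst|exact: continuous_fst]|exact: cvg_cst].
split=> w; apply: cvgM; try exact: cfg; apply: cvgM; try exact: ce.
  by apply: (@continuous_comp _ _ _ (fun w : pt => s * w.1 + th)); [exact: cl|exact: continuous_cos].
by apply: (@continuous_comp _ _ _ (fun w : pt => s * w.1 + th)); [exact: cl|exact: continuous_sin].
Qed.

Lemma wave_sqr f g s th w : wave_cos f g s th w ^+ 2 + wave_sin f g s th w ^+ 2 =
  (f w.1 * g w.2 * expR (- (s * w.2))) ^+ 2.
Proof.
rewrite /wave_cos /wave_sin !mulrA; set E := _ * expR _.
by rewrite !exprMn -mulrDr cos2Dsin2 mulr1.
Qed.

Lemma wave_expR_le s (y : R) : 0 <= y <= pi -> expR (- (s * y)) <= expR (`|s| * pi).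
Proof.
move=> /andP[y0 y1]; rewrite ler_expR; apply: (@le_trans _ _ (`|s| * y)).
  by rewrite -mulNr ler_wpM2r// -normrN ler_norm.
by rewrite ler_wpM2l.
Qed.

End waves.

Lemma norm_le_sqr (R : realType) (g : R) : `|g| <= 1 + g ^+ 2.
Proof.
by rewrite -(real_normK (num_real g)); have := sqr_ge0 (`|g| - 1); have := normr_ge0 g; nra.
Qed.

Lemma continuous_line1 (R : realType) (x y : R) : {for x, continuous (fun x : R => (x, y))}.
Proof.
have c1 : {for x, continuous (id : R -> R)} by exact: cvg_id.
have c2 : {for x, continuous (fun _ : R => y)} by exact: cvg_cst.
exact: (cvg_pair c1 c2).
Qed.

Lemma continuous_line2 (R : realType) (x y : R) : {for y, continuous (fun y : R => (x, y))}.
Proof.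
have c1 : {for y, continuous (id : R -> R)} by exact: cvg_id.
have c2 : {for y, continuous (fun _ : R => x)} by exact: cvg_cst.
exact: (cvg_pair c2 c1).
Qed.

Ltac nonneg := repeat first [done | exact: sqr_ge0 | exact: normr_ge0 | exact: expR_ge0 |
  exact: addr_ge0 (sqr_ge0 _) (sqr_ge0 _) | apply: mulr_ge0 | apply: addr_ge0 ].

(** * The estimate in the interior of the strip *)

Section interior_estimate.
Context {R : realType}.
Local Notation mu := (@lebesgue_measure R).
Local Notation lam := (area R).
Local Notation pt := (R * R)%type.
Implicit Types (z w : pt).
Variables (ta D ta' D' : R) (F : pt -> pt) (a1 b1 a2 b2 : pt -> R) (C : R).
Hypotheses (D0 : 0 < D < 2 * pi) (D0' : 0 < D' < 2 * pi).
Hypotheses (cF : forall z, unit_disk R z -> {for z, continuous F})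
  (FD : forall z, unit_disk R z -> unit_disk R (F z)).
Hypotheses (ma1 : measurable_fun setT a1) (mb1 : measurable_fun setT b1)
  (ma2 : measurable_fun setT a2) (mb2 : measurable_fun setT b2).
Hypothesis dF : {ae lam, forall z, unit_disk R z ->
  has_differential (fun w => (F w).1) (a1 z) (b1 z) z /\
  has_differential (fun w => (F w).2) (a2 z) (b2 z) z}.
Hypothesis ac1 : forall s t : R, 0 < s -> 0 < t -> s ^+ 2 + t ^+ 2 < 1 ->
  {ae mu, forall y, `|y| <= t -> abs_continuous (fun x => F (x, y)) (- s) s}.
Hypothesis ac2 : forall s t : R, 0 < s -> 0 < t -> s ^+ 2 + t ^+ 2 < 1 ->
  {ae mu, forall x, `|x| <= t -> abs_continuous (fun y => F (x, y)) (- s) s}.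
Let e := grad_sqr a1 b1 a2 b2.
Hypothesis energy : forall rho : pt -> R, (forall w, 0 <= rho w) ->
  (forall w, unit_disk R w -> {for w, continuous rho}) ->
  (\int[lam]_(z in unit_disk R) (rho (F z) * e z)%:E <= C%:E * \int[lam]_(z in unit_disk R) (rho z)%:E)%E.

Let mD : measurable (unit_disk R : set (measurableTypeR R * measurableTypeR R)).
Proof. exact: open_measurable_plane (@open_unit_disk R). Qed.

Let lamD : (lam (unit_disk R) < +oo)%E.
Proof.
have -> : unit_disk R = disc 0 1 by apply/seteqP; split => z; rewrite /disc /unit_disk /= subr0.
exact: area_disc1_lty.
Qed.

Let e_ge0 z : 0 <= e z.
Proof. by rewrite /e /grad_sqr !addr_ge0// sqr_ge0. Qed.

Let mc (f : pt -> R) : (forall z, unit_disk R z -> {for z, continuous f}) -> measurable_fun (unit_disk R) f.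
Proof. by apply: continuous_measurable_plane; exact: open_unit_disk. Qed.

Let mS (f : pt -> R) : measurable_fun setT f -> measurable_fun (unit_disk R) f.
Proof. exact: (measurable_funS measurableT (@subsetT _ _)). Qed.

Let me : measurable_fun (unit_disk R) e.
Proof.
by apply: mS; apply: measurable_funD; apply: measurable_funD; apply: measurable_funX.
Qed.

Let ccF (f : pt -> R) : (forall z, unit_disk R z -> {for z, continuous f}) ->
  forall z, unit_disk R z -> {for z, continuous (fun z => f (F z))}.
Proof.
by move=> cf z z1; apply: (@continuous_comp _ _ _ F f); [exact: cF|exact/cf/FD].
Qed.

Section composite.
Variables (Psi P Q rho : pt -> R).
Hypotheses (dPsi : forall z, unit_disk R z -> has_differential Psi (P z) (Q z) z)
  (cP : forall z, unit_disk R z -> {for z, continuous P})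
  (cQ : forall z, unit_disk R z -> {for z, continuous Q})
  (crho : forall z, unit_disk R z -> {for z, continuous rho})
  (rho0 : forall z, 0 <= rho z)
  (hrho : forall z, unit_disk R z -> P z ^+ 2 + Q z ^+ 2 <= rho z)
  (irho : (\int[lam]_(z in unit_disk R) (rho z)%:E < +oo)%E).

Let cPsi z : unit_disk R z -> {for z, continuous Psi}.
Proof. by move=> /dPsi/has_differential_continuous. Qed.

(** An integrable majorant for the gradient of [Psi \o F]: each of its components [g] satisfies
    [|g| <= 1 + g^2], and [g^2] is at most [rho (F z) * e z]. *)
Let ienergy : lam.-integrable (unit_disk R) (EFin \o (fun z => 1 + rho (F z) * e z)).
Proof.
have m1 : measurable_fun (unit_disk R) (fun z => rho (F z) * e z).
  by apply: measurable_funM => //; apply: mc; exact: ccF.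
apply/integrableP; split.
  by apply/measurable_EFinP; apply: measurable_funD => //; exact: measurable_cst.
have E : (\int[lam]_(z in unit_disk R) `|(EFin \o (fun z => (1 + rho (F z) * e z)%R)) z| =
    \int[lam]_(z in unit_disk R) (1%:E + (rho (F z) * e z)%:E))%E.
  by apply: eq_integral => z _; rewrite /= ger0_norm ?addr_ge0// mulr_ge0.
rewrite E; have -> : (\int[lam]_(z in unit_disk R) (1%:E + (rho (F z) * e z)%:E) =
    \int[lam]_(z in unit_disk R) 1%:E + \int[lam]_(z in unit_disk R) (rho (F z) * e z)%:E)%E.
  rewrite (@ge0_integralD _ _ _ lam _ mD)//; try exact/measurable_EFinP.
  by move=> z _; rewrite lee_fin mulr_ge0.
rewrite (@integral_cst _ _ _ lam _ mD) mul1e lte_add_pinfty//.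
apply: (le_lt_trans (energy rho0 crho)).
apply: (@le_lt_trans _ _ (`|C|%:E * \int[lam]_(z in unit_disk R) (rho z)%:E)%E).
  by apply: lee_wpmul2r; [apply: integral_ge0 => z _; rewrite lee_fin|rewrite lee_fin ler_norm].
by rewrite lte_mul_pinfty// lee_fin.
Qed.

Let integrable_comp (x y : pt -> R) : measurable_fun setT x -> measurable_fun setT y ->
  (forall z, x z ^+ 2 + y z ^+ 2 <= e z) ->
  lam.-integrable (unit_disk R) (EFin \o (fun z => P (F z) * x z + Q (F z) * y z)).
Proof.
move=> mx my xye; apply: (@le_integrable _ _ _ lam _ mD _ _ _ _ ienergy).
  apply/measurable_EFinP; apply: measurable_funD; apply: measurable_funM; try exact: mS.
    by apply: mc; exact: ccF.
  by apply: mc; exact: ccF.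
move=> z z1 /=; rewrite lee_fin [leRHS]ger0_norm; last by rewrite addr_ge0// mulr_ge0.
set g := _ + _.
have g2 : g ^+ 2 <= rho (F z) * e z.
  have h1 := hrho (FD z1); have h2 := xye z.
  have : g ^+ 2 <= (P (F z) ^+ 2 + Q (F z) ^+ 2) * (x z ^+ 2 + y z ^+ 2).
    rewrite -subr_ge0 (_ : _ - _ = (P (F z) * y z - Q (F z) * x z) ^+ 2) ?sqr_ge0//.
    by rewrite /g; ring.
  by move=> /le_trans; apply; apply: ler_pM => //; rewrite addr_ge0// sqr_ge0.
by apply: le_trans (norm_le_sqr g) _; rewrite lerD2l.
Qed.

Let lipchain (h : R -> pt) (s : R) : (forall x, - s <= x <= s -> unit_disk R (h x)) ->
  (forall x, - s <= x <= s -> {for x, continuous h}) ->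
  abs_continuous h (- s) s -> abs_continuousR (fun x => Psi (h x)) (- s) s.
Proof.
move=> hD ch hac.
have [r [r1 hr]] : exists r : R, r < 1 /\ forall x, - s <= x <= s -> cmod (h x) <= r.
  have [s0|s0] := leP (- s) s; last first.
    by exists 0; split => // x /andP[x1 x2]; exfalso; move: (le_lt_trans (le_trans x1 x2) s0); rewrite ltxx.
  have cc : {within `[- s, s], continuous (fun x => cmod (h x))}.
    apply: continuous_in_subspaceT => x; rewrite inE /= in_itv /= => xs.
    apply: (@continuous_comp _ _ _ h (@cmod R)); first exact: ch.
    apply/cts_normP => ep ep0; exists ep => // w wz.
    rewrite (le_lt_trans _ wz)// ler_norml cmodBB andbT lerNl opprB cmodC.
    exact: cmodBB.
  have [c + cmax] := EVT_max s0 cc; rewrite in_itv /= => cs.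
  exists (cmod (h c)); split; first exact: hD.
  by move=> x xs; apply: cmax; rewrite in_itv.
have [K K0 hK] := lipschitz_on_disc r1 dPsi cP cQ.
apply: abs_continuous_chain hac => s' t' ss ts st'; exists K => // x y sx xy yt.
by apply: hK; apply: hr; apply/andP; split; lra.
Qed.

Let disk_line (s t x y : R) : 0 < s -> 0 < t -> s ^+ 2 + t ^+ 2 < 1 -> `|x| <= s -> `|y| <= t ->
  x ^+ 2 + y ^+ 2 < 1.
Proof.
move=> s0 t0 st; rewrite !ler_norml => /andP[x1 x2] /andP[y1 y2].
by apply: le_lt_trans st; apply: lerD; nra.
Qed.

(** Everything that [weak_identity] requires of [Psi \o F]. On a segment inside the disk [F] stays
    in a compact disc, where [Psi] is Lipschitz, and this preserves absolute continuity;
    integrability comes from the energy bound with a weight [rho] that dominates the squared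
    gradient of [Psi]. *)
Lemma composite_regular : let u z := Psi (F z) in
  let g1 z := P (F z) * a1 z + Q (F z) * a2 z in
  let g2 z := P (F z) * b1 z + Q (F z) * b2 z in
  [/\ (forall z, unit_disk R z -> {for z, continuous u}),
      (measurable_fun (unit_disk R) g1 /\ measurable_fun (unit_disk R) g2),
      (lam.-integrable (unit_disk R) (EFin \o g1) /\ lam.-integrable (unit_disk R) (EFin \o g2)),
      ((forall s t : R, 0 < s -> 0 < t -> s ^+ 2 + t ^+ 2 < 1 ->
         {ae mu, forall y, `|y| <= t -> abs_continuousR (fun x => u (x, y)) (- s) s}) /\
       (forall s t : R, 0 < s -> 0 < t -> s ^+ 2 + t ^+ 2 < 1 ->
         {ae mu, forall x, `|x| <= t -> abs_continuousR (fun y => u (x, y)) (- s) s})) &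
      ({ae lam, forall z, unit_disk R z -> is_derive z.1 (1 : R) (fun t => u (t, z.2)) (g1 z)} /\
       {ae lam, forall z, unit_disk R z -> is_derive z.2 (1 : R) (fun t => u (z.1, t)) (g2 z)})].
Proof.
move=> u g1 g2; have i1 := integrable_comp ma1 ma2 _; have i2 := integrable_comp mb1 mb2 _.
have {}i1 : lam.-integrable (unit_disk R) (EFin \o g1).
  by apply: i1 => z; rewrite /e /grad_sqr; have := sqr_ge0 (b1 z); have := sqr_ge0 (b2 z); lra.
have {}i2 : lam.-integrable (unit_disk R) (EFin \o g2).
  by apply: i2 => z; rewrite /e /grad_sqr; have := sqr_ge0 (a1 z); have := sqr_ge0 (a2 z); lra.
have cut (x y : R) : x ^+ 2 + y ^+ 2 < 1 -> unit_disk R (x, y).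
  by move=> h; rewrite /unit_disk /= -(@expr_lt1 _ 2)// ?cmod_ge0// cmod_sqr.
split.
- exact: ccF.
- by split; [have /integrableP[/measurable_EFinP] := i1|have /integrableP[/measurable_EFinP] := i2].
- by [].
- split=> s t s0 t0 st.
    apply: ae_imply (ac1 s0 t0 st) => y hy yt.
    have dl x : - s <= x <= s -> unit_disk R (x, y).
      by move=> xs; apply: cut; apply: (disk_line s0 t0 st) => //; rewrite ler_norml.
    apply: (lipchain (h := fun x => F (x, y))); last exact: hy.
      by move=> x /dl/FD.
    move=> x /dl xD; apply: (@continuous_comp _ _ _ (fun x => (x, y)) F); last exact: cF.
    exact: continuous_line1.
  apply: ae_imply (ac2 s0 t0 st) => x hx xt.
  have dl y : - s <= y <= s -> unit_disk R (x, y).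
    by move=> ys; apply: cut; rewrite addrC; apply: (disk_line s0 t0 st) => //; rewrite ler_norml.
  apply: (lipchain (h := fun y => F (x, y))); last exact: hx.
    by move=> y /dl/FD.
  move=> y /dl yD; apply: (@continuous_comp _ _ _ (fun y => (x, y)) F); last exact: cF.
  exact: continuous_line2.
- have dall z : unit_disk R z -> has_differential (fun w => (F w).1) (a1 z) (b1 z) z ->
      has_differential (fun w => (F w).2) (a2 z) (b2 z) z -> has_differential u (g1 z) (g2 z) z.
    move=> z1 h1 h2.
    have dP : has_differential Psi (P (F z)) (Q (F z)) ((F z).1, (F z).2).
      by rewrite -surjective_pairing; exact/dPsi/FD.
    have := @has_differential_comp22 _ Psi (fun w => (F w).1) (fun w => (F w).2) _ _ _ _ _ _ z dP h1 h2.
    by apply: has_differential_ext => //; apply/funext => w; rewrite -surjective_pairing.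
  split; apply: ae_imply dF => z hz z1; have [h1 h2] := hz z1.
    exact: (has_differential_partial1 (dall z z1 h1 h2)).
  exact: (has_differential_partial2 (dall z z1 h1 h2)).
Qed.

End composite.

(** [chi] cuts off along the image strip, [eta] along the source strip and [ze] across it; [s] and
    [t] are the frequencies of the image wave and of the source wave. [b] controls the slope of
    [chi], [ep] the dilatation where [eta] is nonzero, and [I], [J] bound the masses of the
    majorants [rho1] and [etab]. *)
Variables (chi chi' eta eta' ze ze' rho1 etab : R -> R) (s t th b ep I J L d : R).
Hypotheses (dchi : forall x, is_derive x (1 : R) chi (chi' x)) (cchi' : continuous chi').
Hypotheses (deta : forall x, is_derive x (1 : R) eta (eta' x)) (ceta' : continuous eta').
Hypotheses (dze : forall x, is_derive x (1 : R) ze (ze' x)) (cze' : continuous ze').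
Hypotheses (d0 : 0 < d) (supp_ze : forall y, ~ (d <= y <= pi - d) -> ze y = 0 /\ ze' y = 0)
  (ze01 : forall y, 0 <= ze y <= 1).
Hypothesis supp_eta : forall x, L < `|x| -> eta x = 0 /\ eta' x = 0.
Hypotheses (crho1 : continuous rho1) (rho10 : forall x, 0 <= rho1 x)
  (chi_rho : forall x, chi x ^+ 2 <= rho1 x) (chi'_rho : forall x, chi' x ^+ 2 <= b ^+ 2 * rho1 x).
Hypotheses (cetab : continuous etab) (etab0 : forall x, 0 <= etab x)
  (eta_etab : forall x, eta x ^+ 2 <= etab x).
Hypotheses (hI : (\int[lam]_(w in open_strip) (rho1 w.1)%:E <= I%:E)%E)
  (hJ : (\int[lam]_(w in open_strip) (etab w.1)%:E <= J%:E)%E).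
Hypothesis window : {ae lam, forall z, unit_disk R z -> eta (strip_map ta D z).1 != 0 ->
  (a1 z - b2 z) ^+ 2 + (a2 z + b1 z) ^+ 2 <= ep ^+ 2 * ((a1 z + b2 z) ^+ 2 + (a2 z - b1 z) ^+ 2)}.
Hypothesis C0 : 0 <= C.

Let T := strip_map ta D.
Let T' := strip_map ta' D'.
Let one : R -> R := cst 1.
Let nul : R -> R := cst 0.
Let A' := strip_A ta' D'.
Let B' := strip_B ta' D'.
Let A := strip_A ta D.
Let B := strip_B ta D.
Let nu1 := wave_cos chi one s 0.
Let nu2 := wave_sin chi one s 0.
Let nx w := wave_cos chi' one s 0 w - s * wave_sin chi one s 0 w.
Let ny w := wave_cos chi nul s 0 w - s * wave_cos chi one s 0 w.
Let mx w := wave_sin chi' one s 0 w + s * wave_cos chi one s 0 w.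
Let my w := wave_sin chi nul s 0 w - s * wave_sin chi one s 0 w.
Let Psi1 z := nu1 (T' z).
Let Psi2 z := nu2 (T' z).
Let P1 z := nx (T' z) * A' z - ny (T' z) * B' z.
Let Q1 z := nx (T' z) * B' z + ny (T' z) * A' z.
Let P2 z := mx (T' z) * A' z - my (T' z) * B' z.
Let Q2 z := mx (T' z) * B' z + my (T' z) * A' z.
Let K := expR (`|s| * pi).
Let K1 := expR (`|t| * pi).
Let f1 := wave_cos eta ze t th.
Let f2 := wave_sin eta ze t th.

Let cont1 (f f' : R -> R) : (forall x, is_derive x (1 : R) f (f' x)) -> continuous f.
Proof. by move=> df x; apply: differentiable_continuous; apply/derivable1_diffP; case: (df x). Qed.

Let cchi : continuous chi := cont1 dchi.
Let ceta : continuous eta := cont1 deta.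
Let cze : continuous ze := cont1 dze.
Let cone : continuous one. Proof. by move=> x; exact: cvg_cst. Qed.
Let cnul : continuous nul. Proof. by move=> x; exact: cvg_cst. Qed.

Let cT z : unit_disk R z -> {for z, continuous T}.
Proof. by move=> z1; apply: continuous_strip_map; exact: disk_strip_dom. Qed.
Let cT' z : unit_disk R z -> {for z, continuous T'}.
Proof. by move=> z1; apply: continuous_strip_map; exact: disk_strip_dom. Qed.

Let cnx : continuous nx.
Proof.
move=> w; apply: cvgB; first exact: (continuous_wave s 0 cchi' cone).1.
by apply: cvgM; [exact: cvg_cst|exact: (continuous_wave s 0 cchi cone).2].
Qed.
Let cny : continuous ny.
Proof.
move=> w; apply: cvgB; first exact: (continuous_wave s 0 cchi cnul).1.
by apply: cvgM; [exact: cvg_cst|exact: (continuous_wave s 0 cchi cone).1].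
Qed.
Let cmx : continuous mx.
Proof.
move=> w; apply: cvgD; first exact: (continuous_wave s 0 cchi' cone).2.
by apply: cvgM; [exact: cvg_cst|exact: (continuous_wave s 0 cchi cone).1].
Qed.
Let cmy : continuous my.
Proof.
move=> w; apply: cvgB; first exact: (continuous_wave s 0 cchi cnul).2.
by apply: cvgM; [exact: cvg_cst|exact: (continuous_wave s 0 cchi cone).2].
Qed.

Let coT' (f : pt -> R) z : continuous f -> unit_disk R z -> {for z, continuous (fun z => f (T' z))}.
Proof. by move=> cf z1; apply: (@continuous_comp _ _ _ T' f); [exact: cT'|exact: cf]. Qed.

Let cAB' z : unit_disk R z -> {for z, continuous A'} /\ {for z, continuous B'}.
Proof. exact: continuous_strip_AB. Qed.

Let cPQ z : unit_disk R z -> [/\ {for z, continuous P1}, {for z, continuous Q1},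
  {for z, continuous P2} & {for z, continuous Q2}].
Proof.
move=> z1; have [cA cB] := cAB' z1.
by split; [apply: cvgB|apply: cvgD|apply: cvgB|apply: cvgD]; apply: cvgM => //; exact: coT'.
Qed.

Let dwave w : has_differential nu1 (nx w) (ny w) w /\ has_differential nu2 (mx w) (my w) w.
Proof.
have done : is_derive w.2 (1 : R) one (nul w.2) by exact: is_derive_cst.
exact: (has_differential_wave s 0 (dchi _) done).
Qed.

Let dPsi z : unit_disk R z -> has_differential Psi1 (P1 z) (Q1 z) z /\ has_differential Psi2 (P2 z) (Q2 z) z.
Proof.
move=> z1; have dz := @disk_strip_dom _ ta' D' z z1.
have hx := has_differential_strip_x dz; have hy := has_differential_strip_y dz.
have [h1 h2] := dwave (T' z).
split.
  have := @has_differential_comp22 _ nu1 (strip_x ta' D') (strip_y ta' D') _ _ _ _ _ _ z h1 hx hy.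
  by apply: has_differential_ext => //; rewrite mulrN.
have := @has_differential_comp22 _ nu2 (strip_x ta' D') (strip_y ta' D') _ _ _ _ _ _ z h2 hx hy.
by apply: has_differential_ext => //; rewrite mulrN.
Qed.

Let E z := expR (- (s * (T' z).2)).

Let EK z : unit_disk R z -> E z ^+ 2 <= K ^+ 2.
Proof.
move=> z1; rewrite (@ler_pXn2r _ 2)// ?nnegrE ?expR_ge0//; apply: wave_expR_le.
by have [/andP[h1 h2] _] := strip_map_disk ta' D0' z1; rewrite !ltW.
Qed.

(** A majorant for the squared gradients of [Psi1] and [Psi2]. The conformal factor stands in front
    so that its integral over the disk becomes an integral of [rho1] over the strip. *)
Let rho z := strip_om ta' D' z * (K ^+ 2 * (2 * b ^+ 2 + 3 * s ^+ 2) * rho1 (T' z).1).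

Let om'0 z : 0 <= strip_om ta' D' z.
Proof. by rewrite addr_ge0// sqr_ge0. Qed.

Let rho_ge0 z : 0 <= rho z.
Proof.
by apply: mulr_ge0; [exact: om'0|nonneg].
Qed.

Let rho_bound z : unit_disk R z -> P1 z ^+ 2 + Q1 z ^+ 2 <= rho z /\ P2 z ^+ 2 + Q2 z ^+ 2 <= rho z.
Proof.
move=> z1; have ek := EK z1; set x := (T' z).1.
have h1 := chi_rho x; have h2 := chi'_rho x; have h0 := rho10 x.
have e0 : 0 <= E z ^+ 2 by exact: sqr_ge0.
have gen (u v : R) : u ^+ 2 + v ^+ 2 <= E z ^+ 2 * (2 * chi' x ^+ 2 + 3 * s ^+ 2 * chi x ^+ 2) ->
    (u * A' z - v * B' z) ^+ 2 + (u * B' z + v * A' z) ^+ 2 <= rho z.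
  move=> uv; have -> : (u * A' z - v * B' z) ^+ 2 + (u * B' z + v * A' z) ^+ 2 =
     strip_om ta' D' z * (u ^+ 2 + v ^+ 2) by rewrite /strip_om -/A' -/B'; ring.
  apply: ler_wpM2l => //; apply: (le_trans uv); rewrite -[leRHS]mulrA; apply: ler_pM => //.
    by nonneg.
  rewrite -/x [leRHS]mulrDl; apply: lerD; first by rewrite -[leRHS]mulrA ler_wpM2l.
  by apply: ler_wpM2l => //; nonneg.
set c := cos (s * x + 0); set sn := sin (s * x + 0).
have cs : c ^+ 2 + sn ^+ 2 = 1 := cos2Dsin2 _.
have bnd : forall p q c sn : R, c ^+ 2 + sn ^+ 2 = 1 ->
   (p * c - q * sn) ^+ 2 + (q * c) ^+ 2 <= 2 * p ^+ 2 + 3 * q ^+ 2.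
  move=> p q {}c {}sn {}cs; have c1 : c ^+ 2 <= 1 by have := sqr_ge0 sn; lra.
  rewrite -subr_ge0 (_ : _ - _ = (p * c + q * sn) ^+ 2 + 2 * p ^+ 2 * (1 - c ^+ 2) + 
     (3 * q ^+ 2 - 2 * q ^+ 2 * sn ^+ 2 - q ^+ 2 * c ^+ 2)); last by ring.
  have -> : sn ^+ 2 = 1 - c ^+ 2 by lra.
  have := sqr_ge0 (p * c + q * sn); have := sqr_ge0 p; have := sqr_ge0 q; nra.
split; apply: gen.
  have := bnd (chi' x) (s * chi x) c sn cs.
  rewrite /nx /ny /wave_cos /wave_sin /one /nul /cst -/x -/(E z) -/c -/sn => h.
  rewrite (_ : _ + _ = E z ^+ 2 * ((chi' x * c - s * chi x * sn) ^+ 2 + (s * chi x * c) ^+ 2)); last by ring.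
  have -> : 2 * chi' x ^+ 2 + 3 * s ^+ 2 * chi x ^+ 2 = 2 * chi' x ^+ 2 + 3 * (s * chi x) ^+ 2 by ring.
  exact: ler_wpM2l.
have := bnd (chi' x) (- (s * chi x)) sn c; rewrite addrC cs => /(_ erefl).
rewrite /mx /my /wave_cos /wave_sin /one /nul /cst -/x -/(E z) -/c -/sn => h.
rewrite (_ : _ + _ = E z ^+ 2 * ((chi' x * sn - - (s * chi x) * c) ^+ 2 + (- (s * chi x) * sn) ^+ 2)); last by ring.
have -> : 2 * chi' x ^+ 2 + 3 * s ^+ 2 * chi x ^+ 2 = 2 * chi' x ^+ 2 + 3 * (- (s * chi x)) ^+ 2 by ring.
exact: ler_wpM2l.
Qed.

Let rhoF z := rho1 (T' z).1 * strip_om ta' D' z.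

Let crho1' z : unit_disk R z -> {for z, continuous (fun z => rho1 (T' z).1)}.
Proof.
move=> z1; apply: (@continuous_comp _ _ _ (fun z => (T' z).1) rho1); last exact: crho1.
by apply: (@continuous_comp _ _ _ T' fst); [exact: cT'|exact: continuous_fst].
Qed.

Let crhoF z : unit_disk R z -> {for z, continuous rhoF}.
Proof. by move=> z1; apply: cvgM; [exact: crho1'|exact: continuous_strip_om]. Qed.

Let rhoF0 z : 0 <= rhoF z.
Proof. by rewrite mulr_ge0// om'0. Qed.

Let int_rhoF : (\int[lam]_(z in unit_disk R) (rhoF z)%:E <= I%:E)%E.
Proof.
rewrite /rhoF (@strip_change_ge0 _ _ _ D0' (fun w => rho1 w.1))// => w _.
by apply: (@continuous_comp _ _ _ fst rho1); [exact: continuous_fst|exact: crho1].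
Qed.

Let int_etab : (\int[lam]_(z in unit_disk R) (etab (T z).1 * strip_om ta D z)%:E <= J%:E)%E.
Proof.
rewrite (@strip_change_ge0 _ _ _ D0 (fun w => etab w.1))// => w _.
by apply: (@continuous_comp _ _ _ fst etab); [exact: continuous_fst|exact: cetab].
Qed.

Let crho z : unit_disk R z -> {for z, continuous rho}.
Proof.
move=> z1; apply: cvgM; first exact: continuous_strip_om.
by apply: cvgM; [exact: cvg_cst|exact: crho1'].
Qed.

Let irho : (\int[lam]_(z in unit_disk R) (rho z)%:E < +oo)%E.
Proof.
pose k := K ^+ 2 * (2 * b ^+ 2 + 3 * s ^+ 2).
have k0 : 0 <= k by nonneg.
have -> : (\int[lam]_(z in unit_disk R) (rho z)%:E =
    \int[lam]_(z in unit_disk R) (k%:E * (rhoF z)%:E))%E.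
  by apply: eq_integral => z _; rewrite -EFinM /rho /rhoF -/k; congr (_%:E); ring.
rewrite (@ge0_integralZl _ _ _ lam _ mD); last 3 first.
- by apply/measurable_EFinP; apply: mc; exact: crhoF.
- by move=> z _; rewrite lee_fin.
- by rewrite lee_fin.
apply: (@le_lt_trans _ _ (k%:E * I%:E)%E); last by rewrite -EFinM ltry.
by apply: lee_wpmul2l; rewrite ?lee_fin.
Qed.

Let supp_wave w : ~ in_box L d w ->
  [/\ f1 w = 0, wave_cos eta' ze t th w - t * wave_sin eta ze t th w = 0 &
      wave_cos eta ze' t th w - t * wave_cos eta ze t th w = 0] /\
  [/\ f2 w = 0, wave_sin eta' ze t th w + t * wave_cos eta ze t th w = 0 &
      wave_sin eta ze' t th w - t * wave_sin eta ze t th w = 0].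
Proof.
move=> nb; have [w1|w1] := ltP L `|w.1|.
  have [e1 e2] := supp_eta w1.
  by rewrite /f1 /f2 /wave_cos /wave_sin e1 e2; split; split; ring.
have [e1 e2] : ze w.2 = 0 /\ ze' w.2 = 0 by apply: supp_ze => w2; apply: nb.
by rewrite /f1 /f2 /wave_cos /wave_sin e1 e2; split; split; ring.
Qed.

Let df w : has_differential f1 (wave_cos eta' ze t th w - t * wave_sin eta ze t th w)
    (wave_cos eta ze' t th w - t * wave_cos eta ze t th w) w /\
  has_differential f2 (wave_sin eta' ze t th w + t * wave_cos eta ze t th w)
    (wave_sin eta ze' t th w - t * wave_sin eta ze t th w) w.
Proof. exact: has_differential_wave. Qed.

(** Of the squared Cauchy-Riemann defect, the part with [ep ^+ 2] comes from the dilatation of [F],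
    and the remaining [b ^+ 2] from the cutoff [chi], which is not holomorphic. *)
Let Kc := K ^+ 2 * ((b ^+ 2 + 4 * s ^+ 2) * ep ^+ 2 + b ^+ 2).

Let defect z (u := F z) : unit_disk R u -> eta (T z).1 != 0 ->
  (a1 z - b2 z) ^+ 2 + (a2 z + b1 z) ^+ 2 <= ep ^+ 2 * ((a1 z + b2 z) ^+ 2 + (a2 z - b1 z) ^+ 2) ->
  ((P1 u * a1 z + Q1 u * a2 z) - (P2 u * b1 z + Q2 u * b2 z)) ^+ 2 +
  ((P1 u * b1 z + Q1 u * b2 z) + (P2 u * a1 z + Q2 u * a2 z)) ^+ 2 <= Kc * (rhoF u * e z).
Proof.
move=> u1 _ hd; have := defect_bound (a1 z) (b1 z) (a2 z) (b2 z) (A' u) (B' u)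
  (nx (T' u)) (ny (T' u)) (mx (T' u)) (my (T' u)).
rewrite -/(P1 u) -/(Q1 u) -/(P2 u) -/(Q2 u) => /le_trans; apply.
set x := (T' u).1; set cs := cos (s * x + 0); set sn := sin (s * x + 0).
have CS : cs ^+ 2 + sn ^+ 2 = 1 := cos2Dsin2 _.
have E1 : (nx (T' u) + my (T' u)) ^+ 2 + (mx (T' u) - ny (T' u)) ^+ 2 =
    E u ^+ 2 * (chi' x ^+ 2 + 4 * s ^+ 2 * chi x ^+ 2).
  rewrite /nx /ny /mx /my /wave_cos /wave_sin /one /nul /cst -/x -/(E u) -/cs -/sn.
  transitivity ((cs ^+ 2 + sn ^+ 2) * (E u ^+ 2 * (chi' x ^+ 2 + 4 * s ^+ 2 * chi x ^+ 2))); first by ring.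
  by rewrite CS mul1r.
have E2 : (nx (T' u) - my (T' u)) ^+ 2 + (mx (T' u) + ny (T' u)) ^+ 2 = E u ^+ 2 * chi' x ^+ 2.
  rewrite /nx /ny /mx /my /wave_cos /wave_sin /one /nul /cst -/x -/(E u) -/cs -/sn.
  by transitivity ((cs ^+ 2 + sn ^+ 2) * (E u ^+ 2 * chi' x ^+ 2)); [ring|rewrite CS mul1r].
rewrite E1 E2; set Q4 := _ + (a2 z + b1 z) ^+ 2 in hd *; set P4 := _ + (a2 z - b1 z) ^+ 2 in hd *.
have P40 : 0 <= P4 by rewrite addr_ge0// sqr_ge0.
have Q40 : 0 <= Q4 by rewrite addr_ge0// sqr_ge0.
have eE : P4 + Q4 = 2 * e z by rewrite /P4 /Q4 /e /grad_sqr; ring.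
have r0 := rho10 x; have hc := chi_rho x; have hc' := chi'_rho x; have ek := EK u1.
have k0 : 0 <= K ^+ 2 by exact: sqr_ge0.
have s0 : 0 <= 4 * s ^+ 2 by rewrite mulr_ge0// sqr_ge0.
have b0 : 0 <= b ^+ 2 by exact: sqr_ge0.
have e0 : 0 <= ep ^+ 2 by exact: sqr_ge0.
have H1 : E u ^+ 2 * (chi' x ^+ 2 + 4 * s ^+ 2 * chi x ^+ 2) <= K ^+ 2 * ((b ^+ 2 + 4 * s ^+ 2) * rho1 x).
  apply: ler_pM => //; [nonneg|nonneg|].
  by rewrite [leRHS]mulrDl; apply: lerD => //; rewrite ler_wpM2l.
have H2 : E u ^+ 2 * chi' x ^+ 2 <= K ^+ 2 * (b ^+ 2 * rho1 x).
  by apply: ler_pM; rewrite ?sqr_ge0.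
have H3 : E u ^+ 2 * (chi' x ^+ 2 + 4 * s ^+ 2 * chi x ^+ 2) * Q4 <=
    K ^+ 2 * ((b ^+ 2 + 4 * s ^+ 2) * rho1 x) * (ep ^+ 2 * P4).
  by apply: ler_pM => //; nonneg.
have H4 : E u ^+ 2 * chi' x ^+ 2 * P4 <= K ^+ 2 * (b ^+ 2 * rho1 x) * P4 by rewrite ler_wpM2r.
have -> : Kc * (rhoF u * e z) = strip_om ta' D' u / 2 *
   (K ^+ 2 * ((b ^+ 2 + 4 * s ^+ 2) * rho1 x) * (ep ^+ 2 * (P4 + Q4)) + K ^+ 2 * (b ^+ 2 * rho1 x) * (P4 + Q4)).
  by rewrite eE /Kc /rhoF -/x; field.
rewrite -/(strip_om ta' D' u); apply: ler_wpM2l; first by rewrite divr_ge0.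
have PQ : P4 <= P4 + Q4 by rewrite lerDl.
apply: (le_trans (lerD H3 H4)); apply: lerD; apply: ler_wpM2l => //; [nonneg| |nonneg].
exact: ler_wpM2l.
Qed.

(** A weak Cauchy formula for the wave transported by [F]: on one side the derivatives [eta'] and
    [ze'] of the source cutoffs, on the other the defect, which [pairing_bound] estimates with the
    free weight [q] between the energy of the image wave and the mass of the source wave. *)
Lemma interior_estimate (q : R) : 0 < q ->
  let Phi w := T' (F (strip_inv ta D w)) in
  exists c1 c2 : R, [/\
   (\int[lam]_(w in open_strip) (nu1 (Phi w) * (wave_cos eta' ze t th w - wave_sin eta ze' t th w))%:E = c1%:E)%E,
   (\int[lam]_(w in open_strip) (nu2 (Phi w) * - (wave_sin eta' ze t th w + wave_cos eta ze' t th w))%:E = c2%:E)%E &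
   `|c1 + c2| <= (q * (Kc * (C * I)) + K1 ^+ 2 * J / q) / 2].
Proof.
move=> q0 Phi.
have cPQ1 z (dz : unit_disk R z) : {for z, continuous P1} by have [] := cPQ dz.
have cPQ2 z (dz : unit_disk R z) : {for z, continuous Q1} by have [] := cPQ dz.
have cPQ3 z (dz : unit_disk R z) : {for z, continuous P2} by have [] := cPQ dz.
have cPQ4 z (dz : unit_disk R z) : {for z, continuous Q2} by have [] := cPQ dz.
have [cu1 [mg1 mg2] [ig1 ig2] [acx acy] [du1 du2]] := composite_regular
  (fun z dz => (dPsi dz).1) cPQ1 cPQ2 crho rho_ge0 (fun z dz => (rho_bound dz).1) irho.
have [cu2 [mh1 mh2] [ih1 ih2] [bcx bcy] [dv1 dv2]] := composite_regular
  (fun z dz => (dPsi dz).2) cPQ3 cPQ4 crho rho_ge0 (fun z dz => (rho_bound dz).2) irho.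
pose nf (f : pt -> R) w := - f w.
have dN (f p r : pt -> R) w : has_differential f (p w) (r w) w -> has_differential (nf f) (nf p w) (nf r w) w.
  exact: has_differentialN.
pose p1 w := wave_cos eta' ze t th w - t * wave_sin eta ze t th w.
pose r1 w := wave_cos eta ze' t th w - t * wave_cos eta ze t th w.
pose p2 w := wave_sin eta' ze t th w + t * wave_cos eta ze t th w.
pose r2 w := wave_sin eta ze' t th w - t * wave_sin eta ze t th w.
have cM (f : pt -> R) : continuous f -> continuous (fun w => t * f w).
  by move=> cf w; apply: cvgM; [exact: cvg_cst|exact: cf].
have cp1 : continuous p1.
  by move=> w; apply: cvgB; [exact: (continuous_wave t th ceta' cze).1|apply: cM; exact: (continuous_wave t th ceta cze).2].
have cr1 : continuous r1.
  by move=> w; apply: cvgB; [exact: (continuous_wave t th ceta cze').1|apply: cM; exact: (continuous_wave t th ceta cze).1].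
have cp2 : continuous p2.
  by move=> w; apply: cvgD; [exact: (continuous_wave t th ceta' cze).2|apply: cM; exact: (continuous_wave t th ceta cze).1].
have cr2 : continuous r2.
  by move=> w; apply: cvgB; [exact: (continuous_wave t th ceta cze').2|apply: cM; exact: (continuous_wave t th ceta cze).2].
have cn (f : pt -> R) : continuous f -> continuous (nf f).
  by move=> cf w; apply: cvgN; exact: cf.
have df1 w : has_differential f1 (p1 w) (r1 w) w by have [] := df w.
have df2 w : has_differential f2 (p2 w) (r2 w) w by have [] := df w.
have df1n w : has_differential (nf f1) (nf p1 w) (nf r1 w) w by exact: dN.
have df2n w : has_differential (nf f2) (nf p2 w) (nf r2 w) w by exact: dN.
have sup1 w : ~ in_box L d w -> [/\ f1 w = 0, p1 w = 0 & r1 w = 0] /\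
    [/\ nf f2 w = 0, nf p2 w = 0 & nf r2 w = 0].
  move=> /supp_wave[[e1 e2 e3] [e4 e5 e6]].
  by split; split => //; rewrite /nf ?/p2 ?/r2 ?e4 ?e5 ?e6 oppr0.
have sup2 w : ~ in_box L d w -> [/\ nf f2 w = 0, nf p2 w = 0 & nf r2 w = 0] /\
    [/\ nf f1 w = 0, nf p1 w = 0 & nf r1 w = 0].
  move=> /supp_wave[[e1 e2 e3] [e4 e5 e6]].
  by split; split; rewrite /nf ?/p2 ?/r2 ?/p1 ?/r1 ?e1 ?e2 ?e3 ?e4 ?e5 ?e6 oppr0.
(* The fields [(f1, - f2)] for the real part and [(- f2, - f1)] for the imaginary part are such that
   in their divergences the terms with [t] cancel, the source wave being holomorphic up to its
   cutoffs. *)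
have [i1 W1] := weak_identity ta D0 cu1 mg1 mg2 ig1 ig2 acx acy du1 du2 d0 df1 df2n cp1 cr1 (cn _ cp2) (cn _ cr2) sup1.
have [i2 W2] := weak_identity ta D0 cu2 mh1 mh2 ih1 ih2 bcx bcy dv1 dv2 d0 df2n df1n (cn _ cp2) (cn _ cr2) (cn _ cp1) (cn _ cr1) sup2.
set X1 := (fun z => _) in i1 W1; set X2 := (fun z => _) in i2 W2.
have fin (f : pt -> R) : lam.-integrable (unit_disk R) (EFin \o f) ->
    exists c : R, (\int[lam]_(z in unit_disk R) (f z)%:E = c%:E)%E.
  move=> /(@integrable_fin_num _ _ _ lam _ mD) h.
  by exists (fine (\int[lam]_(z in unit_disk R) (f z)%:E)%E); rewrite fineK.
have [d1 X1E] := fin _ i1; have [d2 X2E] := fin _ i2.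
exists (- d1), (- d2); split.
- rewrite EFinN -X1E W1 oppeK; apply: eq_integral => w _; congr (_%:E).
  by rewrite /Psi1 /p1 /nf /r2; congr (_ * _); ring.
- rewrite EFinN -X2E W2 oppeK; apply: eq_integral => w _; congr (_%:E).
  by rewrite /Psi2 /p2 /nf /r1; congr (_ * _); ring.
rewrite -opprD normrN -lee_fin.
have -> : (`|d1 + d2|%:E = `|\int[lam]_(z in unit_disk R) (X1 z + X2 z)%:E|)%E.
  by rewrite (@integralD _ _ _ lam _ mD _ _ i1 i2) X1E X2E.
have i12 : lam.-integrable (unit_disk R) (EFin \o (fun z => X1 z + X2 z)).
  exact: (@integrableD _ _ _ lam _ mD _ _ i1 i2).
have [mX _] := integrableP _ _ _ i12.
apply: (le_trans (@le_abse_integral _ _ _ lam _ _ mD mX)).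
have m1 : measurable_fun (unit_disk R) (fun z => rhoF (F z) * e z).
  by apply: measurable_funM => //; apply: mc; apply: ccF; exact: crhoF.
have m2 : measurable_fun (unit_disk R) (fun z => etab (T z).1 * strip_om ta D z).
  apply: mc => z z1; apply: cvgM; last exact: continuous_strip_om.
  apply: (@continuous_comp _ _ _ (fun z => (T z).1) etab); last exact: cetab.
  by apply: (@continuous_comp _ _ _ T fst); [exact: cT|exact: continuous_fst].
pose k1 := q * Kc / 2; pose k2 := K1 ^+ 2 / q / 2.
have Kc0 : 0 <= Kc by rewrite /Kc; nonneg.
have k10 : 0 <= k1 by rewrite divr_ge0// mulr_ge0// ltW.
have k20 : 0 <= k2 by rewrite !divr_ge0// ?sqr_ge0// ltW.
have om0 z : 0 <= strip_om ta D z by rewrite addr_ge0// sqr_ge0.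
apply: (@le_trans _ _ (\int[lam]_(z in unit_disk R) (k1%:E * (rhoF (F z) * e z)%:E +
    k2%:E * (etab (T z).1 * strip_om ta D z)%:E))%E).
  apply: (@ae_ge0_le_integral _ _ _ lam _ mD).
  - by move=> z _; rewrite abse_ge0.
  - exact: measurableT_comp.
  - by move=> z _; rewrite -!EFinM -EFinD lee_fin addr_ge0// mulr_ge0// mulr_ge0.
  - by apply: emeasurable_funD; apply: measurable_funeM; exact/measurable_EFinP.
  apply: ae_imply window => z hz z1; rewrite /= -EFinD lee_fin.
  set u := F z; have u1 : unit_disk R u := FD z1.
  have re : 0 <= rhoF u * e z by rewrite mulr_ge0.
  have eo : 0 <= etab (T z).1 * strip_om ta D z by rewrite mulr_ge0.
  have XE : X1 z + X2 z = ((P1 u * a1 z + Q1 u * a2 z) * (f1 (T z) * A z + f2 (T z) * B z) +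
      (P1 u * b1 z + Q1 u * b2 z) * (f1 (T z) * B z - f2 (T z) * A z)) +
    ((P2 u * a1 z + Q2 u * a2 z) * (- f2 (T z) * A z + f1 (T z) * B z) +
      (P2 u * b1 z + Q2 u * b2 z) * (- f2 (T z) * B z - f1 (T z) * A z)).
    by rewrite /X1 /X2 /nf -/A -/B -/T -/u; ring.
  (* The dilatation is small only where [eta] is nonzero; elsewhere the test field vanishes and
     there is nothing to estimate. *)
  rewrite XE; have [eta0|eta0] := eqVneq (eta (T z).1) 0.
    have f10 : f1 (T z) = 0 by rewrite /f1 /wave_cos eta0 !mul0r.
    have f20 : f2 (T z) = 0 by rewrite /f2 /wave_sin eta0 !mul0r.
    rewrite f10 f20 oppr0 !mul0r subr0 !addr0 !mulr0 !addr0.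
    by rewrite normr0 addr_ge0// mulr_ge0.
  apply: (le_trans (pairing_bound _ _ _ _ _ _ _ _ q0)).
  have h1 := defect u1 eta0 (hz z1 eta0).
  have h2 : (A z ^+ 2 + B z ^+ 2) * (f1 (T z) ^+ 2 + f2 (T z) ^+ 2) / q <=
     K1 ^+ 2 / q * (etab (T z).1 * strip_om ta D z).
    rewrite /f1 /f2 wave_sqr -/(strip_om ta D z) exprMn exprMn.
    have [/andP[y1 y2] _] := strip_map_disk ta D0 z1.
    have yr : 0 <= (T z).2 <= pi by rewrite !ltW.
    have E1 : expR (- (t * (T z).2)) ^+ 2 <= K1 ^+ 2.
      by rewrite (@ler_pXn2r _ 2)// ?nnegrE ?expR_ge0//; exact: wave_expR_le.
    have z2 : ze (T z).2 ^+ 2 <= 1 by have /andP[? ?] := ze01 (T z).2; rewrite expr_le1.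
    have H : eta (T z).1 ^+ 2 * ze (T z).2 ^+ 2 * expR (- (t * (T z).2)) ^+ 2 <= etab (T z).1 * 1 * K1 ^+ 2.
      apply: ler_pM; [nonneg|exact: sqr_ge0| |exact: E1].
      by apply: ler_pM => //; nonneg.
    rewrite mulr1 in H; rewrite [leRHS]mulrAC; apply: ler_wpM2r; first by rewrite invr_ge0 ltW.
    by rewrite [leRHS]mulrCA [leRHS]mulrA [leRHS]mulrC; exact: ler_wpM2l.
  have h3 := ler_wpM2l (ltW q0) h1.
  rewrite ler_pdivrMr// /k1 /k2 -/u (le_trans (lerD h3 h2))//.
  by rewrite le_eqVlt; apply/orP; left; apply/eqP; rewrite -/(rhoF u); field; rewrite gt_eqF.
rewrite (@ge0_integralD _ _ _ lam _ mD); last 4 first.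
- by move=> z _; rewrite -EFinM lee_fin mulr_ge0// mulr_ge0.
- by apply: measurable_funeM; exact/measurable_EFinP.
- by move=> z _; rewrite -EFinM lee_fin mulr_ge0// mulr_ge0.
- by apply: measurable_funeM; exact/measurable_EFinP.
rewrite !(@ge0_integralZl _ _ _ lam _ mD); try exact/measurable_EFinP; rewrite ?lee_fin//; last 2 first.
- by move=> z _; rewrite lee_fin mulr_ge0.
- by move=> z _; rewrite lee_fin mulr_ge0.
have en := le_trans (energy rhoF0 crhoF) (lee_wpmul2l (_ : (0 <= C%:E)%E) int_rhoF).
rewrite lee_fin in en; have {}en := en C0.
apply: (@le_trans _ _ (k1%:E * (C%:E * I%:E) + k2%:E * J%:E)%E).
  by apply: leeD; apply: lee_wpmul2l; rewrite ?lee_fin.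
rewrite -!EFinM -EFinD lee_fin /k1 /k2 le_eqVlt; apply/orP; left; apply/eqP; field.
by rewrite gt_eqF.
Qed.

End interior_estimate.

(** * Vertical cutoffs and kernels at the two boundary lines *)

Section kernels.
Context {R : realType}.
Local Notation mu := (@lebesgue_measure R).

Lemma integral_derive (F f : R -> R) (a b : R) : a < b ->
  (forall x, is_derive x (1 : R) F (f x)) -> continuous f ->
  (\int[mu]_(x in `[a, b]) (f x)%:E = (F b - F a)%:E)%E.
Proof.
move=> ab dF cf; have cF : continuous F.
  by move=> x; apply: differentiable_continuous; apply/derivable1_diffP; case: (dF x).
rewrite (@continuous_FTC2 _ f F)//.
- exact: continuous_subspaceT.
- split; first by move=> x _; case: (dF x).
    by apply: cvg_at_right_filter; exact: cF.
  by apply: cvg_at_left_filter; exact: cF.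
- by move=> x _; rewrite derive1E; case: (dF x).
Qed.

Lemma integral_translate (h : R -> R) (a b c : R) : a <= b -> continuous h ->
  (\int[mu]_(x in `[(a + c)%R, (b + c)%R]) (h x)%:E = \int[mu]_(x in `[a, b]) (h (x + c))%:E)%E.
Proof.
move=> ab ch; pose F x := x + c.
have dF x : is_derive x (1 : R) F 1.
  by have := is_deriveD (is_derive_id x (1 : R)) (is_derive_cst c x (1 : R)); rewrite addr0.
have F' : derive1 F = cst 1 by apply/funext => x; rewrite derive1E; case: (dF x).
have cF x : {for x, continuous F} by apply: cvgD; [exact: cvg_id|exact: cvg_cst].
rewrite (@integration_by_substitution_increasing _ F h a b)//.
- by apply: eq_integral => x _; rewrite F' /= mulr1.
- by move=> x y _ _ xy; rewrite ltrD2r.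
- by rewrite F' => x _; exact: cvg_cst.
- by rewrite F'; exact: is_cvg_cst.
- by rewrite F'; exact: is_cvg_cst.
- split; first by move=> x _; case: (dF x).
    by apply: cvg_at_right_filter; exact: cF.
  by apply: cvg_at_left_filter; exact: cF.
- exact: continuous_subspaceT.
Qed.

Lemma kernel_average (A : set (measurableTypeR R)) (k h : R -> R) (c e : R) : measurable A -> 0 <= e ->
  measurable_fun A k -> measurable_fun A h -> (forall y, A y -> 0 <= k y) ->
  (\int[mu]_(y in A) (k y)%:E = 1)%E ->
  (forall y, A y -> k y != 0 -> `|h y - c| <= e) ->
  mu.-integrable A (EFin \o (fun y => k y * h y)) /\
  exists2 v, (\int[mu]_(y in A) (k y * h y)%:E = v%:E)%E & `|v - c| <= e.
Proof.
move=> mA e0 mk mh k0 k1 he.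
have ik : mu.-integrable A (EFin \o k).
  apply/integrableP; split; first exact/measurable_EFinP.
  rewrite (_ : (\int[mu]_(x in A) _)%E = 1%E) ?ltry// -k1; apply: eq_integral => y.
  by rewrite inE => Ay /=; rewrite ger0_norm// k0.
have mkd : measurable_fun A (fun y => k y * (h y - c)).
  by apply: measurable_funM => //; apply: measurable_funB => //; exact: measurable_cst.
have bd y : A y -> `|k y * (h y - c)| <= e * k y.
  move=> Ay; rewrite normrM ger0_norm ?k0// mulrC.
  have [->|ky] := eqVneq (k y) 0; first by rewrite !mulr0.
  by rewrite ler_wpM2r ?k0// he.
have id' : mu.-integrable A (EFin \o (fun y => k y * (h y - c))).
  have i2 := integrableZl mA e ik.
  apply: (le_integrable mA _ _ i2); first exact/measurable_EFinP.
  by move=> y Ay /=; rewrite lee_fin (le_trans (bd y Ay))// ler_norm.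
have ic : mu.-integrable A (fun y => (c%:E * (k y)%:E)%E) by exact: integrableZl.
have E y : (k y * h y)%:E = (c%:E * (k y)%:E + (k y * (h y - c))%:E)%E.
  by rewrite -EFinM -EFinD; congr (_%:E); ring.
have ikh : mu.-integrable A (EFin \o (fun y => k y * h y)).
  by have := integrableD mA ic id'; apply: eq_integrable => // y _ /=; rewrite E.
split => //; pose v' := fine (\int[mu]_(y in A) (k y * (h y - c))%:E)%E.
have v'E : (\int[mu]_(y in A) (k y * (h y - c))%:E = v'%:E)%E.
  by rewrite fineK//; exact: integrable_fin_num.
exists (c + v').
  under eq_integral do rewrite E.
  by rewrite integralD// integralZl// k1 mule1 v'E.
rewrite addrC addKr -lee_fin.
have -> : (`|v'|%:E = `|\int[mu]_(y in A) (k y * (h y - c))%:E|)%E by rewrite v'E.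
apply: (le_trans (le_abse_integral mu mA _)); first exact/measurable_EFinP.
rewrite -[leRHS]mule1 -k1 -integralZl//; apply: ge0_le_integral => //.
- by apply: measurableT_comp => //; exact/measurable_EFinP.
- by apply: measurable_funeM; exact/measurable_EFinP.
Qed.

(** [strip_cutoff n] rises from 0 to 1 between [1 / n] and [2 / n] and falls symmetrically below
    [pi]. Its derivative is the difference of two probability densities that concentrate on the
    lines [y = 0] and [y = pi], so pairing with it yields boundary values. The ramps do not overlap
    when [2 <= n], because [2 <= pi]. *)
Definition bottom_kernel (n : nat) (y : R) : R := n%:R * smoothstep' (n%:R * y - 1).
Definition top_kernel (n : nat) (y : R) : R := n%:R * smoothstep' (n%:R * (pi - y) - 1).
Definition strip_cutoff (n : nat) (y : R) : R :=
  smoothstep (n%:R * y - 1) + smoothstep (n%:R * (pi - y) - 1) - 1.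
Definition strip_cutoff' (n : nat) (y : R) : R := bottom_kernel n y - top_kernel n y.

Lemma continuous_kernels n : continuous (bottom_kernel n) /\ continuous (top_kernel n).
Proof.
split=> y; apply: cvgM; try exact: cvg_cst.
  apply: (@continuous_comp _ _ _ (fun y : R => n%:R * y - 1)); last exact: continuous_smoothstep'.
  by apply: cvgB; [apply: cvgM; [exact: cvg_cst|exact: cvg_id]|exact: cvg_cst].
apply: (@continuous_comp _ _ _ (fun y : R => n%:R * (pi - y) - 1)); last exact: continuous_smoothstep'.
apply: cvgB; last exact: cvg_cst.
by apply: cvgM; [exact: cvg_cst|apply: cvgB; [exact: cvg_cst|exact: cvg_id]].
Qed.

Lemma is_derive_kernels n y :
  is_derive y (1 : R) (fun y => smoothstep (n%:R * y - 1)) (bottom_kernel n y) /\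
  is_derive y (1 : R) (fun y => - smoothstep (n%:R * (pi - y) - 1)) (top_kernel n y).
Proof.
have aff (p q : R) : is_derive y (1 : R) (fun y => p * y + q) p.
  apply/is_derive1_eps => e e0; exists e => // x _.
  have -> : p * x + q - (p * y + q) - p * (x - y) = 0 by ring.
  by rewrite normr0 mulr_ge0// ltW.
split.
  have h := @is_derive1_comp _ smoothstep (fun y => n%:R * y + -1) y _ _
    (is_derive_smoothstep (n%:R * y - 1)) (aff n%:R (-1)).
  by move: h; rewrite /bottom_kernel mulrC.
rewrite /top_kernel; set N : R := n%:R.
have -> : (fun y : R => - smoothstep (N * (pi - y) - 1)) =
    \- (smoothstep \o (fun y => - N * y + (N * pi - 1))).
  apply/funext => x; change (- smoothstep (N * (pi - x) - 1) = - smoothstep (- N * x + (N * pi - 1))).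
  by congr (- smoothstep _); ring.
have E : - N * y + (N * pi - 1) = N * (pi - y) - 1 by ring.
have ds := is_derive_smoothstep (- N * y + (N * pi - 1)).
have h := @is_derive1_comp _ smoothstep (fun y => - N * y + (N * pi - 1)) y _ _ ds
  (aff (- N) (N * pi - 1)).
have := is_deriveN h; rewrite E.
have -> : - (smoothstep' (N * (pi - y) - 1) * - N) = N * smoothstep' (N * (pi - y) - 1) by ring.
exact.
Qed.

Lemma is_derive_strip_cutoff n y : is_derive y (1 : R) (strip_cutoff n) (strip_cutoff' n y).
Proof.
have [h1 h2] := is_derive_kernels n y.
have h := is_deriveB (is_deriveB h1 h2) (is_derive_cst (1 : R) y (1 : R)).
move: h; rewrite subr0; congr (is_derive _ _ _ _).
by apply/funext => x; rewrite /strip_cutoff /= /GRing.add /= /GRing.opp /= opprK.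
Qed.

Lemma kernels_ge0 n y : 0 <= bottom_kernel n y /\ 0 <= top_kernel n y.
Proof.
have h (t : R) : 0 <= smoothstep' t by have [] := smoothstep_bounds t.
by rewrite /bottom_kernel /top_kernel; split; rewrite mulr_ge0.
Qed.

Lemma smoothstep'_le4 (t : R) : smoothstep' t <= 4.
Proof.
rewrite /smoothstep'; have p0 := pos_part_ge0 t.
have [t1|t1] := leP 1 t; first by have [_ h] := smoothstep_ge1 t1; move: h; rewrite /smoothstep' => ->.
have p1 : pos_part t <= 1 by rewrite /pos_part ge_max (ltW t1) ler01.
have := pos_part_one_sub_le1 (pos_part t); have := pos_part_ge0 (1 - pos_part t ^+ 2).
by nra.
Qed.

Lemma strip_cutoff'_le n y : `|strip_cutoff' n y| <= n%:R * 8.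
Proof.
have [b0 t0] := kernels_ge0 n y.
have n0 : 0 <= n%:R :> R by [].
have h1 : bottom_kernel n y <= n%:R * 4 by rewrite ler_wpM2l// smoothstep'_le4.
have h2 : top_kernel n y <= n%:R * 4 by rewrite ler_wpM2l// smoothstep'_le4.
by rewrite /strip_cutoff' ler_norml; apply/andP; split; lra.
Qed.

Lemma kernels_support n y : (0 < n)%N ->
  (bottom_kernel n y != 0 -> n%:R^-1 < y < 2 / n%:R) /\
  (top_kernel n y != 0 -> n%:R^-1 < pi - y < 2 / n%:R).
Proof.
move=> n0; have np : 0 < n%:R :> R by rewrite ltr0n.
have gen (t : R) : n%:R * smoothstep' (n%:R * t - 1) != 0 -> n%:R^-1 < t < 2 / n%:R.
  rewrite mulf_eq0 negb_or => /andP[_ h]; apply/andP; split.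
    rewrite ltNge; apply: contra h => h.
    have h1 : n%:R * t - 1 <= 0 by rewrite subr_le0 -ler_pdivlMl// mulr1.
    by rewrite (smoothstep_le0 h1).2.
  rewrite ltNge; apply: contra h => h.
  have h1 : 1 <= n%:R * t - 1 by rewrite lerBrDr -ler_pdivrMl// mulrC.
  by rewrite (smoothstep_ge1 h1).2.
by split; exact: gen.
Qed.

Lemma integral_kernels n : (2 <= n)%N ->
  (\int[mu]_(y in `]0%R, pi[) (bottom_kernel n y)%:E = 1)%E /\
  (\int[mu]_(y in `]0%R, pi[) (top_kernel n y)%:E = 1)%E.
Proof.
move=> n2; have n2' : 2 <= n%:R :> R by rewrite ler_nat.
have p2 : 2 <= (pi : R) by exact: pi_ge2.
have big : 1 <= n%:R * pi - 1 :> R by nra.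
have pi0 := pi_gt0 R.
have oo (k : R -> R) : continuous k -> (\int[mu]_(y in `]0%R, pi[) (k y)%:E = \int[mu]_(y in `[0%R, pi]) (k y)%:E)%E.
  move=> ck; have mk : measurable_fun setT (fun y => (k y)%:E).
    by apply/measurable_EFinP; exact: continuous_measurable_fun.
  by rewrite [RHS]integral_itv_bndoo//; exact: measurable_funTS.
have [cb ct] := continuous_kernels n.
have s1 := (smoothstep_ge1 big).1.
have s0 : smoothstep (n%:R * 0 - 1) = 0 :> R by rewrite mulr0 sub0r; apply: (smoothstep_le0 _).1; lra.
rewrite !oo//; split.
  have -> := integral_derive pi0 (fun y => (is_derive_kernels n y).1) cb.
  by rewrite s1 s0 subr0.
have -> := integral_derive pi0 (fun y => (is_derive_kernels n y).2) ct.
by rewrite subr0 subrr s1 s0 oppr0 sub0r opprK.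
Qed.

Lemma strip_cutoff_bounds n y : (2 <= n)%N -> 0 <= strip_cutoff n y <= 1.
Proof.
move=> n2; have n2' : 2 <= n%:R :> R by rewrite ler_nat.
have p2 : 2 <= (pi : R) by exact: pi_ge2.
have [b1 b2 _] := smoothstep_bounds (n%:R * y - 1).
have [t1 t2 _] := smoothstep_bounds (n%:R * (pi - y) - 1).
rewrite /strip_cutoff; have [yp|yp] := leP y (pi / 2).
  have h : 1 <= n%:R * (pi - y) - 1 by nra.
  by rewrite (smoothstep_ge1 h).1; apply/andP; split; lra.
have h : 1 <= n%:R * y - 1 by nra.
by rewrite (smoothstep_ge1 h).1; apply/andP; split; lra.
Qed.

Lemma strip_cutoff_support n y : (2 <= n)%N -> ~ (n%:R^-1 <= y <= pi - n%:R^-1) ->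
  strip_cutoff n y = 0 /\ strip_cutoff' n y = 0.
Proof.
move=> n2 h; have n2' : 2 <= n%:R :> R by rewrite ler_nat.
have n0 : 0 < n%:R :> R by lra.
have p2 : 2 <= (pi : R) by exact: pi_ge2.
have ni : n%:R * n%:R^-1 = 1 :> R by rewrite divff// gt_eqF.
have ni2 : n%:R^-1 <= 1 / 2 :> R by rewrite ler_pdivlMr// mulrC ler_pdivrMr ?mul1r//.
have [y1|y1] := ltP y n%:R^-1.
  have h1 : n%:R * y - 1 <= 0 by nra.
  have h2 : 1 <= n%:R * (pi - y) - 1 by nra.
  have [e1 e2] := smoothstep_le0 h1; have [e3 e4] := smoothstep_ge1 h2.
  by rewrite /strip_cutoff /strip_cutoff' /bottom_kernel /top_kernel e1 e2 e3 e4; split; ring.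
have [y2|y2] := ltP (pi - n%:R^-1) y; last by case: h; rewrite y1.
have h1 : n%:R * (pi - y) - 1 <= 0 by nra.
have h2 : 1 <= n%:R * y - 1 by nra.
have [e1 e2] := smoothstep_le0 h1; have [e3 e4] := smoothstep_ge1 h2.
by rewrite /strip_cutoff /strip_cutoff' /bottom_kernel /top_kernel e1 e2 e3 e4; split; ring.
Qed.

End kernels.

(** * From integrals over the strip to boundary integrals *)

Section strip_boundary.
Context {R : realType}.
Local Notation mu := (@lebesgue_measure R).
Local Notation lam := (area R).
Local Notation pt := (R * R)%type.

Lemma mS : measurable (open_strip : set (measurableTypeR R * measurableTypeR R)).
Proof. exact: open_measurable_plane open_open_strip. Qed.

Lemma measurable_slab (c B L : R) :
  measurable_fun setT (fun w : measurableTypeR R * measurableTypeR R => (if `|w.1 - c| <= L then B else 0)%:E).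
Proof.
have -> : (fun w : pt => (if `|w.1 - c| <= L then B else 0)%:E) = fun w : pt => (B * \1_(`[- L + c, L + c] : set R) w.1)%:E.
  apply/funext => w; rewrite indicE; case: ifPn; rewrite ler_norml lerBrDr lerBlDr => h.
    by rewrite mem_set ?mulr1//= in_itv.
  by rewrite memNset ?mulr0//= in_itv; exact/negP.
apply/measurable_EFinP; apply: measurable_funM; first exact: measurable_cst.
by apply: measurableT_comp; [exact: measurable_indic|exact: measurable_fst].
Qed.

Lemma open_strip_slab (c B L : R) : 0 <= L -> 0 <= B ->
  (\int[lam]_(w in open_strip) (if `|w.1 - c| <= L then B else 0)%:E <= (2 * L * pi * B)%:E)%E.
Proof.
move=> L0 B0; pose K : set pt := `[- L + c, L + c]%classic `*` `[0, pi]%classic.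
have mK : measurable (K : set (measurableTypeR R * measurableTypeR R)) by exact: measurableX.
apply: (@le_trans _ _ (\int[lam]_(w in K) B%:E)%E).
  rewrite integral_mkcond [leRHS]integral_mkcond.
  apply: ge0_le_integral => //.
  - by move=> w _; rewrite patchE; case: ifP => // _; case: ifP.
  - apply: (measurable_restrictT _ mS).1.
    by apply: (@measurable_funS _ _ _ _ setT) => //; exact: (measurable_slab c).
  - by apply: (measurable_restrictT _ mK).1; exact: measurable_cst.
  - move=> w _; rewrite !patchE; case: ifPn => [/set_mem ws|_]; last by case: ifP.
    case: ifPn => [wL|_]; last by case: ifP.
    rewrite mem_set//; split; first by move: wL; rewrite /= in_itv /= ler_norml lerBrDr lerBlDr.
    by move: ws => /andP[w1 w2]; rewrite /= in_itv /= !ltW.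
rewrite (@integral_cst _ _ _ lam _ mK).
have lamK : lam K = (mu `[(- L + c)%R, (L + c)%R] * mu `[0%R, pi])%E by exact: product_measure1E.
suff h : (B%:E * lam K <= (2 * L * pi * B)%:E)%E by exact: h.
rewrite lamK.
rewrite !lebesgue_measure_itv /=.
have pi0 := pi_gt0 R.
rewrite !lte_fin pi0; case: ifPn => [LL|_]; last first.
  by rewrite mul0e mule0 lee_fin !mulr_ge0// ltW.
rewrite -!EFinB -!EFinM lee_fin le_eqVlt; apply/orP; left; apply/eqP; ring.
Qed.

Lemma integrable_strip (h : pt -> R) (c B L : R) :
  (forall w, open_strip w -> {for w, continuous h}) -> 0 <= B -> 0 <= L ->
  (forall w, open_strip w -> `|h w| <= if `|w.1 - c| <= L then B else 0) ->
  lam.-integrable open_strip (EFin \o h) /\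
  (\int[lam]_(w in open_strip) `|h w|%:E <= (2 * L * pi * B)%:E)%E.
Proof.
move=> ch B0 L0 hB.
have mh : measurable_fun open_strip h.
  by apply: continuous_measurable_plane => //; exact: open_open_strip.
have le1 : (\int[lam]_(w in open_strip) `|h w|%:E <= (2 * L * pi * B)%:E)%E.
  apply: le_trans (open_strip_slab c L0 B0).
  apply: ge0_le_integral => //; first exact: mS.
  - by apply/measurable_EFinP; exact: measurableT_comp.
  - by apply: (@measurable_funS _ _ _ _ setT) => //; exact: (measurable_slab c).
split => //; apply/integrableP; split; first exact/measurable_EFinP.
by apply: le_lt_trans le1 _; rewrite ltry.
Qed.

(** Integrating over [y] first gives the average of [H (x, -)] near the bottom minus that near the
    top. These tend to [H0 x - H1 x] under a fixed bound with support in the window, so dominated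
    convergence applies in [x]. *)
Lemma strip_boundary_limit (H : pt -> R) (H0 H1 : R -> R) (c B L C : R) : 0 <= B -> 0 <= L ->
  (forall w, open_strip w -> {for w, continuous H}) ->
  (forall w, open_strip w -> `|H w| <= if `|w.1 - c| <= L then B else 0) ->
  continuous H0 -> continuous H1 ->
  (forall x e, 0 < e -> exists2 d, 0 < d & forall y, 0 < y < d -> `|H (x, y) - H0 x| <= e) ->
  (forall x e, 0 < e -> exists2 d, 0 < d & forall y, 0 < pi - y < d -> `|H (x, y) - H1 x| <= e) ->
  (forall n, (2 <= n)%N ->
     (`|\int[lam]_(w in open_strip) (strip_cutoff' n w.2 * H w)%:E| <= C%:E)%E) ->
  (`|\int[mu]_(x in `[(- L + c)%R, (L + c)%R]) (H0 x - H1 x)%:E| <= C%:E)%E.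
Proof.
move=> B0 L0 cH HB cH0 cH1 l0 l1 hC.
(* The index is shifted by 2, since [integral_kernels] gives mass 1 for [2 <= n]. *)
pose fn n : pt -> \bar R := (fun w => (strip_cutoff' n.+2 w.2 * H w)%:E) \_ open_strip.
have mH : measurable_fun open_strip H.
  by apply: continuous_measurable_plane => //; exact: open_open_strip.
have cze n : continuous (strip_cutoff' n : R -> R).
  by have [cb ct] := @continuous_kernels R n; move=> y; apply: cvgB; [exact: cb|exact: ct].
have ifn n : lam.-integrable setT (fn n).
  apply/(integrable_mkcond _ mS).
  have c1 w : open_strip w -> {for w, continuous (fun w : pt => strip_cutoff' n.+2 w.2 * H w)}.
    move=> ws; apply: cvgM; last exact: cH.
    by apply: (@continuous_comp _ _ _ snd (strip_cutoff' n.+2)); [exact: continuous_snd|exact: cze].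
  have c2 : 0 <= n.+2%:R * 8 * B by rewrite !mulr_ge0.
  have c3 w : open_strip w -> `|strip_cutoff' n.+2 w.2 * H w| <= if `|w.1 - c| <= L then n.+2%:R * 8 * B else 0.
    move=> ws; rewrite normrM; have := HB w ws; case: ifP => _ h.
      by apply: ler_pM => //; exact: strip_cutoff'_le.
    have -> : `|H w| = 0 by apply/eqP; rewrite eq_le h normr_ge0.
    by rewrite mulr0.
  by have [] := integrable_strip c1 c2 L0 c3.
pose Fn n x := fubini_F mu (fn n) x.
have mF n : measurable_fun setT (Fn n) := measurable_fubini_F (ifn n).
have FnE n x : Fn n x = (\int[mu]_(y in `]0%R, pi[) (strip_cutoff' n.+2 y * H (x, y))%:E)%E.
  rewrite /Fn /fubini_F /fn [RHS]integral_mkcond; apply: eq_integral => y _.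
  rewrite !patchE; have -> : ((x, y) \in open_strip) = (y \in `]0%R, pi[%classic); last by [].
  by apply/idP/idP => /set_mem h; apply/mem_set; move: h; rewrite /open_strip /= in_itv.
have mHx x : measurable_fun (`]0%R, pi[ : set (measurableTypeR R)) (fun y => H (x, y)).
  apply: open_continuous_measurable_fun; first exact: interval_open.
  move=> y; rewrite inE /= in_itv => xy.
  by apply: (@continuous_comp _ _ _ (fun y : R => (x, y)) H); [exact: continuous_line2|exact: cH].
have mk n : measurable_fun (`]0%R, pi[ : set (measurableTypeR R)) (bottom_kernel n : R -> R) /\
    measurable_fun (`]0%R, pi[ : set (measurableTypeR R)) (top_kernel n : R -> R).
  by have [cb ct] := @continuous_kernels R n; split; apply: measurable_funTS; exact: continuous_measurable_fun.
pose A : set (measurableTypeR R) := `]0%R, pi[%classic.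
have mA : measurable A by exact: measurable_itv.
(* Used twice: with [c0 = c1 = 0] for the dominating bound, and with the boundary values for the
   limit. *)
have split_kernels n x (c0 c1 e : R) : 0 <= e ->
    (forall y, A y -> bottom_kernel n.+2 y != 0 -> `|H (x, y) - c0| <= e) ->
    (forall y, A y -> top_kernel n.+2 y != 0 -> `|H (x, y) - c1| <= e) ->
    exists2 v, Fn n x = v%:E & `|v - (c0 - c1)| <= e + e.
  move=> e0 h0 h1; have [m0 m1] := mk n.+2; have [i0 i1] := @integral_kernels R n.+2 isT.
  have g y := @kernels_ge0 R n.+2 y.
  have [j0 [v0 v0E v0e]] := kernel_average mA e0 m0 (mHx x) (fun y _ => (g y).1) i0 h0.
  have [j1 [v1 v1E v1e]] := kernel_average mA e0 m1 (mHx x) (fun y _ => (g y).2) i1 h1.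
  exists (v0 - v1).
    rewrite FnE EFinB -v0E -v1E -integralB//; apply: eq_integral => y _.
    by rewrite -EFinB /strip_cutoff' mulrBl.
  have -> : v0 - v1 - (c0 - c1) = v0 - c0 - (v1 - c1) by ring.
  by rewrite (le_trans (ler_normB _ _))// lerD.
have Fn_bd n x : (`|Fn n x| <= (if `|x - c| <= L then 2 * B else 0)%:E)%E.
  have bd y : A y -> `|H (x, y) - 0| <= if `|x - c| <= L then B else 0.
    by move=> Ay; rewrite subr0; apply: HB; move: Ay; rewrite /A /= in_itv.
  have e0 : 0 <= (if `|x - c| <= L then B else 0) by case: ifP.
  have [v -> hv] := @split_kernels n x 0 0 _ e0 (fun y Ay _ => bd y Ay) (fun y Ay _ => bd y Ay).
  move: hv; rewrite subrr subr0 => hv; rewrite lee_fin (le_trans hv)//.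
  by case: ifP => _; lra.
have Fn_cvg x : Fn ^~ x @ \oo --> (H0 x - H1 x)%:E.
  apply/fine_cvgP; split.
    by near=> n; rewrite fin_num_abs (le_lt_trans (Fn_bd n x))// ltry.
  apply/cvgrPdist_le => e e0; have e2 : 0 < e / 2 by rewrite divr_gt0.
  have [d0 d00 hd0] := l0 x _ e2; have [d1 d10 hd1] := l1 x _ e2.
  near=> n; have n20 : 0 < n.+2%:R :> R by rewrite ltr0n.
  have nd0 : 2 / n.+2%:R < d0.
    rewrite ltr_pdivrMr// mulrC -ltr_pdivrMr//.
    by apply: (@lt_le_trans _ _ n%:R); [near: n; exact: nbhs_infty_gtr|by rewrite ler_nat -addn2 leq_addr].
  have nd1 : 2 / n.+2%:R < d1.
    rewrite ltr_pdivrMr// mulrC -ltr_pdivrMr//.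
    by apply: (@lt_le_trans _ _ n%:R); [near: n; exact: nbhs_infty_gtr|by rewrite ler_nat -addn2 leq_addr].
  have [v vE hv] : exists2 v, Fn n x = v%:E & `|v - (H0 x - H1 x)| <= e / 2 + e / 2.
    apply: split_kernels; first exact: ltW.
    - move=> y; rewrite /A /= in_itv /= => /andP[y0 _] /(kernels_support y (isT : (0 < n.+2)%N)).1 /andP[_ yn].
      by apply: hd0; rewrite y0 (lt_trans yn).
    - move=> y; rewrite /A /= in_itv /= => /andP[_ y0] /(kernels_support y (isT : (0 < n.+2)%N)).2 /andP[_ yn].
      by apply: hd1; rewrite subr_gt0 y0 (lt_trans yn).
  by rewrite /= vE /= distrC (le_trans hv)// -splitr.
have ig : mu.-integrable setT (fun x : measurableTypeR R => (if `|x - c| <= L then 2 * B else 0)%:E).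
  have E : (fun x : measurableTypeR R => (if `|x - c| <= L then 2 * B else 0)%:E) =
     (fun x : measurableTypeR R => (2 * B)%:E) \_ `[- L + c, L + c]%classic.
    apply/funext => x; rewrite patchE; case: ifPn; rewrite ler_norml lerBrDr lerBlDr => h.
      by rewrite mem_set//= in_itv.
    by rewrite memNset//= in_itv; exact/negP.
  have [mk' _] := @integrable_mkcond _ _ _ mu `[- L + c, L + c]%classic (fun _ => (2 * B)%:E) (measurable_itv _).
  rewrite E; apply: mk'; apply: continuous_compact_integrable; first exact: segment_compact.
  by apply: continuous_subspaceT => x; exact: cvg_cst.
have lim : (\int[mu]_x Fn n x)%E @[n --> \oo] --> (\int[mu]_x (H0 x - H1 x)%:E)%E.
  apply: (@dominated_cvg _ _ _ mu _ measurableT _ _ _ mF _ _ ig); last by move=> n x _; exact: Fn_bd.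
    by move=> x _; exact: Fn_cvg.
  by [].
(* Outside the window the vertical integrals are all 0, hence so is their limit. *)
have out x : L < `|x - c| -> H0 x - H1 x = 0.
  move=> Lx; apply: EFin_inj; have : Fn ^~ x @ \oo --> (0 : \bar R).
    apply: cvg_near_cst; near=> n; have := Fn_bd n x; rewrite [`|x - c| <= L]leNgt Lx /= => h.
    by apply/eqP; rewrite -abse_eq0 eq_le h abse_ge0.
  by apply: cvg_unique; [exact: ereal_hausdorff|exact: Fn_cvg].
have -> : (\int[mu]_(x in `[(- L + c)%R, (L + c)%R]) (H0 x - H1 x)%:E = \int[mu]_x (H0 x - H1 x)%:E)%E.
  rewrite integral_mkcond; apply: eq_integral => x _; rewrite patchE; case: ifPn => //.
  rewrite notin_setE /= in_itv /= => /negP h; rewrite out// ltNge; apply: contra h.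
  by rewrite ler_norml lerBrDr lerBlDr.
have lim' : `|\int[mu]_x Fn n x|%E @[n --> \oo] --> `|\int[mu]_x (H0 x - H1 x)%:E|%E by exact: cvg_abse.
rewrite -(cvg_lim _ lim')//.
apply: lime_le; first by apply/cvg_ex; eexists; exact: lim'.
near=> n; have := hC n.+2 isT; congr (`|_| <= _)%E.
rewrite integral_mkcond -/(fn n).
exact: esym (integral12_prod_meas1 (ifn n)).
Unshelve. all: by end_near.
Qed.

End strip_boundary.

(** * Bumps on a window *)

Section window_bump.
Context {R : realType}.
Variables (c L : R).
Hypothesis L0 : 0 < L.
Implicit Types (x : R).

Definition window_bump x : R := bump ((x - c) / L).
Definition window_bump' x : R := bump' ((x - c) / L) / L.
(** The common majorant of the squares of [window_bump] and, up to [(4 / L) ^+ 2], of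
    [window_bump']. It plays the part of [rho1] for the image cutoff and of [etab] for the
    window. *)
Definition window_weight x : R := pos_part (1 - ((x - c) / L) ^+ 2).

Lemma continuous_rescale : continuous (fun x : R => (x - c) / L).
Proof.
by move=> x; apply: cvgM; [apply: cvgB; [exact: cvg_id|exact: cvg_cst]|exact: cvg_cst].
Qed.

Lemma is_derive_window_bump x : is_derive x (1 : R) window_bump (window_bump' x).
Proof.
have aff : is_derive x (1 : R) (fun x : R => (x - c) / L) L^-1.
  apply/is_derive1_eps => e e0; exists e => // y _.
  have -> : (y - c) / L - (x - c) / L - L^-1 * (y - x) = 0 by ring.
  by rewrite normr0 mulr_ge0// ltW.
have := @is_derive1_comp _ bump (fun x => (x - c) / L) x _ _ (is_derive_bump ((x - c) / L)) aff.
by [].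
Qed.

Lemma continuous_window_bump' : continuous window_bump'.
Proof.
move=> x; apply: cvgM; last exact: cvg_cst.
by apply: (@continuous_comp _ _ _ (fun x : R => (x - c) / L)); [exact: continuous_rescale|exact: continuous_bump'].
Qed.

Lemma continuous_window_bump : continuous window_bump.
Proof.
move=> x; apply: differentiable_continuous; apply/derivable1_diffP.
by case: (is_derive_window_bump x).
Qed.

Lemma window_bump_bounds x : [/\ 0 <= window_bump x, window_bump x <= 1 & `|window_bump' x| <= 4 / L].
Proof.
have [b0 b1 b2] := bump_bounds ((x - c) / L); split => //.
by rewrite normrM [`|L^-1|]gtr0_norm ?invr_gt0// ler_wpM2r// invr_ge0 ltW.
Qed.

Lemma window_bump_out x : L < `|x - c| -> window_bump x = 0 /\ window_bump' x = 0.
Proof.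
move=> h; have h1 : 1 <= `|(x - c) / L|.
  by rewrite normrM [`|L^-1|]gtr0_norm ?invr_gt0// ler_pdivlMr// mul1r ltW.
by have [e1 e2] := bump_out h1; rewrite /window_bump /window_bump' e1 e2 mul0r.
Qed.

Lemma continuous_window_weight : continuous window_weight.
Proof.
move=> x; apply: (@continuous_comp _ _ _ (fun x : R => 1 - ((x - c) / L) ^+ 2)); last exact: continuous_pos_part.
by apply: cvgB; [exact: cvg_cst|apply: cvgM; exact: continuous_rescale].
Qed.

Lemma window_weight_bounds x : [/\ 0 <= window_weight x,
  window_bump x ^+ 2 <= window_weight x, window_bump' x ^+ 2 <= (4 / L) ^+ 2 * window_weight x &
  window_weight x <= if `|x - c| <= L then 1 else 0].
Proof.
rewrite /window_weight /window_bump' /window_bump /bump /bump'; set y := (x - c) / L.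
have p0 := pos_part_ge0 (1 - y ^+ 2); have p1 := pos_part_one_sub_le1 y.
set p := pos_part (1 - y ^+ 2) in p0 p1 *; split => //.
- have p2 : p ^+ 2 <= p by nra.
  by apply: le_trans p2; rewrite -[leRHS]mulr1 [leLHS]expr2 ler_pM ?sqr_ge0// expr_le1.
- rewrite !exprMn [leRHS]mulrAC; apply: ler_wpM2r; first exact: sqr_ge0.
  have [y1|y1] := leP 1 `|y|.
    have [_] := bump_out y1; rewrite /bump' -/p => ->; rewrite expr0n /=.
    by rewrite mulr_ge0// sqr_ge0.
  have y2 : y ^+ 2 <= 1 by rewrite -(real_normK (num_real y)) expr_le1// ltW.
  rewrite sqrrN (_ : (4 * y * p) ^+ 2 = 4 ^+ 2 * (y ^+ 2 * p ^+ 2)); last by ring.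
  rewrite ler_wpM2l ?sqr_ge0//; apply: (@le_trans _ _ (1 * p ^+ 2)); first by rewrite ler_wpM2r ?sqr_ge0.
  by nra.
- case: ifPn => //; rewrite -ltNge => h; rewrite /p pos_part_le0// subr_le0.
  rewrite -(real_normK (num_real y)) expr_ge1// /y normrM [`|L^-1|]gtr0_norm ?invr_gt0//.
  by rewrite ler_pdivlMr// mul1r ltW.
Qed.

Lemma integral_window_weight :
  (\int[area R]_(w in open_strip) (window_weight w.1)%:E <= (2 * L * pi)%:E)%E.
Proof.
have cw (w : R * R) : open_strip w -> {for w, continuous (fun w : R * R => window_weight w.1)}.
  by move=> _; apply: (@continuous_comp _ _ _ fst); [exact: continuous_fst|exact: continuous_window_weight].
have bw (w : R * R) : open_strip w -> `|window_weight w.1| <= if `|w.1 - c| <= L then 1 else 0.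
  by move=> _; have [h _ _ h'] := window_weight_bounds w.1; rewrite ger0_norm.
have [_] := integrable_strip cw ler01 (ltW L0) bw; rewrite mulr1.
congr (_ <= _)%E; apply: eq_integral => w _; rewrite ger0_norm//.
by have [] := window_weight_bounds w.1.
Qed.

End window_bump.

(** * A bound independent of the length of the window *)

Section key_bound.
Context {R : realType}.
Local Notation mu := (@lebesgue_measure R).
Local Notation lam := (area R).
Local Notation pt := (R * R)%type.
Implicit Types (w : pt).
Variables (ta D ta' D' : R) (F : pt -> pt) (a1 b1 a2 b2 : pt -> R) (C : R).
Hypotheses (D0 : 0 < D < 2 * pi) (D0' : 0 < D' < 2 * pi).
Hypotheses (cF : forall z, unit_disk R z -> {for z, continuous F})
  (FD : forall z, unit_disk R z -> unit_disk R (F z)).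
Hypotheses (ma1 : measurable_fun setT a1) (mb1 : measurable_fun setT b1)
  (ma2 : measurable_fun setT a2) (mb2 : measurable_fun setT b2).
Hypothesis dF : {ae lam, forall z, unit_disk R z ->
  has_differential (fun w => (F w).1) (a1 z) (b1 z) z /\
  has_differential (fun w => (F w).2) (a2 z) (b2 z) z}.
Hypothesis ac1 : forall s t : R, 0 < s -> 0 < t -> s ^+ 2 + t ^+ 2 < 1 ->
  {ae mu, forall y, `|y| <= t -> abs_continuous (fun x => F (x, y)) (- s) s}.
Hypothesis ac2 : forall s t : R, 0 < s -> 0 < t -> s ^+ 2 + t ^+ 2 < 1 ->
  {ae mu, forall x, `|x| <= t -> abs_continuous (fun y => F (x, y)) (- s) s}.
Hypothesis energy : forall rho : pt -> R, (forall w, 0 <= rho w) ->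
  (forall w, unit_disk R w -> {for w, continuous rho}) ->
  (\int[lam]_(z in unit_disk R) (rho (F z) * grad_sqr a1 b1 a2 b2 z)%:E <=
   C%:E * \int[lam]_(z in unit_disk R) (rho z)%:E)%E.
Hypothesis C0 : 0 <= C.
Hypothesis small : forall ep : R, 0 < ep -> exists2 r : R, 0 < r &
  {ae lam, forall z, unit_disk R z -> cmod (z - circle_pt ta) <= r ->
    (a1 z - b2 z) ^+ 2 + (a2 z + b1 z) ^+ 2 <= ep ^+ 2 * ((a1 z + b2 z) ^+ 2 + (a2 z - b1 z) ^+ 2)}.
Variables (u0 u1 : R -> R) (l l' : R).
Hypotheses (cu0 : continuous u0) (cu1 : continuous u1).
Let Phi w := strip_map ta' D' (F (strip_inv ta D w)).
Hypothesis lim0 : forall x, (fun y => Phi (x, y)) @ 0^'+ --> (u0 x, 0 : R).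
Hypothesis lim1 : forall x, (fun y => Phi (x, y)) @ pi^'- --> (u1 x, pi : R).
Hypotheses (l0 : 0 < l) (u0_period : forall x, u0 (x + l) = u0 x + l')
  (u1_period : forall x, u1 (x + l) = u1 x + l').

Let Phi_strip w : open_strip w -> open_strip (Phi w).
Proof.
move=> ws; have [d1 _] := strip_inv_strip ta D0 ws.
by have [h _] := strip_map_disk ta' D0' (FD d1).
Qed.

Let continuous_Phi w : open_strip w -> {for w, continuous Phi}.
Proof.
move=> ws; have [d1 _] := strip_inv_strip ta D0 ws.
apply: (@continuous_comp _ _ _ (F \o strip_inv ta D) (strip_map ta' D')).
  apply: (@continuous_comp _ _ _ (strip_inv ta D) F); last exact: cF.
  by apply: continuous_strip_inv => //; move: ws => /andP[w1 w2]; rewrite !ltW.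
apply: continuous_strip_map; apply: disk_strip_dom; exact: FD.
Qed.

(** The first summand comes from the derivative of the source window, a slope of at most [4 / L]
    over an area [2 L pi]. The second is [interior_estimate] with [q = L], where [L / M <= 1] and
    [M^-1 <= 1] have removed both scales; [32] is [16 + 16], from the slope [4 / M] of the image
    cutoff. *)
Definition key_const (C s t : R) : R :=
  let K := expR (`|s| * pi) in let K1 := expR (`|t| * pi) in
  8 * pi * K * K1 + (K ^+ 2 * (32 + 4 * s ^+ 2) * C * 2 * pi + 2 * K1 ^+ 2 * pi) / 2.

Section wave_term.
Variables (s t : R) (f g k : R -> R) (tau : pt -> R) (c L Bg Bk : R).
Hypotheses (L0 : 0 < L) (f01 : forall x, 0 <= f x <= 1) (gB : forall x, `|g x| <= Bg)
  (g_out : forall x, L < `|x - c| -> g x = 0) (kB : forall x, `|k x| <= Bk) (tau1 : forall w, `|tau w| <= 1).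
Hypotheses (cf : continuous f) (cg : continuous g) (ck : continuous k)
  (ctau : forall w, open_strip w -> {for w, continuous tau}).

(** The common shape of all integrands that occur; [tau] is the trigonometric factor. One bound and
    one proof of continuity serve for each of them. *)
Definition wave_term w : R :=
  f (Phi w).1 * expR (- (s * (Phi w).2)) * (g w.1 * k w.2 * expR (- (t * w.2))) * tau w.

Lemma wave_term_bound w : open_strip w ->
  `|wave_term w| <= if `|w.1 - c| <= L then expR (`|s| * pi) * expR (`|t| * pi) * (Bg * Bk) else 0.
Proof.
move=> ws; have /andP[p1 p2] := Phi_strip ws; have /andP[w1 w2] := ws.
have e1 : expR (- (s * (Phi w).2)) <= expR (`|s| * pi) by apply: wave_expR_le; rewrite !ltW.
have e2 : expR (- (t * w.2)) <= expR (`|t| * pi) by apply: wave_expR_le; rewrite !ltW.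
case: ifPn => [_|]; last by rewrite -ltNge => /g_out h; rewrite /wave_term h !mul0r mulr0 mul0r normr0.
have /andP[f0 f1] := f01 (Phi w).1.
have E1 := expR_ge0 (- (s * (Phi w).2)); have E2 := expR_ge0 (- (t * w.2)).
rewrite /wave_term !normrM (ger0_norm f0) (ger0_norm E1) (ger0_norm E2).
rewrite -[leRHS]mulr1; apply: ler_pM => //; first by rewrite !mulr_ge0.
have -> : f (Phi w).1 * expR (- (s * (Phi w).2)) * (`|g w.1| * `|k w.2| * expR (- (t * w.2))) =
   f (Phi w).1 * (expR (- (s * (Phi w).2)) * expR (- (t * w.2)) * (`|g w.1| * `|k w.2|)) by ring.
rewrite -[leRHS]mul1r; apply: ler_pM => //.
by apply: ler_pM => //; apply: ler_pM.
Qed.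

Lemma continuous_wave_term w : open_strip w -> {for w, continuous wave_term}.
Proof.
move=> ws; have cP := continuous_Phi ws.
have cP1 : {for w, continuous (fun w => (Phi w).1)} by apply: (@continuous_comp _ _ _ Phi fst); [exact: cP|exact: continuous_fst].
have cP2 : {for w, continuous (fun w => (Phi w).2)} by apply: (@continuous_comp _ _ _ Phi snd); [exact: cP|exact: continuous_snd].
apply: cvgM; last exact: ctau.
apply: cvgM; apply: cvgM.
- by apply: (@continuous_comp _ _ _ (fun w => (Phi w).1) f); [exact: cP1|exact: cf].
- apply: (@continuous_comp _ _ _ (fun w => - (s * (Phi w).2)) (@expR R)); last exact: continuous_expR.
  by apply: cvgN; apply: cvgM; [exact: cvg_cst|exact: cP2].
- apply: cvgM; first by apply: (@continuous_comp _ _ _ fst g); [exact: continuous_fst|exact: cg].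
  by apply: (@continuous_comp _ _ _ snd k); [exact: continuous_snd|exact: ck].
- apply: (@continuous_comp _ _ _ (fun w : pt => - (t * w.2)) (@expR R)); last exact: continuous_expR.
  by apply: cvgN; apply: cvgM; [exact: cvg_cst|exact: continuous_snd].
Qed.

Lemma integrable_wave_term : lam.-integrable open_strip (EFin \o wave_term) /\
  (\int[lam]_(w in open_strip) `|wave_term w|%:E <=
   (2 * L * pi * (expR (`|s| * pi) * expR (`|t| * pi) * (Bg * Bk)))%:E)%E.
Proof.
have Bg0 := le_trans (normr_ge0 _) (gB 0); have Bk0 := le_trans (normr_ge0 _) (kB 0).
apply: (@integrable_strip _ _ c _ L); first exact: continuous_wave_term.
- by rewrite !mulr_ge0// expR_ge0.
- exact: ltW.
- exact: wave_term_bound.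
Qed.

End wave_term.

Let near_right (h : R -> R) (v : R) : h y @[y --> 0^'+] --> v ->
  forall e, 0 < e -> exists2 d, 0 < d & forall y, 0 < y < d -> `|h y - v| <= e.
Proof.
move=> hv e e0; have /cvgrPdist_le /(_ _ e0) [d /= d0 hd] := hv.
exists d => // y /andP[y0 yd]; rewrite distrC; apply: hd => //=.
by rewrite sub0r normrN gtr0_norm.
Qed.

Let near_left (h : R -> R) (v : R) : h y @[y --> pi^'-] --> v ->
  forall e, 0 < e -> exists2 d, 0 < d & forall y, 0 < pi - y < d -> `|h y - v| <= e.
Proof.
move=> hv e e0; have /cvgrPdist_le /(_ _ e0) [d /= d0 hd] := hv.
exists d => // y /andP[y0 yd]; rewrite distrC; apply: hd => //=.
  by rewrite gtr0_norm.
by rewrite -subr_gt0.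
Qed.

(** On the window the dilatation is at most [1 / M] and the image cutoff has slope at most [4 / M].
    The squared defect is thus of order [M^-2], the energy of order [M], and with the weight [q = L]
    the product is of order [L / M <= 1]. *)
Lemma key_bound_windowed (s t th L M c c' : R) : 0 < L -> 1 <= M -> L <= M ->
  {ae lam, forall z, unit_disk R z -> window_bump c L (strip_map ta D z).1 != 0 ->
    (a1 z - b2 z) ^+ 2 + (a2 z + b1 z) ^+ 2 <= M^-1 ^+ 2 * ((a1 z + b2 z) ^+ 2 + (a2 z - b1 z) ^+ 2)} ->
  (`|\int[mu]_(x in `[(- L + c)%R, (L + c)%R])
     (window_bump c' M (u0 x) * window_bump c L x * sin (s * u0 x + t * x + th) -
      window_bump c' M (u1 x) * window_bump c L x * (expR (- ((s + t) * pi)) * sin (s * u1 x + t * x + th)))%:E|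
     <= (key_const C s t)%:E)%E.
Proof.
move=> L0 M1 LM win; have M0 : 0 < M by lra.
pose chi := window_bump c' M; pose eta := window_bump c L.
have chi01 x : 0 <= chi x <= 1 by have [h1 h2 _] := window_bump_bounds c' M0 x; rewrite h1 h2.
have eta01 x : `|eta x| <= 1 by have [h1 h2 _] := window_bump_bounds c L0 x; rewrite ger0_norm.
have eta'B x : `|window_bump' c L x| <= 4 / L by have [_ _ h] := window_bump_bounds c L0 x.
have eta_out x : L < `|x - c| -> eta x = 0 by move=> /(window_bump_out L0)[].
have eta'_out x : L < `|x - c| -> window_bump' c L x = 0 by move=> /(window_bump_out L0)[].
have cchi : continuous chi := @continuous_window_bump R c' M.
have ceta : continuous eta := @continuous_window_bump R c L.
have ceta' : continuous (window_bump' c L) := @continuous_window_bump' R c L.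
pose one : R -> R := cst 1.
have cone : continuous one by move=> x; exact: cvg_cst.
have one1 x : `|one x| <= 1 by rewrite /one /= normr1.
have cl (p : pt -> R) w : {for w, continuous p} ->
    {for w, continuous (fun w => sin (p w))} /\ {for w, continuous (fun w => cos (p w))}.
  by move=> cp; split; [apply: (@continuous_comp _ _ _ p (@sin R))|apply: (@continuous_comp _ _ _ p (@cos R))] => //;
    [exact: continuous_sin|exact: continuous_cos].
have ca w : open_strip w -> {for w, continuous (fun w => s * (Phi w).1)}.
  move=> ws; apply: cvgM; first exact: cvg_cst.
  by apply: (@continuous_comp _ _ _ Phi fst); [exact: continuous_Phi|exact: continuous_fst].
have cb w : {for w, continuous (fun w : pt => t * w.1 + th)}.
  by apply: cvgD; [apply: cvgM; [exact: cvg_cst|exact: continuous_fst]|exact: cvg_cst].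
have cab w : open_strip w -> {for w, continuous (fun w => s * (Phi w).1 + (t * w.1 + th))}.
  by move=> ws; apply: cvgD; [exact: ca|exact: cb].
have sin1 (x : R) : `|sin x| <= 1 by rewrite ler_norml sin_geN1 sin_le1.
have cos1 (x : R) : `|cos x| <= 1 by rewrite ler_norml cos_geN1 cos_le1.
pose H := wave_term s t chi eta one (fun w => sin (s * (Phi w).1 + (t * w.1 + th))).
(* The limit of [H (x, y)] as [y] tends to [q] and [Phi (x, y)] to [(v, q)]; only [q = 0] and
   [q = pi] are used. *)
pose V x q v := chi v * expR (- (s * q)) * (eta x * 1 * expR (- (t * q))) * sin (s * v + (t * x + th)).
have limH (G : set_system R) (FG : Filter G) x q v : (fun y => Phi (x, y)) @ G --> (v, q) -> y @[y --> G] --> q ->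
    (fun y => H (x, y)) @ G --> V x q v.
  move=> lG yG; have l1 : (fun y => (Phi (x, y)).1) @ G --> v by apply: cvg_comp lG _; exact: cvg_fst.
  have l2 : (fun y => (Phi (x, y)).2) @ G --> q by apply: cvg_comp lG _; exact: cvg_snd.
  rewrite /H /wave_term /V; apply: cvgM.
    apply: cvgM; apply: cvgM.
    - exact: (cvg_comp _ _ l1 (cchi v)).
    - apply: (cvg_comp (fun y => - (s * (Phi (x, y)).2)) expR _ (@continuous_expR R (- (s * q)))).
      by apply: cvgN; apply: cvgM; [exact: cvg_cst|exact: l2].
    - exact: cvg_cst.
    - apply: (cvg_comp (fun y => - (t * y)) expR _ (@continuous_expR R (- (t * q)))).
      by apply: cvgN; apply: cvgM; [exact: cvg_cst|exact: yG].
  apply: (cvg_comp (fun y => s * (Phi (x, y)).1 + (t * x + th)) sin _ (@continuous_sin R _)).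
  by apply: cvgD; [apply: cvgM; [exact: cvg_cst|exact: l1]|exact: cvg_cst].
have yr : (fun y : R => y) @ (0 : R)^'+ --> (0 : R) by apply: cvg_at_right_filter; exact: cvg_id.
have yl : (fun y : R => y) @ (pi : R)^'- --> (pi : R) by apply: cvg_at_left_filter; exact: cvg_id.
have cV (u : R -> R) q : continuous u -> continuous (fun x => V x q (u x)).
  move=> cu x; rewrite /V; apply: cvgM.
    apply: cvgM; apply: cvgM; try exact: cvg_cst.
      by apply: (@continuous_comp _ _ _ u chi); [exact: cu|exact: cchi].
    by apply: cvgM; [exact: ceta|exact: cvg_cst].
  apply: (@continuous_comp _ _ _ (fun x => s * u x + (t * x + th)) sin); last exact: continuous_sin.
  apply: cvgD; first by apply: cvgM; [exact: cvg_cst|exact: cu].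
  by apply: cvgD; [apply: cvgM; [exact: cvg_cst|exact: cvg_id]|exact: cvg_cst].
have VE x : window_bump c' M (u0 x) * window_bump c L x * sin (s * u0 x + t * x + th) -
      window_bump c' M (u1 x) * window_bump c L x * (expR (- ((s + t) * pi)) * sin (s * u1 x + t * x + th)) =
   V x 0 (u0 x) - V x pi (u1 x).
  rewrite /V !mulr0 oppr0 expR0 !mulr1 mulrDl opprD expRD -/(chi _) -/(eta _) -/(chi (u1 x)) !addrA; ring.
under eq_integral do rewrite VE.
apply: (@strip_boundary_limit _ H _ _ c (expR (`|s| * pi) * expR (`|t| * pi) * (1 * 1))).
- by rewrite !mulr_ge0// expR_ge0.
- exact: ltW.
- by move=> w ws; apply: continuous_wave_term => // w' ws'; have [] := cl _ _ (cab w' ws').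
- by move=> w ws; apply: wave_term_bound.
- exact: cV.
- exact: cV.
- by move=> x; apply: near_right; exact: limH.
- by move=> x; apply: near_left; exact: limH.
move=> n n2; pose ze : R -> R := strip_cutoff n; pose ze' : R -> R := strip_cutoff' n.
have dze x : is_derive x (1 : R) ze (ze' x) by exact: is_derive_strip_cutoff.
have cze : continuous ze.
  by move=> x; apply: differentiable_continuous; apply/derivable1_diffP; case: (dze x).
have cze' : continuous ze'.
  by have [k1 k2] := @continuous_kernels R n; move=> x; apply: cvgB; [exact: k1|exact: k2].
have ze01 x : 0 <= ze x <= 1 by exact: strip_cutoff_bounds.
have ze1 x : `|ze x| <= 1 by have /andP[z0 z1] := ze01 x; rewrite ger0_norm.
have ze'B x : `|ze' x| <= n%:R * 8 by exact: strip_cutoff'_le.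
have n0 : 0 < n%:R^-1 :> R by rewrite invr_gt0 ltr0n (leq_trans _ n2).
have supp_eta x : L + `|c| < `|x| -> eta x = 0 /\ window_bump' c L x = 0.
  by move=> h; apply: window_bump_out => //; have := ler_normD (x - c) c; rewrite subrK; lra.
have supp_ze y : ~ (n%:R^-1 <= y <= pi - n%:R^-1) -> ze y = 0 /\ ze' y = 0 by exact: strip_cutoff_support.
(* The parameters are [b = 4 / M], [ep = 1 / M], masses [2 M pi] and [2 L pi], and [q = L], which
   makes [K1 ^+ 2 * J / q] independent of [L]. The support bound is [L + |c|], because the window is
   centred at [c] and not at 0. *)
have [c1 [c2 [e1 e2 le12]]] := @interior_estimate R ta D ta' D' F a1 b1 a2 b2 C D0 D0' cF FD ma1 mb1 ma2 mb2 dF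
  ac1 ac2 energy chi (window_bump' c' M) eta (window_bump' c L) ze ze' (window_weight c' M) (window_weight c L)
  s t th (4 / M) M^-1 (2 * M * pi) (2 * L * pi) (L + `|c|) n%:R^-1 (is_derive_window_bump c' M)
  (@continuous_window_bump' R c' M) (is_derive_window_bump c L) ceta' dze cze' n0 supp_ze ze01 supp_eta
  (@continuous_window_weight R c' M) (fun x => let: And4 h _ _ _ := window_weight_bounds c' M0 x in h)
  (fun x => let: And4 _ h _ _ := window_weight_bounds c' M0 x in h)
  (fun x => let: And4 _ _ h _ := window_weight_bounds c' M0 x in h)
  (@continuous_window_weight R c L) (fun x => let: And4 h _ _ _ := window_weight_bounds c L0 x in h)
  (fun x => let: And4 _ h _ _ := window_weight_bounds c L0 x in h)
  (integral_window_weight c' M0) (integral_window_weight c L0) win C0 L L0.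
pose a w := s * (Phi w).1 + 0; pose be (w : pt) := t * w.1 + th.
have caw w : open_strip w -> {for w, continuous (fun w => sin (a w))} /\ {for w, continuous (fun w => cos (a w))}.
  by move=> ws; apply: cl; apply: cvgD; [exact: ca|exact: cvg_cst].
have cbw w : {for w, continuous (fun w => sin (be w))} /\ {for w, continuous (fun w => cos (be w))}.
  by apply: cl; exact: cb.
have prod1 (x y : R) : `|x| <= 1 -> `|y| <= 1 -> `|x * y| <= 1.
  by move=> x1 y1; rewrite normrM -[leRHS]mulr1 ler_pM.
have it (p r : pt -> R) (p1 : forall w, `|p w| <= 1) (r1 : forall w, `|r w| <= 1)
   (cp : forall w, open_strip w -> {for w, continuous p}) (cr : forall w, {for w, continuous r}) :
   lam.-integrable open_strip (EFin \o wave_term s t chi (window_bump' c L) ze (fun w => p w * r w)) /\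
   lam.-integrable open_strip (EFin \o wave_term s t chi eta ze' (fun w => p w * r w)).
  have cpr w : open_strip w -> {for w, continuous (fun w => p w * r w)}.
    by move=> ws; apply: cvgM; [exact: cp|exact: cr].
  have pr1 w : `|p w * r w| <= 1 by exact: prod1.
  split.
    by have [] := integrable_wave_term s t L0 chi01 eta'B eta'_out ze1 pr1 cchi ceta' cze cpr.
  by have [] := integrable_wave_term s t L0 chi01 eta01 eta_out ze'B pr1 cchi ceta cze' cpr.
have [icc icc'] := it _ _ (fun w => cos1 (a w)) (fun w => cos1 (be w)) (fun w ws => (caw w ws).2) (fun w => (cbw w).2).
have [ics ics'] := it _ _ (fun w => cos1 (a w)) (fun w => sin1 (be w)) (fun w ws => (caw w ws).2) (fun w => (cbw w).1).
have [isc isc'] := it _ _ (fun w => sin1 (a w)) (fun w => cos1 (be w)) (fun w ws => (caw w ws).1) (fun w => (cbw w).2).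
have [iss iss'] := it _ _ (fun w => sin1 (a w)) (fun w => sin1 (be w)) (fun w ws => (caw w ws).1) (fun w => (cbw w).1).
have [iG leG] := integrable_wave_term s t L0 chi01 eta'B eta'_out ze1 (fun w => cos1 (s * (Phi w).1 + (t * w.1 + th)))
  cchi ceta' cze (fun w ws => (cl _ _ (cab w ws)).2).
set G := wave_term _ _ _ _ _ _ in iG leG.
have mS := @mS R.
set A1 := fun w => _ in e1; set A2 := fun w => _ in e2.
have i1 : lam.-integrable open_strip A1.
  apply: (eq_integrable mS _ _ _ (integrableB mS icc ics')) => w ws.
  rewrite /A1 /= -EFinB /wave_term /wave_cos /wave_sin /= -/(a w) -/(be w) /a; congr (_%:E); ring.
have i2 : lam.-integrable open_strip A2.
  apply: (eq_integrable mS _ _ _ (integrableN (integrableD mS iss isc'))) => w ws.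
  transitivity ((- (wave_term s t chi (window_bump' c L) ze (fun w => sin (a w) * sin (be w)) w +
    wave_term s t chi eta ze' (fun w => sin (a w) * cos (be w)) w))%:E); first by [].
  rewrite /A2 /wave_term /wave_cos /wave_sin /= -/(a w) -/(be w) /a; congr (_%:E); ring.
have fG : (\int[lam]_(w in open_strip) (G w)%:E)%E \is a fin_num by exact: integrable_fin_num.
(* By the addition formulas the two integrands of [interior_estimate] add up to a term with [eta'],
   here [G], minus the term with [ze'], which is the integrand to be bounded. *)
have E : (\int[lam]_(w in open_strip) (strip_cutoff' n w.2 * H w)%:E =
    \int[lam]_(w in open_strip) (G w)%:E - (c1%:E + c2%:E))%E.
  rewrite -e1 -e2 -integralD// -integralB//; last exact: integrableD.
  apply: eq_integral => w _.
  transitivity ((G w - (wave_cos chi (cst 1) s 0 (Phi w) *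
     (wave_cos (window_bump' c L) ze t th w - wave_sin eta ze' t th w) +
     wave_sin chi (cst 1) s 0 (Phi w) *
     - (wave_sin (window_bump' c L) ze t th w + wave_cos eta ze' t th w)))%:E); last by [].
  rewrite /G /H /wave_term /wave_cos /wave_sin /= -/(ze' _) addr0 cosD sinD; congr (_%:E).
  by rewrite -/eta /one /=; ring.
rewrite E (le_trans (lee_abs_sub _ _))//.
pose Ks := expR (`|s| * pi); pose Kt := expR (`|t| * pi).
apply: (@le_trans _ _ ((8 * pi * Ks * Kt)%:E + ((key_const C s t) - 8 * pi * Ks * Kt)%:E)%E); last first.
  by rewrite -EFinD lee_fin addrC subrK.
apply: leeD.
  apply: (le_trans (le_abse_integral lam mS _)); first by have /integrableP[] := iG.
  apply: (le_trans leG); rewrite lee_fin le_eqVlt; apply/orP; left; apply/eqP.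
  by rewrite /Ks /Kt; field; rewrite gt_eqF.
rewrite -EFinD lee_fin; apply: (le_trans le12).
rewrite /key_const -/Ks -/Kt addrAC subrr add0r ler_pM2r ?invr_gt0//.
have pi0 := pi_gt0 R.
have -> : Kt ^+ 2 * (2 * L * pi) / L = 2 * Kt ^+ 2 * pi by field; rewrite gt_eqF.
rewrite lerD2r.
have -> : L * (Ks ^+ 2 * (((4 / M) ^+ 2 + 4 * s ^+ 2) * M^-1 ^+ 2 + (4 / M) ^+ 2) * (C * (2 * M * pi))) =
   Ks ^+ 2 * C * 2 * pi * ((L / M) * (16 * M^-1 ^+ 2 + 4 * s ^+ 2 + 16)) by field; rewrite gt_eqF.
have -> : Ks ^+ 2 * (32 + 4 * s ^+ 2) * C * 2 * pi = Ks ^+ 2 * C * 2 * pi * (1 * (16 * 1 + 4 * s ^+ 2 + 16)) by ring.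
have C0' := C0; have M1' : M^-1 <= 1 by rewrite invf_le1.
have Mi : 0 <= M^-1 by rewrite invr_ge0 ltW.
have Ks0 : 0 <= Ks := expR_ge0 _; have pi0' := ltW pi0; apply: ler_wpM2l; first by rewrite !mulr_ge0.
apply: ler_pM; rewrite ?mulr_ge0// ?(ltW L0)//.
- by apply: addr_ge0 => //; apply: addr_ge0; apply: mulr_ge0 => //; exact: sqr_ge0.
- by rewrite ler_pdivrMr// mul1r.
- by rewrite !lerD2r ler_wpM2l// expr_le1.
Qed.

(** The window is moved to the left by [k] periods, to where the dilatation is at most [1 / M]. By
    equivariance of [u0] and [u1] the moved integral is the original one, with an image cutoff of
    half-width [M] centred at 0; letting [M] tend to infinity removes that cutoff. *)
Lemma key_bound (s t th L : R) : 0 < L ->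
  (`|\int[mu]_(x in `[(- L)%R, L]) (bump (x / L) * (sin (s * u0 x + t * x + th) -
      expR (- ((s + t) * pi)) * sin (s * u1 x + t * x + th)))%:E| <= (key_const C s t)%:E)%E.
Proof.
move=> L0.
pose bM M (u : R -> R) x := bump (u x / M).
pose fM M x := bump (x / L) * (bM M u0 x * sin (s * u0 x + t * x + th) -
  bM M u1 x * (expR (- ((s + t) * pi)) * sin (s * u1 x + t * x + th))).
have cb : continuous (@bump R).
  by move=> x; apply: differentiable_continuous; apply/derivable1_diffP; case: (is_derive_bump x).
have csc (u : R -> R) k : continuous u -> continuous (fun x => bump (u x / k)).
  move=> cu x; apply: (@continuous_comp _ _ _ (fun x => u x / k) (@bump R)); last exact: cb.
  by apply: cvgM; [exact: cu|exact: cvg_cst].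
have csin (u : R -> R) th' : continuous u -> continuous (fun x => sin (s * u x + t * x + th')).
  move=> cu x; apply: (@continuous_comp _ _ _ (fun x => s * u x + t * x + th') sin); last exact: continuous_sin.
  apply: cvgD; last exact: cvg_cst.
  by apply: cvgD; apply: cvgM; [exact: cvg_cst|exact: cu|exact: cvg_cst|exact: cvg_id].
have cfM M : continuous (fM M).
  move=> x; apply: cvgM; first by apply: (csc id) => y; exact: cvg_id.
  apply: cvgB; apply: cvgM; [exact: csc|exact: csin|exact: csc|].
  by apply: cvgM; [exact: cvg_cst|exact: csin].
have bound n : L <= n.+1%:R -> (`|\int[mu]_(x in `[(- L)%R, L]) (fM n.+1%:R x)%:E| <= (key_const C s t)%:E)%E.
  move=> Ln; set M : R := n.+1%:R in Ln *.
  have M1 : 1 <= M by rewrite /M ler1n.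
  have M0 : 0 < M^-1 by rewrite invr_gt0; lra.
  have [r r0 hr] := small M0.
  (* The right end of the moved window lies below [ln (r / 2)], so by [strip_x_left] all points over
     the window are within [r] of the fixed point. *)
  have [k hk] : exists k : nat, - (k%:R * l) + L <= ln (r / 2).
    exists (Num.truncn ((L - ln (r / 2)) / l)).+1.
    have := truncnS_gt ((L - ln (r / 2)) / l); rewrite ltr_pdivrMr//.
    by move=> h; lra.
  pose c := - (k%:R * l); pose c' := - (k%:R * l').
  have per (u : R -> R) : (forall x, u (x + l) = u x + l') -> forall x, u (x + c) = u x + c'.
    move=> pu x; have h m y : u (y + m%:R * l) = u y + m%:R * l'.
      elim: m => [|m IH]; first by rewrite !mul0r !addr0.
      by rewrite -natr1 !mulrDl !mul1r !addrA pu IH.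
    by have := h k (x + c); rewrite /c /c' subrK => ->; rewrite addrK.
  have win : {ae lam, forall z, unit_disk R z -> window_bump c L (strip_map ta D z).1 != 0 ->
    (a1 z - b2 z) ^+ 2 + (a2 z + b1 z) ^+ 2 <= M^-1 ^+ 2 * ((a1 z + b2 z) ^+ 2 + (a2 z - b1 z) ^+ 2)}.
    apply: ae_imply hr => z hz dz wz; apply: hz => //.
    apply: (@strip_x_left R ta D); [exact: r0|exact: disk_strip_dom|].
    apply: le_trans hk; have : `|(strip_map ta D z).1 - c| <= L.
      by rewrite leNgt; apply: contra wz => /(window_bump_out L0)[->].
    by rewrite ler_norml => /andP[_]; rewrite lerBlDr addrC.
  (* The phase is corrected by [- (s c' + t c)], which compensates the translations of image and
     source; [th] being arbitrary, this costs nothing. *)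
  have := @key_bound_windowed s t (th + s * - c' + t * - c) L M c c' L0 M1 Ln win.
  pose h x := window_bump c' M (u0 x) * window_bump c L x * sin (s * u0 x + t * x + (th + s * - c' + t * - c)) -
    window_bump c' M (u1 x) * window_bump c L x *
    (expR (- ((s + t) * pi)) * sin (s * u1 x + t * x + (th + s * - c' + t * - c))).
  rewrite (@integral_translate _ h); last 2 first.
  - by lra.
  - have cw (u : R -> R) k' M' : continuous u -> continuous (fun x => window_bump k' M' (u x)).
      by move=> cu x; apply: (@continuous_comp _ _ _ u (window_bump k' M')); [exact: cu|exact: continuous_window_bump].
    move=> x; apply: cvgB; apply: cvgM.
    - by apply: cvgM; [exact: cw|exact: continuous_window_bump].
    - exact: csin.
    - by apply: cvgM; [exact: cw|exact: continuous_window_bump].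
    - by apply: cvgM; [exact: cvg_cst|exact: csin].
  congr (`|_| <= _)%E; apply: eq_integral => x _; congr (_%:E).
  rewrite /h /fM /bM /window_bump addrK (per u0)// (per u1)// !addrK.
  have ph u : s * (u + c') + t * (x + c) + (th + s * - c' + t * - c) = s * u + t * x + th by ring.
  by rewrite !ph; ring.
pose f x := bump (x / L) * (sin (s * u0 x + t * x + th) - expR (- ((s + t) * pi)) * sin (s * u1 x + t * x + th)).
have bM_cvg (u : R -> R) x : (fun n : nat => bM n.+1%:R u x) @ \oo --> (1 : R).
  have e1 : bump (u x * 0) = 1 by rewrite mulr0 /bump expr0n /= subr0 pos_part_id// expr1n.
  have c1 : (fun n : nat => u x / n.+1%:R) @ \oo --> u x * 0.
    by apply: cvgM; [exact: cvg_cst|exact: cvg_harmonic].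
  by have := cvg_comp _ _ c1 (cb (u x * 0)); rewrite e1.
have fM_cvg x : (fun n : nat => fM n.+1%:R x) @ \oo --> f x.
  rewrite /fM /f; set S0 := sin _; set S1 := sin _.
  have -> : bump (x / L) * (S0 - expR (- ((s + t) * pi)) * S1) =
    bump (x / L) * (1 * S0 - 1 * (expR (- ((s + t) * pi)) * S1)) by rewrite !mul1r.
  apply: cvgM; first exact: cvg_cst.
  by apply: cvgB; apply: cvgM; [exact: bM_cvg|exact: cvg_cst|exact: bM_cvg|exact: cvg_cst].
pose E := expR (- ((s + t) * pi)); have E0 : 0 <= E := expR_ge0 _.
have fM_le (M x : R) : `|fM M x| <= 1 + E.
  have bb (y : R) : `|bump y| <= 1 by have [h1 h2 _] := bump_bounds y; rewrite ger0_norm.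
  have sb (y : R) : `|sin y| <= 1 by rewrite ler_norml sin_geN1 sin_le1.
  have gen (p0 p1 p2 s0 s1 : R) : `|p0| <= 1 -> `|p1| <= 1 -> `|p2| <= 1 -> `|s0| <= 1 -> `|s1| <= 1 ->
    `|p0 * (p1 * s0 - p2 * (E * s1))| <= 1 + E.
    move=> h0 h1 h2 h3 h4; rewrite normrM -[leRHS]mul1r; apply: ler_pM => //.
    apply: (le_trans (ler_normB _ _)); rewrite !normrM (ger0_norm E0); apply: lerD.
      by rewrite -[leRHS]mulr1 ler_pM.
    by rewrite -[leRHS]mul1r ler_pM ?mulr_ge0// ler_piMr.
  by apply: gen; [exact: bb|exact: bb|exact: bb|exact: sb|exact: sb].
pose A : set (measurableTypeR R) := `[- L, L]%classic.
have mA : measurable A by exact: measurable_itv.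
have lim : (\int[mu]_(x in A) (fM n.+1%:R x)%:E)%E @[n --> \oo] --> (\int[mu]_(x in A) (f x)%:E)%E.
  apply: (@dominated_cvg _ _ _ mu _ mA (fun n x => (fM n.+1%:R x)%:E) _ (fun=> (1 + E)%:E)).
  - by move=> n; apply/measurable_EFinP; apply: measurable_funTS; apply: continuous_measurable_fun; exact: cfM.
  - by move=> x _; apply: cvg_EFin; [near=> n; by []|exact: fM_cvg].
  - by [].
  - apply: continuous_compact_integrable; first exact: segment_compact.
    by apply: continuous_subspaceT => x; exact: cvg_cst.
  - by move=> n x _; rewrite /= lee_fin.
have lim' : `|\int[mu]_(x in A) (fM n.+1%:R x)%:E|%E @[n --> \oo] --> `|\int[mu]_(x in A) (f x)%:E|%E.
  exact: cvg_abse.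
rewrite -(cvg_lim _ lim')//; apply: lime_le; first by apply/cvg_ex; eexists; exact: lim'.
near=> n; apply: bound; apply: (@le_trans _ _ n%:R); last by rewrite ler_nat.
by near: n; exact: nbhs_infty_ger.
Unshelve. all: by end_near.
Qed.

End key_bound.

(** * Fourier analysis of the boundary values *)

Section segment_integral.
Context {R : realType}.
Local Notation mu := (@lebesgue_measure R).
Implicit Types (f g : R -> R) (a b c : R).

Definition seg_int f a b : R := \int[mu]_(x in `[a, b]) f x.

Lemma integrable_segment f a b : continuous f -> mu.-integrable `[a, b] (EFin \o f).
Proof.
move=> cf; apply: continuous_compact_integrable; first exact: segment_compact.
exact: continuous_subspaceT.
Qed.

Lemma seg_int_cst k a b : a <= b -> seg_int (fun=> k) a b = k * (b - a).
Proof.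
move=> ab; rewrite /seg_int Rintegral_cst; last exact: measurable_itv.
have -> : fine (mu `[a, b]) = b - a; last by [].
change (fine (@lebesgue_measure R [set` `[a, b]]) = b - a); rewrite lebesgue_measure_itv /= lte_fin.
by case: ltP => //= h; apply/esym/eqP; rewrite subr_eq0 eq_le h ab.
Qed.

Lemma seg_intD f g a b : continuous f -> continuous g ->
  seg_int (fun x => f x + g x) a b = seg_int f a b + seg_int g a b.
Proof. by move=> cf cg; apply: RintegralD; [exact: measurable_itv|exact: integrable_segment|exact: integrable_segment]. Qed.

Lemma seg_intB f g a b : continuous f -> continuous g ->
  seg_int (fun x => f x - g x) a b = seg_int f a b - seg_int g a b.
Proof. by move=> cf cg; apply: RintegralB; [exact: measurable_itv|exact: integrable_segment|exact: integrable_segment]. Qed.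

Lemma seg_intZ k f a b : continuous f -> seg_int (fun x => k * f x) a b = k * seg_int f a b.
Proof. by move=> cf; apply: RintegralZl; [exact: measurable_itv|exact: integrable_segment]. Qed.

Lemma eq_seg_int f g a b : (forall x, f x = g x) -> seg_int f a b = seg_int g a b.
Proof. by move=> /funext ->. Qed.

Lemma le_seg_int f g a b : continuous f -> continuous g -> (forall x, a <= x <= b -> f x <= g x) ->
  seg_int f a b <= seg_int g a b.
Proof.
move=> cf cg fg; apply: le_Rintegral; [exact: measurable_itv|exact: integrable_segment|exact: integrable_segment|].
by move=> x; rewrite /= in_itv; exact: fg.
Qed.

Lemma seg_int_norm_within f a b (B : R) : {within `[a, b], continuous f} -> a <= b ->
  (forall x, a <= x <= b -> `|f x| <= B) -> `|seg_int f a b| <= B * (b - a).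
Proof.
move=> cf ab fB.
have i : mu.-integrable `[a, b] (EFin \o f) by apply: continuous_compact_integrable => //; exact: segment_compact.
have ck (k : R) : continuous (fun _ : R => k) by move=> x; exact: cvg_cst.
rewrite ler_norml -mulNr -!seg_int_cst//; apply/andP; split.
  apply: le_Rintegral => //; first exact: integrable_segment.
  by move=> x; rewrite /= in_itv => /fB; rewrite ler_norml => /andP[].
apply: le_Rintegral => //; first exact: integrable_segment.
by move=> x; rewrite /= in_itv => /fB; rewrite ler_norml => /andP[].
Qed.

Lemma seg_int_norm f a b (B : R) : continuous f -> a <= b -> (forall x, a <= x <= b -> `|f x| <= B) ->
  `|seg_int f a b| <= B * (b - a).
Proof. by move=> cf; apply: seg_int_norm_within; exact: continuous_subspaceT. Qed.

Lemma seg_int_split f a b c : continuous f -> a <= c -> c <= b ->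
  seg_int f a b = seg_int f a c + seg_int f c b.
Proof.
move=> cf ac cb; have i := integrable_segment a b cf.
have := @Rintegral_itvB _ f (BLeft a) (BRight b) c i; rewrite !bnd_simp => /(_ ac cb).
rewrite Rintegral_itv_obnd_cbnd; first by rewrite /seg_int => <-; rewrite addrC subrK.
apply: (integrableS _ _ _ (integrable_segment c b cf)); try exact: measurable_itv.
by apply: subset_itvr; rewrite bnd_simp.
Qed.

Lemma seg_int_translate f a b c : a <= b -> continuous f ->
  seg_int f (a + c) (b + c) = seg_int (fun x => f (x + c)) a b.
Proof. by move=> ab cf; rewrite /seg_int /Rintegral integral_translate. Qed.

Lemma seg_int_ibp (F F' P g : R -> R) a b : a < b ->
  (forall x, is_derive x (1 : R) F (F' x)) -> continuous F' -> continuous g ->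
  (forall x, a <= x <= b -> is_derive x (1 : R) P (g x)) -> F a = 0 -> F b = 0 ->
  seg_int (fun x => F x * g x) a b = - seg_int (fun x => F' x * P x) a b.
Proof.
move=> ab dF cF' cg dP Fa Fb.
have cd (h h' : R -> R) x : is_derive x (1 : R) h (h' x) -> {for x, continuous h}.
  by move=> [d _]; apply: differentiable_continuous; apply/derivable1_diffP.
have fs (h h' : R -> R) : (forall x, a <= x <= b -> is_derive x (1 : R) h (h' x)) -> derivable_oo_LRcontinuous h a b.
  move=> dh; split.
  - by move=> x; rewrite in_itv /= => /andP[xa xb]; have [] := dh x _; rewrite ?ltW.
  - by apply: cvg_at_right_filter; apply: (cd _ h'); apply: dh; rewrite lexx ltW.
  - by apply: cvg_at_left_filter; apply: (cd _ h'); apply: dh; rewrite lexx ltW.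
have := @integration_by_parts _ F P F' g a b ab (continuous_subspaceT cF') (fs _ _ (fun x _ => dF x)) _
  (continuous_subspaceT cg) (fs _ _ dP) _.
rewrite Fa Fb !mul0r subrr add0e => h.
rewrite /seg_int /Rintegral h; first by rewrite fineN.
  by move=> x _; rewrite derive1E; case: (dF x).
move=> x; rewrite in_itv /= => /andP[xa xb]; rewrite derive1E; case: (dP x) => //.
by rewrite !ltW.
Qed.

End segment_integral.

(** * Means of periodic functions *)

Section period_mean.
Context {R : realType}.
Local Notation mu := (@lebesgue_measure R).
Variables (f : R -> R) (l B K : R).
Hypotheses (cf : continuous f) (l0 : 0 < l) (f_period : forall x, f (x + l) = f x) (fB : forall x, `|f x| <= B).

Let cbump L : continuous (fun x : R => bump (x / L)).
Proof.
move=> x; apply: (@continuous_comp _ _ _ (fun x : R => x / L) (@bump R)).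
  by apply: cvgM; [exact: cvg_id|exact: cvg_cst].
by apply: differentiable_continuous; apply/derivable1_diffP; case: (is_derive_bump (x / L)).
Qed.

(** On the middle half the bump is at least [(1 - 1/4)^2 = 9/16]. *)
Lemma bump_mass (L : R) : 0 < L -> L / 2 <= seg_int (fun x => bump (x / L)) (- L) L.
Proof.
move=> L0; have b0 (x : R) : 0 <= bump x by have [] := bump_bounds x.
have cL := @cbump L; rewrite (@seg_int_split _ _ (- L) L (- (L / 2)))//; [|by lra|by lra].
rewrite (@seg_int_split _ _ (- (L / 2)) L (L / 2))//; [|by lra|by lra].
have p (a b : R) : 0 <= seg_int (fun x => bump (x / L)) a b.
  by apply: Rintegral_ge0 => x _.
have q : L / 2 <= seg_int (fun x => bump (x / L)) (- (L / 2)) (L / 2).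
  apply: (@le_trans _ _ (seg_int (fun=> 1 / 2) (- (L / 2)) (L / 2))).
    by rewrite seg_int_cst; lra.
  apply: le_seg_int => // [x|x /andP[x1 x2]]; first exact: cvg_cst.
  have h : (x / L) ^+ 2 <= 1 / 4.
    have y1 : x / L <= 1 / 2 by rewrite ler_pdivrMr//; lra.
    have y2 : - (1 / 2) <= x / L by rewrite ler_pdivlMr//; lra.
    by nra.
  have h0 := sqr_ge0 (x / L).
  by rewrite /bump pos_part_id; [nra|lra].
by have := p (- L) (- (L / 2)); have := p (L / 2) L; lra.
Qed.

(** Full periods contribute 0, so at most one period of the integral counts. The hypothesis on [a]
    says that [a] itself is a period; the induction moves it by [l]. *)
Lemma bounded_primitive (g : R -> R) (B' a : R) (n : nat) : continuous g -> (forall x, g (x + l) = g x) ->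
  (forall x, `|g x| <= B') -> seg_int g 0 l = 0 -> (forall x, g (x + a) = g x) ->
  forall x, a <= x <= a + n%:R * l -> `|seg_int g a x| <= B' * l.
Proof.
move=> cg gp gB g0; have B0 := le_trans (normr_ge0 _) (gB 0).
have l0' := l0; elim: n a => [|n IH] a ga x /andP[ax xn].
  have xa : x = a by apply/eqP; rewrite eq_le ax andbT; lra.
  rewrite xa; apply: (le_trans (seg_int_norm cg (lexx a) (fun y _ => gB y))).
  by rewrite subrr mulr0 mulr_ge0// ltW.
have [xl|xl] := leP x (a + l).
  apply: (le_trans (seg_int_norm cg ax (fun y _ => gB y))); rewrite ler_wpM2l//; lra.
rewrite (@seg_int_split _ _ _ _ (a + l))//; [|lra|lra].
have -> : seg_int g a (a + l) = 0.
  by rewrite -{1}[a]add0r [a + l]addrC seg_int_translate ?(ltW l0)//; rewrite -[RHS]g0; exact: eq_seg_int.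
rewrite add0r; apply: IH; first by move=> y; rewrite addrA gp.
by rewrite (ltW xl) /=; move: xn; rewrite -natr1 mulrDl mul1r; lra.
Qed.

(** Write [f = g + m] with [m] the mean. The primitive of [g] is bounded, and integration by parts
    bounds the bump integral of [g] uniformly in [L], the slope [4 / L] being spread over length
    [2 L]. The part of [m] has size at least [|m| L / 2], so [m = 0]. *)
Lemma period_mean_eq0 : (forall L : R, 0 < L -> `|seg_int (fun x => bump (x / L) * f x) (- L) L| <= K) ->
  seg_int f 0 l = 0.
Proof.
move=> hK; have l0' := l0; have B0 := le_trans (normr_ge0 _) (fB 0).
pose m := seg_int f 0 l / l; pose g x := f x - m; pose B' := B + `|m|.
have cg : continuous g by move=> x; apply: cvgB; [exact: cf|exact: cvg_cst].
have gp x : g (x + l) = g x by rewrite /g f_period.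
have gB x : `|g x| <= B' by rewrite (le_trans (ler_normB _ _))// lerD2r.
have cm : continuous (fun _ : R => m) by move=> x; exact: cvg_cst.
have g0 : seg_int g 0 l = 0.
  by rewrite seg_intB// seg_int_cst ?(ltW l0)// subr0 /m divfK ?subrr// gt_eqF.
have B'0 : 0 <= B' by rewrite addr_ge0.
have main N : `|m| * (N.+1%:R * l / 2) <= K + 8 * (B' * l).
  (* Multiples of [l] suffice, and make the base point [a] below a period. *)
  set L := N.+1%:R * l; have L0 : 0 < L by rewrite mulr_gt0.
  have gper n x : g (x - n%:R * l) = g x.
    elim: n => [|n IH]; first by rewrite mul0r subr0.
    by rewrite -[RHS]IH -[LHS]gp -natr1; congr (g _); ring.
  (* One period to the left of [- L], so that the primitive is differentiable on all of [[- L, L]],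
     the end point included. *)
  pose a := - (N.+2%:R * l).
  have aL : a = - L - l by rewrite /a /L -[in LHS]natr1; ring.
  pose P x := seg_int g a x.
  have dP x : - L <= x <= L -> is_derive x (1 : R) P (g x).
    move=> /andP[x1 x2].
    have xx : x < x + 1 by lra.
    have ax : a < x by rewrite aL; lra.
    have [d1 d2] := @continuous_FTC1_closed _ g a x (x + 1) xx (integrable_segment _ _ cg) ax (cg x).
    exact: (DeriveDef d1 (etrans (esym (derive1E _ _)) d2)).
  have PB x : - L <= x <= L -> `|P x| <= B' * l.
    move=> /andP[x1 x2]; apply: (@bounded_primitive g B' a (N.+2 + N.+2)%N) => //.
      by move=> y; rewrite /a gper.
    rewrite natrD mulrDl; have -> : N.+2%:R * l = L + l by rewrite /L -[in LHS]natr1; ring.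
    by rewrite aL; apply/andP; split; lra.
  have dF x : is_derive x (1 : R) (fun x => bump (x / L)) (window_bump' 0 L x).
    have := is_derive_window_bump 0 L x; congr (is_derive _ _ _ _).
    by apply/funext => y; rewrite /window_bump subr0.
  have bL (y : R) : `|y| = L -> bump (y / L) = 0.
    by move=> yL; apply: (bump_out _).1; rewrite normrM yL [`|L^-1|]gtr0_norm ?invr_gt0// divff// gt_eqF.
  have E1 := @seg_int_ibp _ _ _ P g (- L) L _ dF (@continuous_window_bump' _ 0 L) cg dP.
  have {}E1 : seg_int (fun x => bump (x / L) * g x) (- L) L = - seg_int (fun x => window_bump' 0 L x * P x) (- L) L.
    by apply: E1; [lra|rewrite bL// normrN gtr0_norm|rewrite bL// gtr0_norm].
  have E2 : `|seg_int (fun x => bump (x / L) * g x) (- L) L| <= 8 * (B' * l).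
    rewrite E1 normrN.
    have -> : 8 * (B' * l) = 4 / L * (B' * l) * (L - - L) by field; rewrite gt_eqF.
    apply: seg_int_norm_within; last 2 first.
    - by lra.
    - move=> x xL; rewrite normrM; apply: ler_pM => //; last exact: PB.
      by have [_ _] := window_bump_bounds 0 L0 x.
    have cP : {within `[- L, L], continuous P}.
      by apply: derivable_within_continuous => x; rewrite in_itv /= => xL; case: (dP x xL).
    move=> x; apply: cvgM; last exact: cP.
    by apply: (continuous_subspaceT (@continuous_window_bump' _ 0 L)).
  have E3 : seg_int (fun x => bump (x / L) * f x) (- L) L =
     seg_int (fun x => bump (x / L) * g x) (- L) L + m * seg_int (fun x => bump (x / L)) (- L) L.
    have c1 : continuous (fun x : R => bump (x / L) * g x).
      by move=> x; apply: cvgM; [exact: cbump|exact: cg].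
    have c2 : continuous (fun x : R => m * bump (x / L)).
      by move=> x; apply: cvgM; [exact: cvg_cst|exact: cbump].
    rewrite -(seg_intZ _ _ _ (@cbump L)) -(seg_intD _ _ c1 c2).
    by apply: eq_seg_int => x; rewrite /g; ring.
  have bm := bump_mass L0.
  have mb0 : 0 <= seg_int (fun x => bump (x / L)) (- L) L by lra.
  apply: (@le_trans _ _ (`|m * seg_int (fun x => bump (x / L)) (- L) L|)).
    by rewrite [leRHS]normrM (ger0_norm mb0) ler_wpM2l.
  have -> : m * seg_int (fun x => bump (x / L)) (- L) L = seg_int (fun x => bump (x / L) * f x) (- L) L -
     seg_int (fun x => bump (x / L) * g x) (- L) L by rewrite E3; ring.
  by rewrite (le_trans (ler_normB _ _))// lerD// hK.
have m0 : m = 0.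
  apply/eqP; rewrite -normr_eq0 eq_le normr_ge0 andbT leNgt; apply/negP => mp.
  pose T := (K + 8 * (B' * l)) / (`|m| * l / 2).
  have h := truncnS_gt T; have := main (Num.truncn T).
  have q0 : 0 < `|m| * l / 2 by rewrite !mulr_gt0.
  move: h; rewrite /T ltr_pdivrMr// => h.
  have -> : `|m| * ((Num.truncn T).+1%:R * l / 2) = (Num.truncn T).+1%:R * (`|m| * l / 2) by ring.
  by rewrite leNgt => /negP; apply.
by move: m0 => /eqP; rewrite /m mulf_eq0 invr_eq0 (gt_eqF l0) orbF => /eqP.
Qed.

End period_mean.

(** * Uniqueness of Fourier coefficients *)

Section fourier_uniqueness.
Context {R : realType}.
Variables (h : R -> R) (l B : R).
Hypotheses (ch : continuous h) (l0 : 0 < l) (hB : forall x, `|h x| <= B).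
Let q : R := 2 * pi / l.
Hypothesis coef0 : forall (n : int) (al : R), seg_int (fun x => h x * sin (n%:~R * q * x + al)) 0 l = 0.

Let csin (k al : R) : continuous (fun x : R => sin (k * x + al)) /\ continuous (fun x : R => cos (k * x + al)).
Proof.
have c x : {for x, continuous (fun x : R => k * x + al)}.
  by apply: cvgD; [apply: cvgM; [exact: cvg_cst|exact: cvg_id]|exact: cvg_cst].
split=> x; first by apply: (@continuous_comp _ _ _ (fun x : R => k * x + al) sin); [exact: c|exact: continuous_sin].
by apply: (@continuous_comp _ _ _ (fun x : R => k * x + al) cos); [exact: c|exact: continuous_cos].
Qed.

(* [fourier_kernel^m] is a trigonometric polynomial that concentrates on [|x - x0| < d]: the kernel exceeds 1 there
   and has modulus at most 1 elsewhere. *)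
Definition fourier_kernel (x0 d x : R) : R := (1 - cos (q * d)) + cos (q * x - q * x0).

Lemma continuous_fourier_kernel x0 d : continuous (fourier_kernel x0 d).
Proof. by move=> x; apply: cvgD; [exact: cvg_cst|exact: (csin q (- (q * x0))).2]. Qed.

(** The kernel has frequencies -1, 0 and 1 only, so one more factor replaces the frequency [n] by
    [n - 1], [n] and [n + 1]; all frequencies and phases are carried through the induction. *)
Lemma fourier_kernel_orthogonal x0 d (m : nat) (n : int) (al : R) :
  seg_int (fun x => h x * fourier_kernel x0 d x ^+ m * sin (n%:~R * q * x + al)) 0 l = 0.
Proof.
have ck m' : continuous (fun x => h x * fourier_kernel x0 d x ^+ m').
  move=> x; apply: cvgM; first exact: ch.
  apply: (@continuous_comp _ _ _ (fourier_kernel x0 d) (fun y => y ^+ m')); last exact: exprn_continuous.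
  exact: continuous_fourier_kernel.
have cks m' (n' : int) al' : continuous (fun x => h x * fourier_kernel x0 d x ^+ m' * sin (n'%:~R * q * x + al')).
  by move=> x; apply: cvgM; [exact: ck|exact: (csin _ _).1].
elim: m n al => [|m IH] n al.
  by rewrite -[RHS](coef0 n al); apply: eq_seg_int => x; rewrite expr0 mulr1.
pose f k al' x := h x * fourier_kernel x0 d x ^+ m * sin ((k : int)%:~R * q * x + al').
have E x : h x * fourier_kernel x0 d x ^+ m.+1 * sin (n%:~R * q * x + al) =
   (1 - cos (q * d)) * f n al x + 2^-1 * (f (n + 1) (al - q * x0) x + f (n - 1) (al + q * x0) x).
  rewrite /f exprS !intrD rmorphN /=.
  have -> : (n%:~R + 1) * q * x + (al - q * x0) = (n%:~R * q * x + al) + (q * x - q * x0) by ring.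
  have -> : (n%:~R - 1) * q * x + (al + q * x0) = (n%:~R * q * x + al) - (q * x - q * x0) by ring.
  set Y := _ + al; rewrite (sinD Y) (sinB Y).
  have -> : fourier_kernel x0 d x * fourier_kernel x0 d x ^+ m =
    (1 - cos (q * d) + cos (q * x - q * x0)) * fourier_kernel x0 d x ^+ m by [].
  by field.
rewrite (eq_seg_int _ _ E) seg_intD; last 2 first.
- by move=> x; apply: cvgM; [exact: cvg_cst|exact: cks].
- by move=> x; apply: cvgM; [exact: cvg_cst|apply: cvgD; exact: cks].
rewrite !seg_intZ; last 2 first.
- by move=> x; apply: cvgD; exact: cks.
- exact: cks.
rewrite seg_intD; [|exact: cks|exact: cks].
by rewrite /f !IH; ring.
Qed.

(** If [h x0] were positive, the integral of [h] against the powers of the kernel would grow without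
    bound near [x0] and stay bounded elsewhere, although it is 0 for every power. The other
    inequality is this one for [- h]. *)
Lemma fourier_uniqueness_le (x0 : R) : 0 < x0 < l -> h x0 <= 0.
Proof.
move=> /andP[x00 x0l]; rewrite leNgt; apply/negP => h0.
have l0' := l0.
have q0 : 0 < q by rewrite divr_gt0// mulr_gt0// pi_gt0.
have ql : q * l = 2 * pi by rewrite /q divfK// gt_eqF.
have h2 : 0 < h x0 / 2 by rewrite divr_gt0.
(* [d] keeps the interval about [x0] inside the period, keeps [h] above [h x0 / 2] on it, and
   [q d < pi] keeps the cosine monotone there. *)
have [d [d0 dx0 dxl dpi hd]] : exists d, [/\ 0 < d, d < x0, d < l - x0, q * d < pi &
    forall x, `|x - x0| <= d -> h x0 / 2 <= h x].
  have /cvgrPdist_le /(_ _ h2) [d1 /= d10 hd1] := @ch x0.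
  exists (Num.min (d1 / 2) (Num.min (x0 / 2) (Num.min ((l - x0) / 2) (l / 4)))); split.
  - by rewrite !lt_min !divr_gt0// subr_gt0.
  - by rewrite !gt_min; apply/orP; right; apply/orP; left; lra.
  - by rewrite !gt_min; apply/orP; right; apply/orP; right; apply/orP; left; lra.
  - apply: (@le_lt_trans _ _ (q * (l / 4))).
      by rewrite ler_pM2l// !ge_min lexx !orbT.
    by rewrite mulrA ql; have := pi_gt0 R; lra.
  - move=> x; rewrite le_min => /andP[xd _]; have := hd1 x; rewrite /= distrC => hx.
    have {}hx : `|h x0 - h x| <= h x0 / 2 by apply: hx; lra.
    by move: hx; rewrite ler_norml => /andP[_]; lra.
have ql2 : q * d < pi by [].
pose k := fourier_kernel x0 d.
have cosE x : cos (q * x - q * x0) = cos (q * `|x - x0|).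
  by rewrite -mulrBr; case: (ler0P (x - x0)) => _ //; rewrite mulrN cosN.
have cos_mono (y z : R) : 0 <= y -> y <= z -> z <= pi -> cos z <= cos y.
  by move=> y0 yz zp; rewrite leNgt ltr_cos ?in_itv /= -?leNgt//; apply/andP; split; lra.
have k_out x : 0 <= x <= l -> d <= `|x - x0| -> `|k x| <= 1.
  move=> /andP[x1 x2] dx; have c1 : cos (q * `|x - x0|) <= cos (q * d).
    have y1 : `|x - x0| <= l - d by rewrite ler_norml; apply/andP; split; lra.
    have [yp|yp] := leP (q * `|x - x0|) pi.
      by apply: cos_mono => //; [rewrite mulr_ge0// ltW|rewrite ler_pM2l].
    have -> : cos (q * `|x - x0|) = cos (2 * pi - q * `|x - x0|).
      by rewrite mulr_natl cosB cos2pi sin2pi mul1r mul0r addr0.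
    apply: cos_mono; [by rewrite mulr_ge0// ltW| |lra].
    by rewrite lerBrDl -lerBrDr -ql -mulrBr ler_pM2l.
  have := cos_geN1 (q * `|x - x0|); have := cos_le1 (q * d).
  by rewrite /k /fourier_kernel cosE ler_norml => a1 a2; apply/andP; split; lra.
(* The kernel is at least [1 + c] on the inner half of the interval; by Bernoulli's inequality its
   powers grow at least linearly there. *)
pose c := cos (q * (d / 2)) - cos (q * d).
have c0 : 0 < c.
  have qd0 : 0 < q * d by rewrite mulr_gt0.
  have qd2 : q * (d / 2) = q * d / 2 by rewrite mulrA.
  rewrite subr_gt0 qd2 ltr_cos ?in_itv /=; first lra.
    by apply/andP; split; lra.
  by apply/andP; split; lra.
have k_in x : `|x - x0| <= d -> 1 <= k x.
  move=> xd; rewrite /k /fourier_kernel cosE.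
  have : cos (q * d) <= cos (q * `|x - x0|).
    by apply: cos_mono; [rewrite mulr_ge0// ltW|rewrite ler_pM2l|exact: ltW].
  by lra.
have k_in2 x : `|x - x0| <= d / 2 -> 1 + c <= k x.
  move=> xd; rewrite /k /fourier_kernel cosE /c.
  have : cos (q * (d / 2)) <= cos (q * `|x - x0|).
    apply: cos_mono; [by rewrite mulr_ge0// ltW|by rewrite ler_pM2l|].
    by apply: ltW; apply: le_lt_trans dpi; rewrite ler_pM2l//; lra.
  by lra.
pose H m x := h x * k x ^+ m.
have cH m : continuous (H m).
  move=> x; apply: cvgM; first exact: ch.
  apply: (@continuous_comp _ _ _ k (fun y => y ^+ m)); last exact: exprn_continuous.
  exact: continuous_fourier_kernel.
have H0 m : seg_int (H m) 0 l = 0.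
  rewrite -[RHS](fourier_kernel_orthogonal x0 d m 0 (pi / 2)); apply: eq_seg_int => x.
  by rewrite mulr0z !mul0r add0r sin_pihalf mulr1.
have lb m (a b v : R) : a <= b -> (forall x, a <= x <= b -> v <= H m x) -> v * (b - a) <= seg_int (H m) a b.
  move=> ab Hv; rewrite -seg_int_cst//; apply: le_seg_int => //.
  by move=> x; exact: cvg_cst.
have B0 := le_trans (normr_ge0 _) (hB 0).
have [e1 e2 e3 e4 e5] : [/\ 0 <= x0 - d, x0 - d <= x0 - d / 2, x0 - d / 2 <= x0 + d / 2, x0 + d / 2 <= x0 + d &
    x0 + d <= l] by split; lra.
have [e6 e7 e8] : [/\ x0 - d <= l, x0 - d / 2 <= l & x0 + d / 2 <= l] by split; lra.
have dd : x0 + d / 2 - (x0 - d / 2) = d by field.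
have out m x : 0 <= x <= l -> d <= `|x - x0| -> - B <= H m x.
  move=> xl dx; have : `|H m x| <= B by rewrite normrM normrX -[leRHS]mulr1 ler_pM// exprn_ile1// k_out.
  by rewrite ler_norml => /andP[].
have pos m x : `|x - x0| <= d -> 0 <= H m x.
  move=> xd; rewrite mulr_ge0// ?exprn_ge0//; first exact: le_trans (ltW h2) (hd x xd).
  exact: le_trans ler01 (k_in x xd).
have bern m : 1 + m%:R * c <= (1 + c) ^+ m.
  elim: m => [|m IH]; first by rewrite mul0r addr0 expr0.
  have c1 : 0 <= 1 + c by rewrite addr_ge0// ltW.
  rewrite exprS -natr1; apply: le_trans (ler_wpM2l c1 IH).
  have -> : (1 + c) * (1 + m%:R * c) = 1 + (m%:R + 1) * c + m%:R * c ^+ 2 by ring.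
  by rewrite lerDl mulr_ge0// sqr_ge0.
have mid m x : x0 - d / 2 <= x <= x0 + d / 2 -> h x0 / 2 * (1 + m%:R * c) <= H m x.
  move=> /andP[x1 x2]; have xd2 : `|x - x0| <= d / 2 by rewrite ler_norml; apply/andP; split; lra.
  have xd : `|x - x0| <= d by apply: (le_trans xd2); lra.
  have m0 : 0 <= m%:R * c by rewrite mulr_ge0// ltW.
  apply: ler_pM; [exact: ltW|exact: addr_ge0|exact: hd|].
  apply: (le_trans (bern m)); apply: lerXn2r; [|by rewrite nnegrE (le_trans ler01 (k_in x xd))|exact: k_in2].
  by rewrite nnegrE addr_ge0// ltW.
have main m : h x0 / 2 * (1 + m%:R * c) * d <= B * l.
  have i1 : - B * (x0 - d - 0) <= seg_int (H m) 0 (x0 - d).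
    apply: lb => // x /andP[x1 x2]; apply: out; first by rewrite x1 (le_trans x2).
    by rewrite distrC ler_normr lerBrDr -lerBrDl x2.
  have i5 : - B * (l - (x0 + d)) <= seg_int (H m) (x0 + d) l.
    apply: lb => // x /andP[x1 x2]; apply: out; first by rewrite x2 andbT (le_trans _ x1)// addr_ge0 ?ltW.
    by rewrite ler_normr lerBrDl x1.
  have i2 : 0 * (x0 - d / 2 - (x0 - d)) <= seg_int (H m) (x0 - d) (x0 - d / 2).
    apply: lb => // x /andP[x1 x2].
    by apply: pos; rewrite ler_norml lerBrDl x1 /= lerBlDl (le_trans x2)// (le_trans e3).
  have i4 : 0 * (x0 + d - (x0 + d / 2)) <= seg_int (H m) (x0 + d / 2) (x0 + d).
    apply: lb => // x /andP[x1 x2].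
    by apply: pos; rewrite ler_norml lerBrDl [x - x0 <= d]lerBlDl x2 andbT (le_trans e2)// (le_trans e3).
  have i3 : h x0 / 2 * (1 + m%:R * c) * (x0 + d / 2 - (x0 - d / 2)) <= seg_int (H m) (x0 - d / 2) (x0 + d / 2).
    by apply: lb => //; exact: mid.
  have := H0 m; rewrite (@seg_int_split _ _ 0 l (x0 - d))// (@seg_int_split _ _ (x0 - d) l (x0 - d / 2))//.
  rewrite (@seg_int_split _ _ (x0 - d / 2) l (x0 + d / 2))// (@seg_int_split _ _ (x0 + d / 2) l (x0 + d))//.
  rewrite dd in i3; set T := _ * _ * d in i3 *.
  have Bd : 0 <= B * d by rewrite mulr_ge0// ltW.
  by move: i1 i2 i4 i5; rewrite !mulrBr !mulrDr; lra.
have s0 : 0 < h x0 / 2 * c * d by rewrite !mulr_gt0.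
pose T := B * l / (h x0 / 2 * c * d).
have := truncnS_gt T; have := main (Num.truncn T).+1; rewrite {2}/T ltr_pdivrMr//.
have : 0 < h x0 / 2 * d by rewrite mulr_gt0.
set N : R := _.+1%:R.
have -> : h x0 / 2 * (1 + N * c) * d = h x0 / 2 * d + N * (h x0 / 2 * c * d) by ring.
by lra.
Qed.

End fourier_uniqueness.

(** * Rigidity of the boundary functions *)

Section translation_rigidity.
Context {R : realType}.
Local Notation mu := (@lebesgue_measure R).

Lemma sin_add_period (x : R) (n : int) : sin (x + n%:~R * (2 * pi)) = sin x.
Proof.
have h (m : nat) y : sin (y + m%:R * (2 * pi)) = sin y :> R.
  elim: m y => [|m IH] y; first by rewrite mul0r addr0.
  by rewrite -natr1 mulrDl mul1r addrA sinD IH (_ : 2 * pi = pi *+ 2) ?cos2pi ?sin2pi ?mulr1 ?mulr0 ?addr0// mulr_natl.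
case: n => m; first exact: h.
by rewrite NegzE mulrNz mulNr -[LHS](h m.+1) subrK.
Qed.

Lemma continuous_phase (u : R -> R) (s t th : R) : continuous u -> continuous (fun x => sin (s * u x + t * x + th)).
Proof.
move=> cu x; apply: (@continuous_comp _ _ _ (fun x => s * u x + t * x + th) sin); last exact: continuous_sin.
apply: cvgD; last exact: cvg_cst.
by apply: cvgD; apply: cvgM; [exact: cvg_cst|exact: cu|exact: cvg_cst|exact: cvg_id].
Qed.

Lemma continuous_sine (k al : R) : continuous (fun x : R => sin (k * x + al)).
Proof.
move=> x; apply: (@continuous_comp _ _ _ (fun x : R => k * x + al) sin); last exact: continuous_sin.
by apply: cvgD; [apply: cvgM; [exact: cvg_cst|exact: cvg_id]|exact: cvg_cst].
Qed.

Lemma continuous_bump_scale (L : R) : continuous (fun x : R => bump (x / L)).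
Proof.
move=> x; apply: (@continuous_comp _ _ _ (fun x : R => x / L) (@bump R)).
  by apply: cvgM; [exact: cvg_id|exact: cvg_cst].
by apply: differentiable_continuous; apply/derivable1_diffP; case: (is_derive_bump (x / L)).
Qed.

(** A continuous angle that is constant modulo [2 pi] is constant: otherwise it would somewhere have
    changed by an amount [d] in []0, pi]], and [cos d < 1] contradicts equal sines and cosines. *)
Lemma constant_of_sin_cos (B : R -> R) (a b : R) : continuous B ->
  (forall x y, a < x < b -> a < y < b -> sin (B x) = sin (B y) /\ cos (B x) = cos (B y)) ->
  forall x y, a < x -> x < y -> y < b -> B x = B y.
Proof.
move=> cB hB x y ax xy yb; apply/eqP; rewrite -subr_eq0; apply/negPn/negP => ne.
have pi0 := pi_gt0 R.
pose d : R := Num.min `|B x - B y| pi.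
have d0 : 0 < d by rewrite lt_min normr_gt0 ne pi0.
have [z zxy Bz] : exists2 z, x <= z <= y & `|B z - B x| = d.
  have dle : d <= `|B x - B y| by rewrite /d ge_min lexx.
  have cBw : {within `[x, y], continuous B} by exact: continuous_subspaceT.
  have [le|lt] := leP (B x) (B y).
    have [|z] := @IVT _ B x y (B x + d) (ltW xy) cBw.
      rewrite minElt maxElt; move: dle; rewrite distrC ger0_norm ?subr_ge0// => dle.
      by move: le; rewrite le_eqVlt => /orP[/eqP e|->]; [move: ne; rewrite e subrr eqxx|apply/andP; split; lra].
    by rewrite in_itv /= => hz Bz; exists z => //; rewrite Bz addrC addKr gtr0_norm.
  have [|z] := @IVT _ B x y (B x - d) (ltW xy) cBw.
    rewrite minElt maxElt; move: dle; rewrite gtr0_norm ?subr_gt0// => dle.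
    by rewrite ltNge (ltW lt) /=; apply/andP; split; lra.
  by rewrite in_itv /= => hz Bz; exists z => //; rewrite Bz addrC addKr normrN gtr0_norm.
have zb : a < z < b by move: zxy => /andP[z1 z2]; apply/andP; split; lra.
have xb : a < x < b by apply/andP; split; lra.
have [e1 e2] := hB z x zb xb.
have c1 : cos (B z - B x) = 1 by rewrite cosB e1 e2 -!expr2 cos2Dsin2.
have : cos d < 1.
  rewrite -cos0 ltr_cos ?in_itv /= ?lexx ?(ltW pi0) ?(ltW d0)//.
  by rewrite /d ge_min lexx orbT.
by rewrite -Bz; case: (ler0P (B z - B x)) => _; rewrite ?cosN c1 ltxx.
Qed.

Section single.
Variables (u : R -> R) (l l' : R).
Hypotheses (cu : continuous u) (l0 : 0 < l) (l0' : l' != 0) (u_period : forall x, u (x + l) = u x + l').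
Hypothesis bounded : forall s t th : R, s + t != 0 -> exists K : R, forall L : R, 0 < L ->
  `|seg_int (fun x => bump (x / L) * sin (s * u x + t * x + th)) (- L) L| <= K.
Let q : R := 2 * pi / l.
Let q' : R := 2 * pi / l'.

Let q0 : 0 < q. Proof. by rewrite divr_gt0// mulr_gt0// pi_gt0. Qed.
Let ql : q * l = 2 * pi. Proof. by rewrite /q divfK// gt_eqF. Qed.
Let ql' : q' * l' = 2 * pi. Proof. by rewrite /q' divfK. Qed.

Let sin1 (x : R) : `|sin x| <= 1. Proof. by rewrite ler_norml sin_geN1 sin_le1. Qed.

Lemma phase_period (n : int) (th x : R) :
  sin (q' * u (x + l) + n%:~R * q * (x + l) + th) = sin (q' * u x + n%:~R * q * x + th).
Proof.
rewrite -[RHS](sin_add_period _ (1 + n)) intrD mulrDl -{1}ql' -ql u_period; congr sin; ring.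
Qed.

Lemma phase_mean (n : int) (th : R) : q' + n%:~R * q != 0 ->
  seg_int (fun x => sin (q' * u x + n%:~R * q * x + th)) 0 l = 0.
Proof.
move=> nz; have [K hK] := bounded th nz.
apply: (@period_mean_eq0 R _ l 1 K) => //; first exact: continuous_phase.
exact: phase_period.
Qed.

Lemma sine_mean (n : int) (al : R) : n != 0 -> seg_int (fun x => sin (n%:~R * q * x + al)) 0 l = 0.
Proof.
move=> n0; pose k := n%:~R * q; have k0 : k != 0 by rewrite mulf_neq0 ?intr_eq0// gt_eqF.
have dF x : is_derive x (1 : R) (fun x => - (k^-1 * cos (k * x + al))) (sin (k * x + al)).
  have aff : is_derive x (1 : R) (fun y => k * y + al) k.
    apply/is_derive1_eps => e e0; exists e => // y _.
    have -> : k * y + al - (k * x + al) - k * (y - x) = 0 by ring.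
    by rewrite normr0 mulr_ge0// ltW.
  have d1 := @is_derive1_comp _ cos (fun y => k * y + al) x _ _ (is_derive_cos (k * x + al)) aff.
  have := is_deriveN (is_deriveZ k^-1 d1).
  have -> : - (k^-1 *: (- sin (k * x + al) * k)) = sin (k * x + al).
    by change (- (k^-1 * (- sin (k * x + al) * k)) = sin (k * x + al)); field.
  by [].
have cs := @continuous_sine k al.
rewrite /seg_int /Rintegral (integral_derive l0 dF cs) /=.
have -> : k * l + al = k * 0 + al + n%:~R * (2 * pi) by rewrite /k -ql; ring.
have cosE y : cos y = sin (y + pi / 2) :> R by rewrite sinDpihalf.
by rewrite !cosE addrAC sin_add_period; ring.
Qed.

(** By [phase_mean] all Fourier coefficients of [exp (i q' u)] vanish except perhaps the resonant
    one. After multiplication by [exp (i n0 q x)] only the constant term is left; the assertion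
    follows by applying Fourier uniqueness to the deviation from the mean. *)
Lemma phase_constant (n0 : int) : (forall n : int, n != n0 -> q' + n%:~R * q != 0) ->
  forall th, exists c, forall x, 0 < x < l -> sin (q' * u x + n0%:~R * q * x + th) = c.
Proof.
move=> hn th; pose f x := sin (q' * u x + n0%:~R * q * x + th).
have cf : continuous f by exact: continuous_phase.
pose c := seg_int f 0 l / l; exists c.
have cc : continuous (fun _ : R => c) by move=> x; exact: cvg_cst.
pose h x := f x - c.
have ch : continuous h by move=> x; apply: cvgB; [exact: cf|exact: cc].
have hB x : `|h x| <= 1 + `|c| by rewrite (le_trans (ler_normB _ _))// lerD2r sin1.
have cs (n : int) al := @continuous_sine (n%:~R * q) al.
have coef (n : int) al : seg_int (fun x => h x * sin (n%:~R * q * x + al)) 0 l = 0.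
  have [->|nn] := eqVneq n 0.
    rewrite (@eq_seg_int _ _ (fun x => sin al * h x)); last by move=> x; rewrite mulr0z !mul0r add0r mulrC.
    by rewrite seg_intZ// seg_intB// seg_int_cst ?(ltW l0)// subr0 /c divfK ?subrr ?mulr0// gt_eqF.
  pose g m be x := sin (q' * u x + (m : int)%:~R * q * x + be).
  have cg m be : continuous (g m be) by exact: continuous_phase.
  (* The product is turned into a sum, which moves the frequency [n0] to [n0 - n] and [n0 + n]; both
     differ from [n0], so [phase_mean] applies. *)
  have E x : h x * sin (n%:~R * q * x + al) =
     2^-1 * (g (n0 - n) (th - al + pi / 2) x - g (n0 + n) (th + al + pi / 2) x) - c * sin (n%:~R * q * x + al).
    rewrite /h /g mulrBl; congr (_ - _); rewrite !addrA !sinDpihalf !intrD mulrNz.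
    have -> : q' * u x + (n0%:~R - n%:~R) * q * x + th - al =
      (q' * u x + n0%:~R * q * x + th) - (n%:~R * q * x + al) by ring.
    have -> : q' * u x + (n0%:~R + n%:~R) * q * x + th + al =
      (q' * u x + n0%:~R * q * x + th) + (n%:~R * q * x + al) by ring.
    by rewrite /f; set X := _ + th; set Y := _ + al; rewrite (cosB X) (cosD X); field.
  have cgg : continuous (fun x => g (n0 - n) (th - al + pi / 2) x - g (n0 + n) (th + al + pi / 2) x).
    by move=> x; apply: cvgB; exact: cg.
  rewrite (eq_seg_int _ _ E) seg_intB; last 2 first.
  - by move=> x; apply: cvgM; [exact: cvg_cst|exact: cgg].
  - by move=> x; apply: cvgM; [exact: cvg_cst|exact: cs].
  rewrite (seg_intZ _ _ _ cgg) (seg_intZ _ _ _ (cs n al)) seg_intB//.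
  rewrite /g !phase_mean ?sine_mean//; first by rewrite subrr !mulr0 subrr.
  - by apply: hn; rewrite -subr_eq0 addrAC subrr add0r.
  - by apply: hn; rewrite -subr_eq0 addrAC subrr add0r oppr_eq0.
move=> x xl; apply/eqP; rewrite -subr_eq0 eq_le; apply/andP; split.
  exact: (@fourier_uniqueness_le R h l (1 + `|c|)).
rewrite -oppr_le0; apply: (@fourier_uniqueness_le R (fun x => - h x) l (1 + `|c|)) => //.
- by move=> y; apply: cvgN; exact: ch.
- by move=> y; rewrite normrN.
- move=> n al; rewrite -[RHS](mulr0 (-1)) -[in RHS](coef n al) -seg_intZ; first by apply: eq_seg_int => y; ring.
  by move=> y; apply: cvgM; [exact: ch|exact: cs].
Qed.

(** [q' u + n0 q x] is constant over a period, while its increment over the period is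
    [(1 + n0) 2 pi]. So [n0 = -1], whence [q' = q] and [l' = l], and [u - x] is constant. *)
Lemma translation_of_bounded_phase : exists C, forall x, u x = x + C.
Proof.
have [n0 [hn h0]] : exists n0 : int, (forall n : int, n != n0 -> q' + n%:~R * q != 0) /\
    (n0 = - 1 -> q' = q).
  have [[n0 e]|h] := pselect (exists n : int, q' + n%:~R * q = 0).
    (* Two different resonant indices would give [q = 0], so the resonance, if there is one, is
       unique. *)
    exists n0; split=> [n|en0].
      apply: contraNneq => e2; have : (n%:~R - n0%:~R) * q = 0 by rewrite -(subrr 0) -{1}e2 -e; ring.
      by move=> /eqP; rewrite mulf_eq0 (gt_eqF q0) orbF subr_eq0 eqr_int.
    by move: e; rewrite en0 mulrN1z mulN1r => /eqP; rewrite subr_eq0 => /eqP.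
  (* Without resonance any index may serve as [n0]; for 0 the second clause is void, and the count
     of turns below excludes the case. *)
  by exists 0; split=> // n _; apply/eqP => e; apply: h; exists n.
pose B x := q' * u x + n0%:~R * q * x.
have cB : continuous B.
  by move=> x; apply: cvgD; apply: cvgM; [exact: cvg_cst|exact: cu|exact: cvg_cst|exact: cvg_id].
have Bc x y : 0 < x -> x < y -> y < l -> B x = B y.
  apply: constant_of_sin_cos => // {x y} x y hx hy.
  have [c0 hc0] := phase_constant hn 0; have [c1 hc1] := phase_constant hn (pi / 2).
  split; first by have := hc0 x hx; rewrite -(hc0 y hy) !addr0.
  by have := hc1 x hx; rewrite -(hc1 y hy) !sinDpihalf.
have l0d := l0; pose be := B (l / 2).
have Bbe x : 0 < x < l -> B x = be.
  move=> /andP[x0 xl]; have [xm|mx|->//] := ltgtP x (l / 2); first by apply: Bc => //; lra.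
  by apply/esym; apply: Bc => //; lra.
have B0 : B 0 = be.
  have h1 : B x @[x --> (0 : R)^'+] --> B 0 by apply: cvg_at_right_filter; exact: cB.
  apply: (cvg_unique _ h1); first exact: Rhausdorff.
  apply: cvg_near_cst; near=> x; apply: Bbe; apply/andP; split; near: x.
    exact: nbhs_right_gt.
  exact: nbhs_right_lt.
have Bl : B l = be.
  have h1 : B x @[x --> (l : R)^'-] --> B l by apply: cvg_at_left_filter; exact: cB.
  apply: (cvg_unique _ h1); first exact: Rhausdorff.
  apply: cvg_near_cst; near=> x; apply: Bbe; apply/andP; split; near: x.
    exact: nbhs_left_gt.
  exact: nbhs_left_lt.
have n0E : n0 = -1.
  have e : (1 + n0)%:~R * (2 * pi) = 0 :> R.
    have : B l - B 0 = 0 by rewrite B0 Bl subrr.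
    rewrite /B -{1}[l]add0r u_period => e; rewrite -[RHS]e intrD mulrDl -{1}ql' -ql; ring.
  move: e => /eqP; rewrite mulf_eq0 mulf_eq0 pnatr_eq0 /= (gt_eqF (pi_gt0 R)) orbF intr_eq0 addrC addr_eq0.
  by move=> /eqP.
have qq := h0 n0E.
have ll : l' = l.
  have qn : q != 0 by rewrite gt_eqF.
  by apply: (mulfI qn); rewrite ql -[in LHS]qq ql'.
pose C := be / q; exists C.
have uC x : 0 <= x <= l -> u x = x + C.
  move=> /andP[x0 xl]; have : B x = be.
    move: x0; rewrite le_eqVlt => /orP[/eqP <-//|x0].
    move: xl; rewrite le_eqVlt => /orP[/eqP ->//|xl].
    by apply: Bbe; rewrite x0.
  rewrite /B n0E mulrN1z mulN1r qq /C => <-; field; by rewrite gt_eqF.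
have per (n : int) y : u (y + n%:~R * l) = u y + n%:~R * l.
  have h (m : nat) z : u (z + m%:R * l) = u z + m%:R * l.
    elim: m z => [|m IH] z; first by rewrite !mul0r !addr0.
    by rewrite -natr1 !mulrDl !mul1r !addrA u_period IH ll.
  case: n => m; first exact: h.
  by rewrite NegzE mulrNz mulNr -{2}[y](subrK (m.+1%:R * l)) h addrK.
move=> x; pose k := Num.floor (x / l).
have ux : u (x - k%:~R * l) = x - k%:~R * l + C.
  apply: uC; have /andP[k1 k2] := floor_itv (x / l); apply/andP; split.
    by rewrite subr_ge0 -ler_pdivlMr.
  by move: k2; rewrite ltr_pdivrMr// intrD mulrDl mul1r => k2; rewrite lerBlDl ltW.
by have := per k (x - k%:~R * l); rewrite subrK ux => ->; ring.
Unshelve. all: by end_near.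
Qed.

End single.

(* Comparing [(s, t, th)] with [(-s, -t, -th)] decouples [u0] from [u1], because [exp ((s + t) pi)] differs from its
   inverse when [s + t] is nonzero. *)
Lemma common_translation (u0 u1 : R -> R) (l l' : R) : continuous u0 -> continuous u1 -> 0 < l -> l' != 0 ->
  (forall x, u0 (x + l) = u0 x + l') -> (forall x, u1 (x + l) = u1 x + l') ->
  (forall s t th : R, exists K : R, forall L : R, 0 < L ->
    `|seg_int (fun x => bump (x / L) * (sin (s * u0 x + t * x + th) -
      expR (- ((s + t) * pi)) * sin (s * u1 x + t * x + th))) (- L) L| <= K) ->
  exists C, (forall x, u0 x = x + C) /\ (forall x, u1 x = x + C).
Proof.
move=> cu0 cu1 l0 l0' p0 p1 hK.
pose J (u : R -> R) s t th L := seg_int (fun x => bump (x / L) * sin (s * u x + t * x + th)) (- L) L.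
have cJ (u : R -> R) s t th L : continuous u ->
    continuous (fun x : R => bump (x / L) * sin (s * u x + t * x + th)).
  by move=> cu x; apply: cvgM; [exact: continuous_bump_scale|exact: continuous_phase].
have JE s t th L (e : R) : seg_int (fun x => bump (x / L) * (sin (s * u0 x + t * x + th) -
      e * sin (s * u1 x + t * x + th))) (- L) L = J u0 s t th L - e * J u1 s t th L.
  rewrite /J -seg_intZ; last exact: cJ.
  rewrite -seg_intB; [|exact: cJ|].
    by apply: eq_seg_int => x; ring.
  by move=> x; apply: cvgM; [exact: cvg_cst|exact: cJ].
have JN u s t th L : continuous u -> J u (- s) (- t) (- th) L = - J u s t th L.
  move=> cu; rewrite -[RHS]mulN1r /J -seg_intZ; last exact: cJ.
  apply: eq_seg_int => x; have -> : - s * u x + - t * x + - th = - (s * u x + t * x + th) by ring.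
  by rewrite sinN; ring.
have both s t th : s + t != 0 -> exists K : R, forall L : R, 0 < L -> `|J u0 s t th L| <= K /\ `|J u1 s t th L| <= K.
  move=> st; have [K1 h1] := hK s t th; have [K2 h2] := hK (- s) (- t) (- th).
  set sg := (s + t) * pi in h1; have sg0 : sg != 0 by rewrite mulf_neq0// gt_eqF// pi_gt0.
  have sgE : (- s + - t) * pi = - sg by rewrite /sg; ring.
  pose D := expR sg - expR (- sg).
  have D0 : D != 0.
    rewrite subr_eq0; apply: contra sg0 => /eqP /expR_inj e.
    by apply/eqP; lra.
  have D0' : 0 < `|D| by rewrite normr_gt0.
  exists (Num.max ((K1 + K2) / `|D|) (K1 + expR (- sg) * ((K1 + K2) / `|D|))) => L L0.
  have := h2 L L0; have := h1 L L0; rewrite !JE sgE opprK !JN// => g1 g2.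
  have b1 : `|J u1 s t th L| <= (K1 + K2) / `|D|.
    rewrite ler_pdivlMr// -normrM; apply: le_trans (lerD g1 g2); apply: le_trans (ler_normD _ _).
    by rewrite le_eqVlt; apply/orP; left; apply/eqP; congr (`|_|); rewrite /D; ring.
  split; last by rewrite le_max b1.
  rewrite le_max; apply/orP; right.
  have -> : J u0 s t th L = (J u0 s t th L - expR (- sg) * J u1 s t th L) + expR (- sg) * J u1 s t th L by ring.
  apply: (le_trans (ler_normD _ _)); apply: lerD => //.
  by rewrite normrM (ger0_norm (expR_ge0 _)) ler_wpM2l// expR_ge0.
have [C0 e0] : exists C, forall x, u0 x = x + C.
  apply: (translation_of_bounded_phase cu0 l0 l0' p0) => s t th st.
  by have [K h] := both s t th st; exists K => L L0; have [] := h L L0.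
have [C1 e1] : exists C, forall x, u1 x = x + C.
  apply: (translation_of_bounded_phase cu1 l0 l0' p1) => s t th st.
  by have [K h] := both s t th st; exists K => L L0; have [] := h L L0.
exists C0; split=> // x; rewrite e1; congr (_ + _).
apply/eqP; rewrite -subr_eq0; apply/negPn/negP => ne.
(* With [t = - s] the phases are constant, and this [s] makes the difference of the two sines equal
   to -1. The bump integral is then minus the mass of the bump, which is unbounded in [L]. *)
pose s := pi / 2 / (C1 - C0).
have [K h] := hK s (- s) (- (s * C0)).
have h' L : 0 < L -> L / 2 <= K.
  move=> L0; apply: le_trans (h L L0); apply: le_trans (bump_mass L0) _.
  rewrite subrr mul0r oppr0 expR0.
  rewrite [X in _ <= `|X|](@eq_seg_int _ _ (fun x => -1 * bump (x / L))); last first.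
    move=> y; rewrite e0 e1.
    have -> : s * (y + C0) + - s * y + - (s * C0) = 0 by ring.
    have -> : s * (y + C1) + - s * y + - (s * C0) = pi / 2 by rewrite /s; field.
    by rewrite sin0 sin_pihalf; ring.
  by rewrite seg_intZ ?normrM ?normrN1 ?mul1r ?ler_norm//; exact: continuous_bump_scale.
have := h' (2 * (`|K| + 1)); have := ler_norm K; have := normr_ge0 K => k0 k1 k2.
have : 2 * (`|K| + 1) / 2 <= K by apply: k2; lra.
by lra.
Qed.

End translation_rigidity.

(** * Moebius groups *)

Section moebius.
Context {R : realType}.
Local Notation pt := (R * R)%type.
Local Notation S1 := (unit_circle R).
Local Open Scope complex_scope.
Implicit Types (a b c d : R[i]) (p : pt) (g h : S1 -> S1).

Definition circle_elt p (h : cmod p = 1) : S1 := exist _ p (mem_set h).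

Lemma circle_eltE p (h : cmod p = 1) : \val (circle_elt h) = p. Proof. by []. Qed.

Lemma cmod_val (z : S1) : cmod (\val z) = 1.
Proof. by have := set_mem (valP z). Qed.

Lemma toC_ofC (z : R[i]) : toC (ofC z) = z.
Proof. by case: z. Qed.

Lemma ofC_toC p : ofC (toC p) = p.
Proof. by case: p. Qed.

Lemma norm_conjc (z : R[i]) : `|z^*%C| = `|z|.
Proof. exact: norm_conjC. Qed.

Lemma normc_sqr (z : R[i]) : `|z| ^+ 2 = z * z^*%C.
Proof. by rewrite normCK. Qed.

Lemma mobius_den_neq0 a b p : `|b| < `|a| -> cmod p <= 1 -> b^*%C * toC p + a^*%C != 0.
Proof.
move=> ba p1; apply/eqP => e; have le : `|a| <= `|b|; last by have := lt_le_trans ba le; rewrite ltxx.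
rewrite -(norm_conjc a); have -> : a^*%C = - (b^*%C * toC p) by apply/eqP; rewrite -addr_eq0 addrC e.
by rewrite normrN normrM norm_conjc toC_norm ler_piMr// lecR.
Qed.

Lemma disk_mobiusP a b p q : `|b| < `|a| -> cmod p <= 1 ->
  disk_mobius a b p = q <-> toC q * (b^*%C * toC p + a^*%C) = a * toC p + b.
Proof.
move=> ba p1; have d0 := mobius_den_neq0 ba p1; rewrite /disk_mobius; split=> [<-|e].
  by rewrite toC_ofC divfK.
by rewrite -e mulfK// ofC_toC.
Qed.

Lemma is_mobius_comp a b c d g h : is_mobius_of a b g -> is_mobius_of c d h ->
  is_mobius_of (a * c + b * d^*%C) (a * d + b * c^*%C) (g \o h).
Proof.
move=> [ba gE] [dc hE].
have lt : `|a * d + b * c^*%C| < `|a * c + b * d^*%C|.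
  rewrite -(@ltr_pXn2r _ 2)// ?nnegrE//; rewrite !normc_sqr -subr_gt0 !rmorphD !rmorphM /= !conjcK.
  have -> : (a * c + b * d^*%C) * (a^*%C * c^*%C + b^*%C * d) - (a * d + b * c^*%C) * (a^*%C * d^*%C + b^*%C * c) =
    (a * a^*%C - b * b^*%C) * (c * c^*%C - d * d^*%C) by ring.
  by rewrite -!normc_sqr mulr_gt0// subr_gt0 ltr_pXn2r ?nnegrE.
split=> // z /=; apply/esym/disk_mobiusP; rewrite ?cmod_val//.
have z1 : cmod (\val z) <= 1 by rewrite cmod_val.
have w1 : cmod (\val (h z)) <= 1 by rewrite cmod_val.
have e1 := (disk_mobiusP _ dc z1).1 (esym (hE z)); have e2 := (disk_mobiusP _ ba w1).1 (esym (gE (h z))).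
have d0 := mobius_den_neq0 dc z1.
have : toC (\val (g (h z))) * (b^*%C * toC (\val (h z)) + a^*%C) * (d^*%C * toC (\val z) + c^*%C) =
   (a * toC (\val (h z)) + b) * (d^*%C * toC (\val z) + c^*%C) by rewrite e2.
rewrite !rmorphD !rmorphM /= !conjcK => e3.
rewrite /= in e1.
set v := toC (sval (g (h z))) in e3 *; set w := toC (sval (h z)) in e1 e3; set x := toC (sval z) in e1 e3 *.
have -> : (a * c + b * d^*%C) * x + (a * d + b * c^*%C) = a * (c * x + d) + b * (d^*%C * x + c^*%C) by ring.
have -> : v * ((a^*%C * d^*%C + b^*%C * c) * x + (a^*%C * c^*%C + b^*%C * d)) =
   v * (b^*%C * (c * x + d) + a^*%C * (d^*%C * x + c^*%C)) by ring.
rewrite -e1.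
transitivity (v * (b^*%C * w + a^*%C) * (d^*%C * x + c^*%C)); first by ring.
by rewrite e3; ring.
Qed.

Lemma is_mobius_inv a b g h : is_mobius_of a b g -> cancel h g -> is_mobius_of a^*%C (- b) h.
Proof.
move=> [ba gE] hK; split=> [|z]; first by rewrite normrN norm_conjc.
have w1 : cmod (\val (h z)) <= 1 by rewrite cmod_val.
have e := (disk_mobiusP _ ba w1).1 (esym (gE (h z))).
apply/esym/disk_mobiusP; rewrite ?normrN ?norm_conjc ?cmod_val//.
move: e; rewrite hK rmorphN /= conjcK => e.
set w := toC (\val (h z)) in e *; set x := toC (\val z) in e *.
have -> : w * (- b^*%C * x + a) = (a * w + b) - x * b^*%C * w - b by ring.
by rewrite -e; ring.
Qed.

Lemma disk_mobius_fixP a b p : `|b| < `|a| -> cmod p <= 1 ->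
  disk_mobius a b p = p <->
  complex.Re b * (p.1 ^+ 2 - p.2 ^+ 2 - 1) + 2 * complex.Im b * p.1 * p.2 + 2 * complex.Im a * p.2 = 0 /\
  2 * complex.Re b * p.1 * p.2 - complex.Im b * (p.1 ^+ 2 - p.2 ^+ 2 + 1) - 2 * complex.Im a * p.1 = 0.
Proof.
move=> ba p1; rewrite disk_mobiusP//.
case: a b p {ba p1} => [a1 a2] [b1 b2] [x y] /=.
split=> [/eqP|[e1 e2]].
  by rewrite eq_complex /= => /andP[/eqP e1 /eqP e2]; split; lra.
by apply/eqP; rewrite eq_complex /=; apply/andP; split; apply/eqP; lra.
Qed.

Lemma normc_lt_coord (a b : R[i]) : (`|b| < `|a|) =
  (complex.Re b ^+ 2 + complex.Im b ^+ 2 < complex.Re a ^+ 2 + complex.Im a ^+ 2).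
Proof.
by rewrite -(@ltr_pXn2r _ 2)// ?nnegrE// !normc_def -!rmorphXn /= ltcR !sqr_sqrtr// addr_ge0// sqr_ge0.
Qed.

(** The fixed points solve [b^* z^2 - 2 i s z - b = 0] with [s] the imaginary part of [a]. Under the
    hypothesis the roots are [(e + i s) b / |b|^2] with [e] a real square root of [|b|^2 - s^2], and
    they have modulus 1. *)
Lemma mobius_two_fixpoints a b g : is_mobius_of a b g ->
  complex.Im a ^+ 2 < complex.Re b ^+ 2 + complex.Im b ^+ 2 ->
  exists z1 z2 : S1, [/\ z1 <> z2, g z1 = z1 & g z2 = z2].
Proof.
move=> [ba gE] sb; set s := complex.Im a in sb; set b1 := complex.Re b in sb; set b2 := complex.Im b in sb.
pose n := b1 ^+ 2 + b2 ^+ 2; pose dd := Num.sqrt (n - s ^+ 2).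
have n0 : 0 < n by apply: le_lt_trans sb; exact: sqr_ge0.
have dd2 : dd ^+ 2 = n - s ^+ 2 by rewrite sqr_sqrtr// subr_ge0 ltW.
have dd0 : 0 < dd by rewrite sqrtr_gt0 subr_gt0.
pose z (e : R) : pt := ((e * b1 - s * b2) / n, (s * b1 + e * b2) / n).
have z1 (e : R) : e ^+ 2 = n - s ^+ 2 -> cmod (z e) = 1.
  move=> e2; rewrite /cmod /= (_ : _ + _ = 1) ?sqrtr1//.
  have -> : ((e * b1 - s * b2) / n) ^+ 2 + ((s * b1 + e * b2) / n) ^+ 2 = (e ^+ 2 + s ^+ 2) * (b1 ^+ 2 + b2 ^+ 2) / n ^+ 2.
    by field; rewrite gt_eqF.
  by rewrite e2 -/n; field; rewrite gt_eqF.
have zfix (e : R) : e ^+ 2 = n - s ^+ 2 -> disk_mobius a b (z e) = z e.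
  move=> e2; apply/(disk_mobius_fixP ba); first by rewrite z1.
  rewrite -/s -/b1 -/b2 /=; have nE : n = b1 ^+ 2 + b2 ^+ 2 by [].
  have n0' : n != 0 by rewrite gt_eqF.
  have e2' : e ^+ 2 + s ^+ 2 = n by rewrite e2; ring.
  clearbody n; split.
    have -> : b1 * (((e * b1 - s * b2) / n) ^+ 2 - ((s * b1 + e * b2) / n) ^+ 2 - 1) +
      2 * b2 * ((e * b1 - s * b2) / n) * ((s * b1 + e * b2) / n) + 2 * s * ((s * b1 + e * b2) / n) =
      (b1 * ((e ^+ 2 - s ^+ 2) * (b1 ^+ 2 + b2 ^+ 2) - n ^+ 2) - 2 * s * e * b2 * (b1 ^+ 2 + b2 ^+ 2) + 2 * s * (s * b1 + e * b2) * n) / n ^+ 2.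
      by field.
    by rewrite -nE (_ : _ - _ + _ = b1 * n * (e ^+ 2 + s ^+ 2 - n)); [rewrite e2' subrr mulr0 mul0r|ring].
  have -> : 2 * b1 * ((e * b1 - s * b2) / n) * ((s * b1 + e * b2) / n) -
    b2 * (((e * b1 - s * b2) / n) ^+ 2 - ((s * b1 + e * b2) / n) ^+ 2 + 1) - 2 * s * ((e * b1 - s * b2) / n) =
    (b2 * ((e ^+ 2 - s ^+ 2) * (b1 ^+ 2 + b2 ^+ 2) - n ^+ 2) + 2 * s * e * b1 * (b1 ^+ 2 + b2 ^+ 2) - 2 * s * (e * b1 - s * b2) * n) / n ^+ 2.
    by field.
  by rewrite -nE (_ : _ + _ - _ = b2 * n * (e ^+ 2 + s ^+ 2 - n)); [rewrite e2' subrr mulr0 mul0r|ring].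
have dn2 : (- dd) ^+ 2 = n - s ^+ 2 by rewrite sqrrN.
exists (circle_elt (z1 _ dd2)), (circle_elt (z1 _ dn2)); split.
- move=> /(congr1 \val); rewrite !circle_eltE => -[/eqP e1 /eqP e2].
  have i0 : n^-1 != 0 by rewrite invr_eq0 gt_eqF.
  move: e1 e2; rewrite !(inj_eq (mulIf i0)) => /eqP e1 /eqP e2.
  have f1 : dd * b1 = 0 by lra.
  have f2 : dd * b2 = 0 by lra.
  have d0 : dd != 0 by rewrite gt_eqF.
  move: f1 f2 => /eqP; rewrite mulf_eq0 (negPf d0) /= => /eqP f1 /eqP; rewrite mulf_eq0 (negPf d0) /= => /eqP f2.
  by move: n0; rewrite /n f1 f2 expr0n /= addr0 ltxx.
- by apply: val_inj; rewrite gE circle_eltE zfix.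
- by apply: val_inj; rewrite gE circle_eltE zfix.
Qed.

End moebius.

(** * Multipliers, and existence of a hyperbolic element *)

Section axis.
Context {R : realType}.
Local Notation pt := (R * R)%type.
Local Notation S1 := (unit_circle R).
Local Open Scope complex_scope.
Implicit Types (a b c d : R[i]) (p : pt) (g h : S1 -> S1).

(** The denominators [p] and [r] at the fixed points are the eigenvalues of the matrix of [g]. They
    are real because the fixed points lie on the circle, and their product is the determinant
    [|a|^2 - |b|^2], so [r / p] is positive. *)
Lemma moebius_multiplier a b g (z1 z2 : S1) : is_mobius_of a b g -> z1 <> z2 -> g z1 = z1 -> g z2 = z2 ->
  exists lam : R, [/\ 0 < lam, (lam = 1 -> forall z, g z = z) & forall z,
    (toC (\val (g z)) - toC (\val z1)) * (toC (\val z) - toC (\val z2)) =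
    lam%:C * ((toC (\val z) - toC (\val z1)) * (toC (\val (g z)) - toC (\val z2)))].
Proof.
move=> [ba gE] z12 g1 g2.
have eqn (z : S1) : toC (\val (g z)) * (b^*%C * toC (\val z) + a^*%C) = a * toC (\val z) + b.
  by apply/(disk_mobiusP _ ba); rewrite ?cmod_val.
have unit (z : S1) : toC (\val z) * (toC (\val z))^*%C = 1 by rewrite -normc_sqr toC_norm cmod_val expr1n.
have toC_inj (z w : S1) : toC (\val z) = toC (\val w) -> z = w.
  by move=> /(congr1 (@ofC R)); rewrite !ofC_toC => /val_inj.
set x1 := toC (\val z1); set x2 := toC (\val z2).
pose p := b^*%C * x1 + a^*%C; pose r := b^*%C * x2 + a^*%C.
have e1 : x1 * p = a * x1 + b by rewrite /p /x1 -{1}g1 eqn.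
have e2 : x2 * r = a * x2 + b by rewrite /r /x2 -{1}g2 eqn.
have x12 : x1 - x2 != 0 by rewrite subr_eq0; apply/eqP => /toC_inj.
(* On the circle the conjugate of [x] is [1 / x]; conjugating the eigenvalue equation then returns
   the eigenvalue itself. *)
have real_of x (q : R[i]) : x * x^*%C = 1 -> q = b^*%C * x + a^*%C -> x * q = a * x + b -> q = (complex.Re q)%:C.
  move=> xx qE xq; have qc : q^*%C = q.
    rewrite -[RHS]mul1r -xx [x * _]mulrC -mulrA xq qE rmorphD rmorphM /= !conjcK.
    by rewrite mulrDr [x^*%C * (a * x)]mulrCA [x^*%C * x]mulrC xx; ring.
  move: qc; case: (q) => q1 q2 /eqP; rewrite eq_complex /= => /andP[_ /eqP q20].
  by apply/eqP; rewrite eq_complex /= eqxx /=; apply/eqP; lra.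
have pR := real_of x1 p (unit z1) erefl e1; have rR := real_of x2 r (unit z2) erefl e2.
have sum : a + a^*%C = p + r.
  apply/eqP; rewrite -subr_eq0; have : (a + a^*%C - (p + r)) * (x1 - x2) = 0.
    have -> : (a + a^*%C - (p + r)) * (x1 - x2) = (a * x1 + b) - (a * x2 + b) + (a^*%C - p - r) * (x1 - x2) by ring.
    by rewrite -e1 -e2 /p /r; ring.
  by move=> /eqP; rewrite mulf_eq0 (negPf x12) orbF.
have det : p * r = a * a^*%C - b * b^*%C.
  have -> : r = a + a^*%C - p by rewrite sum; ring.
  have -> : p * (a + a^*%C - p) = p * a - (x1 * p) * b^*%C by rewrite /p; ring.
  by rewrite e1 /p; ring.
set pr := complex.Re p in pR; set rr := complex.Re r in rR.
have prod0 : 0 < pr * rr.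
  have : 0 < p * r by rewrite det -!normc_sqr subr_gt0 ltr_pXn2r ?nnegrE.
  by rewrite pR rR -rmorphM /= ltcR.
have pr0 : pr != 0 by apply: contraTneq prod0 => ->; rewrite mul0r ltxx.
have rr0 : rr != 0 by apply: contraTneq prod0 => ->; rewrite mulr0 ltxx.
have rel z : (toC (\val (g z)) - x1) * (toC (\val z) - x2) =
    (rr / pr)%:C * ((toC (\val z) - x1) * (toC (\val (g z)) - x2)).
  have Q0 : b^*%C * toC (\val z) + a^*%C != 0 by apply: mobius_den_neq0 => //; rewrite cmod_val.
  have := eqn z; move: Q0; set w := toC (\val (g z)); set x := toC (\val z) => Q0 e.
  have p0 : p != 0 by rewrite pR; apply/eqP => /(congr1 (@complex.Re R)) /= /eqP; exact/negP.
  have -> : (rr / pr)%:C = r / p by rewrite pR rR rmorphM /= fmorphV.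
  apply: (mulfI p0); apply: (mulfI Q0).
  have f1 : (w - x1) * (b^*%C * x + a^*%C) = r * (x - x1).
    have -> : r = a + a^*%C - p by rewrite sum; ring.
    have -> : (w - x1) * (b^*%C * x + a^*%C) = w * (b^*%C * x + a^*%C) - x1 * (b^*%C * x + a^*%C) by ring.
    have bE : b = x1 * p - a * x1 by rewrite e1; ring.
    by rewrite e {1}bE /p; ring.
  have f2 : (w - x2) * (b^*%C * x + a^*%C) = p * (x - x2).
    have -> : p = a + a^*%C - r by rewrite sum; ring.
    have -> : (w - x2) * (b^*%C * x + a^*%C) = w * (b^*%C * x + a^*%C) - x2 * (b^*%C * x + a^*%C) by ring.
    have bE : b = x2 * r - a * x2 by rewrite e2; ring.
    by rewrite e {1}bE /r; ring.
  transitivity (p * (x - x2) * ((w - x1) * (b^*%C * x + a^*%C))); first by ring.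
  rewrite f1; transitivity (r * (x - x1) * ((w - x2) * (b^*%C * x + a^*%C))); first by rewrite f2; ring.
  by field.
exists (rr / pr); split=> //.
  have -> : rr / pr = (pr * rr) / pr ^+ 2 by field.
  by rewrite divr_gt0// exprn_even_gt0.
move=> l1 z; have := rel z; rewrite l1 mul1r => e; apply: toC_inj.
have : (toC (\val (g z)) - toC (\val z)) * (x1 - x2) = 0.
  have -> : (toC (\val (g z)) - toC (\val z)) * (x1 - x2) =
    (toC (\val (g z)) - x1) * (toC (\val z) - x2) - (toC (\val z) - x1) * (toC (\val (g z)) - x2) by ring.
  by rewrite e subrr.
by move=> /eqP; rewrite mulf_eq0 (negPf x12) orbF subr_eq0 => /eqP.
Qed.

(** In the Lorentz space of vectors [(s, b)] the two given vectors are time-like or null, and the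
    last hypothesis says that their cross product is not space-like. The cross product of two
    independent vectors of this kind is space-like, so they are dependent. *)
Lemma proportional_of_small (s t b1 b2 d1 d2 : R) : s != 0 ->
  b1 ^+ 2 + b2 ^+ 2 <= s ^+ 2 -> d1 ^+ 2 + d2 ^+ 2 <= t ^+ 2 ->
  (s * d1 - t * b1) ^+ 2 + (s * d2 - t * b2) ^+ 2 <= (b2 * d1 - b1 * d2) ^+ 2 ->
  s * d1 = t * b1 /\ s * d2 = t * b2.
Proof.
move=> s0 bs dt W; set w1 := s * d1 - t * b1 in W; set w2 := s * d2 - t * b2 in W.
pose X := b1 * w1 + b2 * w2; pose Y := b2 * w1 - b1 * w2; pose N := w1 ^+ 2 + w2 ^+ 2.
have N0 : 0 <= N by rewrite addr_ge0// sqr_ge0.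
have s2 : 0 < s ^+ 2 by rewrite exprn_even_gt0.
have h1 : s ^+ 2 * N <= Y ^+ 2.
  have -> : Y ^+ 2 = s ^+ 2 * (b2 * d1 - b1 * d2) ^+ 2 by rewrite /Y /w1 /w2; ring.
  by rewrite ler_pM2l.
have h2 : X ^+ 2 + Y ^+ 2 = (b1 ^+ 2 + b2 ^+ 2) * N by rewrite /X /Y /N; ring.
have h3 : (b1 ^+ 2 + b2 ^+ 2) * N <= s ^+ 2 * N by rewrite ler_wpM2r.
have X2 := sqr_ge0 X.
have X0 : X = 0 by apply/eqP; rewrite -sqrf_eq0 eq_le X2 andbT; lra.
have h4 : (s ^+ 2 - (b1 ^+ 2 + b2 ^+ 2)) * N <= 0 by rewrite mulrBl; lra.
have h5 : N = s ^+ 2 * (d1 ^+ 2 + d2 ^+ 2) - t ^+ 2 * (b1 ^+ 2 + b2 ^+ 2) - 2 * t * X.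
  by rewrite /N /X /w1 /w2; ring.
have Nz : N = 0.
  apply/eqP; rewrite eq_le N0 andbT; rewrite leNgt; apply/negP => Np.
  have e : s ^+ 2 - (b1 ^+ 2 + b2 ^+ 2) <= 0 by rewrite -(pmulr_lle0 _ Np).
  have e' : b1 ^+ 2 + b2 ^+ 2 = s ^+ 2 by lra.
  move: h5; rewrite X0 mulr0 subr0 e'.
  have : s ^+ 2 * (d1 ^+ 2 + d2 ^+ 2) <= s ^+ 2 * t ^+ 2 by rewrite ler_pM2l.
  by rewrite [t ^+ 2 * _]mulrC; lra.
have q1 := sqr_ge0 w1; have q2 := sqr_ge0 w2.
have w10 : w1 = 0 by apply/eqP; rewrite -sqrf_eq0 eq_le q1 andbT; move: Nz; rewrite /N; lra.
have w20 : w2 = 0 by apply/eqP; rewrite -sqrf_eq0 eq_le q2 andbT; move: Nz; rewrite /N; lra.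
by split; apply/eqP; rewrite -subr_eq0; apply/eqP.
Qed.

(* The trace of the commutator [g h g^-1 h^-1] exceeds twice its determinant, which makes it hyperbolic, unless the
   vectors [(Im a, b)] and [(Im c, d)] of the Lorentz space are close in the sense of the conclusion. *)
Lemma commutator_small a b c d : let s := complex.Im a in let t := complex.Im c in
  let b1 := complex.Re b in let b2 := complex.Im b in let d1 := complex.Re d in let d2 := complex.Im d in
  let p := a * c + b * d^*%C in let q := a * d + b * c^*%C in
  let u := a^*%C * c^*%C + - b * (- d)^*%C in let v := a^*%C * - d + - b * c^*%C^*%C in
  let A := p * u + q * v^*%C in let B := p * v + q * u^*%C in
  `|b| < `|a| -> `|d| < `|c| -> complex.Re B ^+ 2 + complex.Im B ^+ 2 <= complex.Im A ^+ 2 ->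
  (s * d1 - t * b1) ^+ 2 + (s * d2 - t * b2) ^+ 2 <= (b2 * d1 - b1 * d2) ^+ 2.
Proof.
cbv zeta; rewrite !normc_lt_coord; case: a b c d => [a1 s] [b1 b2] [c1 t] [d1 d2] /= ba dc.
set ReB := (X in X ^+ 2 + _); set ImB := (X in _ + X ^+ 2 <= _); set ImA := (X in _ <= X ^+ 2 -> _) => h.
pose de := (a1 ^+ 2 + s ^+ 2 - (b1 ^+ 2 + b2 ^+ 2)) * (c1 ^+ 2 + t ^+ 2 - (d1 ^+ 2 + d2 ^+ 2)).
pose X := (s * d1 - t * b1) ^+ 2 + (s * d2 - t * b2) ^+ 2 - (b2 * d1 - b1 * d2) ^+ 2.
have de0 : 0 < de by rewrite mulr_gt0// subr_gt0.
have E : (de + 2 * X) ^+ 2 + ImA ^+ 2 - ReB ^+ 2 - ImB ^+ 2 = de ^+ 2.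
  by rewrite /ReB /ImB /ImA /de /X; ring.
clearbody ReB ImB ImA de; rewrite -subr_le0 -/X; clearbody X.
rewrite leNgt; apply/negP => X0.
have : 0 < 4 * X * (de + X) by rewrite !mulr_gt0// addr_gt0.
by nra.
Qed.

(** For a transformation other than the identity this is what hyperbolic means here. *)
Definition circle_fix2 g := exists z1 z2 : S1, [/\ z1 <> z2, g z1 = z1 & g z2 = z2].

Lemma moebius_id_coeff a b g : is_mobius_of a b g -> (forall z, g z = z) -> b = 0.
Proof.
move=> [ba gE] gid.
have eqs (x y : R) : cmod (x, y) = 1 ->
  complex.Re b * (x ^+ 2 - y ^+ 2 - 1) + 2 * complex.Im b * x * y + 2 * complex.Im a * y = 0 /\
  2 * complex.Re b * x * y - complex.Im b * (x ^+ 2 - y ^+ 2 + 1) - 2 * complex.Im a * x = 0.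
  move=> xy; apply: (disk_mobius_fixP (p := (x, y)) ba _).1; first by rewrite xy.
  by have := gE (circle_elt xy); rewrite gid circle_eltE.
have [_ h1] : _ /\ _ := eqs 1 0 ltac:(by rewrite /cmod /= expr1n expr0n addr0 sqrtr1).
have [_ h2] : _ /\ _ := eqs (-1) 0 ltac:(by rewrite /cmod /= sqrrN expr1n expr0n addr0 sqrtr1).
have [h3 _] : _ /\ _ := eqs 0 1 ltac:(by rewrite /cmod /= expr1n expr0n add0r sqrtr1).
by apply/eqP; rewrite eq_complex; apply/andP; split; apply/eqP => /=; lra.
Qed.

(** Without hyperbolic elements every element, commutators included, has [|b| <= |Im a|]. Hence all
    vectors [(Im a, b)] are proportional to a single one, and the fixed point equation depends on
    this vector only. *)
Lemma common_fixed_point (G : set (S1 -> S1)) : Mob_subgroup G ->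
  (forall g, G g -> circle_fix2 g -> forall z, g z = z) ->
  exists p, cmod p <= 1 /\ forall g a b, G g -> is_mobius_of a b g -> disk_mobius a b p = p.
Proof.
move=> [GM _ Gcomp Ginv] NH.
have nh g a b : G g -> is_mobius_of a b g -> complex.Re b ^+ 2 + complex.Im b ^+ 2 <= complex.Im a ^+ 2.
  move=> Gg gab; rewrite leNgt; apply/negP => lt.
  have gid := NH g Gg (mobius_two_fixpoints gab lt).
  by move: lt; rewrite (moebius_id_coeff gab gid) /= expr0n addr0 ltNge sqr_ge0.
(* If [Im a = 0] throughout, then [b = 0] throughout, and the origin is fixed. *)
have [[g [a [b [Gg gab s0]]]]|triv] := pselect (exists g a b, [/\ G g, is_mobius_of a b g & complex.Im a != 0]); last first.
  exists (0, 0); rewrite cmod0; split=> // g a b Gg gab.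
  have s0 : complex.Im a = 0 by apply/eqP/negPn/negP => s0; apply: triv; exists g, a, b.
  have := nh g a b Gg gab; rewrite s0 expr0n /= => le0.
  have q1 := sqr_ge0 (complex.Re b); have q2 := sqr_ge0 (complex.Im b).
  have b1 : complex.Re b = 0 by apply/eqP; rewrite -sqrf_eq0 eq_le q1 andbT; lra.
  have b2 : complex.Im b = 0 by apply/eqP; rewrite -sqrf_eq0 eq_le q2 andbT; lra.
  apply/(disk_mobius_fixP gab.1); first by rewrite cmod0.
  by rewrite /= b1 b2 s0; split; ring.
set s := complex.Im a in s0; set b1 := complex.Re b; set b2 := complex.Im b.
have bs := nh g a b Gg gab; rewrite -/s -/b1 -/b2 in bs.
pose be1 := b1 / s; pose be2 := b2 / s.
have s2 : 0 < s ^+ 2 by rewrite exprn_even_gt0.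
have be_le : be1 ^+ 2 + be2 ^+ 2 <= 1.
  by rewrite !expr_div_n -mulrDl ler_pdivrMr// mul1r.
pose e := Num.sqrt (1 - (be1 ^+ 2 + be2 ^+ 2)).
have e2 : e ^+ 2 = 1 - (be1 ^+ 2 + be2 ^+ 2) by rewrite sqr_sqrtr// subr_ge0.
have e0 : 0 <= e := sqrtr_ge0 _.
have r0 : 1 + e != 0 by rewrite gt_eqF//; lra.
(* The root [i be / (1 + e)] of [be^* z^2 - 2 i z - be = 0], with [be = b / s]: the one in the
   closed disk, written so that [be = 0] is allowed. *)
pose x := - be2 / (1 + e); pose y := be1 / (1 + e).
have p1 : cmod (x, y) <= 1.
  rewrite -(@ler_pXn2r _ 2) ?nnegrE ?cmod_ge0 ?ler01// expr1n cmod_sqr /= /x /y.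
  rewrite [(- be2 / _) ^+ 2]expr_div_n [(be1 / _) ^+ 2]expr_div_n sqrrN -mulrDl ler_pdivrMr ?exprn_even_gt0// mul1r.
  have -> : be2 ^+ 2 + be1 ^+ 2 = 1 - e ^+ 2 by rewrite e2; ring.
  have E : (1 + e) ^+ 2 = 1 + 2 * e + e ^+ 2 by ring.
  by have := sqr_ge0 e; rewrite E; lra.
exists (x, y); split=> // h c d Gh hcd.
have [g' [Gg' gK' g'K]] := Ginv g Gg; have [h' [Gh' hK' h'K]] := Ginv h Gh.
have gab' := is_mobius_inv gab g'K; have hcd' := is_mobius_inv hcd h'K.
have kk := is_mobius_comp (is_mobius_comp gab hcd) (is_mobius_comp gab' hcd').
have Gk : G ((g \o h) \o (g' \o h')) by apply: (Gcomp); apply: (Gcomp).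
have small := commutator_small gab.1 hcd.1 (nh _ _ _ Gk kk).
have [w1 w2] := proportional_of_small s0 bs (nh _ _ _ Gh hcd) small.
set t := complex.Im c in w1 w2; set d1 := complex.Re d in w1 w2; set d2 := complex.Im d in w1 w2.
apply/(disk_mobius_fixP hcd.1) => //; rewrite /= -/t -/d1 -/d2.
have -> : d1 = t * be1 by rewrite /be1 mulrA -w1 mulrAC divff ?mul1r.
have -> : d2 = t * be2 by rewrite /be2 mulrA -w2 mulrAC divff ?mul1r.
have b12 : be1 ^+ 2 = 1 - e ^+ 2 - be2 ^+ 2 by rewrite e2; ring.
have key : - (be1 ^+ 2 + be2 ^+ 2) - (1 + e) ^+ 2 + 2 * (1 + e) = 0 by rewrite b12; ring.
rewrite /x /y; clearbody be1 be2 e; split.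
  transitivity (t * be1 * (- (be1 ^+ 2 + be2 ^+ 2) - (1 + e) ^+ 2 + 2 * (1 + e)) / (1 + e) ^+ 2); first by field.
  by rewrite key mulr0 mul0r.
transitivity (t * be2 * (- (be1 ^+ 2 + be2 ^+ 2) - (1 + e) ^+ 2 + 2 * (1 + e)) / (1 + e) ^+ 2); first by field.
by rewrite key mulr0 mul0r.
Qed.

(** If all fixed points of hyperbolic elements lay in [X], they would form a finite set, invariant
    by conjugation, which must then be empty; [common_fixed_point] excludes that case as well. *)
Lemma hyperbolic_element (G : set (S1 -> S1)) (X : set pt) : Mob_subgroup G -> non_elementary G -> finite_set X ->
  exists g (z1 z2 : S1), [/\ G g, z1 <> z2, g z1 = z1, g z2 = z2 & ~ X (\val z1) /\ exists z, g z <> z].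
Proof.
move=> hG hne Xfin; have [GM _ Gcomp Ginv] := hG; apply: contrapT => none; apply: hne.
pose F := [set p : pt | exists g (z1 z2 : S1), [/\ G g, z1 <> z2, g z1 = z1, g z2 = z2 & \val z1 = p /\ exists z, g z <> z]].
have FX : F `<=` X.
  move=> p [g [z1 [z2 [Gg z12 g1 g2 [<- gz]]]]]; apply: contrapT => nX; apply: none.
  by exists g, z1, z2.
have [[p Fp]|F0] := pselect (F !=set0); last first.
  have [|p [p1 pfix]] := @common_fixed_point G hG.
    move=> g Gg [z1 [z2 [z12 g1 g2]]] z; apply: contrapT => gz; apply: F0; exists (\val z1), g, z1, z2.
    by split=> //; split=> //; exists z.
  exists [set p]; split; [exact: finite_set1|by exists p|by move=> q ->|].
  by move=> g a b Gg gab; rewrite image_set1 (pfix g a b).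
exists F; split; [exact: sub_finite_set Xfin|by exists p|by move=> q [g [z1 [z2 [_ _ _ _ [<- _]]]]]; rewrite /closed_unit_disk /= cmod_val|].
have conj k k' : G k -> G k' -> cancel k k' -> cancel k' k -> forall z, F (\val z) -> F (\val (k z)).
  move=> Gk Gk' kK k'K z [g [z1 [z2 [Gg z12 g1 g2 [/val_inj <- [w gw]]]]]].
  exists (k \o (g \o k')), (k z1), (k z2); split.
  - by apply: (Gcomp) => //; apply: (Gcomp).
  - by move=> e; apply: z12; rewrite -(kK z1) e kK.
  - by rewrite /= kK g1.
  - by rewrite /= kK g2.
  - split=> //; exists (k w); rewrite /= kK => e; apply: gw.
    by rewrite -(kK (g w)) e kK.
move=> k a b Gk kab; have [k' [Gk' kK k'K]] := Ginv k Gk.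
apply/seteqP; split=> q.
  move=> [q' Fq' <-]; have [g [z1 [z2 [_ _ _ _ [e _]]]]] := Fq'.
  by rewrite -e -kab.2; apply: (conj k k') => //; rewrite e.
move=> Fq; have [g [z1 [z2 [_ _ _ _ [e _]]]]] := Fq.
exists (\val (k' z1)); first by apply: (conj k' k) => //; rewrite e.
by rewrite -kab.2 k'K.
Qed.

End axis.

(** * Boundary values in strip coordinates *)

Section boundary_geometry.
Context {R : realType}.
Local Notation pt := (R * R)%type.
Local Notation S1 := (unit_circle R).
Local Open Scope complex_scope.
Implicit Types (z w : pt).

Lemma circle_pt_period (t : R) (n : int) : circle_pt (t + n%:~R * (2 * pi)) = circle_pt t.
Proof.
have cosE y : cos y = sin (y + pi / 2) :> R by rewrite sinDpihalf.
by rewrite /circle_pt !cosE addrAC !sin_add_period.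
Qed.

Lemma circle_angle_range (ta : R) (z : S1) : exists t, ta <= t < ta + 2 * pi /\ \val z = circle_pt t.
Proof.
have [t tE] := circle_angle (cmod_val z); have pi0 := pi_gt0 R.
pose n := Num.floor ((t - ta) / (2 * pi)); have p2 : 0 < 2 * pi :> R by lra.
have /andP[n1 n2] := floor_itv ((t - ta) / (2 * pi)).
exists (t + (- n)%:~R * (2 * pi)); rewrite circle_pt_period; split=> //.
move: n1 n2; rewrite -/n ler_pdivlMr// ltr_pdivrMr// mulrDl intrD mulrDl mul1r mulrNz mulNr => n1 n2.
by apply/andP; split; lra.
Qed.

Lemma one_sub_cisN (t : R) z : 1 - cis (- t) * toC z = - cis (- t) * (toC z - cis t).
Proof. by rewrite mulrBr mulNr mulNr cisNK opprK addrC. Qed.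

Lemma toC_neq z w : z <> w -> toC z - toC w != 0.
Proof. by move=> zw; rewrite subr_eq0; apply/eqP => /(congr1 (@ofC R)); rewrite !ofC_toC. Qed.

Section strip.
Variables (ta D : R).
Hypothesis D0 : 0 < D < 2 * pi.

(** The exponential of the strip coordinate is a constant times [(z - a) / (z - b)], so a positive
    multiplier acts as a horizontal translation by its logarithm. *)
Lemma strip_translate z w (lam : R) : strip_dom ta D z -> strip_dom ta D w -> 0 < lam ->
  (toC w - cis ta) * (toC z - cis (ta + D)) = lam%:C * ((toC z - cis ta) * (toC w - cis (ta + D))) ->
  strip_map ta D w = (strip_x ta D z + ln lam, strip_y ta D z).
Proof.
move=> dz dw lam0 rel; apply: polar_inj; [exact: strip_y_range|exact: strip_y_range|].
have [_ _ zb] := dz; have [_ _ wb] := dw.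
have nz : toC z - cis (ta + D) != 0 by have := toC_neq zb.
have nw : toC w - cis (ta + D) != 0 by have := toC_neq wb.
rewrite expRD lnK ?posrE// rmorphM /= mulrAC !strip_exp// !one_sub_cisN.
have c0 : cis (- (ta + D)) != 0 by exact: cis_neq0.
have -> : - cis (- ta) * (toC w - cis ta) / (- cis (- (ta + D)) * (toC w - cis (ta + D))) =
  cis (- ta) / cis (- (ta + D)) * (lam%:C * ((toC z - cis ta) / (toC z - cis (ta + D)))).
  have -> : (toC w - cis ta) = lam%:C * ((toC z - cis ta) * (toC w - cis (ta + D))) / (toC z - cis (ta + D)).
    by rewrite -rel mulfK.
  by field; rewrite nz nw c0.
by field; rewrite nz c0.
Qed.

End strip.

Section homeo.
Variables (f f' : S1 -> S1) (phi : R -> R) (ta D : R).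
Hypotheses (D0 : 0 < D < 2 * pi) (fK : cancel f f') (lift : sense_preserving_lift f phi).
Let ta' := phi ta.
Let D' := phi (ta + D) - phi ta.

Lemma lift_circle_pt (t : R) (z : S1) : \val z = circle_pt t -> \val (f z) = circle_pt (phi t).
Proof. by have [_ _ _ h] := lift; exact: h. Qed.

Lemma lift_arc : 0 < D' < 2 * pi.
Proof.
have [_ mono per _] := lift; have /andP[d0 d1] := D0; apply/andP; split.
  by rewrite subr_gt0; apply: mono; lra.
have : phi (ta + D) < phi (ta + 2 * pi) by apply: mono; lra.
by rewrite per /D'; lra.
Qed.

(** The lift is increasing, so [f] maps the arc from [a] to [b] onto the arc between their images;
    in strip coordinates each boundary line goes to the line at the same height. *)
Lemma boundary_arcs (z : S1) : \val z <> circle_pt ta -> \val z <> circle_pt (ta + D) ->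
  [/\ strip_dom ta D (\val z), strip_dom ta' D' (\val (f z)),
      strip_y ta' D' (\val (f z)) = strip_y ta D (\val z) &
      strip_y ta D (\val z) = 0 \/ strip_y ta D (\val z) = pi].
Proof.
move=> za zb; have [t [/andP[t1 t2] tE]] := circle_angle_range ta z.
have [_ mono per _] := lift; have D0' := lift_arc.
have tr : ta < t < ta + 2 * pi.
  by rewrite t2 andbT lt_neqAle t1 andbT; apply/eqP => e; apply: za; rewrite tE e.
have tD : t != ta + D by apply/eqP => e; apply: zb; rewrite tE e.
have fE := lift_circle_pt tE; have /andP[t1' _] := tr.
have taD : ta' + D' = phi (ta + D) by rewrite /D' addrC subrK.
have tr' : ta' < phi t < ta' + 2 * pi by rewrite /ta' -per; apply/andP; split; exact: mono.
have tD' : phi t != ta' + D'.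
  by rewrite taD; have [h|h|e] := ltgtP t (ta + D); [rewrite lt_eqF// mono|rewrite gt_eqF// mono|move: tD; rewrite e eqxx].
rewrite fE tE; split; [exact: circle_strip_dom|exact: circle_strip_dom| |].
  rewrite !strip_y_boundary// taD; have [h|h|e] := ltgtP t (ta + D); last by move: tD; rewrite e eqxx.
    by rewrite mono.
  by rewrite ltNge (ltW (mono _ _ h)).
by rewrite strip_y_boundary//; case: ifP => _; [left|right].
Qed.

Variables (y0 : R).
(** [y0] is 0 or [pi]: the two boundary lines are treated at once. *)
Hypothesis (sy0 : sin y0 = 0) (ry0 : 0 <= y0 <= pi).

Lemma boundary_cmod (x : R) : cmod (strip_inv ta D (x, y0)) = 1.
Proof.
have [c c0 e] := strip_inv_mod ta D0 (w := (x, y0)) ry0.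
have e2 : cmod (strip_inv ta D (x, y0)) ^+ 2 = 1 by move: e; rewrite /= sy0 mulr0; lra.
by apply/eqP; rewrite -(eqrXn2 (_ : 0 < 2)%N (cmod_ge0 _) ler01)// e2 expr1n.
Qed.

Definition boundary_pt (x : R) : S1 := circle_elt (boundary_cmod x).

Definition boundary_fun (x : R) : R := strip_x ta' D' (\val (f (boundary_pt x))).

Lemma boundary_pt_dom (x : R) : strip_dom ta D (\val (boundary_pt x)) /\
  strip_map ta D (\val (boundary_pt x)) = (x, y0).
Proof. by split; [exact: strip_inv_dom|exact: strip_mapK]. Qed.

Lemma boundary_image (x : R) : strip_dom ta' D' (\val (f (boundary_pt x))) /\
  strip_map ta' D' (\val (f (boundary_pt x))) = (boundary_fun x, y0).
Proof.
have [[_ za zb] m] := boundary_pt_dom x; have [_ d e _] := boundary_arcs za zb.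
by split=> //; rewrite /strip_map e; congr pair; case: m.
Qed.

(** [g] and [h] are translations in the strip coordinates at their respective fixed points, and [f]
    intertwines them. *)
Lemma boundary_fun_period (g h : S1 -> S1) (lam lam' : R) : 0 < lam -> 0 < lam' -> h \o f = f \o g ->
  (forall z : S1, (toC (\val (g z)) - cis ta) * (toC (\val z) - cis (ta + D)) =
    lam%:C * ((toC (\val z) - cis ta) * (toC (\val (g z)) - cis (ta + D)))) ->
  (forall z : S1, (toC (\val (h z)) - cis ta') * (toC (\val z) - cis (ta' + D')) =
    lam'%:C * ((toC (\val z) - cis ta') * (toC (\val (h z)) - cis (ta' + D')))) ->
  (forall z : S1, \val (g z) = circle_pt ta -> \val z = circle_pt ta) ->
  (forall z : S1, \val (g z) = circle_pt (ta + D) -> \val z = circle_pt (ta + D)) ->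
  forall x, boundary_fun (x + ln lam) = boundary_fun x + ln lam'.
Proof.
move=> lam0 lam0' hf grel hrel ga gb x.
have [dz zE] := boundary_pt_dom x; have [_ za zb] := dz.
have gza : \val (g (boundary_pt x)) <> circle_pt ta by move=> /ga.
have gzb : \val (g (boundary_pt x)) <> circle_pt (ta + D) by move=> /gb.
have [dg dfg _ _] := boundary_arcs gza gzb.
have gx : g (boundary_pt x) = boundary_pt (x + ln lam).
  apply: val_inj; rewrite -(strip_invK D0 dg) (strip_translate D0 dz dg lam0 (grel _)).
  by case: zE => -> ->.
have [df fE] := boundary_image x.
have hE : h (f (boundary_pt x)) = f (g (boundary_pt x)) by exact: (congr1 (fun k => k (boundary_pt x)) hf).
have dh : strip_dom ta' D' (\val (h (f (boundary_pt x)))) by rewrite hE.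
have := strip_translate lift_arc df dh lam0' (hrel _); rewrite hE gx.
by rewrite /strip_map => -[e _]; exact: e.
Qed.

Hypothesis cf : continuous f.

Lemma continuous_boundary_fun : continuous boundary_fun.
Proof.
have cval : continuous (set_val : S1 -> R * R) by exact: initial_continuous.
have cb : continuous boundary_pt.
  apply: continuous_comp_initial => x.
  apply: (@continuous_comp _ _ _ (fun x : R => (x, y0)) (strip_inv ta D)); first exact: continuous_line1.
  by apply: continuous_strip_inv; [exact: D0|exact: ry0].
move=> x; have [df _] := boundary_image x.
apply: (@continuous_comp _ _ _ (fun x => \val (f (boundary_pt x))) (strip_x ta' D')).
  apply: (@continuous_comp _ _ _ (f \o boundary_pt) set_val); last exact: cval.
  by apply: continuous_comp; [exact: cb|exact: cf].
apply: (@continuous_comp _ _ _ (strip_map ta' D') fst); last exact: continuous_fst.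
exact: continuous_strip_map.
Qed.

(** The filter is left general to cover both the right limit at 0 and the left limit at [pi]. *)
Lemma boundary_fun_limit (F : pt -> pt) (G : set_system R) (FG : Filter G) (x : R) :
  boundary_extension F f -> y @[y --> G] --> y0 -> (\forall y \near G, 0 < y < pi) ->
  (fun y => strip_map ta' D' (F (strip_inv ta D (x, y)))) @ G --> (boundary_fun x, y0).
Proof.
move=> ext Gy Gpi; have [df <-] := boundary_image x.
have c1 : (fun y => F (strip_inv ta D (x, y))) @ G --> \val (f (boundary_pt x)).
  apply: cvg_comp (ext (boundary_pt x)) => A hA.
  have c2 : (fun y => strip_inv ta D (x, y)) @ G --> strip_inv ta D (x, y0).
    apply: (cvg_comp (fun y : R => (x, y)) (strip_inv ta D) _ (continuous_strip_inv D0 (w := (x, y0)) ry0)).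
    by apply: cvg_comp Gy _; exact: continuous_line2.
  have := c2 _ hA; apply: filterS2 Gpi => y yp h; apply: h.
  by have [h _] := strip_inv_strip ta D0 (w := (x, y)) yp.
by apply: cvg_comp c1 _; exact: continuous_strip_map.
Qed.

End homeo.

(** The difference of the squared moduli is [4 K sin (D / 2) sin (D' / 2)]. *)
Lemma normc_translate_lt (D D' K : R) : 0 < D < 2 * pi -> 0 < D' < 2 * pi -> 0 < K ->
  let k := K%:C * cis ((D' - D) / 2) in `|k - 1| < `|cis (- D) - k|.
Proof.
move=> /andP[d0 d1] /andP[d0' d1'] K0; cbv zeta; rewrite normc_lt_coord /= !mul0r !subr0 !addr0 cosN sinN.
have sD : 0 < sin (D / 2) by apply: sin_gt0_pi; apply/andP; split; lra.
have sD' : 0 < sin (D' / 2) by apply: sin_gt0_pi; apply/andP; split; lra.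
set g := (D' - D) / 2; have cs := cos2Dsin2 g; have csD := cos2Dsin2 D.
have E : cos g - cos (D + g) = 2 * (sin (D' / 2) * sin (D / 2)).
  have -> : g = D' / 2 - D / 2 by rewrite /g; ring.
  have -> : D + (D' / 2 - D / 2) = D' / 2 + D / 2 by field.
  by rewrite cosB cosD; ring.
rewrite cosD in E; have P : 0 < K * (2 * (sin (D' / 2) * sin (D / 2))) by rewrite !mulr_gt0.
rewrite -subr_gt0.
have -> : (cos D - K * cos g) ^+ 2 + (- sin D - K * sin g) ^+ 2 - ((K * cos g - 1) ^+ 2 + (K * sin g) ^+ 2) =
   (cos D ^+ 2 + sin D ^+ 2 - 1) + 2 * (K * (cos g - (cos D * cos g - sin D * sin g))) by ring.
by rewrite csD subrr add0r E mulr_gt0.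
Qed.

(** Exponentiating the translation gives a bilinear relation between [z] and [f z], which extends to
    the two poles; solving it for [f z] gives the coefficients. *)
Lemma mobius_of_strip_translation (f : S1 -> S1) (phi : R -> R) (ta D C : R) :
  0 < D < 2 * pi -> sense_preserving_lift f phi ->
  (forall z : S1, \val z <> circle_pt ta -> \val z <> circle_pt (ta + D) ->
    strip_map (phi ta) (phi (ta + D) - phi ta) (\val (f z)) =
    (strip_x ta D (\val z) + C, strip_y ta D (\val z))) ->
  Mob_circle R f.
Proof.
move=> D0 lift hC; set ta' := phi ta; set D' := phi (ta + D) - phi ta.
have D0' : 0 < D' < 2 * pi := lift_arc ta D0 lift.
have taD' : ta' + D' = phi (ta + D) by rewrite /ta' /D' addrC subrK.
pose K := expR C; have K0 : 0 < K := expR_gt0 C.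
pose k := K%:C * cis ((D' - D) / 2).
have rel (z : S1) : (1 - cis (- ta') * toC (\val (f z))) * (1 - cis (- (ta + D)) * toC (\val z)) =
   k * (1 - cis (- ta) * toC (\val z)) * (1 - cis (- (ta' + D')) * toC (\val (f z))).
  have [ea|za] := pselect (\val z = circle_pt ta).
    by rewrite (lift_circle_pt lift ea) ea !toC_circle_pt !cisNK !subrr mulr0 !mul0r.
  have [eb|zb] := pselect (\val z = circle_pt (ta + D)).
    by rewrite (lift_circle_pt lift eb) eb !toC_circle_pt -taD' !cisNK !subrr !mulr0.
  have [dz dw _ _] := boundary_arcs D0 lift za zb; rewrite -/ta' -/D' in dw.
  have [ex ey] : strip_x ta' D' (\val (f z)) = strip_x ta D (\val z) + C /\
      strip_y ta' D' (\val (f z)) = strip_y ta D (\val z).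
    by have [h1 h2] := hC z za zb; split; [exact: h1|exact: h2].
  have := strip_exp dw; rewrite ex ey.
  have -> : (expR (strip_x ta D (\val z) + C))%:C * cis (strip_y ta D (\val z)) =
      K%:C * ((expR (strip_x ta D (\val z)))%:C * cis (strip_y ta D (\val z))).
    by rewrite expRD rmorphM /= -/K; ring.
  rewrite (strip_exp dz).
  have -> : cis (pi - D / 2) = cis ((D' - D) / 2) * cis (pi - D' / 2) by rewrite -cisD; congr cis; field.
  have [_ _ zb'] := dz; have [_ _ wb'] := dw.
  set x := toC (\val z); set w := toC (\val (f z)).
  have nz : 1 - cis (- (ta + D)) * x != 0.
    by rewrite one_sub_cisN mulf_neq0 ?oppr_eq0 ?cis_neq0//; have := toC_neq zb'.
  have nw : 1 - cis (- (ta' + D')) * w != 0.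
    by rewrite one_sub_cisN mulf_neq0 ?oppr_eq0 ?cis_neq0//; have := toC_neq wb'.
  set cp := cis (pi - _); have cp0 : cp != 0 := cis_neq0 _; rewrite /k; set ck := cis (_ / 2).
  move=> e; have e' : K%:C * ck * ((1 - cis (- ta) * x) / (1 - cis (- (ta + D)) * x)) =
     (1 - cis (- ta') * w) / (1 - cis (- (ta' + D')) * w).
    by apply: (mulfI cp0); rewrite -e; ring.
  have -> : 1 - cis (- ta') * w = (K%:C * ck * ((1 - cis (- ta) * x) / (1 - cis (- (ta + D)) * x))) *
    (1 - cis (- (ta' + D')) * w) by rewrite e' divfK.
  by field.
pose nu := (ta + ta' + D + pi) / 2; pose mu := cis nu.
have cispi_add (t : R) : cis (t + pi) = - cis t by rewrite cisD cispi mulrN1.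
pose A := mu * (cis (- (ta + D)) - k * cis (- ta)); pose B := mu * (k - 1).
have cM (x y : R[i]) : (x * y)^*%C = x^*%C * y^*%C by exact: rmorphM.
have cB (x y : R[i]) : (x - y)^*%C = x^*%C - y^*%C by exact: rmorphB.
have conjE : k^*%C = K%:C * cis ((D - D') / 2).
  by rewrite /k cM conjc_real conj_cis; congr (_ * cis _); field.
have AE : A^*%C = mu * (k * cis (- (ta' + D')) - cis (- ta')).
  rewrite /A cM cB cM conjE !conj_cis !opprK /mu /k !mulrBr !mulrA.
  rewrite ![_ * K%:C]mulrC -!mulrA -!cisD.
  have -> : nu + ((D' - D) / 2 - (ta' + D')) = (- nu + ((D - D') / 2 + ta)) + pi by rewrite /nu; field.
  have -> : nu - ta' = (- nu + (ta + D)) + pi by rewrite /nu; field.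
  by rewrite !cispi_add; ring.
have BE : B^*%C = mu * (cis (- ta') * cis (- (ta + D)) - k * cis (- ta) * cis (- (ta' + D'))).
  rewrite /B cM cB conjc1 conjE !conj_cis /mu /k !mulrBr !mulrA mulr1.
  rewrite ![_ * K%:C]mulrC -!mulrA -!cisD.
  have -> : nu + ((D' - D) / 2 + (- ta - (ta' + D'))) = (- nu + ((D - D') / 2)) + pi by rewrite /nu; field.
  have -> : nu + (- ta' - (ta + D)) = - nu + pi by rewrite /nu; field.
  by rewrite !cispi_add; ring.
have BA : `|B| < `|A|.
  rewrite /A /B !normrM ltr_pM2l ?norm_cis//.
  have -> : cis (- (ta + D)) - k * cis (- ta) = cis (- ta) * (cis (- D) - k).
    by rewrite mulrBr -cisD opprD; ring.
  by rewrite normrM norm_cis mul1r; exact: normc_translate_lt.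
exists A, B; split=> // z; apply/esym/(disk_mobiusP _ BA); first by rewrite cmod_val.
have := rel z; rewrite AE BE /A /B; set w := toC (\val (f z)); set x := toC (\val z) => e.
set ca := cis (- ta') in e *; set cb := cis (- (ta + D)) in e *; set cc := cis (- ta) in e *.
set cd := cis (- (ta' + D')) in e *; apply/eqP; rewrite -subr_eq0.
have -> : w * (mu * (ca * cb - k * cc * cd) * x + mu * (k * cd - ca)) - (mu * (cb - k * cc) * x + mu * (k - 1)) =
   mu * ((1 - ca * w) * (1 - cb * x) - k * (1 - cc * x) * (1 - cd * w)) by ring.
by rewrite e subrr mulr0.
Qed.

End boundary_geometry.

(** * Dilatation near the fixed point, and the conclusion *)

Section assembly.
Context {R : realType}.
Local Notation lam := (area R).
Local Notation mu := (@lebesgue_measure R).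
Local Notation pt := (R * R)%type.
Local Notation S1 := (unit_circle R).

Lemma Linf_on_ae (A : set pt) (nu : pt -> pt) (e : R) : (Linf_on A nu < e%:E)%E ->
  {ae lam, forall z, A z -> cmod (nu z) <= e}.
Proof.
rewrite /Linf_on Lnorm.unlock => h.
have Dd : disc 0 1 = unit_disk R :> set pt by apply/seteqP; split => z; rewrite /disc /unit_disk /= subr0.
have pos : (0 < lam [set: measurableTypeR R * measurableTypeR R])%E.
  apply: (@lt_le_trans _ _ (lam (disc 0 1))); first exact: area_disc1_gt0.
  by apply: le_measure; rewrite ?inE// Dd; exact: (open_measurable_plane (@open_unit_disk R)).
move: h; rewrite pos => h; apply: ae_imply (ess_sup_inf.ess_sup_ge lam _) => z hz Az.
have := le_trans hz (ltW h); rewrite /= patchE mem_set//= lee_fin ger0_norm//.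
exact: cmod_ge0.
Qed.

(** The compact set outside of which the dilatation is below [e] lies in the disk together with [X],
    so it misses [a] and, being closed, a neighbourhood of [a]. This is where a fixed point outside
    [X] is needed. *)
Lemma dilatation_window (X : set pt) (F nu : pt -> pt) (a : pt) : M_sharp X nu -> complex_dilatation F nu ->
  ~ unit_disk R a -> ~ X a -> forall e : R, 0 < e -> exists2 r : R, 0 < r &
  {ae lam, forall z, unit_disk R z -> cmod (z - a) <= r -> `|d_zbar F z| <= e%:C%C * `|d_z F z|}.
Proof.
move=> [_ _ hM] dil Da Xa e e0; have [K [cK KX hK]] := hM e e0.
have Ka : ~ K a by move=> /KX[].
have oK : open (~` K) by apply: closed_openC; exact: compact_closed (@norm_hausdorff _ _) cK.
have /nbhs_disc[r r0 hr] : nbhs a (~` K) by apply: open_nbhs_nbhs.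
exists (r / 2); first by rewrite divr_gt0.
apply: (ae_imply2 _ (Linf_on_ae hK) dil) => z h1 h2 Dz zr.
rewrite h2// normrM toC_norm ler_wpM2r// lecR; apply: h1; split=> //.
apply: hr; rewrite /disc /=; lra.
Qed.

Lemma continuous_unit_disk (F : pt -> pt) : {within unit_disk R, continuous F} ->
  forall z, unit_disk R z -> {for z, continuous F}.
Proof.
have oD := @open_unit_disk R.
by rewrite continuous_open_subspace// => h z Dz; apply: h; rewrite inE.
Qed.

Lemma common_boundary_translation (X : set pt) (f : S1 -> S1) (F nu : pt -> pt) (phi : R -> R)
    (ta D l l' : R) (D0 : 0 < D < 2 * pi) (r0 : 0 <= (0 : R) <= pi) (r1 : 0 <= (pi : R) <= pi) :
  quasiconformal F -> complex_dilatation F nu -> M_sharp X nu -> boundary_extension F f ->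
  continuous f -> sense_preserving_lift f phi -> ~ X (circle_pt ta) -> 0 < l -> l' != 0 ->
  (forall x, boundary_fun f phi ta D0 (@sin0 R) r0 (x + l) = boundary_fun f phi ta D0 (@sin0 R) r0 x + l') ->
  (forall x, boundary_fun f phi ta D0 (@sinpi R) r1 (x + l) = boundary_fun f phi ta D0 (@sinpi R) r1 x + l') ->
  exists C, (forall x, boundary_fun f phi ta D0 (@sin0 R) r0 x = x + C) /\
    (forall x, boundary_fun f phi ta D0 (@sinpi R) r1 x = x + C).
Proof.
move=> [[F' [[cF cF'] FD FD' FK FK']] acl [k /andP[k0 k1] hk]] dil sharp ext cf lift Xa l0 l0' p0 p1.
have D0' := lift_arc ta D0 lift.
(* [k] may be 0, whereas [qc_stretch] asks for a positive bound. *)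
pose k' := (1 + k) / 2; have k'01 : 0 < k' < 1 by apply/andP; split; rewrite /k'; lra.
have hk' : {ae lam, forall z, unit_disk R z -> [/\ derivable F z (1, 0), derivable F z (0, 1) &
     `|d_zbar F z| <= k'%:C%C * `|d_z F z|]}.
  apply: ae_imply hk => z h Dz; have [h1 h2 h3] := h Dz; split=> //; apply: (le_trans h3).
  by rewrite ler_wpM2r// lecR /k'; lra.
have [a1 [b1 [a2 [b2 [[ma1 mb1 ma2 mb2] dF energy]]]]] := qc_gradient (continuous_unit_disk cF)
  (continuous_unit_disk cF') (fun z Dz => conj (FD z Dz) (FK z Dz)) (fun z Dz => conj (FD' z Dz) (FK' z Dz)) k'01 hk'.
have dF' : {ae lam, forall z, unit_disk R z -> has_differential (fun w => (F w).1) (a1 z) (b1 z) z /\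
    has_differential (fun w => (F w).2) (a2 z) (b2 z) z}.
  by apply: ae_imply dF => z h Dz; have [h1 h2 _ _] := h Dz.
have rect (s t : R) : 0 < s -> 0 < t -> s ^+ 2 + t ^+ 2 < 1 ->
    `[- s, s]%classic `*` `[- t, t]%classic `<=` unit_disk R.
  move=> s0 t0 st z [] /=; rewrite !in_itv /= -!ler_norml => z1 z2; rewrite /unit_disk /=.
  rewrite -(@ltr_pXn2r _ 2) ?nnegrE ?cmod_ge0 ?ler01// expr1n cmod_sqr; apply: le_lt_trans st.
  by apply: lerD; rewrite -[leLHS](real_normK (num_real _)) ler_pXn2r ?nnegrE// ltW.
have ac1 s t (s0 : 0 < s) (t0 : 0 < t) (st : s ^+ 2 + t ^+ 2 < 1) :
    {ae mu, forall y, `|y| <= t -> abs_continuous (fun x => F (x, y)) (- s) s}.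
  have [h _] := acl (- s) s (- t) t (gtrN s0) (gtrN t0) (rect s t s0 t0 st).
  by apply: ae_imply h => y h yt; apply: h; rewrite in_itv /= -ler_norml.
have ac2 s t (s0 : 0 < s) (t0 : 0 < t) (st : s ^+ 2 + t ^+ 2 < 1) :
    {ae mu, forall x, `|x| <= t -> abs_continuous (fun y => F (x, y)) (- s) s}.
  have st' : t ^+ 2 + s ^+ 2 < 1 by rewrite addrC.
  have [_ h] := acl (- t) t (- s) s (gtrN t0) (gtrN s0) (rect t s t0 s0 st').
  by apply: ae_imply h => x h xt; apply: h; rewrite in_itv /= -ler_norml.
have C0 : 0 <= 4 / (1 - k') ^+ 2 by rewrite divr_ge0// sqr_ge0.
have Da : ~ unit_disk R (circle_pt ta) by rewrite /unit_disk /= cmod_circle_pt ltxx.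
have small ep : 0 < ep -> exists2 r : R, 0 < r & {ae lam, forall z, unit_disk R z -> cmod (z - circle_pt ta) <= r ->
    (a1 z - b2 z) ^+ 2 + (a2 z + b1 z) ^+ 2 <= ep ^+ 2 * ((a1 z + b2 z) ^+ 2 + (a2 z - b1 z) ^+ 2)}.
  move=> ep0; have [r rp hr] := dilatation_window sharp dil Da Xa ep0; exists r => //.
  apply: (ae_imply2 _ hr dF) => z h1 h2 Dz zr; have [_ _ h3 _] := h2 Dz.
  by apply: h3; [exact: ltW|exact: h1].
set u0 := boundary_fun f phi ta D0 (@sin0 R) r0 in p0 *; set u1 := boundary_fun f phi ta D0 (@sinpi R) r1 in p1 *.
have cu0 : continuous u0 by exact: continuous_boundary_fun lift _ _ _ cf.
have cu1 : continuous u1 by exact: continuous_boundary_fun lift _ _ _ cf.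
pose Phi (w : pt) := strip_map (phi ta) (phi (ta + D) - phi ta) (F (strip_inv ta D w)).
have lim0 x : (fun y => Phi (x, y)) @ 0^'+ --> (u0 x, 0 : R).
  apply: (boundary_fun_limit lift _ ext); first by apply: cvg_at_right_filter; exact: cvg_id.
  near=> y; apply/andP; split; near: y; [exact: nbhs_right_gt|exact: nbhs_right_lt (pi_gt0 R)].
have lim1 x : (fun y => Phi (x, y)) @ pi^'- --> (u1 x, pi : R).
  apply: (boundary_fun_limit lift _ ext); first by apply: cvg_at_left_filter; exact: cvg_id.
  near=> y; apply/andP; split; near: y; [exact: nbhs_left_gt (pi_gt0 R)|exact: nbhs_left_lt].
apply: (common_translation cu0 cu1 l0 l0' p0 p1) => s t th.
exists (key_const (4 / (1 - k') ^+ 2) s t) => L L0.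
have := @key_bound R ta D (phi ta) (phi (ta + D) - phi ta) F a1 b1 a2 b2 _ D0 D0' (continuous_unit_disk cF) FD
  ma1 mb1 ma2 mb2 dF' ac1 ac2 energy C0 small u0 u1 l l' cu0 cu1 lim0 lim1 l0 p0 p1 s t th L L0.
rewrite -EFin_normr_Rintegral ?lee_fin//.
apply: integrable_segment => x; apply: cvgM; first exact: continuous_bump_scale.
apply: cvgB; first exact: continuous_phase.
by apply: cvgM; [exact: cvg_cst|exact: continuous_phase].
Unshelve. all: by end_near.
Qed.

End assembly.

Theorem theorem8p2 (R : realType) (G : set (unit_circle R -> unit_circle R))
    (X : set (R * R)) (f : unit_circle R -> unit_circle R)
    (hG : Mob_subgroup G) (hne : non_elementary G)
    (hX : X `<=` unit_circle R) (hXfin : finite_set X)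
    (hf : QS_sharp X f)
    (hconj : conj_set f G `<=` Mob_circle R) :
  Mob_circle R f.
Proof.
have [[f' [fK f'K cf _]] [phi [lift _]] [F [nu [qc dil sharp ext]]]] := hf.
have [g [z1 [z2 [Gg z12 g1 g2 [nX [z0 gz0]]]]]] := hyperbolic_element hG hne hXfin.
have [GM _ _ Ginv] := hG; have [gi [_ gK _]] := Ginv g Gg.
have [a [b gab]] := GM g Gg.
pose h := f \o g \o f'.
have hfg : h \o f = f \o g by apply/funext => z; rewrite /h /= fK.
have [c [d hcd]] : Mob_circle R h by apply: hconj; exists g.
have f12 : f z1 <> f z2 by move=> /(can_inj fK).
have h1 : h (f z1) = f z1 by rewrite /h /= fK g1.
have h2 : h (f z2) = f z2 by rewrite /h /= fK g2.
have [la [la0 la1 grel]] := moebius_multiplier gab z12 g1 g2.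
have [lb [lb0 lb1 hrel]] := moebius_multiplier hcd f12 h1 h2.
(* Neither [g] nor its conjugate is the identity, so both translation lengths [ln la] and [ln lb]
   are nonzero. *)
have la_neq : la != 1 by apply/eqP => /la1 /(_ z0).
have lb_neq : lb != 1.
  apply/eqP => /lb1 /(_ (f z0)); rewrite /h /= fK => /(can_inj fK); exact: gz0.
have [ta taE] := circle_angle (cmod_val z1).
(* The angle of [z2] is taken within one turn after that of [z1], so that [D] is the length of the
   arc from [a] to [b]. *)
have [tb [/andP[tb1 tb2] tbE]] := circle_angle_range ta z2.
pose D := tb - ta; have tbD : ta + D = tb by rewrite /D addrC subrK.
have D0 : 0 < D < 2 * pi.
  rewrite /D; apply/andP; split; last by lra.
  rewrite subr_gt0 lt_neqAle tb1 andbT; apply/eqP => e; apply: z12; apply: val_inj.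
  by rewrite taE tbE e.
have e2 : \val z2 = circle_pt (ta + D) by rewrite tbD.
have taD' : phi ta + (phi (ta + D) - phi ta) = phi (ta + D) by rewrite addrC subrK.
rewrite taE e2 !toC_circle_pt in grel.
rewrite (lift_circle_pt lift taE) (lift_circle_pt lift e2) !toC_circle_pt -taD' in hrel.
have ga z : \val (g z) = circle_pt ta -> \val z = circle_pt ta.
  by rewrite -taE => /val_inj; rewrite -{1}g1 => /(can_inj gK) ->.
have gb z : \val (g z) = circle_pt (ta + D) -> \val z = circle_pt (ta + D).
  by rewrite -e2 => /val_inj; rewrite -{1}g2 => /(can_inj gK) ->.
have pi0 := pi_gt0 R.
have r0 : 0 <= (0 : R) <= pi by rewrite lexx ltW.
have r1 : 0 <= (pi : R) <= pi by rewrite lexx ltW.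
have p0 := boundary_fun_period D0 lift (@sin0 R) r0 la0 lb0 hfg grel hrel ga gb.
have p1 := boundary_fun_period D0 lift (@sinpi R) r1 la0 lb0 hfg grel hrel ga gb.
have nXa : ~ X (circle_pt ta) by rewrite -taE.
have ln_neq0 (x : R) : 0 < x -> x != 1 -> ln x != 0.
  by move=> x0; apply: contra => /eqP lx; rewrite -(lnK (x := x)) ?posrE// lx expR0.
have la_ln := ln_neq0 _ la0 la_neq; have lb_ln := ln_neq0 _ lb0 lb_neq.
set u0 := boundary_fun _ _ _ _ _ r0 in p0; set u1 := boundary_fun _ _ _ _ _ r1 in p1.
have [C [t0 t1]] : exists C, (forall x, u0 x = x + C) /\ (forall x, u1 x = x + C).
  have [l0|l0] := ltP 0 (ln la).
    exact: (common_boundary_translation (l := ln la) (l' := ln lb) (X := X) qc dil sharp ext).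
  (* The period has to be positive; for negative [ln la] the relation is read backwards, which
     amounts to using the inverse of [g]. *)
  have l0' : 0 < - ln la by rewrite oppr_gt0 lt_neqAle la_ln.
  apply: (common_boundary_translation (l := - ln la) (l' := - ln lb) (X := X) qc dil sharp ext) => //.
  - by rewrite oppr_eq0.
  - by move=> x; have := p0 (x - ln la); rewrite subrK /u0 => ->; rewrite addrK.
  - by move=> x; have := p1 (x - ln la); rewrite subrK /u1 => ->; rewrite addrK.
apply: (mobius_of_strip_translation (ta := ta) (D := D) (C := C) D0 lift) => z za zb.
have [dz _ _ y01] := boundary_arcs D0 lift za zb.
have zE y (sy : sin y = 0) (ry : 0 <= y <= pi) : strip_y ta D (\val z) = y ->
    z = boundary_pt ta D0 sy ry (strip_x ta D (\val z)).
  by move=> yE; apply: val_inj; rewrite /= -[LHS](strip_invK D0 dz) /strip_map yE.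
case: y01 => yE.
  have [_ m] := boundary_image ta D0 lift (@sin0 R) r0 (strip_x ta D (\val z)).
  by rewrite {1}(zE _ (@sin0 R) r0 yE) m -/u0 t0 yE.
have [_ m] := boundary_image ta D0 lift (@sinpi R) r1 (strip_x ta D (\val z)).
by rewrite {1}(zE _ (@sinpi R) r1 yE) m -/u1 t1 yE.
Qed.
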